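(* There exists a constant $c$ such that C2C \textsc{Nondeterministic Constraint Logic} is $\mathsf{PSPACE}$-complete even when restricted to planar constraint graphs of bandwidth at most $c$ in which every vertex is an AND vertex or an OR vertex.
   Context: A constraint graph is an undirected graph with a positive integer weight on every edge and a nonnegative integer weight (its minimum inflow) on every vertex. A legal configuration is an assignment of an orientation to every edge such that for every vertex, the total weight of the edges oriented into that vertex is at least that vertex's minimum inflow. An OR vertex is a vertex of minimum inflow $2$ with exactly three incident edges, all of weight $2$. An AND vertex is a vertex of minimum inflow $2$ with exactly three incident edges, two of weight $1$ and one of weight $2$. C2C \textsc{Nondeterministic Constraint Logic}: given a constraint graph $G$ and two legal configurations $C_1,C_2$ of $G$, is there a sequence of legal configurations starting at $C_1$ and ending at $C_2$ in which each configuration is obtained from the previous one by reversing the orientation of exactly one edge? The bandwidth of a graph $G=(V,E)$ is the minimum, over all bijections $f:V\to\{1,\dots,|V|\}$, of $\max_{\{u,v\}\in E}|f(u)-f(v)|$. *)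

(* Defs.v *)
From mathcomp Require Import all_boot all_order fingroup perm ssralg ssrnum.
From mathcomp Require Import ssrint interval.
From mathcomp Require Import classical_sets set_interval reals topology.
From mathcomp Require Import normedtype.

Set Implicit Arguments.
Unset Strict Implicit.
Unset Printing Implicit Defensive.

Import numFieldNormedType.Exports.

Local Open Scope nat_scope.

Definition language := seq bool -> Prop.

Variant direction := MoveLeft | Stay | MoveRight.

(* [None] is the blank; besides the bits, a machine may use the finitely many
   work symbols in [extra]. *)
Definition symbol (extra : finType) : finType := option (bool + extra).

(* The transition table is total; it is ignored in halting states. *)
Record machine := Machine {
  ntapes : nat;                         (* the machine has ntapes.+1 tapes *)
  state : finType;
  extra : finType;
  start : state;
  halting : pred state;
  accepting : pred state;
  trans : state -> {ffun 'I_ntapes.+1 -> symbol extra} ->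
          state * {ffun 'I_ntapes.+1 -> symbol extra * direction} }.

(* A two-way infinite tape, of which only the cells that held the input or have
   been scanned are stored; [tleft] lists the cells to the left of the head,
   nearest first. Moving the head never discards a cell. *)
Record tape (A : Type) := Tape { tleft : seq A; tcur : A; tright : seq A }.

Definition tape_of (A : Type) (blank : A) (s : seq A) : tape A :=
  if s is x :: s' then Tape [::] x s' else Tape [::] blank [::].

Definition write (A : Type) (x : A) (t : tape A) : tape A :=
  Tape (tleft t) x (tright t).

Definition shift (A : Type) (blank : A) (d : direction) (t : tape A) : tape A :=
  let: Tape l x r := t in
  match d with
  | MoveLeft => Tape (behead l) (head blank l) (x :: r)
  | Stay => t
  | MoveRight => Tape (x :: l) (head blank r) (behead r)
  end.

Definition tape_space (A : Type) (t : tape A) : nat :=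
  (size (tleft t) + size (tright t)).+1.

Record config (M : machine) := Config {
  cstate : state M;
  ctapes : {ffun 'I_(ntapes M).+1 -> tape (symbol (extra M))} }.

(* The input is on tape 0, with the head on its first symbol. *)
Definition init (M : machine) (w : seq bool) : config M :=
  Config (start M)
    [ffun i => tape_of None
       (if i == ord0 then [seq Some (inl b) | b <- w] else [::])].

Definition halted (M : machine) (c : config M) : bool := halting (cstate c).

Definition step (M : machine) (c : config M) : config M :=
  if halted c then c else
  let: (q, act) := trans (cstate c) [ffun i => tcur (ctapes c i)] in
  Config q [ffun i => shift None (act i).2 (write (act i).1 (ctapes c i))].

Definition run (M : machine) (w : seq bool) (t : nat) : config M :=
  iter t (@step M) (init M w).

Definition space (M : machine) (c : config M) : nat :=
  \sum_i tape_space (ctapes c i).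

Fixpoint bit_prefix (X : finType) (s : seq (symbol X)) : seq bool :=
  if s is Some (inl b) :: s' then b :: bit_prefix s' else [::].

(* The output is the word of bits on the last tape that starts under the head
   and extends to the right up to the first symbol that is not a bit. *)
Definition output (M : machine) (c : config M) : seq bool :=
  let t := ctapes c ord_max in bit_prefix (tcur t :: tright t).

Definition poly_bound (a d n : nat) : nat := a * n ^ d + a.

Definition decides_in_space (M : machine) (L : language) (s : nat -> nat) : Prop :=
  forall w : seq bool,
    (forall t, space (run M w t) <= s (size w)) /\
    (exists2 t, halted (run M w t) & (accepting (cstate (run M w t)) <-> L w)).

Definition in_PSPACE (L : language) : Prop :=
  exists (M : machine) (a d : nat), decides_in_space M L (poly_bound a d).

Definition computes_in_time (M : machine) (f : seq bool -> seq bool)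
    (s : nat -> nat) : Prop :=
  forall w : seq bool,
    exists2 t, t <= s (size w) & halted (run M w t) /\ output (run M w t) = f w.

Definition polytime_computable (f : seq bool -> seq bool) : Prop :=
  exists (M : machine) (a d : nat), computes_in_time M f (poly_bound a d).

(* The restriction of the problem [L] to the instances in [D] is the promise
   problem with promise [D]: every reduction has to produce instances in [D]
   only, whereas membership is required of [L] itself, hence on all inputs.
   Nothing is said about the complexity of recognising [D]. *)
Definition PSPACE_hard_on (L D : language) : Prop :=
  forall K : language, in_PSPACE K ->
    exists f : seq bool -> seq bool,
      polytime_computable f /\ (forall w, D (f w) /\ (K w <-> L (f w))).

Definition PSPACE_complete_on (L D : language) : Prop :=
  in_PSPACE L /\ PSPACE_hard_on L D.

(* The graph is simple; the edge {u, v} with u < v is stored as (u, v). *)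
Record constraint_graph := ConstraintGraph {
  nv : nat;
  ne : nat;
  ends : {ffun 'I_ne -> 'I_nv * 'I_nv};
  weight : {ffun 'I_ne -> nat};
  min_inflow : {ffun 'I_nv -> nat};
  ends_lt : forall e, (ends e).1 < (ends e).2;
  ends_inj : injective ends;
  weight_gt0 : forall e, 0 < weight e }.
Arguments ends {c}.
Arguments weight {c}.
Arguments min_inflow {c}.

Definition incident (G : constraint_graph) (v : 'I_(nv G)) (e : 'I_(ne G)) : bool :=
  (v == (ends e).1) || (v == (ends e).2).

(* [true] orients the edge from its first to its second end. *)
Definition orientation (G : constraint_graph) : finType := {ffun 'I_(ne G) -> bool}.

Definition edge_target (G : constraint_graph) (C : orientation G) (e : 'I_(ne G)) :
    'I_(nv G) :=
  if C e then (ends e).2 else (ends e).1.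

Definition legal (G : constraint_graph) (C : orientation G) : bool :=
  [forall v, min_inflow v <= \sum_(e | edge_target C e == v) weight e].

Definition one_reversal (G : constraint_graph) (C C' : orientation G) : bool :=
  #|[set e | C e != C' e]| == 1.

Definition reconfigurable (G : constraint_graph) (C1 C2 : orientation G) : Prop :=
  exists p : seq (orientation G),
    [/\ path (@one_reversal G) C1 p, all (@legal G) (C1 :: p) & last C1 p = C2].

Definition or_vertex (G : constraint_graph) (v : 'I_(nv G)) : bool :=
  [&& min_inflow v == 2,
      #|[set e | incident v e]| == 3
    & [forall e, incident v e ==> (weight e == 2)]].

Definition and_vertex (G : constraint_graph) (v : 'I_(nv G)) : bool :=
  [&& min_inflow v == 2,
      #|[set e | incident v e]| == 3,
      #|[set e | incident v e & weight e == 1]| == 2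
    & #|[set e | incident v e & weight e == 2]| == 1].

Definition and_or_graph (G : constraint_graph) : Prop :=
  forall v : 'I_(nv G), and_vertex v || or_vertex v.

(* Layouts number the vertices from 0 instead of 1. *)
Definition layout_width (G : constraint_graph) (s : {perm 'I_(nv G)}) : nat :=
  \max_(e < ne G) `|s (ends e).1 - s (ends e).2|%N.

Definition bandwidth (G : constraint_graph) : nat :=
  layout_width [arg min_(s < (1%g : {perm 'I_(nv G)})) layout_width s].

Section Planarity.
Local Open Scope ring_scope.
Local Open Scope classical_set_scope.

(* A drawing in the plane R^2: distinct points [p v] for the vertices, and for
   every edge a simple arc [g e] between its ends, such that the interior of an
   arc contains no vertex and meets the interior of no other arc. *)
Definition planar (R : realType) (G : constraint_graph) : Prop :=
  exists (p : 'I_(nv G) -> R * R) (g : 'I_(ne G) -> R -> R * R),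
    [/\ injective p,
        forall e, [/\ {within `[0, 1], continuous (g e)},
                      {in `[0, 1]%R &, injective (g e)},
                      g e 0 = p (ends e).1 & g e 1 = p (ends e).2],
        forall e v (t : R), 0 < t < 1 -> g e t <> p v
      & forall e e' (s t : R), e != e' -> 0 < s < 1 -> 0 < t < 1 -> g e s <> g e' t].

End Planarity.

Record instance := Instance {
  graph : constraint_graph;
  source : orientation graph;
  target : orientation graph;
  source_legal : legal source;
  target_legal : legal target }.

(* Binary digits, least significant first. *)
Fixpoint positive_digits (p : BinNums.positive) : seq bool :=
  match p with
  | BinNums.xH => [:: true]
  | BinNums.xO q => false :: positive_digits q
  | BinNums.xI q => true :: positive_digits q
  end.

Definition nat_digits (n : nat) : seq bool :=
  if bin_of_nat n is BinNums.Npos p then positive_digits p else [::].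

(* Self-delimiting: every digit is preceded by [true], and the number is
   terminated by [false]. *)
Definition encode_nat (n : nat) : seq bool :=
  flatten [seq [:: true; b] | b <- nat_digits n] ++ [:: false].

Definition edge_data (I : instance) (e : 'I_(ne (graph I))) : seq nat :=
  [:: nat_of_ord (ends e).1; nat_of_ord (ends e).2; weight e;
      nat_of_bool (source I e); nat_of_bool (target I e)].

Definition instance_data (I : instance) : seq nat :=
  [:: nv (graph I); ne (graph I)]
    ++ [seq min_inflow v | v <- enum 'I_(nv (graph I))]
    ++ flatten [seq edge_data e | e <- enum 'I_(ne (graph I))].

Definition encode (I : instance) : seq bool :=
  flatten [seq encode_nat n | n <- instance_data I].

Definition C2C_NCL : language := fun w =>
  exists2 I : instance, encode I = w & reconfigurable (source I) (target I).

Definition instances_on (P : constraint_graph -> Prop) : language := fun w =>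
  exists2 I : instance, encode I = w & P (graph I).

(* Main.v *)
(** Hardness. The run of a Turing machine in polynomial space is a path in the graph of the words over
    a finite alphabet under rewriting rules [ab <-> cd]: a carrier sweeps over a row of cells that
    holds the tapes as pairs of stacks. The rules are deterministic in one direction, so the starting
    word is connected to the accepting one if and only if the machine accepts. Overlapping pairs of
    letters turn rewriting into changing single symbols of a word, subject to a relation between
    neighbouring symbols. Such a word is written on a strip of blocks, one for each position, whose
    number of rows and columns depends on the alphabet only: the edges of a block carry the chosen
    symbol along rows to the next block, where crossing gadgets let the signals pass each other and
    the gadgets at forbidden pairs let them clash. The strip is planar and of bounded bandwidth.

    The alphabet, and hence the bandwidth, depends on the machine. But the problem itself is in PSPACE,
    by Savitch's theorem, so some fixed machine decides it: composing the reduction to it from an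
    arbitrary machine with the reduction from the fixed machine bounds the bandwidth by a constant. *)
Require Import Defs.
From mathcomp Require Import all_boot zify.

Set Implicit Arguments.
Unset Strict Implicit.
Unset Printing Implicit Defensive.

(** * Stack machines *)

(** The reductions and the search must run on Turing machines. Functions are therefore built from
    combinators for [polyf], programs with four stacks that work on serialized binary trees;
    [polyf_polytime] and [pspace_loop] translate these into machines once and for all, and whatever
    has bounded range becomes a finite table. On the side of graphs, the obstacle is that
    reconfiguration passes through configurations that encode no word. Three things control them.
    Each gadget is checked by computation to behave like a set of clauses on its ports: its legal
    inner orientations for fixed ports are connected, and one of them survives any allowed change of
    a single port, so that inner edges can be forgotten. Wires are monotone, so that turning many of
    them is a matter of a suitable order, [link_rank]. Finally, a block may choose several symbols
    at once: during a change both the old and the new symbol are chosen, and conversely every word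
    that can be read off a reachable configuration is itself reachable. For a similar reason a rule,
    which changes two letters and hence three overlapping pairs, is applied in several phases. *)

Variant reg := RW | RA | RB | RC.

Record store := St { sW : seq bool; sA : seq bool; sB : seq bool; sC : seq bool }.

Definition get (s : store) (r : reg) : seq bool :=
  match r with RW => sW s | RA => sA s | RB => sB s | RC => sC s end.

Definition set (s : store) (r : reg) (x : seq bool) : store :=
  match r with
  | RW => St x (sA s) (sB s) (sC s)
  | RA => St (sW s) x (sB s) (sC s)
  | RB => St (sW s) (sA s) x (sC s)
  | RC => St (sW s) (sA s) (sB s) x
  end.

Definition height (s : store) : nat :=
  maxn (maxn (size (sW s)) (size (sA s))) (maxn (size (sB s)) (size (sC s))).

Lemma height_get s r : size (get s r) <= height s.
Proof. by rewrite /height; case: s r => w a b c [] /=; lia. Qed.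

Definition reg_ord (r : reg) : 'I_4 :=
  match r with
  | RW => @Ordinal 4 0 isT | RA => @Ordinal 4 1 isT
  | RB => @Ordinal 4 2 isT | RC => @Ordinal 4 3 isT
  end.

Variant instr := IPush of reg & bool | IPop of reg | IBr of reg & nat & nat & nat.

Definition istep (code : seq instr) (c : nat * store) : nat * store :=
  let: (p, s) := c in
  match nth (IBr RW 0 0 0) code p with
  | IPush r b => (p.+1, set s r (b :: get s r))
  | IPop r => (p.+1, set s r (behead (get s r)))
  | IBr r n t f =>
      (match get s r with [::] => n | true :: _ => t | false :: _ => f end, s)
  end.

Section StackMachine.
Variable code : seq instr.
Let L := size code.

Let sym := symbol void.
(** The addresses [L] and [L.+1], just past the code, are the halting ones, rejecting and accepting.
    The Boolean is the phase of a push, which takes two machine steps. *)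
Let mstate : finType := ('I_L.+2 * bool)%type.

Definition only (rd : {ffun 'I_4 -> sym}) (r : reg) (x : sym * direction) :
    {ffun 'I_4 -> sym * direction} :=
  [ffun i => if i == reg_ord r then x else (rd i, Stay)].

Definition stack_trans (q : mstate) (rd : {ffun 'I_4 -> sym}) :
    mstate * {ffun 'I_4 -> sym * direction} :=
  let: (p, phase) := q in
  match nth (IBr RW 0 0 0) code p with
  | IPush r b =>
      if phase then ((inord p.+1, false), only rd r (Some (inl b), Stay))
      else ((p, true), only rd r (rd (reg_ord r), MoveLeft))
  | IPop r =>
      ((inord p.+1, false),
       only rd r (if rd (reg_ord r) is None then (None, Stay) else (None, MoveRight)))
  | IBr r n t f =>
      ((inord (match rd (reg_ord r) with
               | Some (inl true) => t | Some (inl false) => f | _ => n end), false),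
       [ffun i => (rd i, Stay)])
  end.

Definition stack_machine : machine :=
  @Machine 3 mstate void (ord0, false)
    (fun q => L <= q.1) (fun q => q.1 == L.+1 :> nat) stack_trans.

(** The top of the stack is under the head and the stack extends to the right. A pop leaves a blank
    on the left and a push reuses it, so the cells in use never exceed the greatest height [H] by
    more than the blank [k] scanned below the bottom. *)
Definition on_tape (s : seq bool) (H : nat) (t : tape sym) : Prop :=
  exists j k, [/\ k <= 1, j + size s <= H, tleft t = nseq j None
    & tcur t :: tright t = [seq Some (inl b) | b <- s] ++ nseq k None].

Lemma on_tape_space s H t : on_tape s H t -> tape_space t <= H.+1.
Proof.
case=> j [k [k1 jH el er]]; rewrite /tape_space el size_nseq.
have := congr1 size er; rewrite /= size_cat size_map size_nseq; lia.
Qed.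

Lemma on_tapeW s H H' t : H <= H' -> on_tape s H t -> on_tape s H' t.
Proof. by move=> HH [j [k [k1 jH el er]]]; exists j, k; split=> //; lia. Qed.

Definition on_config (pc : nat * store) (H : nat) (c : config stack_machine) : Prop :=
  [/\ (cstate c).1 = pc.1 :> nat, (cstate c).2 = false
    & forall r, on_tape (get pc.2 r) H (ctapes c (reg_ord r))].

Lemma reg_ord_surj (i : 'I_4) : exists r, i = reg_ord r.
Proof.
case: i => -[|[|[|[|//]]]] h; [exists RW|exists RA|exists RB|exists RC]; exact: val_inj.
Qed.

Lemma space_config H (c : config stack_machine) :
  (forall r, tape_space (ctapes c (reg_ord r)) <= H) -> space c <= 4 * H.
Proof.
move=> h; rewrite /space -[X in X * H](card_ord 4) -sum_nat_const.
by apply: leq_sum => i _; case: (reg_ord_surj i) => r ->.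
Qed.

Lemma on_config_space pc H c : on_config pc H c -> space c <= 4 * H.+1.
Proof. by case=> _ _ h; apply: space_config => r; apply: on_tape_space. Qed.

Lemma get_set s r x r' : get (set s r x) r' = if reg_ord r' == reg_ord r then x else get s r'.
Proof. by case: r; case: r'. Qed.

Lemma height_set s r x : size x <= height (set s r x).
Proof. by have := height_get (set s r x) r; rewrite get_set eqxx. Qed.

(** A push moves the head to the left and then writes; every other instruction takes one step.
    Between the two steps of a push no store is represented, so there the space is bounded directly,
    by means of the height that the new stack is about to have. *)
Lemma istep_sim pc H c :
  on_config pc H c -> pc.1 < L -> (istep code pc).1 <= L.+1 ->
  height (istep code pc).2 <= H ->
  exists n, [/\ 0 < n <= 2, on_config (istep code pc) H (iter n (@step _) c)
    & forall i, i <= n -> space (iter i (@step _) c) <= 4 * H.+1].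
Proof.
move=> oc; have sp0 := on_config_space oc.
case: pc oc => p s oc /= pL; case: (oc) => /= ep eph ht.
case: c oc ep eph ht sp0 => -[q ph] T oc /= ep eph ht sp0; subst ph.
have nh : halted (Config (M := stack_machine) (q, false) T) = false.
  by rewrite /halted /= ep; apply/negbTE; rewrite -ltnNge.
have hd r : tcur (T (reg_ord r)) = if get s r is b :: _ then Some (inl b) else None.
  case: (ht r) => j [k [k1 _ _]]; case: (get s r) => [|b l] /=; last by case.
  by case: k k1 => //= k _ [].
case E: (nth (IBr RW 0 0 0) code p) => [r b|r|r n t f] /=.
- move=> pL2 hH.
  have ec1 : step (Config (M := stack_machine) (q, false) T) =
      Config (M := stack_machine) (q, true)
       [ffun i => if i == reg_ord r then shift None MoveLeft (T i) else T i].
    rewrite /step nh /= ep E; congr Config; apply/ffunP=> i; rewrite !ffunE.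
    by case: eqP => [->|_] /=; case: (T _) => //= l x l'; rewrite ?ffunE.
  have oc' : on_config (p.+1, set s r (b :: get s r)) H
      (iter 2 (@step _) (Config (M := stack_machine) (q, false) T)).
    rewrite /= ec1 /step /= /halted /= ep leqNgt pL /= E /=; split=> //=.
      by rewrite inordK.
    move=> r'; rewrite !ffunE /= get_set.
    case: eqP => [e|ne] /=; last by have := ht r'; case: (T _).
    rewrite e; have := ht r; case: (T _) => l x l' [j [k [k1 jH /= -> er]]].
    have := height_set s r (b :: get s r) => /= hs.
    case: j jH => [|j] jH; [exists 0, k|exists j, k]; split=> //=; try lia.
      by rewrite er.
    by rewrite er.
  exists 2; split=> //; case=> [|[|[|//]]] // _; last exact: on_config_space oc'.
  rewrite /= ec1; apply: space_config => r'; rewrite /= !ffunE.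
  case: eqP => [e|ne] /=; last exact: on_tape_space (ht r').
  have := ht r; rewrite e; case: (T _) => l x l' [j [k [k1 jH /= -> er]]].
  have := height_set s r (b :: get s r) => /= hs.
  have := congr1 size er; rewrite /= size_cat size_map size_nseq.
  by rewrite /tape_space /= size_behead size_nseq; lia.
- move=> pL2 hH; have oc' : on_config (p.+1, set s r (behead (get s r))) H
      (step (Config (M := stack_machine) (q, false) T)).
    rewrite /step nh /= ep E; split=> //=; first by rewrite inordK.
    move=> r'; rewrite !ffunE /= get_set.
    case: eqP => [e|ne] /=; last by have := ht r'; case: (T _).
    rewrite e hd; have := ht r; case: (T _) => l x l' [j [k [k1 jH /= -> er]]].
    case: (get s r) jH er => [|a u] /= jH er.
      by case: k k1 er => [|[|//]] // _ [_ ->]; exists j, 1.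
    exists j.+1; case: u jH er => [|a' u] /= jH [_ ->].
      by exists 1; split=> //=; try lia; case: k k1 => [|[]].
    by exists k; split=> //=; lia.
  exists 1; split=> //; case=> [|[|//]] //= _; exact: on_config_space oc'.
- move=> pL2 hH; have oc' : on_config (match get s r with [::] => n | true :: _ => t | false :: _ => f end, s) H
      (step (Config (M := stack_machine) (q, false) T)).
    rewrite /step nh /= ep E; split=> //=.
      rewrite ffunE hd; move: pL2; case: (get s r) => [|[] _] h; exact: inordK.
    by move=> r'; rewrite !ffunE /=; have := ht r'; case: (T _).
  exists 1; split=> //; case=> [|[|//]] //= _; exact: on_config_space oc'.
Qed.

End StackMachine.

(** * Structured programs *)

(** The height bound is required after every instruction, because it stands for space. The address
    bound admits the two halting addresses. *)
Inductive runs (code : seq instr) (H : nat) : nat -> nat * store -> nat * store -> Prop :=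
| RunsStop c : runs code H 0 c c
| RunsStep n c c' : c.1 < size code -> (istep code c).1 <= (size code).+1 ->
    height (istep code c).2 <= H -> runs code H n (istep code c) c' ->
    runs code H n.+1 c c'.

Lemma runs_trans code H n m c c' c'' :
  runs code H n c c' -> runs code H m c' c'' -> runs code H (n + m) c c''.
Proof. by elim=> [//|{}n {}c {}c' *] /=; apply: RunsStep => //; auto. Qed.

Lemma runs1 code H c c' : c.1 < size code -> istep code c = c' ->
  c'.1 <= (size code).+1 -> height c'.2 <= H -> runs code H 1 c c'.
Proof. by move=> h1 e; rewrite -e => *; apply: RunsStep => //; apply: RunsStop. Qed.

Lemma runs_sim code H n pc pc' (c : config (stack_machine code)) :
  on_config pc H c -> runs code H n pc pc' ->
  exists n', [/\ n' <= 2 * n, on_config pc' H (iter n' (@step _) c)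
    & forall i, i <= n' -> space (iter i (@step _) c) <= 4 * H.+1].
Proof.
move=> oc r; elim: r c oc => [{}pc c oc|{}n {}pc {}pc' h1 h2 h3 _ IH c oc].
  by exists 0; split=> // -[|//] _; apply: on_config_space oc.
have [m [/andP[m0 m2] oc1 sp1]] := istep_sim oc h1 h2 h3.
have [n' [n2 oc2 sp2]] := IH _ oc1; exists (n' + m); split.
- lia.
- by rewrite iterD.
- move=> i ile; have [im|mi] := leqP i m; first exact: sp1.
  by rewrite -(subnK (ltnW mi)) iterD; apply: sp2; lia.
Qed.

Inductive cmd :=
| Skip
| Push of reg & bool
| Pop of reg
| Seq of cmd & cmd
| Case of reg & cmd & cmd & cmd
| While of reg & bool & cmd.

Fixpoint clen (c : cmd) : nat :=
  match c with
  | Skip => 0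
  | Push _ _ | Pop _ => 1
  | Seq a b => clen a + clen b
  | Case _ n t f => (clen n + clen t + clen f).+3
  | While _ _ c => (clen c).+2
  end.

Definition jmp (p : nat) : instr := IBr RW p p p.

Fixpoint compile (c : cmd) (p : nat) : seq instr :=
  match c with
  | Skip => [::]
  | Push r b => [:: IPush r b]
  | Pop r => [:: IPop r]
  | Seq a b => compile a p ++ compile b (p + clen a)
  | Case r n t f =>
      let pt := (p + clen n).+2 in let pf := (pt + clen t).+1 in let e := pf + clen f in
      IBr r p.+1 pt pf :: compile n p.+1 ++ jmp e :: compile t pt ++ jmp e :: compile f pf
  | While r b c =>
      let e := (p + clen c).+2 in
      IBr r e p.+1 (if b then e else p.+1) :: compile c p.+1 ++ [:: jmp p]
  end.

Lemma size_cons T (x : T) l : size (x :: l) = (size l).+1.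
Proof. by []. Qed.

Lemma size_compile c p : size (compile c p) = clen c.
Proof.
elim: c p => [|r b|r|a IHa b IHb|r n IHn t IHt f IHf|r b c IHc] p //=.
- by rewrite size_cat IHa IHb.
- by rewrite size_cat /= size_cat /= IHn IHt IHf; lia.
- by rewrite size_cat /= IHc; lia.
Qed.

(* [While r true c] loops while the top of [r] is [true], [While r false c] while [r] is nonempty. *)
Definition continues (s : store) (r : reg) (b : bool) : bool :=
  if get s r is x :: _ then x || ~~ b else false.

(* [n] bounds the number of instructions and [H] the heights of all stacks. *)
Inductive exec : cmd -> store -> store -> nat -> nat -> Prop :=
| ExSkip s H : exec Skip s s 0 H
| ExPush r b s H : height (set s r (b :: get s r)) <= H ->
    exec (Push r b) s (set s r (b :: get s r)) 1 H
| ExPop r s H : height (set s r (behead (get s r))) <= H ->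
    exec (Pop r) s (set s r (behead (get s r))) 1 H
| ExSeq a b s s1 s2 n m H : exec a s s1 n H -> exec b s1 s2 m H ->
    exec (Seq a b) s s2 (n + m) H
| ExCase r cn ct cf s s' n H : height s <= H -> height s' <= H ->
    exec (match get s r with [::] => cn | true :: _ => ct | false :: _ => cf end) s s' n H ->
    exec (Case r cn ct cf) s s' n.+2 H
| ExStop r b c s H : height s <= H -> ~~ continues s r b ->
    exec (While r b c) s s 1 H
| ExLoop r b c s s1 s2 n m H : height s <= H -> height s1 <= H -> continues s r b ->
    exec c s s1 n H -> exec (While r b c) s1 s2 m H ->
    exec (While r b c) s s2 (n + m).+2 H.

(** Addresses in the code are absolute, so the induction ranges over all code before and after the
    command. The count is only an upper bound: the third branch of [Case] comes last and ends
    without a jump. *)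
Lemma compileP c s s' n H : exec c s s' n H ->
  forall pre post, exists2 n', n' <= n &
  let code := pre ++ compile c (size pre) ++ post in
  runs code H n' (size pre, s) (size pre + clen c, s').
Proof.
have nth_pre (pre : seq instr) (x : instr) (l : seq instr) d :
  nth d (pre ++ x :: l) (size pre) = x by rewrite nth_cat ltnn subnn.
elim=> {c s s' n H}.
- by move=> s H pre post; exists 0 => //=; rewrite addn0; apply: RunsStop.
- move=> r b s H h pre post; exists 1 => //=.
  by apply: runs1 => //=; rewrite ?nth_pre ?addn1 // size_cat /=; lia.
- move=> r s H h pre post; exists 1 => //=.
  by apply: runs1 => //=; rewrite ?nth_pre ?addn1 // size_cat /=; lia.
- move=> a b s s1 s2 n m H _ IHa _ IHb pre post /=.
  have [n1 n1le r1] := IHa pre (compile b (size pre + clen a) ++ post).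
  have [n2 n2le r2] := IHb (pre ++ compile a (size pre)) post.
  exists (n1 + n2); first lia; apply: runs_trans; first by rewrite -catA; exact: r1.
  by move: r2; rewrite size_cat size_compile addnA -?catA.
- move=> r cn ct cf s s' n H hs hs' _ IH pre post /=.
  set p := size pre; set pt := (p + clen cn).+2; set pf := (pt + clen ct).+1.
  set e := pf + clen cf; set ib := IBr r _ _ _.
  set code := pre ++ _.
  have sc : size code = e + size post.
    by rewrite /code !(size_cat, size_compile, size_cons) /e /pf /pt /p; lia.
  have -> : p + (clen cn + clen ct + clen cf).+3 = e by rewrite /e /pf /pt; lia.
  have rb x : x <= e -> istep code (p, s) = (x, s) -> runs code H 1 (p, s) (x, s).
    by move=> xe ei; apply: runs1 => //=; rewrite sc /e /pf /pt; lia.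
  have rj pre' post' : code = pre' ++ jmp e :: post' ->
     runs code H 1 (size pre', s') (e, s').
    move=> ec; apply: runs1 => //=; rewrite ?sc; try lia.
      by rewrite -sc ec !(size_cat, size_cons); lia.
    by rewrite ec nth_pre /=; case: (sW s') => [|[]].
  have eb : nth (IBr RW 0 0 0) code p = ib by rewrite /code nth_pre.
  move: IH; case E: (get s r) => [|[] u] IH.
  + have [n1 n1le r1] := IH (rcons pre ib) (jmp e :: compile ct pt ++ jmp e :: compile cf pf ++ post).
    exists (1 + (n1 + 1)); first lia; apply: (runs_trans (c' := (p.+1, s))).
      by apply: rb; [rewrite /e /pf /pt; lia|rewrite /= eb /= E].
    apply: (runs_trans (c' := (p.+1 + clen cn, s'))).
      by move: r1; rewrite size_rcons cat_rcons /code -?catA /= -?catA.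
    have := rj (pre ++ ib :: compile cn p.+1) (compile ct pt ++ jmp e :: compile cf pf ++ post).
    by rewrite !(size_cat, size_compile, size_cons) addnS addSn; apply; rewrite /code /= -?catA /= -?catA /= -?catA.
  + have [n1 n1le r1] := IH (pre ++ ib :: compile cn p.+1 ++ [:: jmp e]) (jmp e :: compile cf pf ++ post).
    have sz : size (pre ++ ib :: compile cn p.+1 ++ [:: jmp e]) = pt.
      by rewrite !(size_cat, size_compile, size_cons) /= /pt /p; lia.
    rewrite sz in r1.
    exists (1 + (n1 + 1)); first lia; apply: (runs_trans (c' := (pt, s))).
      by apply: rb; [rewrite /e /pf /pt; lia|rewrite /= eb /= E].
    apply: (runs_trans (c' := (pt + clen ct, s'))).
      by move: r1; rewrite /code -?catA /= -?catA.
    have := rj (pre ++ ib :: compile cn p.+1 ++ jmp e :: compile ct pt) (compile cf pf ++ post).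
    rewrite !(size_cat, size_compile, size_cons).
    have -> : size pre + (clen cn + (clen ct).+1).+1 = pt + clen ct by rewrite /pt /p; lia.
    by apply; rewrite /code /= -?catA /= -?catA /= -?catA.
  + have [n1 n1le r1] := IH (pre ++ ib :: compile cn p.+1 ++ jmp e :: compile ct pt ++ [:: jmp e]) post.
    have sz : size (pre ++ ib :: compile cn p.+1 ++ jmp e :: compile ct pt ++ [:: jmp e]) = pf.
      by rewrite !(size_cat, size_compile, size_cons) /= /pf /pt /p; lia.
    rewrite sz in r1.
    exists (1 + n1); first lia; apply: (runs_trans (c' := (pf, s))).
      by apply: rb; [rewrite /e; lia|rewrite /= eb /= E].
    by move: r1; rewrite /code -?catA /= -?catA /= -?catA.
- move=> r b c s H hs nc pre post; exists 1 => //=.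
  apply: runs1 => //=; rewrite ?(size_cat, size_compile, size_cons) /=; try lia.
  rewrite nth_pre; move: nc; rewrite /continues.
  by case: (get s r) => [|[] u] //=; case: b => // _; congr pair; lia.
- move=> r b c s s1 s2 n m H hs hs1 cs _ IH1 _ IH2 pre post /=.
  set p := size pre; set e := (p + clen c).+2; set ib := IBr _ _ _ _.
  have [n1 n1le r1] := IH1 (rcons pre ib) (jmp p :: post).
  have [n2 n2le r2] := IH2 pre post.
  move: r2; rewrite /= -/p -/e -/ib -catA /= => r2.
  move: r1; rewrite size_rcons cat_rcons /= => r1.
  exists (1 + (n1 + (1 + n2))); first lia; rewrite -?catA /= -?catA /=.
  apply: (runs_trans (c' := (p.+1, s))).
    apply: runs1 => //=; rewrite ?(size_cat, size_compile, size_cons) -/p; try lia.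
    rewrite nth_pre /ib; move: cs; rewrite /continues.
    by case: (get s r) => [|[] u] //= /negbTE ->.
  apply: (runs_trans r1); apply: (runs_trans _ r2).
  rewrite addSn -addnS; apply: runs1 => //=.
  + by rewrite !(size_cat, size_compile, size_cons) /= -/p; lia.
  + have -> : pre ++ ib :: compile c p.+1 ++ jmp p :: post =
              (pre ++ ib :: compile c p.+1) ++ jmp p :: post by rewrite -catA.
    have -> : p + (clen c).+1 = size (pre ++ ib :: compile c p.+1).
      by rewrite !(size_cat, size_compile, size_cons).
    by rewrite nth_pre /=; case: (sW s1) => [|[]].
  + by rewrite !(size_cat, size_compile, size_cons) /= -/p; lia.
Qed.

Lemma execW c s s' n H H' : exec c s s' n H -> H <= H' -> exec c s s' n H'.
Proof.
elim=> {c s s' n H}; try by (move=> *; econstructor => //; try lia; eauto).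
all: by move=> *; econstructor; eauto; lia.
Qed.

Lemma exec_height c s s' n H : exec c s s' n H -> height s' <= height s + n.
Proof.
elim=> {c s s' n H} //=; try by move=> *; lia.
- by move=> [] b [w x y z] H _; rewrite /height /=; lia.
- by move=> [] [w x y z] H _; rewrite /height /= size_behead; lia.
Qed.

(** An instruction pushes at most one bit, so a time bound is also a height bound. This is why
    [execs] may forget the heights and [execs_exec] can recover them. *)
Lemma exec_min c s s' n H : exec c s s' n H -> exec c s s' n (height s + n).
Proof.
elim=> {c s s' n H}.
- by move=> *; constructor.
- by move=> [] b [w x y z] H _; constructor; rewrite /height /=; lia.
- by move=> [] [w x y z] H _; constructor; rewrite /height /= size_behead; lia.
- move=> a b s s1 s2 n m H ea IHa eb IHb; have := exec_height ea.
  by move=> h; econstructor; [apply: execW IHa _|apply: execW IHb _]; lia.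
- move=> r cn ct cf s s' n H _ _ e IH; have := exec_height e => h.
  by constructor; [lia|lia|apply: execW IH _; lia].
- by move=> *; constructor; lia || done.
- move=> r b c s s1 s2 n m H _ _ cs e1 IH1 e2 IH2; have := exec_height e1.
  by move=> h; apply: (ExLoop _ _ cs (execW IH1 _) (execW IH2 _)); lia.
Qed.

(** * Operations on trees *)

Definition execs (c : cmd) (s s' : store) (n : nat) : Prop :=
  exists n' H, n' <= n /\ exec c s s' n' H.

Lemma exW c s s' n m : execs c s s' n -> n <= m -> execs c s s' m.
Proof. by move=> [n' [H [h e]]] nm; exists n', H; split=> //; lia. Qed.

Lemma ex_size c s s' n : execs c s s' n -> height s' <= height s + n.
Proof. by move=> [n' [H [h /exec_height]]]; lia. Qed.

Lemma ex_skip s : execs Skip s s 0.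
Proof. by exists 0, 0; split=> //; constructor. Qed.

Lemma ex_push r b s : execs (Push r b) s (set s r (b :: get s r)) 1.
Proof. by exists 1, (height (set s r (b :: get s r))); split=> //; constructor. Qed.

Lemma ex_pop r s : execs (Pop r) s (set s r (behead (get s r))) 1.
Proof. by exists 1, (height (set s r (behead (get s r)))); split=> //; constructor. Qed.

Lemma ex_seq a b s s1 s2 n m : execs a s s1 n -> execs b s1 s2 m -> execs (Seq a b) s s2 (n + m).
Proof.
move=> [n' [H [h e]]] [m' [H' [h' e']]]; exists (n' + m'), (maxn H H').
by split; [lia|econstructor; [apply: execW e _|apply: execW e' _]; lia].
Qed.

Lemma ex_case r cn ct cf s s' n :
  execs (match get s r with [::] => cn | true :: _ => ct | false :: _ => cf end) s s' n ->
  execs (Case r cn ct cf) s s' n.+2.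
Proof.
move=> [n' [H [h e]]]; exists n'.+2, (maxn H (maxn (height s) (height s'))).
by split; [lia|constructor; [lia|lia|apply: execW e _; lia]].
Qed.

Lemma ex_stop r b c s : ~~ continues s r b -> execs (While r b c) s s 1.
Proof. by exists 1, (height s); split=> //; constructor. Qed.

Lemma ex_loop r b c s s1 s2 n m : continues s r b ->
  execs c s s1 n -> execs (While r b c) s1 s2 m -> execs (While r b c) s s2 (n + m).+2.
Proof.
move=> cs [n' [H [h e]]] [m' [H' [h' e']]].
exists (n' + m').+2, (maxn (maxn H H') (maxn (height s) (height s1))).
by split; [lia|apply: (ExLoop _ _ cs (execW e _) (execW e' _)); lia].
Qed.

(** All data are binary trees written in preorder. This code is prefix-free, so a program finds the
    end of a value on a stack without knowing its type. *)
Inductive tree := Leaf | Node of tree & tree.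

Fixpoint ser (t : tree) : seq bool :=
  if t is Node l r then true :: ser l ++ ser r else [:: false].

Definition copy_bit (r : reg) (put : bool -> cmd) : cmd :=
  Case r Skip (Seq (Pop r) (put true)) (Seq (Pop r) (put false)).

Definition pour (r : reg) (put : bool -> cmd) : cmd := While r false (copy_bit r put).

(* RC counts in unary the subtrees that are still to be moved. *)
Definition move_tree (put : bool -> cmd) : cmd :=
  Seq (Push RC true)
    (While RC false
       (Case RW Skip (Seq (Pop RW) (Seq (put true) (Push RC true)))
                     (Seq (Pop RW) (Seq (put false) (Pop RC))))).

Section Moving.
Variables (X : Type) (put : bool -> cmd) (f : X -> bool -> X) (k : nat).

Lemma ex_pour r (mk : seq bool -> X -> store) x l :
  (forall l x, get (mk l x) r = l) -> (forall l l' x, set (mk l x) r l' = mk l' x) ->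
  (forall b l x, execs (put b) (mk l x) (mk l (f x b)) k) ->
  execs (pour r put) (mk l x) (mk [::] (foldl f x l)) ((k + 5) * size l).+1.
Proof.
move=> gr sr pr; elim: l x => [|b l IH] x.
  by apply: (@exW _ _ _ 1) => //; apply: ex_stop; rewrite /continues gr.
apply: (@exW _ _ _ ((1 + k).+2 + ((k + 5) * size l).+1).+2); last by rewrite /=; lia.
apply: ex_loop (IH _); first by rewrite /continues gr orbT.
have ep : execs (Pop r) (mk (b :: l) x) (mk l x) 1.
  by have := ex_pop r (mk (b :: l) x); rewrite gr sr.
by apply: ex_case; rewrite gr; case: b ep => ep; apply: ex_seq ep (pr _ _ _).
Qed.

Lemma ex_move_tree (mk : seq bool -> X -> seq bool -> store) t rest x c :
  (forall w x c, get (mk w x c) RW = w) -> (forall w x c, get (mk w x c) RC = c) ->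
  (forall w w' x c, set (mk w x c) RW w' = mk w' x c) ->
  (forall w c' x c, set (mk w x c) RC c' = mk w x c') ->
  (forall b w x c, execs (put b) (mk w x c) (mk w (f x b) c) k) -> c = [::] ->
  execs (move_tree put) (mk (ser t ++ rest) x c) (mk rest (foldl f x (ser t)) c)
     ((k + 6) * size (ser t)).+2.
Proof.
move=> gw gc sw sc pr ->.
set body := Case RW Skip (Seq (Pop RW) (Seq (put true) (Push RC true))) (Seq (Pop RW) (Seq (put false) (Pop RC))).
have step b w x' c' c'' : (b = true /\ c'' = true :: c' \/ b = false /\ c'' = behead c') ->
    execs body (mk (b :: w) x' c') (mk w (f x' b) c'') (k + 4).
  move=> hb; apply: (@exW _ _ _ (1 + (k + 1)).+2); last lia.
  have ep : execs (Pop RW) (mk (b :: w) x' c') (mk w x' c') 1.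
    by have := ex_pop RW (mk (b :: w) x' c'); rewrite gw sw.
  apply: ex_case; rewrite gw; case: b ep hb => ep [] [] // _ ->;
    apply: (ex_seq ep); apply: (ex_seq (pr _ _ _ _)).
    by have := ex_push RC true (mk w (f x' true) c'); rewrite gc sc.
  by have := ex_pop RC (mk w (f x' false) c'); rewrite gc sc.
(* The remainder of the loop is a premise here, so that the two subtrees of a node can be chained by
   the induction hypotheses. *)
have main w x' c' s' m : 
    execs (While RC false body) (mk w (foldl f x' (ser t)) c') s' m ->
    execs (While RC false body) (mk (ser t ++ w) x' (true :: c')) s' ((k + 6) * size (ser t) + m).
  elim: t w x' c' m => [|l IHl r IHr] w x' c' m /= h.
    apply: (@exW _ _ _ (k + 4 + m).+2); last lia.
    by apply: ex_loop h; [rewrite /continues gc|apply: step; right].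
  apply: (@exW _ _ _ (k + 4 + ((k + 6) * size (ser l) + ((k + 6) * size (ser r) + m))).+2).
    apply: (@ex_loop _ _ _ _ (mk ((ser l ++ ser r) ++ w) (f x' true) (true :: true :: c'))).
    - by rewrite /continues gc.
    - by apply: step; left.
    - by rewrite -catA; apply: IHl; apply: IHr; rewrite -foldl_cat.
  by rewrite size_cat; lia.
apply: (@exW _ _ _ (1 + ((k + 6) * size (ser t) + 1))); last lia.
apply: (@ex_seq _ _ _ (mk (ser t ++ rest) x [:: true])).
  by have := ex_push RC true (mk (ser t ++ rest) x [::]); rewrite gc sc.
by apply: main; apply: ex_stop; rewrite /continues gc.
Qed.

End Moving.

Definition push_rev (a : seq bool) (b : bool) := b :: a.

Lemma foldl_push_rev a l : foldl push_rev a l = rev l ++ a.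
Proof. by rewrite -catrevE; elim: l a => //=. Qed.

Definition drop_tree : cmd := move_tree (fun _ => Skip).
Definition toA : cmd := move_tree (Push RA).
Definition toB : cmd := move_tree (Push RB).
Definition fromA : cmd := pour RA (Push RW).
Definition fromB : cmd := pour RB (Push RW).

Definition tree_size (t : tree) : nat := size (ser t).

Lemma tree_size_gt0 t : 0 < tree_size t. Proof. by case: t. Qed.

Lemma ex_drop t w a b : execs drop_tree (St (ser t ++ w) a b [::]) (St w a b [::]) (8 * tree_size t).
Proof.
have := @ex_move_tree unit (fun _ => Skip) (fun u _ => u) 0 (fun w _ c => St w a b c) t w tt [::].
move=> h; apply: exW (h _ _ _ _ _ _) _ => //; first by move=> *; apply: ex_skip.
by rewrite -/(tree_size t); have := tree_size_gt0 t; lia.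
Qed.

Lemma ex_toA t w a b :
  execs toA (St (ser t ++ w) a b [::]) (St w (rev (ser t) ++ a) b [::]) (9 * tree_size t).
Proof.
have := @ex_move_tree _ (Push RA) push_rev 1 (fun w a c => St w a b c) t w a [::].
move=> h; rewrite -foldl_push_rev; apply: exW (h _ _ _ _ _ _) _ => //.
  by move=> x w' a' c; apply: (ex_push RA x (St w' a' b c)).
by rewrite -/(tree_size t); have := tree_size_gt0 t; lia.
Qed.

Lemma ex_toB t w a b :
  execs toB (St (ser t ++ w) a b [::]) (St w a (rev (ser t) ++ b) [::]) (9 * tree_size t).
Proof.
have := @ex_move_tree _ (Push RB) push_rev 1 (fun w b c => St w a b c) t w b [::].
move=> h; rewrite -foldl_push_rev; apply: exW (h _ _ _ _ _ _) _ => //.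
  by move=> x w' b' c; apply: (ex_push RB x (St w' a b' c)).
by rewrite -/(tree_size t); have := tree_size_gt0 t; lia.
Qed.

Lemma ex_fromA w a b c :
  execs fromA (St w a b c) (St (rev a ++ w) [::] b c) (6 * size a).+1.
Proof.
have := @ex_pour _ (Push RW) push_rev 1 RA (fun a w => St w a b c) w a.
move=> h; rewrite -foldl_push_rev; apply: exW (h _ _ _) _ => //.
by move=> x a' w'; apply: (ex_push RW x (St w' a' b c)).
Qed.

Lemma ex_fromB w a b c :
  execs fromB (St w a b c) (St (rev b ++ w) a [::] c) (6 * size b).+1.
Proof.
have := @ex_pour _ (Push RW) push_rev 1 RB (fun b w => St w a b c) w b.
move=> h; rewrite -foldl_push_rev; apply: exW (h _ _ _) _ => //.
by move=> x b' w'; apply: (ex_push RW x (St w' a b' c)).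
Qed.

(** Every move reverses a word. The copy made on [RB] in the same pass as the restored original
    therefore makes two more moves before it lies on [RW] in the right order. *)
Definition dup_tree : cmd :=
  Seq toA (Seq (pour RA (fun b => Seq (Push RW b) (Push RB b)))
    (Seq (pour RB (Push RA)) fromA)).

Lemma ex_dup t w :
  execs dup_tree (St (ser t ++ w) [::] [::] [::]) (St (ser t ++ ser t ++ w) [::] [::] [::])
    (40 * tree_size t).
Proof.
have g0 := tree_size_gt0 t.
have e1 := ex_toA t w [::] [::]; rewrite cats0 in e1.
have e2 : execs (pour RA (fun b => Seq (Push RW b) (Push RB b)))
    (St w (rev (ser t)) [::] [::]) (St (ser t ++ w) [::] (ser t) [::]) (7 * tree_size t).+1.
  have := @ex_pour _ (fun b => Seq (Push RW b) (Push RB b))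
    (fun wb b => (b :: wb.1, b :: wb.2)) 2 RA (fun a wb => St wb.1 a wb.2 [::])
    (w, [::]) (rev (ser t)).
  move=> h; have {h} := h _ _ _; rewrite size_rev => h.
  have fE l u v : foldl (fun wb b => (b :: wb.1, b :: wb.2)) (u, v) l =
      (rev l ++ u, rev l ++ v) :> seq bool * seq bool.
    by elim: l u v => //= b l IH u v; rewrite IH rev_cons !cat_rcons.
  move: h; rewrite fE !revK cats0 /=; apply=> //= b l x.
  by apply: (@ex_seq _ _ _ (St (b :: x.1) l x.2 [::]) _ 1 1);
    [apply: (ex_push RW b (St x.1 l x.2 [::]))|apply: (ex_push RB b (St (b :: x.1) l x.2 [::]))].
have e3 : execs (pour RB (Push RA)) (St (ser t ++ w) [::] (ser t) [::])
    (St (ser t ++ w) (rev (ser t)) [::] [::]) (6 * tree_size t).+1.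
  have := @ex_pour _ (Push RA) push_rev 1 RB (fun b a => St (ser t ++ w) a b [::]) [::] (ser t).
  move=> h; have {h} := h _ _ _; rewrite foldl_push_rev cats0; apply=> // x a' w'.
  by apply: (ex_push RA x (St _ w' a' [::])).
have e4 := ex_fromA (ser t ++ w) (rev (ser t)) [::] [::].
rewrite revK size_rev -/(tree_size t) in e4.
by apply: exW (ex_seq e1 (ex_seq e2 (ex_seq e3 e4))) _; lia.
Qed.

Definition swap_trees : cmd := Seq toA (Seq toB (Seq fromA fromB)).

Lemma ex_swap t u w :
  execs swap_trees (St (ser t ++ ser u ++ w) [::] [::] [::]) (St (ser u ++ ser t ++ w) [::] [::] [::])
    (20 * (tree_size t + tree_size u)).
Proof.
have g0 := tree_size_gt0 t; have g1 := tree_size_gt0 u.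
have e1 := ex_toA t (ser u ++ w) [::] [::].
have e2 := ex_toB u w (rev (ser t) ++ [::]) [::].
have e3 := ex_fromA w (rev (ser t) ++ [::]) (rev (ser u) ++ [::]) [::].
have e4 := ex_fromB (ser t ++ w) [::] (rev (ser u) ++ [::]) [::].
rewrite !cats0 !revK !size_rev -!/(tree_size _) in e1 e2 e3 e4.
by apply: exW (ex_seq e1 (ex_seq e2 (ex_seq e3 e4))) _; lia.
Qed.

Definition left_tree (t : tree) : tree := if t is Node l _ then l else Leaf.
Definition right_tree (t : tree) : tree := if t is Node _ r then r else Leaf.

Definition car_cmd : cmd := Case RW Skip (Seq (Pop RW) (Seq toA (Seq drop_tree fromA))) Skip.
Definition cdr_cmd : cmd := Case RW Skip (Seq (Pop RW) drop_tree) Skip.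

Lemma ex_car t w :
  execs car_cmd (St (ser t ++ w) [::] [::] [::]) (St (ser (left_tree t) ++ w) [::] [::] [::])
    (20 * tree_size t).
Proof.
apply: (@exW _ _ _ (18 * tree_size t).+2); last by have := tree_size_gt0 t; lia.
apply: ex_case; case: t => [|l r] /=; first exact: exW (ex_skip _) _.
have e0 := ex_pop RW (St (true :: (ser l ++ ser r) ++ w) [::] [::] [::]).
rewrite -catA /= in e0 *; have e1 := ex_toA l (ser r ++ w) [::] [::].
have e2 := ex_drop r w (rev (ser l) ++ [::]) [::].
have e3 := ex_fromA w (rev (ser l) ++ [::]) [::] [::].
rewrite !cats0 !revK !size_rev -!/(tree_size _) in e1 e2 e3.
apply: exW (ex_seq e0 (ex_seq e1 (ex_seq e2 e3))) _.
by rewrite /tree_size /= size_cat -!/(tree_size _); lia.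
Qed.

Lemma ex_cdr t w :
  execs cdr_cmd (St (ser t ++ w) [::] [::] [::]) (St (ser (right_tree t) ++ w) [::] [::] [::])
    (20 * tree_size t).
Proof.
apply: (@exW _ _ _ (18 * tree_size t).+2); last by have := tree_size_gt0 t; lia.
apply: ex_case; case: t => [|l r] /=; first exact: exW (ex_skip _) _.
have e0 := ex_pop RW (St (true :: (ser l ++ ser r) ++ w) [::] [::] [::]).
rewrite -catA /= in e0 *; have e1 := ex_drop l (ser r ++ w) [::] [::].
apply: exW (ex_seq e0 e1) _.
by rewrite /tree_size /= size_cat -!/(tree_size _); lia.
Qed.

Definition mark_false : cmd := Seq (Pop RC) (Push RC false).

(** [RC] holds a single flag, initially true, while the two reversed serializations on [RA] and [RB]
    are popped in parallel; a mismatch or a difference in length clears it. *)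
Definition eq_cmd : cmd :=
  Seq toA (Seq toB (Seq (Push RC true)
   (Seq (While RA false
      (Case RA Skip
         (Seq (Pop RA) (Case RB mark_false (Pop RB) (Seq (Pop RB) mark_false)))
         (Seq (Pop RA) (Case RB mark_false (Seq (Pop RB) mark_false) (Pop RB)))))
   (Seq (While RB false (Seq (Pop RB) mark_false))
    (Case RC Skip
       (Seq (Pop RC) (Seq (Push RW false) (Seq (Push RW false) (Push RW true))))
       (Seq (Pop RC) (Push RW false))))))).

Definition bool_tree (b : bool) : tree := if b then Node Leaf Leaf else Leaf.

Lemma ex_mark_false w a b f : execs mark_false (St w a b [:: f]) (St w a b [:: false]) 2.
Proof.
exact: ex_seq (ex_pop RC (St w a b [:: f])) (ex_push RC false (St w a b [::])).
Qed.

Lemma ex_eq t u w :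
  execs eq_cmd (St (ser t ++ ser u ++ w) [::] [::] [::])
    (St (ser (bool_tree (ser t == ser u)) ++ w) [::] [::] [::]) (30 * (tree_size t + tree_size u)).
Proof.
have g0 := tree_size_gt0 t; have g1 := tree_size_gt0 u.
have e1 := ex_toA t (ser u ++ w) [::] [::].
have e2 := ex_toB u w (rev (ser t) ++ [::]) [::]; rewrite !cats0 in e1 e2.
have e3 := ex_push RC true (St w (rev (ser t)) (rev (ser u)) [::]).
pose body := Case RA Skip
   (Seq (Pop RA) (Case RB mark_false (Pop RB) (Seq (Pop RB) mark_false)))
   (Seq (Pop RA) (Case RB mark_false (Seq (Pop RB) mark_false) (Pop RB))).
(* The loop ends when [RA] is empty and ignores a surplus on [RB], so the flag gives the answer only
   in conjunction with [nilp b']. *)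
have e4 a b f : exists b' f', [/\ execs (While RA false body) (St w a b [:: f]) (St w [::] b' [:: f']) (10 * size a).+1,
    f' && nilp b' = f && (a == b) & size b' <= size b].
  elim: a b f => [|x a IH] b f.
    exists b, f; split=> //; first by apply: (@exW _ _ _ 1) => //; apply: ex_stop.
    by case: b.
  have [b' [f' [ew ef sb]]] := IH (behead b) (f && (ohead b == Some x)).
  exists b', f'; split; last by move: sb; rewrite size_behead; lia.
    apply: (@exW _ _ _ (8 + (10 * size a).+1).+2); last by rewrite /=; lia.
    apply: (@ex_loop _ _ _ _ (St w a (behead b) [:: f && (ohead b == Some x)])) ew.
      by rewrite /continues /= orbT.
    have mf a' b' f'' := ex_mark_false w a' b' f''.
    apply: (@exW _ _ _ (1 + (1 + 2).+2).+2); last by [].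
    clear ef sb; apply: ex_case => /=; case: x => /=;
      apply: (ex_seq (ex_pop RA (St w (_ :: a) b [:: f]))) => /=; apply: ex_case => /=.
      case: b => [|[] b] /=; rewrite ?andbF ?andbT; first exact: exW (mf _ _ _) _.
        by apply: exW (ex_pop RB (St w a (_ :: b) [:: f])) _.
      exact: ex_seq (ex_pop RB (St w a (_ :: b) [:: f])) (mf _ _ _).
    case: b => [|[] b] /=; rewrite ?andbF ?andbT; first exact: exW (mf _ _ _) _.
      exact: ex_seq (ex_pop RB (St w a (_ :: b) [:: f])) (mf _ _ _).
    by apply: exW (ex_pop RB (St w a (_ :: b) [:: f])) _.
  rewrite ef; clear; case: b => [|y b1] /=; first by rewrite !andbF.
  by rewrite eqseq_cons -andbA; congr andb; rewrite eq_sym.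
have e5 b f : execs (While RB false (Seq (Pop RB) mark_false)) (St w [::] b [:: f])
    (St w [::] [::] [:: f && nilp b]) (5 * size b).+1.
  elim: b f => [|x b IH] f; first by rewrite andbT; apply: (@exW _ _ _ 1) => //; apply: ex_stop.
  apply: (@exW _ _ _ (1 + 2 + (5 * size b).+1).+2); last by rewrite /=; lia.
  apply: (@ex_loop _ _ _ _ (St w [::] b [:: false])).
  - by rewrite /continues /= orbT.
  - exact: ex_seq (ex_pop RB (St w [::] (x :: b) [:: f])) (ex_mark_false _ _ _ _).
  - by have := IH false; rewrite andbF.
have [b' [f' [e4' ef sb]]] := e4 (rev (ser t)) (rev (ser u)) true.
have e5' := e5 b' f'; rewrite ef /= in e5'.
rewrite !size_rev -!/(tree_size _) in e4' sb.
have -> : (ser t == ser u) = (rev (ser t) == rev (ser u)) by rewrite (inj_eq (can_inj revK)).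
have e6 f : execs (Case RC Skip
       (Seq (Pop RC) (Seq (Push RW false) (Seq (Push RW false) (Push RW true))))
       (Seq (Pop RC) (Push RW false))) (St w [::] [::] [:: f])
       (St (ser (bool_tree f) ++ w) [::] [::] [::]) 6.
  apply: (@exW _ _ _ (1 + (1 + (1 + 1))).+2) => //; apply: ex_case; case: f => /=.
    apply: (ex_seq (ex_pop RC (St w [::] [::] [:: true]))).
    apply: (ex_seq (ex_push RW false (St w [::] [::] [::]))).
    apply: (ex_seq (ex_push RW false (St _ [::] [::] [::]))).
    exact: (ex_push RW true (St _ [::] [::] [::])).
  apply: (@exW _ _ _ (1 + 1)) => //.
  apply: (ex_seq (ex_pop RC (St w [::] [::] [:: false]))).
  exact: (ex_push RW false (St w [::] [::] [::])).
apply: exW (ex_seq e1 (ex_seq e2 (ex_seq e3 (ex_seq e4' (ex_seq e5' (e6 _)))))) _; lia.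
Qed.

(** * Polynomial-time functions *)

(** Monotonicity allows a time bound to be evaluated at an upper bound of the size of its argument,
    as composition requires. *)
Definition mpoly (p : nat -> nat) : Prop :=
  {homo p : m n / m <= n} /\ exists a d, forall n, p n <= poly_bound a d n.

Lemma mpoly_const k : mpoly (fun=> k).
Proof. by split=> //; exists k, 0 => n; rewrite /poly_bound; lia. Qed.

Lemma mpoly_id : mpoly id.
Proof. by split=> //; exists 1, 1 => n; rewrite /poly_bound; lia. Qed.

(** The factor 2 pays for [n = 0], where [0 ^ d] is 1 if [d = 0] and 0 otherwise, so that raising
    the exponent can lower the power. *)
Lemma poly_boundW a d b e n : a <= b -> d <= e -> poly_bound a d n <= poly_bound (2 * b) e n.
Proof.
move=> ab de; rewrite /poly_bound; case: n => [|n].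
  have h : 0 ^ d <= 1 by case: d de => [|d]; rewrite ?expn0 ?exp0n.
  by nia.
have := leq_pexp2l (ltn0Sn n) de; nia.
Qed.

Lemma mpolyD p q : mpoly p -> mpoly q -> mpoly (fun n => p n + q n).
Proof.
move=> [mp [a [d hp]]] [mq [b [e hq]]]; split=> [m n mn|].
  by have := mp _ _ mn; have := mq _ _ mn; lia.
exists (4 * (a + b)), (d + e) => n.
have := leq_trans (hp n) (poly_boundW n (leq_addr b a) (leq_addr e d)).
have := leq_trans (hq n) (poly_boundW n (leq_addl a b) (leq_addl d e)).
rewrite /poly_bound; lia.
Qed.

Lemma mpolyM p q : mpoly p -> mpoly q -> mpoly (fun n => p n * q n).
Proof.
move=> [mp [a [d hp]]] [mq [b [e hq]]]; split=> [m n mn|].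
  exact: leq_mul (mp _ _ mn) (mq _ _ mn).
exists (8 * (a * b)), (d + e) => n.
apply: leq_trans (leq_mul (hp n) (hq n)) _; rewrite /poly_bound.
case: n => [|n].
  have h0 : 0 ^ d <= 1 by case: (d) => [|d']; rewrite ?expn0 ?exp0n.
  have h1 : 0 ^ e <= 1 by case: (e) => [|d']; rewrite ?expn0 ?exp0n.
  have : (a * 0 ^ d + a) * (b * 0 ^ e + b) <= (a * 1 + a) * (b * 1 + b).
    by apply: leq_mul; rewrite leq_add2r leq_mul2l ?h0 ?h1 orbT.
  by nia.
rewrite expnD; have h0 : 0 < n.+1 ^ d by rewrite expn_gt0.
have h1 : 0 < n.+1 ^ e by rewrite expn_gt0.
have aux c N : 0 < N -> c * N + c <= 2 * c * N by nia.
have := leq_mul (aux a _ h0) (aux b _ h1).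
by move/leq_trans; apply; nia.
Qed.

Lemma mpoly_exp p d : mpoly p -> mpoly (fun n => p n ^ d).
Proof.
move=> hp; elim: d => [|d IH]; first exact: mpoly_const.
have := mpolyM hp IH; case=> m [a [e h]]; split=> [x y xy|]; first by rewrite leq_exp2r // hp.1.
by exists a, e => n; rewrite expnS.
Qed.

Lemma mpoly_comp p q : mpoly p -> mpoly q -> mpoly (fun n => p (q n)).
Proof.
move=> [mp [a [d hp]]] [mq hq]; split=> [m n mn|]; first by rewrite mp ?mq.
have [_ [b [e h]]] := mpolyD (mpolyM (mpoly_const a) (mpoly_exp d (conj mq hq))) (mpoly_const a).
by exists b, e => n; apply: leq_trans (hp _) (h _).
Qed.

Lemma mpolyS p : mpoly p -> mpoly (fun n => (p n).+1).
Proof.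
by move=> hp; have [m [a [d h]]] := mpolyD (mpoly_const 1) hp; split=> //; exists a, d.
Qed.

Create HintDb mp.
#[export] Hint Resolve mpoly_const mpoly_id mpolyD mpolyM mpoly_comp mpolyS : mp.

Lemma mpoly_mono p m n : mpoly p -> m <= n -> p m <= p n.
Proof. by case=> h _; apply: h. Qed.

(** Different types deliberately share trees: a nonempty list is a pair, a successor and a [Some]
    are pairs with the unit. Passing between such views is free by [polyf_recode]. *)
Class Enc (T : Type) := enc : T -> tree.

Definition esize {T} {ET : Enc T} (x : T) : nat := tree_size (enc x).

#[export] Instance enc_bool : Enc bool := bool_tree.
#[export] Instance enc_unit : Enc unit := fun _ => Leaf.
(** Numbers are unary, so programs may take time polynomial in their values. This suits indices and
    lengths; weights and inflows of an arbitrary instance, which can be exponential, are handled as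
    words of binary digits instead. *)
#[export] Instance enc_nat : Enc nat := fun n => iter n (Node Leaf) Leaf.
#[export] Instance enc_prod {A B} {EA : Enc A} {EB : Enc B} : Enc (A * B) :=
  fun x => Node (enc x.1) (enc x.2).
#[export] Instance enc_seq {A} {EA : Enc A} : Enc (seq A) :=
  foldr (fun a t => Node (enc a) t) Leaf.
#[export] Instance enc_option {A} {EA : Enc A} : Enc (option A) :=
  fun o => if o is Some a then Node Leaf (enc a) else Leaf.

Lemma esize_pair A B {EA : Enc A} {EB : Enc B} (x : A) (y : B) :
  esize (x, y) = (esize x + esize y).+1.
Proof. by rewrite /esize /enc /= /tree_size /= size_cat. Qed.

Lemma esize_nil A {EA : Enc A} : esize (Nil A) = 1.
Proof. by []. Qed.

Lemma esize_cons A {EA : Enc A} (x : A) l : esize (x :: l) = (esize x + esize l).+1.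
Proof. by rewrite /esize /enc /= /tree_size /= size_cat. Qed.

Lemma esize_nat (n : nat) : esize n = (2 * n).+1.
Proof. by elim: n => //= n; rewrite /esize /enc /= /tree_size /=; lia. Qed.

Lemma esize_bool (b : bool) : esize b <= 3. Proof. by case: b. Qed.

Lemma esize_gt0 A {EA : Enc A} (x : A) : 0 < esize x. Proof. exact: tree_size_gt0. Qed.

Definition arg (t : tree) (rest : seq bool) : store := St (ser t ++ rest) [::] [::] [::].

(** The arbitrary [rest] lets a program run above values that are saved for later, and the other
    three stacks are returned empty. *)
Definition polyf {X Y} {EX : Enc X} {EY : Enc Y} (f : X -> Y) : Prop :=
  exists (c : cmd) (p : nat -> nat), mpoly p /\
    forall x rest, execs c (arg (enc x) rest) (arg (enc (f x)) rest) (p (esize x)).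

(** The output was pushed bit by bit, so its size is at most the size of the input plus the running
    time. *)
Lemma polyf_size X Y {EX : Enc X} {EY : Enc Y} (f : X -> Y) : polyf f ->
  exists2 p, mpoly p & forall x, esize (f x) <= p (esize x).
Proof.
move=> [c [p [mp h]]]; exists (fun n => n + p n); first by auto with mp.
move=> x; have := ex_size (h x [::]); rewrite /height /= !cats0 -!/(tree_size _).
by rewrite -!/(esize _) !maxnE; lia.
Qed.

Lemma polyf_ext X Y {EX : Enc X} {EY : Enc Y} (f g : X -> Y) : f =1 g -> polyf f -> polyf g.
Proof. by move=> fg [c [p [mp h]]]; exists c, p; split=> // x r; rewrite -fg. Qed.

Lemma polyf_recode X Y {EX : Enc X} {EY : Enc Y} (f : X -> Y) :
  (forall x, enc (f x) = enc x) -> polyf f.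
Proof.
by move=> h; exists Skip, (fun=> 0); split; [auto with mp|move=> x r; rewrite h; apply: ex_skip].
Qed.

Lemma polyf_id X {EX : Enc X} : polyf (fun x : X => x).
Proof. exact: polyf_recode. Qed.

Lemma polyf_comp X Y Z {EX : Enc X} {EY : Enc Y} {EZ : Enc Z} (f : X -> Y) (g : Y -> Z) :
  polyf g -> polyf f -> polyf (fun x => g (f x)).
Proof.
move=> [c [p [mp h]]] pf; have [q mq hq] := polyf_size pf.
case: pf => c' [p' [mp' h']]; exists (Seq c' c), (fun n => p' n + p (q n)).
split; first by auto with mp.
move=> x r; apply: exW (ex_seq (h' x r) (h (f x) r)) _.
by rewrite leq_add2l (mpoly_mono mp) ?hq.
Qed.

Fixpoint push_all (s : seq bool) : cmd :=
  if s is b :: s' then Seq (push_all s') (Push RW b) else Skip.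

Lemma ex_push_all s w : execs (push_all s) (St w [::] [::] [::]) (St (s ++ w) [::] [::] [::]) (size s).
Proof.
elim: s => [|b s IH] /=; first exact: ex_skip.
by rewrite -addn1; apply: ex_seq IH (ex_push RW b (St (s ++ w) [::] [::] [::])).
Qed.

Lemma polyf_const X Y {EX : Enc X} {EY : Enc Y} (y : Y) : polyf (fun _ : X => y).
Proof.
exists (Seq drop_tree (push_all (ser (enc y)))), (fun n => 8 * n + esize y).
split; first by auto with mp.
by move=> x r; apply: ex_seq (ex_drop _ _ _ _) (ex_push_all _ _).
Qed.

Lemma polyf_pair X Y Z {EX : Enc X} {EY : Enc Y} {EZ : Enc Z} (f : X -> Y) (g : X -> Z) :
  polyf f -> polyf g -> polyf (fun x => (f x, g x)).
Proof.
move=> pf pg; have [q mq hq] := polyf_size pf; have [q' mq' hq'] := polyf_size pg.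
case: pf => c [p [mp h]]; case: pg => c' [p' [mp' h']].
exists (Seq dup_tree (Seq c (Seq swap_trees (Seq c' (Seq swap_trees (Push RW true)))))),
  (fun n => 40 * n + (p n + (20 * (q n + n) + (p' n + (20 * (q' n + q n) + 1))))).
split; first by auto 20 with mp.
move=> x r; apply: (ex_seq (ex_dup _ _)); apply: (ex_seq (h x _)).
apply: (@ex_seq _ _ _ (arg (enc x) (ser (enc (f x)) ++ r))).
  by apply: exW (ex_swap _ _ _) _; rewrite leq_mul2l leq_add2r hq.
apply: (ex_seq (h' x _)); apply: (@ex_seq _ _ _ (arg (enc (f x)) (ser (enc (g x)) ++ r))).
  by apply: exW (ex_swap _ _ _) _; rewrite leq_mul2l leq_add ?hq ?hq'.
rewrite /arg {2}/enc /= -catA; exact: (ex_push RW true (St _ [::] [::] [::])).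
Qed.

Lemma polyf_fst X Y Z {EX : Enc X} {EY : Enc Y} {EZ : Enc Z} (f : X -> Y * Z) :
  polyf f -> polyf (fun x => (f x).1).
Proof.
apply: (polyf_comp (g := fst)); exists car_cmd, (fun n => 20 * n); split; first by auto with mp.
by move=> [x y] r; apply: ex_car.
Qed.

Lemma polyf_snd X Y Z {EX : Enc X} {EY : Enc Y} {EZ : Enc Z} (f : X -> Y * Z) :
  polyf f -> polyf (fun x => (f x).2).
Proof.
apply: (polyf_comp (g := snd)); exists cdr_cmd, (fun n => 20 * n); split; first by auto with mp.
by move=> [x y] r; apply: ex_cdr.
Qed.

Lemma polyf_cons X Y {EX : Enc X} {EY : Enc Y} (f : X -> Y) (g : X -> seq Y) :
  polyf f -> polyf g -> polyf (fun x => f x :: g x).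
Proof.
move=> pf pg; apply: (polyf_comp (f := fun x => (f x, g x)) (g := fun y => y.1 :: y.2)).
  exact: polyf_recode.
exact: polyf_pair.
Qed.

Lemma polyf_succ X {EX : Enc X} (f : X -> nat) : polyf f -> polyf (fun x => (f x).+1).
Proof.
move=> pf; apply: (polyf_comp (f := fun x => (tt, f x)) (g := fun y => y.2.+1)).
  exact: polyf_recode.
by apply: polyf_pair => //; apply: polyf_const.
Qed.

Lemma polyf_some X Y {EX : Enc X} {EY : Enc Y} (f : X -> Y) : polyf f -> polyf (fun x => Some (f x)).
Proof.
move=> pf; apply: (polyf_comp (f := fun x => (tt, f x)) (g := fun y => Some y.2)).
  exact: polyf_recode.
by apply: polyf_pair => //; apply: polyf_const.
Qed.

(** A value and the content that [sel] extracts from it have the same tree, so matching only tests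
    whether the tree is a leaf. Lists, numbers and Booleans are instances. *)
Lemma polyf_match X Y Z W {EX : Enc X} {EY : Enc Y} {EZ : Enc Z} {EW : Enc W}
  (sel : Y -> option Z) (h : X -> Y) (g0 : X -> W) (g1 : X * Z -> W) :
  (forall y, if sel y is Some z then enc y = enc z /\ enc z <> Leaf else enc y = Leaf) ->
  polyf h -> polyf g0 -> polyf g1 ->
  polyf (fun x => if sel (h x) is Some z then g1 (x, z) else g0 x).
Proof.
move=> hsel ph [c0 [p0 [m0 h0]]] [c1 [p1 [m1 h1]]].
have [q mq hq] := polyf_size ph; case: ph => c [p [mp hp]].
exists (Seq dup_tree (Seq c (Case RW Skip
   (Seq swap_trees (Seq (Push RW true) c1)) (Seq (Pop RW) c0)))),
  (fun n => 40 * n + (p n + (20 * (q n + n) + (1 + p1 ((n + q n).+1)) + (1 + p0 n)).+2)).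
split; first by auto 20 with mp.
move=> x r; apply: (ex_seq (ex_dup _ _)); apply: (ex_seq (hp x _)); apply: ex_case => /=.
have := hq x; have := hsel (h x); case: (sel (h x)) => [z [ez nz]|ez] hqx; last first.
  rewrite ez /=; apply: (@exW _ _ _ (1 + p0 (esize x))); last by lia.
  exact: ex_seq (ex_pop RW (St (false :: ser (enc x) ++ r) [::] [::] [::])) (h0 _ _).
rewrite /esize ez in hqx; rewrite ez; case E: (enc z) nz => [//|l r'] _ /=; rewrite -E.
apply: (@exW _ _ _ (20 * (tree_size (enc z) + tree_size (enc x)) + (1 + p1 (esize (x, z))))).
  apply: (ex_seq (ex_swap _ _ _)); apply: ex_seq _ (h1 (x, z) r).
  rewrite /arg {1}/enc /= -catA; exact: (ex_push RW true (St _ [::] [::] [::])).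
have : p1 (esize (x, z)) <= p1 ((esize x + q (esize x)).+1).
  by apply: (mpoly_mono m1); rewrite esize_pair /esize; lia.
by rewrite /esize in hqx *; lia.
Qed.

Lemma polyf_seq_case X A W {EX : Enc X} {EA : Enc A} {EW : Enc W}
  (h : X -> seq A) (g0 : X -> W) (g1 : X * (A * seq A) -> W) :
  polyf h -> polyf g0 -> polyf g1 ->
  polyf (fun x => if h x is a :: l then g1 (x, (a, l)) else g0 x).
Proof.
move=> ph p0 p1; pose sel (l : seq A) := if l is a :: l' then Some (a, l') else None.
apply: (polyf_ext _ (polyf_match (sel := sel) _ ph p0 p1)).
  by move=> x /=; case: (h x).
by case.
Qed.

Lemma polyf_nat_case X W {EX : Enc X} {EW : Enc W}
  (h : X -> nat) (g0 : X -> W) (g1 : X * nat -> W) :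
  polyf h -> polyf g0 -> polyf g1 -> polyf (fun x => if h x is n.+1 then g1 (x, n) else g0 x).
Proof.
move=> ph p0 p1; pose sel (n : nat) := if n is n'.+1 then Some (tt, n') else None.
have p1' : polyf (fun y : X * (unit * nat) => g1 (y.1, y.2.2)).
  apply: polyf_comp p1 _; apply: polyf_pair; first by apply: polyf_fst; apply: polyf_id.
  by do 2 apply: polyf_snd; apply: polyf_id.
by apply: (polyf_ext _ (polyf_match (sel := sel) _ ph p0 p1')) => [x|] /=; [case: (h x)|case].
Qed.

Lemma polyf_if X W {EX : Enc X} {EW : Enc W} (b : X -> bool) (f g : X -> W) :
  polyf b -> polyf f -> polyf g -> polyf (fun x => if b x then f x else g x).
Proof.
move=> pb pf pg; pose sel (b : bool) := if b then Some (tt, tt) else None.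
have pf' : polyf (fun y : X * (unit * unit) => f y.1).
  by apply: polyf_comp pf _; apply: polyf_fst; apply: polyf_id.
by apply: (polyf_ext _ (polyf_match (sel := sel) _ pb pg pf')) => [x|] /=; [case: (b x)|case].
Qed.

Lemma polyf_andb X {EX : Enc X} (b c : X -> bool) : polyf b -> polyf c -> polyf (fun x => b x && c x).
Proof. by move=> pb pc; apply: (polyf_if pb pc); apply: polyf_const. Qed.

Lemma polyf_orb X {EX : Enc X} (b c : X -> bool) : polyf b -> polyf c -> polyf (fun x => b x || c x).
Proof. by move=> pb pc; apply: (polyf_if pb _ pc); apply: polyf_const. Qed.

Lemma polyf_negb X {EX : Enc X} (b : X -> bool) : polyf b -> polyf (fun x => ~~ b x).
Proof. by move=> pb; apply: (polyf_if pb); apply: polyf_const. Qed.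

Lemma ser_cat_inj t u l m : ser t ++ l = ser u ++ m -> t = u /\ l = m.
Proof.
elim: t u l m => [|t1 IH1 t2 IH2] [|u1 u2] l m //=; first by case.
by rewrite -!catA => -[] /IH1[-> /IH2[-> ->]].
Qed.

Lemma ser_inj : injective ser.
Proof. by move=> t u e; case: (@ser_cat_inj t u [::] [::]); rewrite ?e. Qed.

Class EncInj (T : Type) {ET : Enc T} := enc_inj : injective (enc (T := T)).
Arguments EncInj T {ET}.

#[export] Instance inj_bool : EncInj bool. Proof. by case=> [] []. Qed.
#[export] Instance inj_nat : EncInj nat.
Proof. by move=> m n e; have := esize_nat m; rewrite /esize e -/(esize n) esize_nat; lia. Qed.
#[export] Instance inj_prod A B {EA : Enc A} {EB : Enc B} {IA : EncInj A} {IB : EncInj B} :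
  EncInj (A * B).
Proof. by move=> [a b] [a' b'] [h h']; rewrite (enc_inj h) (enc_inj h'). Qed.
#[export] Instance inj_seq A {EA : Enc A} {IA : EncInj A} : EncInj (seq A).
Proof. by elim=> [|a l IH] [|b m] //= [h /IH->]; rewrite (enc_inj h). Qed.
#[export] Instance inj_option A {EA : Enc A} {IA : EncInj A} : EncInj (option A).
Proof. by case=> [a|] [b|] //= [h]; rewrite (enc_inj h). Qed.

Lemma polyf_eq X (Y : eqType) {EX : Enc X} {EY : Enc Y} {IY : EncInj Y} (f g : X -> Y) :
  polyf f -> polyf g -> polyf (fun x => f x == g x).
Proof.
move=> pf pg; apply: (polyf_comp (f := fun x => (f x, g x)) (g := fun y => y.1 == y.2)); last first.
  exact: polyf_pair.
exists (Seq (Pop RW) eq_cmd), (fun n => 1 + 30 * n); split; first by auto with mp.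
move=> [x y] r; apply: (@ex_seq _ _ _ (St (ser (enc x) ++ ser (enc y) ++ r) [::] [::] [::])).
  by rewrite /arg /= -catA; apply: (ex_pop RW (St (true :: _) [::] [::] [::])).
apply: exW (_ : execs _ _ _ (30 * (esize x + esize y))) _; last by rewrite esize_pair; lia.
have E : (x == y) = (ser (@enc _ EY x) == ser (@enc _ EY y)); last by rewrite /= E; apply: ex_eq.
by apply/idP/idP => [/eqP->//|/eqP/ser_inj e]; apply/eqP; apply: enc_inj e.
Qed.

Definition loop_cmd (ct cb : cmd) : cmd :=
  Seq (Seq dup_tree ct)
   (Seq (While RW true (Seq drop_tree (Seq cb (Seq dup_tree ct)))) drop_tree).

(** The iterates have to be bounded in terms of the initial argument, since a polynomial bound on a
    single execution of [body] would compound over the iterations. *)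
Lemma polyf_iter_on X0 X {EX0 : Enc X0} {EX : Enc X} (P : X0 -> X) (test : X -> bool)
    (body : X -> X) (k : X0 -> nat) q :
  mpoly q -> polyf test -> polyf body ->
  (forall x i, i < k x -> test (iter i body (P x))) ->
  (forall x, ~~ test (iter (k x) body (P x))) ->
  (forall x, k x <= q (esize x)) ->
  (forall x i, i <= k x -> esize (iter i body (P x)) <= q (esize x)) ->
  exists (c : cmd) (p : nat -> nat), mpoly p /\ forall x rest,
    execs c (arg (enc (P x)) rest) (arg (enc (iter (k x) body (P x))) rest) (p (esize x)).
Proof.
move=> mq [ct [pt [mt ht]]] [cb [pb [mb hb]]] tt tf kq sq.
exists (loop_cmd ct cb), (fun n => (40 * q n + pt (q n)) +
  (((q n) * (26 + (pb (q n) + (40 * q n + pt (q n)))) + 1) + 24)).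
split; first by auto 20 with mp.
move=> x r; have qx := sq x; set Q := q (esize x) in kq sq qx *.
pose mid i := St (ser (enc_bool (test (iter i body (P x)))) ++ ser (EX (iter i body (P x))) ++ r) [::] [::] [::].
have et i : i <= k x -> execs (Seq dup_tree ct) (arg (enc (iter i body (P x))) r) (mid i) (40 * Q + pt Q).
  move=> ik; apply: ex_seq; first by apply: exW (ex_dup _ _) _; rewrite leq_mul2l qx.
  by apply: exW (ht _ _) _; apply: (mpoly_mono mt); apply: qx.
have el : forall j, j <= k x -> execs (While RW true (Seq drop_tree (Seq cb (Seq dup_tree ct))))
    (mid (k x - j)) (mid (k x)) (j * (26 + (pb Q + (40 * Q + pt Q))) + 1).
  elim=> [|j IH] jk.
    by rewrite subn0; apply: ex_stop; rewrite /continues /= (negbTE (tf x)).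
  set i := k x - j.+1.
  apply: (@exW _ _ _ (24 + (pb Q + (40 * Q + pt Q)) + (j * (26 + (pb Q + (40 * Q + pt Q))) + 1)).+2); last lia.
  have ei : k x - j = i.+1 by rewrite /i; lia.
  apply: (ex_loop _ _ (IH (ltnW jk))); first by rewrite /continues /= tt // /i; lia.
  apply: (@ex_seq _ _ _ (arg (enc (iter i body (P x))) r)).
    apply: exW (ex_drop _ _ _ _) _.
    by case: (test _).
  rewrite ei; apply: (@ex_seq _ _ _ (arg (enc (iter i.+1 body (P x))) r)).
    by apply: exW (hb _ _) _; apply: (mpoly_mono mb); apply: qx; rewrite /i; lia.
  by apply: et; rewrite /i; lia.
apply: ex_seq (et 0 (leq0n _)) _.
apply: (@ex_seq _ _ _ (mid (k x))).
  have := el (k x) (leqnn _); rewrite subnn => h; apply: exW h _.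
  by rewrite leq_add2r leq_mul2r kq orbT.
apply: exW (ex_drop _ _ _ _) _.
by case: (test _).
Qed.

(** * From polynomial-time functions to Turing machines *)

(** This pushes a bit and the node of its list cell from back to front, the last symbol pushed being
    on top. The input is reversed onto [RA] beforehand, so that the last bit of the word is treated
    first. *)
Definition put_bit (b : bool) : cmd :=
  if b then Seq (Push RW false) (Seq (Push RW false) (Seq (Push RW true) (Push RW true)))
  else Seq (Push RW false) (Push RW true).

Definition in_cmd : cmd := Seq (pour RW (Push RA)) (Seq (Push RW false) (pour RA put_bit)).

Lemma ex_in w : execs in_cmd (St w [::] [::] [::]) (arg (enc w) [::]) (15 * size w + 3).
Proof.
have e1 : execs (pour RW (Push RA)) (St w [::] [::] [::]) (St [::] (rev w) [::] [::])
    (6 * size w).+1.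
  have := @ex_pour _ (Push RA) push_rev 1 RW (fun w a => St w a [::] [::]) [::] w.
  move=> h; rewrite -[rev w]cats0 -foldl_push_rev; apply: exW (h _ _ _) _ => // x w' a'.
  by apply: (ex_push RA x (St w' a' [::] [::])).
have e2 := ex_push RW false (St [::] (rev w) [::] [::]).
have e3 : execs (pour RA put_bit) (St [:: false] (rev w) [::] [::])
    (arg (enc w) [::]) (9 * size w).+1.
  pose f (w : seq bool) (b : bool) := true :: ser (enc_bool b) ++ w.
  have := @ex_pour _ put_bit f 4 RA (fun a w => St w a [::] [::]) [:: false] (rev w).
  rewrite size_rev foldl_rev => h; have {h} := h _ _ _.
  have -> : foldr (fun x z => f z x) [:: false] w = ser (enc w).
    by elim: w {e1 e2} => //= b w ->; rewrite /f.
  rewrite /arg cats0; apply=> // -[] l x.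
    apply: (ex_seq (ex_push RW false (St x l [::] [::]))).
    apply: (ex_seq (ex_push RW false (St _ l [::] [::]))).
    apply: (ex_seq (ex_push RW true (St _ l [::] [::]))).
    exact: (ex_push RW true (St _ l [::] [::])).
  apply: (@exW _ _ _ (1 + 1)) => //.
  apply: (ex_seq (ex_push RW false (St x l [::] [::]))).
  exact: (ex_push RW true (St _ l [::] [::])).
by apply: exW (ex_seq e1 (ex_seq e2 e3)) _; lia.
Qed.

(** The result ends on [RC], which is the last tape and hence the output tape; the passage through
    [RA] restores its order. *)
Definition out_cmd : cmd :=
  Seq (While RW true (Seq (Pop RW) (Case RW Skip
      (Seq (Pop RW) (Seq (Pop RW) (Seq (Pop RW) (Push RA true))))
      (Seq (Pop RW) (Push RA false)))))
  (Seq (Pop RW) (pour RA (Push RC))).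

Lemma ex_out (l : seq bool) :
  execs out_cmd (arg (enc l) [::]) (St [::] [::] [::] l) (15 * size l + 3).
Proof.
rewrite /arg cats0.
have e1 a : execs (While RW true (Seq (Pop RW) (Case RW Skip
      (Seq (Pop RW) (Seq (Pop RW) (Seq (Pop RW) (Push RA true))))
      (Seq (Pop RW) (Push RA false))))) (St (ser (enc l)) a [::] [::])
      (St [:: false] (rev l ++ a) [::] [::]) (9 * size l + 1).
  elim: l a => [|b l IH] a; first by apply: ex_stop.
  apply: (@exW _ _ _ (1 + (1 + (1 + (1 + 1))).+2 + (9 * size l + 1)).+2); last by rewrite /=; lia.
  rewrite rev_cons cat_rcons; apply: ex_loop (IH _) => //.
  apply: (ex_seq (ex_pop RW (St (ser (enc (b :: l))) a [::] [::]))) => /=.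
  apply: ex_case; case: b => /=.
    apply: (ex_seq (ex_pop RW (St _ a [::] [::]))) => /=.
    apply: (ex_seq (ex_pop RW (St _ a [::] [::]))) => /=.
    apply: (ex_seq (ex_pop RW (St _ a [::] [::]))) => /=.
    exact: (ex_push RA true (St _ a [::] [::])).
  apply: (@exW _ _ _ (1 + 1)) => //.
  apply: (ex_seq (ex_pop RW (St _ a [::] [::]))) => /=.
  exact: (ex_push RA false (St _ a [::] [::])).
have e2 := ex_pop RW (St [:: false] (rev l ++ [::]) [::] [::]).
have e3 : execs (pour RA (Push RC)) (St [::] (rev l ++ [::]) [::] [::]) (St [::] [::] [::] l)
    (6 * size l).+1.
  have := @ex_pour _ (Push RC) push_rev 1 RA (fun a c => St [::] a [::] c) [::] (rev l ++ [::]).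
  move=> h; have {h} := h _ _ _; rewrite foldl_push_rev !cats0 size_rev revK; apply=> // x l' c.
  by apply: (ex_push RC x (St [::] l' [::] c)).
by apply: exW (ex_seq (e1 _) (ex_seq e2 e3)) _; lia.
Qed.

Lemma on_config_init code w :
  on_config (0, St w [::] [::] [::]) (size w) (init (stack_machine code) w).
Proof.
split=> //= r; rewrite ffunE.
case: r => /=; try by exists 0, 1.
by case: w => [|b w]; [exists 0, 1|exists 0, 0; split=> //=; rewrite cats0].
Qed.

Lemma exec_run c post w s n H : size w <= H -> exec c (St w [::] [::] [::]) s n H ->
  let M := stack_machine (compile c 0 ++ post) in
  exists n', [/\ n' <= 2 * n, on_config (clen c, s) H (run M w n')
    & forall i, i <= n' -> space (run M w i) <= 4 * H.+1].
Proof.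
move=> wH /compileP/(_ [::] post) [n' nle r] M.
have oc : on_config (0, St w [::] [::] [::]) H (init M w).
  by have [h1 h2 h3] := on_config_init (compile c 0 ++ post) w; split=> // q; apply: on_tapeW (h3 q).
have [m [mle oc' sp]] := runs_sim oc r; exists m; split=> //; lia.
Qed.

Lemma on_tape_output s H (t : tape (symbol void)) :
  on_tape s H t -> bit_prefix (tcur t :: tright t) = s.
Proof.
case=> j [k [k1 _ _ ->]]; elim: s => [|b s IH] /=; last by rewrite IH.
by case: k k1 => [|[]].
Qed.

Theorem polyf_polytime (f : seq bool -> seq bool) : polyf f -> polytime_computable f.
Proof.
move=> pf; have [q mq hq] := polyf_size pf; case: pf => c [p [mp h]].
pose prog := Seq in_cmd (Seq c out_cmd).
(* The list of [n] bits has size at most [4 * n + 1], and an instruction takes at most 2 machine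
   steps. *)
pose P n := 2 * (15 * n + 3 + (p (4 * n + 1) + (15 * q (4 * n + 1) + 3))).
have [_ [a [d hP]]] : mpoly P by rewrite /P; auto 20 with mp.
exists (stack_machine (compile prog 0 ++ [::])), a, d => w.
have sw (l : seq bool) : size l <= esize l <= 4 * size l + 1.
  elim: l => [//|b l IH]; rewrite esize_cons /=; have := esize_bool b; lia.
have [n [H [nle e]]] : execs prog (St w [::] [::] [::]) (St [::] [::] [::] (f w))
    (15 * size w + 3 + (p (4 * size w + 1) + (15 * q (4 * size w + 1) + 3))).
  apply: (ex_seq (ex_in w)); apply: ex_seq.
    by apply: exW (h w [::]) _; apply: (mpoly_mono mp); case/andP: (sw w).
  apply: exW (ex_out (f w)) _; rewrite leq_add2r leq_mul2l /=.
  have /andP[h1 _] := sw (f w); have /andP[_ h2] := sw w.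
  exact: leq_trans h1 (leq_trans (hq w) (mpoly_mono mq h2)).
have [m [mle [e1 e2 e3] _]] := exec_run [::] (leq_maxl (size w) H) (execW e (leq_maxr _ _)).
exists m; first by apply: leq_trans (leq_trans mle _) (hP _); rewrite /P leq_mul2l.
split.
  change (is_true (size (compile prog 0 ++ [::]) <= (cstate (run
    (stack_machine (compile prog 0 ++ [::])) w m)).1)).
  by rewrite e1 cats0 size_compile.
rewrite /output (_ : ord_max = reg_ord RC); first exact: on_tape_output (e3 RC).
exact: val_inj.
Qed.

Lemma execs_exec c s s' n : execs c s s' n -> exists n', exec c s s' n' (height s + n).
Proof. by move=> [n' [H [nle e]]]; exists n'; apply: execW (exec_min e) _; lia. Qed.

Lemma height_arg t : height (arg t [::]) = tree_size t.
Proof. by rewrite /height /= cats0 !maxn0. Qed.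

(** The number [k] of iterations is not bounded at all; only the sizes of the iterates matter. This
    accommodates an exponentially long search in polynomial space. *)
Theorem pspace_loop (L : language) X {EX : Enc X} (ini : seq bool -> X) (test acc : X -> bool)
    (body : X -> X) q :
  mpoly q -> polyf ini -> polyf test -> polyf body -> polyf acc ->
  (forall w, exists k, [/\ forall i, i < k -> test (iter i body (ini w)),
     ~~ test (iter k body (ini w)),
     forall i, i <= k -> esize (iter i body (ini w)) <= q (size w)
   & acc (iter k body (ini w)) <-> L w]) ->
  in_PSPACE L.
Proof.
move=> mq [ci [pi [mi hi]]] [ct [pt [mt ht]]] [cb [pb [mb hb]]] [ca [pa [ma ha]]] hL.
pose prog := Seq in_cmd (Seq ci (Seq (loop_cmd ct cb) ca)).
pose lab := (clen prog).+1.
(* The appended branch looks at the first bit of the serialized verdict. Since the code has length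
   [lab], its targets [lab.+1] and [lab] are the accepting and the rejecting address. *)
pose M := stack_machine (compile prog 0 ++ [:: IBr RW lab lab.+1 lab]).
pose N n := 40 * q n + (pt (q n) + (pb (q n) + pa (q n))).
pose P n := 4 * ((n + (15 * n + 3)) + ((4 * n + 1) + pi (4 * n + 1)) + (2 * q n + 30 + N n)).+1.
have [_ [a [d hP]]] : mpoly P by rewrite /P /N; auto 20 with mp.
exists M, a, d => w.
have sw (l : seq bool) : size l <= esize l <= 4 * size l + 1.
  elim: l => [//|b l IH]; rewrite esize_cons /=; have := esize_bool b; lia.
have [k [tt tf sq accP]] := hL w; set x := ini w in tt tf sq accP.
set Q := q (size w) in sq; pose H2 := 2 * Q + 30 + N (size w).
pose H := (size w + (15 * size w + 3)) + ((4 * size w + 1) + pi (4 * size w + 1)) + H2.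
pose mid i := St (ser (enc_bool (test (iter i body x))) ++ ser (EX (iter i body x)))
  [::] [::] [::].
have hm i : i <= k -> height (mid i) <= H.
  move=> /sq; rewrite /esize /tree_size /enc /height /= size_cat !maxn0 => h.
  by have : size (ser (enc_bool (test (iter i body x)))) <= 3; [case: (test _)|rewrite /H /H2; lia].
have ptQ i : i <= k -> pt (esize (iter i body x)) <= pt Q.
  by move=> ik; apply: (mpoly_mono mt); apply: sq.
have NQ : N (size w) = 40 * Q + (pt Q + (pb Q + pa Q)) by [].
have et i : i <= k -> exists n, exec (Seq dup_tree ct) (arg (enc (iter i body x)) [::]) (mid i) n H.
  move=> ik; have := ex_seq (ex_dup (enc (iter i body x)) [::]) (ht (iter i body x) _).
  rewrite /arg !cats0 => /execs_exec[n e]; exists n; apply: execW e _.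
  rewrite (_ : height _ = esize (iter i body x)); last by rewrite /height /= !maxn0.
  by have := sq i ik; have := ptQ i ik; rewrite -/(esize _) /H /H2 NQ; lia.
have es : exists n, exec prog (St w [::] [::] [::]) (arg (enc (acc (iter k body x))) [::]) n H.
  have [n1 e1] := execs_exec (ex_in w).
  have {}e1 := execW e1 (_ : _ <= H); have [n2 e2] := execs_exec (hi w [::]).
  have {}e2 := execW e2 (_ : _ <= H).
  have [n3 e3] := et 0 (leq0n _).
  have [n4 e4] : exists n, exec (While RW true (Seq drop_tree (Seq cb (Seq dup_tree ct))))
     (mid 0) (mid k) n H.
    suff: forall j, j <= k -> exists n, exec (While RW true (Seq drop_tree (Seq cb (Seq dup_tree ct))))
        (mid (k - j)) (mid k) n H by move/(_ k (leqnn k)); rewrite subnn.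
    elim=> [|j IH] jk.
      exists 1; rewrite subn0; constructor; first exact: hm.
      by rewrite /continues /= (negbTE tf).
    have [m em] := IH (ltnW jk); set i := k - j.+1 in em *.
    have ei : k - j = i.+1 by rewrite /i; lia.
    have ik : i <= k by rewrite /i; lia.
    have ik' : i < k by rewrite /i; lia.
    have [m1 e1'] := et _ ik'; rewrite ei in em.
    have ed := ex_drop (enc_bool (test (iter i body x))) (ser (EX (iter i body x))) [::] [::].
    have eb := hb (iter i body x) [::]; rewrite /arg cats0 in eb.
    have [m2 e2'] := execs_exec (ex_seq ed eb).
    have {}e2' := execW e2' (_ : _ <= H).
    have {e2'} e2' : exec (Seq drop_tree cb) (mid i) (arg (enc (iter i.+1 body x)) [::]) m2 H.
      apply: e2'; have := sq i ik; have := hm i ik; rewrite /H /H2 NQ => h1 h2.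
      have : pb (esize (iter i body x)) <= pb Q by apply: (mpoly_mono mb).
      rewrite /height /= !maxn0 size_cat.
      rewrite /esize /tree_size /enc in h2 *.
      have : tree_size (enc_bool (test (iter i body x))) <= 3 by case: (test _).
      by rewrite /tree_size; lia.
    inversion e2'; subst.
    eexists; apply: (ExLoop _ _ _ _ em); first by apply: hm.
    - by apply: hm.
    - by rewrite /continues /= tt.
    - by econstructor; [eassumption|econstructor; [eassumption|exact: e1']].
  have ed := ex_drop (enc_bool (test (iter k body x))) (ser (EX (iter k body x))) [::] [::].
  have [n5 e5] := execs_exec ed; have {}e5 := execW e5 (_ : _ <= H).
  have [n6 e6] := execs_exec (ha (iter k body x) [::]); have {}e6 := execW e6 (_ : _ <= H).
  have {}e1 := e1 _; have {}e2 := e2 _; have {}e5 := e5 _; have {}e6 := e6 _.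
  eexists; apply: (ExSeq (e1 _)); first by rewrite /height /= !maxn0 /H; lia.
  apply: (ExSeq (e2 _)).
    rewrite height_arg -/(esize w); have /andP[_ h2] := sw w.
    by have := mpoly_mono mi h2; rewrite /H; lia.
  apply: ExSeq; last first.
    apply: e6; rewrite height_arg -/(esize _); have := sq k (leqnn _) => h.
    by have := mpoly_mono ma h; rewrite /H /H2 NQ; lia.
  apply: (ExSeq e3); apply: (ExSeq e4); rewrite /arg cats0; apply: e5.
  have := sq k (leqnn _); have := hm k (leqnn _); rewrite /H /H2 NQ.
  rewrite /height /= !maxn0 size_cat /esize /tree_size /enc => h1 h2.
  have : size (ser (enc_bool (test (iter k body x)))) <= 3 by case: (test _).
  by lia.
case: es => n e; have wH : size w <= H by rewrite /H; lia.
have [m [_ oc sp]] := exec_run [:: IBr RW lab lab.+1 lab] wH e.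
have sc : size (compile prog 0 ++ [:: IBr RW lab lab.+1 lab]) = lab.
  by rewrite size_cat size_compile addn1.
have es : istep (compile prog 0 ++ [:: IBr RW lab lab.+1 lab])
    (clen prog, arg (enc (acc (iter k body x))) [::]) =
    (if acc (iter k body x) then lab.+1 else lab, arg (enc (acc (iter k body x))) [::]).
  rewrite /istep nth_cat size_compile ltnn subnn /=.
  by case: (acc _).
have hfin : height (arg (enc (acc (iter k body x))) [::]) <= H.
  by rewrite height_arg /H /H2; case: (acc _); rewrite /tree_size /=; lia.
have [] := istep_sim oc; rewrite ?sc ?es /=; first by [].
- by case: ifP.
- exact: hfin.
move=> m' [/andP[m0 _] oc' sp'].
have hl : halted (run M w (m' + m)).
  change (is_true (size (compile prog 0 ++ [:: IBr RW lab lab.+1 lab])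
    <= (cstate (run M w (m' + m))).1)).
  by rewrite /run iterD; case: oc' => -> _ _; rewrite sc; case: (acc _).
have after j : run M w (j + (m' + m)) = run M w (m' + m).
  by elim: j => // j IH; rewrite addSn /run iterS -/(run M w _) IH /step hl.
split=> [t|].
  apply: leq_trans (hP _).
  have [tm|mt'] := leqP t m; first exact: sp.
  have [tm|mt''] := leqP t (m' + m).
    by rewrite -(subnK (ltnW mt')) /run iterD; apply: sp'; lia.
  by rewrite -(subnK (ltnW mt'')) after /run iterD; apply: sp'.
exists (m' + m) => //; rewrite -accP.
have E : accepting (cstate (run M w (m' + m))) = acc (iter k body x); last first.
  exact: (eq_ind_r (fun b : bool => b <-> acc (iter k body x)) (iff_refl _) E).
change (((cstate (run M w (m' + m))).1 ==
  (size (compile prog 0 ++ [:: IBr RW lab lab.+1 lab])).+1 :> nat) = acc (iter k body x)).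
rewrite /run iterD; case: oc' => -> _ _; rewrite sc.
by case: (acc _); rewrite ?eqxx // ltn_eqF.
Qed.

(** * A library of polynomial-time functions *)

Lemma polyf_foldl X S A {EX : Enc X} {ES : Enc S} {EA : Enc A}
    (f : X -> S -> A -> S) (s0 : X -> S) (l : X -> seq A) :
  polyf l -> polyf s0 -> polyf (fun t : X * (S * A) => f t.1 t.2.1 t.2.2) ->
  (exists2 q, mpoly q & forall x i, i <= size (l x) ->
     esize (foldl (f x) (s0 x) (take i (l x))) <= q (esize x)) ->
  polyf (fun x => foldl (f x) (s0 x) (l x)).
Proof.
move=> pl ps pf [q mq hq]; have [ql mql hql] := polyf_size pl.
pose T := (X * (seq A * S))%type.
pose body (t : T) : T := if t.2.1 is a :: l' then (t.1, (l', f t.1 t.2.2 a)) else t.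
pose test (t : T) : bool := if t.2.1 is a :: l' then true else false.
have pt1 (Y : Type) (EY : Enc Y) : polyf (fun t : T * Y => t.1.1).
  by do 2 apply: polyf_fst; apply: polyf_id.
have pl1 : polyf (fun t : T => t.2.1) by apply: polyf_fst; apply: polyf_snd; apply: polyf_id.
have ptest : polyf test.
  by apply: (polyf_seq_case (g1 := fun _ => true)) pl1 _ _; apply: polyf_const.
have pbody : polyf body.
  apply: (polyf_seq_case (g1 := fun u => (u.1.1, (u.2.2, f u.1.1 u.1.2.2 u.2.1)))) pl1 _ _.
    exact: polyf_id.
  apply: polyf_pair; first exact: pt1.
  apply: polyf_pair; first by do 2 apply: polyf_snd; apply: polyf_id.
  apply: (polyf_comp (f := fun u : T * (A * seq A) => (u.1.1, (u.1.2.2, u.2.1))) pf).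
  apply: polyf_pair; first exact: pt1.
  apply: polyf_pair; first by do 2 apply: polyf_snd; apply: polyf_fst; apply: polyf_id.
  by apply: polyf_fst; apply: polyf_snd; apply: polyf_id.
have it x l' s i : i <= size l' ->
    iter i body (x, (l', s)) = (x, (drop i l', foldl (f x) s (take i l'))).
  elim: i l' s => [|i IH] [|a l'] s il //.
  by rewrite iterSr /= IH.
have ptot : polyf (fun x => iter (size (l x)) body (x, (l x, s0 x))).
  pose k (t : X * (seq A * S)) := size t.2.1.
  have pini : polyf (fun x => (x, (l x, s0 x))).
    by apply: polyf_pair; [apply: polyf_id|apply: polyf_pair].
  pose good (t : T) := exists x, t = (x, (l x, s0 x)).
  have [c [p [mp h]]] := pbody; have [ct [pt [mt ht]]] := ptest.
  have [ci [pi [mi hi]]] := pini.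
  have H : exists (c : cmd) (p : nat -> nat), mpoly p /\ forall x rest,
     execs c (arg (enc ((x, (l x, s0 x)) : T)) rest)
       (arg (enc (iter (size (l x)) body (x, (l x, s0 x)))) rest) (p (esize x)); last first.
    case: H => c' [p' [mp' h']]; exists (Seq ci c'), (fun n => pi n + p' n).
    by split; [auto with mp|move=> x r; apply: ex_seq (hi x r) (h' x r)].
  apply: (polyf_iter_on (P := fun x => ((x, (l x, s0 x)) : T)) (k := fun x => size (l x))
     (q := fun n => (n + (ql n + q n)).+2 + ql n) _ ptest pbody).
  - by auto 20 with mp.
  - move=> x i il; rewrite it ?(ltnW il) // /test /=.
    by have := size_drop i (l x); case: (drop i (l x)) => //= e; lia.
  - by move=> x; rewrite it // /test /= drop_size.
  - move=> x; have := hql x; have : size (l x) <= esize (l x); last lia.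
    by elim: (l x) => //= a l' IH; rewrite esize_cons; lia.
  - move=> x i il; rewrite it // !esize_pair; have := hq x i il; have := hql x.
    have : esize (drop i (l x)) <= esize (l x); last lia.
    elim: (l x) i {il} => [|a l' IH] [|i] //=; rewrite esize_cons.
    by apply: leq_trans (IH i) _; lia.
apply: (polyf_ext (f := fun x => (iter (size (l x)) body (x, (l x, s0 x))).2.2)).
  by move=> x; rewrite it // take_size.
by do 2 apply: polyf_snd.
Qed.

Lemma esize_take A {EA : Enc A} (l : seq A) i : esize (take i l) <= esize l.
Proof.
elim: l i => [|a l IH] i //; case: i => [|i]; first by rewrite take0 esize_nil esize_gt0.
by rewrite [take _ _]/= !esize_cons; have := IH i; lia.
Qed.

Lemma size_esize A {EA : Enc A} (l : seq A) : size l < esize l.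
Proof. by elim: l => //= a l IH; rewrite esize_cons; have := esize_gt0 a; lia. Qed.

Lemma esize_cat A {EA : Enc A} (l m : seq A) : esize (l ++ m) < esize l + esize m.
Proof.
elim: l => [|a l IH]; first by rewrite esize_nil add1n.
by rewrite cat_cons !esize_cons; lia.
Qed.

(** If each step adds an amount that depends on [x] and on the list element but not on the
    accumulator, then the accumulators grow polynomially. Most loops below are of this kind. *)
Lemma polyf_foldl_grow X S A {EX : Enc X} {ES : Enc S} {EA : Enc A}
    (f : X -> S -> A -> S) (s0 : X -> S) (l : X -> seq A) :
  polyf l -> polyf s0 -> polyf (fun t : X * (S * A) => f t.1 t.2.1 t.2.2) ->
  (exists2 r, mpoly r & forall x s a, esize (f x s a) <= esize s + r (esize x + esize a)) ->
  polyf (fun x => foldl (f x) (s0 x) (l x)).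
Proof.
move=> pl ps pf [r mr hr]; apply: polyf_foldl => //.
have [ql mql hql] := polyf_size pl; have [qs mqs hqs] := polyf_size ps.
exists (fun n => qs n + ql n * r (n + ql n)); first by auto 20 with mp.
move=> x i il; set R := r _.
have : forall l' s, esize l' <= ql (esize x) -> esize (foldl (f x) s l') <= esize s + size l' * R.
  elim=> [|a l' IH] s /=; first by rewrite mul0n addn0.
  rewrite esize_cons => h; have h1 : esize l' <= ql (esize x) by lia.
  have := IH (f x s a) h1; have := hr x s a.
  have : r (esize x + esize a) <= R by apply: (mpoly_mono mr); lia.
  by lia.
move/(_ (take i (l x)) (s0 x)) => h; apply: leq_trans (h _) _.
  exact: leq_trans (esize_take _ _) (hql x).
apply: leq_add => //; apply: leq_mul => //.
exact: leq_trans (ltnW (size_esize _)) (leq_trans (esize_take _ _) (hql x)).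
Qed.

Ltac pproj := repeat lazymatch goal with
  | |- polyf (fun x => x) => exact: polyf_id
  | |- polyf id => exact: polyf_id
  | |- polyf (fun x => fst (@?f x)) => apply: (polyf_fst (f := f))
  | |- polyf (fun x => snd (@?f x)) => apply: (polyf_snd (f := f))
  | |- polyf fst => apply: (polyf_fst (f := fun x => x))
  | |- polyf snd => apply: (polyf_snd (f := fun x => x))
  | |- polyf (fun _ => ?c) => exact: polyf_const
  end.

Lemma polyf_catrev X A {EX : Enc X} {EA : Enc A} (f g : X -> seq A) :
  polyf f -> polyf g -> polyf (fun x => catrev (f x) (g x)).
Proof.
move=> pf pg; apply: (polyf_ext (f := fun x => foldl (fun l a => a :: l) (g x) (f x))).
  by move=> x; elim: (f x) (g x) => //=.
apply: (polyf_foldl_grow (f := fun _ l a => a :: l)) => //.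
  by apply: polyf_cons; pproj.
by exists (fun n => n.+1); [auto with mp|move=> x s a; rewrite esize_cons; lia].
Qed.

Lemma polyf_rev X A {EX : Enc X} {EA : Enc A} (f : X -> seq A) :
  polyf f -> polyf (fun x => rev (f x)).
Proof. by move=> pf; apply: polyf_catrev pf _; apply: polyf_const. Qed.

Lemma polyf_cat X A {EX : Enc X} {EA : Enc A} (f g : X -> seq A) :
  polyf f -> polyf g -> polyf (fun x => f x ++ g x).
Proof.
move=> pf pg; apply: (polyf_ext (f := fun x => catrev (rev (f x)) (g x))).
  by move=> x; rewrite catrevE revK.
by apply: polyf_catrev pg; apply: polyf_rev.
Qed.

Lemma polyf_map X A B {EX : Enc X} {EA : Enc A} {EB : Enc B} (f : X -> A -> B) (l : X -> seq A) :
  polyf (fun t : X * A => f t.1 t.2) -> polyf l -> polyf (fun x => map (f x) (l x)).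
Proof.
move=> pf pl; apply: (polyf_ext (f := fun x => rev (foldl (fun s a => f x a :: s) [::] (l x)))).
  move=> x; suff H : forall s, foldl (fun s a => f x a :: s) s (l x) = rev (map (f x) (l x)) ++ s.
    by rewrite H cats0 revK.
  by elim: (l x) => //= a l' IH s; rewrite IH rev_cons cat_rcons.
apply: polyf_rev; apply: (polyf_foldl_grow (f := fun x s a => f x a :: s)) => //.
- exact: polyf_const.
- apply: polyf_cons; last by pproj.
  by apply: (polyf_comp (f := fun t => (t.1, t.2.2)) pf); apply: polyf_pair; pproj.
have [q mq hq] := polyf_size pf; exists (fun n => (q (n.+1)).+1); first by auto with mp.
move=> x s a; rewrite esize_cons; have := hq (x, a); rewrite /= esize_pair; lia.
Qed.

Lemma polyf_flatten X A {EX : Enc X} {EA : Enc A} (l : X -> seq (seq A)) :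
  polyf l -> polyf (fun x => flatten (l x)).
Proof.
move=> pl; apply: (polyf_ext (f := fun x => foldl (fun s a => s ++ a) [::] (l x))).
  move=> x; suff H : forall s, foldl (fun s a => s ++ a) s (l x) = s ++ flatten (l x) by rewrite H.
  by elim: (l x) => //= [s|a l' IH s]; rewrite ?cats0 // IH catA.
apply: (polyf_foldl_grow (f := fun _ s a => s ++ a)) => //; first exact: polyf_const.
  by apply: polyf_cat; pproj.
by exists id; [auto with mp|move=> x s a; apply: leq_trans (ltnW (esize_cat s a)) _; rewrite leq_add2l leq_addl].
Qed.

Lemma polyf_flatmap X A B {EX : Enc X} {EA : Enc A} {EB : Enc B}
    (f : X -> A -> seq B) (l : X -> seq A) :
  polyf (fun t : X * A => f t.1 t.2) -> polyf l -> polyf (fun x => flatten (map (f x) (l x))).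
Proof. by move=> pf pl; apply: polyf_flatten; apply: polyf_map. Qed.

Lemma polyf_filter X A {EX : Enc X} {EA : Enc A} (p : X -> A -> bool) (l : X -> seq A) :
  polyf (fun t : X * A => p t.1 t.2) -> polyf l -> polyf (fun x => filter (p x) (l x)).
Proof.
move=> pp pl; apply: (polyf_ext (f := fun x => flatten (map (fun a => if p x a then [:: a] else [::]) (l x)))).
  by move=> x; elim: (l x) => //= a l' ->; case: ifP.
apply: (polyf_flatmap (f := fun x a => if p x a then [:: a] else [::])) => //.
apply: polyf_if => //; last exact: polyf_const.
by apply: polyf_cons; pproj.
Qed.

Lemma polyf_all X A {EX : Enc X} {EA : Enc A} (p : X -> A -> bool) (l : X -> seq A) :
  polyf (fun t : X * A => p t.1 t.2) -> polyf l -> polyf (fun x => all (p x) (l x)).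
Proof.
move=> pp pl; apply: (polyf_ext (f := fun x => foldl (fun b a => b && p x a) true (l x))).
  move=> x; suff H : forall b, foldl (fun b a => b && p x a) b (l x) = b && all (p x) (l x) by [].
  by elim: (l x) => //= [b|a l' IH b]; rewrite ?andbT // IH andbA.
apply: (polyf_foldl_grow (f := fun x b a => b && p x a)) => //; first exact: polyf_const.
  apply: polyf_andb; first by pproj.
  by apply: (polyf_comp (f := fun t => (t.1, t.2.2)) pp); apply: polyf_pair; pproj.
exists (fun=> 3); [auto with mp|move=> x s a].
by apply: leq_trans (esize_bool _) _; apply: leq_addl.
Qed.

Lemma polyf_has X A {EX : Enc X} {EA : Enc A} (p : X -> A -> bool) (l : X -> seq A) :
  polyf (fun t : X * A => p t.1 t.2) -> polyf l -> polyf (fun x => has (p x) (l x)).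
Proof.
move=> pp pl; apply: (polyf_ext (f := fun x => ~~ all (fun a => ~~ p x a) (l x))).
  by move=> x; rewrite -has_predC; apply: eq_has => a /=; rewrite negbK.
by apply: polyf_negb; apply: (polyf_all (p := fun x a => ~~ p x a)) => //; apply: polyf_negb.
Qed.

Lemma polyf_mem X (A : eqType) {EX : Enc X} {EA : Enc A} {IA : EncInj A} (a : X -> A) (l : X -> seq A) :
  polyf a -> polyf l -> polyf (fun x => a x \in l x).
Proof.
move=> pa pl; apply: (polyf_ext (f := fun x => has (fun b => b == a x) (l x))).
  by move=> x; rewrite -has_pred1.
apply: (polyf_has (p := fun x b => b == a x)) => //; apply: polyf_eq; first by pproj.
by apply: (polyf_comp (f := fst) pa); pproj.
Qed.

Lemma polyf_unary X {EX : Enc X} (n : X -> nat) : polyf n -> polyf (fun x => nseq (n x) tt).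
Proof.
move=> pn; apply: (polyf_comp (g := fun n => nseq n tt)) pn.
by apply: polyf_recode; elim=> //= k; rewrite /enc /= => ->.
Qed.

Lemma polyf_size_seq X A {EX : Enc X} {EA : Enc A} (l : X -> seq A) :
  polyf l -> polyf (fun x => size (l x)).
Proof.
move=> pl; apply: (polyf_ext (f := fun x => foldl (fun n _ => n.+1) 0 (l x))).
  move=> x; suff H : forall n, foldl (fun n _ => n.+1) n (l x) = n + size (l x) by rewrite H.
  by elim: (l x) => //= [n|a l' IH n]; rewrite ?addn0 // IH addnS.
apply: (polyf_foldl_grow (f := fun _ n _ => n.+1)) => //; first exact: polyf_const.
  by apply: polyf_succ; pproj.
by exists (fun=> 2); [auto with mp|move=> x s a; rewrite !esize_nat; lia].
Qed.

Lemma foldl_unary S (f : S -> S) s n : foldl (fun s _ => f s) s (nseq n tt) = iter n f s.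
Proof. by elim: n s => //= n IH s; rewrite IH -iterSr. Qed.

Lemma polyf_addn X {EX : Enc X} (m n : X -> nat) : polyf m -> polyf n -> polyf (fun x => m x + n x).
Proof.
move=> pm pn; apply: (polyf_ext (f := fun x => foldl (fun s _ => s.+1) (n x) (nseq (m x) tt))).
  by move=> x; rewrite foldl_unary; elim: (m x) => //= k ->.
apply: (polyf_foldl_grow (f := fun _ s _ => s.+1)) => //; first exact: polyf_unary.
  by apply: polyf_succ; pproj.
by exists (fun=> 2); [auto with mp|move=> x s a; rewrite !esize_nat; lia].
Qed.

Lemma polyf_muln X {EX : Enc X} (m n : X -> nat) : polyf m -> polyf n -> polyf (fun x => m x * n x).
Proof.
move=> pm pn; apply: (polyf_ext (f := fun x => foldl (fun s _ => n x + s) 0 (nseq (m x) tt))).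
  by move=> x; rewrite foldl_unary; elim: (m x) => //= k ->; rewrite mulSn.
apply: (polyf_foldl_grow (f := fun x s _ => n x + s)); first exact: polyf_unary.
- exact: polyf_const.
- by apply: polyf_addn; pproj; apply: (polyf_comp pn); pproj.
have [q mq hq] := polyf_size pn; exists q; first by auto with mp.
move=> x s a; have := hq x; rewrite !esize_nat; have : q (esize x) <= q (esize x + esize a).
  by apply: (mpoly_mono mq); apply: leq_addr.
by lia.
Qed.

Lemma polyf_pred X {EX : Enc X} (n : X -> nat) : polyf n -> polyf (fun x => (n x).-1).
Proof.
move=> pn; apply: (polyf_ext (f := fun x => if n x is k.+1 then k else 0)); first by move=> x; case: (n x).
by apply: (polyf_nat_case (g0 := fun=> 0) (g1 := fun t : X * nat => t.2) pn); pproj.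
Qed.

Lemma polyf_subn X {EX : Enc X} (m n : X -> nat) : polyf m -> polyf n -> polyf (fun x => m x - n x).
Proof.
move=> pm pn; apply: (polyf_ext (f := fun x => foldl (fun s _ => s.-1) (m x) (nseq (n x) tt))).
  by move=> x; rewrite foldl_unary; elim: (n x) => [|k /= ->]; rewrite ?subn0 ?subnS.
apply: (polyf_foldl_grow (f := fun _ s _ => s.-1)) => //; first exact: polyf_unary.
  by apply: polyf_pred; pproj.
by exists (fun=> 0); [auto with mp|move=> x s a; rewrite !esize_nat; lia].
Qed.

Lemma polyf_leq X {EX : Enc X} (m n : X -> nat) : polyf m -> polyf n -> polyf (fun x => m x <= n x).
Proof.
by move=> pm pn; apply: polyf_eq; [apply: polyf_subn|apply: polyf_const].
Qed.

Lemma polyf_iota X {EX : Enc X} (n : X -> nat) : polyf n -> polyf (fun x => iota 0 (n x)).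
Proof.
move=> pn; pose g (s : seq nat) := (if s is a :: _ then a.+1 else 0) :: s.
have gE k : iter k g [::] = rev (iota 0 k).
  elim: k => // k IH; rewrite iterS IH -addn1 iotaD rev_cat /= /g; congr cons.
  by case: k {IH} => // k; rewrite -addn1 iotaD rev_cat /= add0n addn1.
apply: (polyf_ext (f := fun x => rev (foldl (fun s _ => g s) [::] (nseq (n x) tt)))).
  by move=> x; rewrite foldl_unary gE revK.
apply: polyf_rev; apply: (polyf_foldl (f := fun _ s _ => g s)).
- exact: polyf_unary.
- exact: polyf_const.
- apply: polyf_cons; last by pproj.
  apply: (polyf_seq_case (h := fun t : X * (seq nat * unit) => t.2.1) (g1 := fun t => t.2.1.+1)).
  + by pproj.
  + exact: polyf_const.
  + by apply: polyf_succ; pproj.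
have [q mq hq] := polyf_size pn; exists (fun k => q k * (2 * q k + 2) + 1); first by auto 20 with mp.
move=> x i; rewrite size_nseq => il; rewrite take_nseq // foldl_unary gE.
have := hq x; rewrite esize_nat => nq.
have : forall l : seq nat, all (fun a => a <= q (esize x)) l ->
    esize l <= size l * (2 * q (esize x) + 2) + 1.
  by elim=> //= a l IH /andP[ha /IH]; rewrite esize_cons esize_nat; lia.
move/(_ (rev (iota 0 i))); rewrite all_rev size_rev size_iota => h; apply: leq_trans (h _) _.
  by apply/allP => a; rewrite mem_iota; lia.
by rewrite leq_add2r; apply: leq_mul => //; lia.
Qed.

Lemma polyf_drop X A {EX : Enc X} {EA : Enc A} (n : X -> nat) (l : X -> seq A) :
  polyf n -> polyf l -> polyf (fun x => drop (n x) (l x)).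
Proof.
move=> pn pl; apply: (polyf_ext (f := fun x => foldl (fun s _ => behead s) (l x) (nseq (n x) tt))).
  move=> x; rewrite foldl_unary; elim: (n x) (l x) => [|k IH] s; first by rewrite drop0.
  by rewrite iterSr IH; case: s => //=; case: k {IH}.
apply: (polyf_foldl_grow (f := fun _ s _ => behead s)) => //; first exact: polyf_unary.
  apply: (polyf_seq_case (h := fun t : X * (seq A * unit) => t.2.1) (g1 := fun t => t.2.2)).
  + by pproj.
  + exact: polyf_const.
  + by pproj.
exists (fun=> 0); [auto with mp|move=> x [|a s] _ //=]; rewrite esize_cons; lia.
Qed.

Lemma polyf_nth X A {EX : Enc X} {EA : Enc A} (d : A) (l : X -> seq A) (n : X -> nat) :
  polyf l -> polyf n -> polyf (fun x => nth d (l x) (n x)).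
Proof.
move=> pl pn; apply: (polyf_ext (f := fun x => if drop (n x) (l x) is a :: _ then a else d)).
  move=> x; have -> : forall s, (if s is a :: _ then a else d) = head d s by case.
  by rewrite -nth0 nth_drop addn0.
apply: (polyf_seq_case (g1 := fun t => t.2.1) (polyf_drop pn pl)); first exact: polyf_const.
by pproj.
Qed.

Lemma polyf_index X (A : eqType) {EX : Enc X} {EA : Enc A} {IA : EncInj A} (a : X -> A) (l : X -> seq A) :
  polyf a -> polyf l -> polyf (fun x => index (a x) (l x)).
Proof.
move=> pa pl; pose f x (s : bool * nat) b := if s.1 || (b == a x) then (true, s.2) else (false, s.2.+1).
apply: (polyf_ext (f := fun x => (foldl (f x) (false, 0) (l x)).2)).
  move=> x; suff H : forall s, (foldl (f x) s (l x)).2 = if s.1 then s.2 else s.2 + index (a x) (l x).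
    by rewrite H.
  elim: (l x) => [|b l' IH] [[] n] //=; rewrite ?addn0 // IH /f /=.
  by case: eqP; rewrite ?addn0 ?addnS.
apply: polyf_snd; apply: (polyf_foldl_grow (f := f)) => //; first exact: polyf_const.
  apply: polyf_if.
  - apply: polyf_orb; first by pproj.
    by apply: polyf_eq; [pproj|apply: (polyf_comp (f := fst) pa); pproj].
  - by apply: polyf_pair; pproj.
  - by apply: polyf_pair; pproj; apply: polyf_succ; pproj.
exists (fun=> 10); first by auto with mp.
move=> x [b n] c; rewrite /f /=; case: ifP => _; rewrite !esize_pair ?esize_nat;
  have := esize_bool true; have := esize_bool false; have := esize_gt0 b; lia.
Qed.

Definition enc_fin (T : finType) : Enc (Finite.sort T) := fun x => enc (enum_rank x : nat).

Lemma inj_fin (T : finType) : @EncInj (Finite.sort T) (@enc_fin T).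
Proof. by move=> x y /(@enc_inj nat) /val_inj /enum_rank_inj. Qed.

(** A function on a fixed finite type is a finite table, whatever its definition. In this way the
    symbols and states of a fixed machine cost nothing. *)
Lemma polyf_fin (T : finType) Y {ET : Enc T} {IT : EncInj T} {EY : Enc Y} (f : T -> Y) : polyf f.
Proof.
case E: (enum T) => [|t0 s].
  exists Skip, (fun=> 0); split; first by auto with mp.
  by move=> x; have := mem_enum T x; rewrite E.
pose g s x := foldr (fun t k => if x == t then f t else k) (f t0) s.
apply: (polyf_ext (f := g (enum T))).
  move=> x; have : x \in enum T by rewrite mem_enum.
  by elim: (enum T) => //= t s' IH; rewrite inE; case: eqP => [->|].
elim: (enum T) => [|t s' IH]; first exact: polyf_const.
by apply: polyf_if => //; [apply: polyf_eq; pproj|apply: polyf_const].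
Qed.

(** * Constraint graphs from lists of vertices and edges *)

From mathcomp Require Import fingroup perm ssralg ssrnum ssrint.

Inductive reach {A : Type} (R : A -> A -> Prop) (x : A) : A -> Prop :=
| ReachRefl : reach R x x
| ReachStep y z : reach R x y -> R y z -> reach R x z.

Lemma reach_trans A (R : A -> A -> Prop) x y z : reach R x y -> reach R y z -> reach R x z.
Proof. by move=> h; elim=> // u v _ IH; apply: ReachStep. Qed.

Lemma reach1 A (R : A -> A -> Prop) x y : R x y -> reach R x y.
Proof. exact: ReachStep (ReachRefl _ _). Qed.

Lemma reach_sym A (R : A -> A -> Prop) x y :
  (forall u v, R u v -> R v u) -> reach R x y -> reach R y x.
Proof.
move=> sR; elim=> [|u v _ IH /sR h]; first exact: ReachRefl.
exact: reach_trans (reach1 h) IH.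
Qed.

Lemma reach_inv A (R : A -> A -> Prop) (P : A -> Prop) x y :
  (forall u v, R u v -> P u -> P v) -> reach R x y -> P x -> P y.
Proof. by move=> h; elim=> // u v _ IH /h huv /IH/huv. Qed.

Lemma reach_map A B (f : A -> B) (R : A -> A -> Prop) (S : B -> B -> Prop) x y :
  (forall u v, R u v -> reach S (f u) (f v)) -> reach R x y -> reach S (f x) (f y).
Proof.
move=> h; elim=> [|u v _ IH /h huv]; first exact: ReachRefl.
exact: reach_trans IH huv.
Qed.

Lemma index_inj_in (T : eqType) (s : seq T) (u v : T) :
  u \in s -> v \in s -> index u s = index v s -> u = v.
Proof. by move=> hu hv e; rewrite -(nth_index u hu) e nth_index. Qed.

Section MakeGraph.
Variables (V K : eqType) (VL : seq V) (EL : seq K) (sv dv : K -> V) (w : K -> nat).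

Record graph_ok : Prop := GraphOk {
  uniqV : uniq VL;
  uniqE : uniq EL;
  sv_in : {in EL, forall k, sv k \in VL};
  dv_in : {in EL, forall k, dv k \in VL};
  sv_lt : {in EL, forall k, index (sv k) VL < index (dv k) VL};
  ends_ok : {in EL &, injective (fun k => (sv k, dv k))};
  w_gt0 : {in EL, forall k, 0 < w k} }.

Hypothesis ok : graph_ok.

Definition edge_key (e : 'I_(size EL)) : K := tnth (in_tuple EL) e.

Lemma edge_key_in e : edge_key e \in EL. Proof. exact: mem_tnth. Qed.

Lemma sv_index e : index (sv (edge_key e)) VL < size VL.
Proof. by rewrite index_mem (sv_in ok) ?edge_key_in. Qed.

Lemma dv_index e : index (dv (edge_key e)) VL < size VL.
Proof. by rewrite index_mem (dv_in ok) ?edge_key_in. Qed.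

Definition key_ends : {ffun 'I_(size EL) -> 'I_(size VL) * 'I_(size VL)} :=
  [ffun e => (Ordinal (sv_index e), Ordinal (dv_index e))].

Lemma key_ends_lt e : (key_ends e).1 < (key_ends e).2.
Proof. by rewrite ffunE /= (sv_lt ok) ?edge_key_in. Qed.

Lemma edge_key_inj : injective edge_key.
Proof.
move=> e e' /eqP; rewrite /edge_key !(tnth_nth (edge_key e)) nth_uniq ?(uniqE ok) //.
by move=> /eqP/val_inj.
Qed.

Lemma key_ends_inj : injective key_ends.
Proof.
move=> e e'; rewrite !ffunE => -[h1 h2]; apply: edge_key_inj.
have i1 := edge_key_in e; have i2 := edge_key_in e'.
apply: (ends_ok ok) => //; congr pair.
  by apply: (index_inj_in (s := VL)) => //; apply: (sv_in ok).
by apply: (index_inj_in (s := VL)) => //; apply: (dv_in ok).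
Qed.

Definition key_weight : {ffun 'I_(size EL) -> nat} := [ffun e => w (edge_key e)].

Lemma key_weight_gt0 e : 0 < key_weight e.
Proof. by rewrite ffunE (w_gt0 ok) ?edge_key_in. Qed.

Definition key_graph : constraint_graph :=
  ConstraintGraph [ffun=> 2] key_ends_lt key_ends_inj key_weight_gt0.

Definition of_fun (c : K -> bool) : orientation key_graph := [ffun e => c (edge_key e)].

Definition to_fun (C : orientation key_graph) (k : K) : bool :=
  if insub (index k EL) is Some e then C e else false.

Lemma index_edge_key e : index (edge_key e) EL = e.
Proof. by rewrite /edge_key (tnth_nth (edge_key e)) index_uniq // (uniqE ok). Qed.

Lemma to_funK C : of_fun (to_fun C) = C.
Proof.
apply/ffunP => e; rewrite ffunE /to_fun index_edge_key.
by rewrite insubT //= => h; congr (C _); apply: val_inj.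
Qed.

Definition inflow (c : K -> bool) (v : V) : nat :=
  \sum_(k <- EL | (if c k then dv k else sv k) == v) w k.

Definition key_legal (c : K -> bool) : Prop := {in VL, forall v, 2 <= inflow c v}.

Lemma big_keys (P : pred K) (F : K -> nat) :
  \sum_(e < size EL | P (edge_key e)) F (edge_key e) = \sum_(k <- EL | P k) F k.
Proof. by rewrite (big_tuple _ _ (in_tuple EL)). Qed.

Lemma legal_of_fun c : reflect (key_legal c) (legal (of_fun c)).
Proof.
have E (v : 'I_(size VL)) u : nth u VL v = u ->
    \sum_(e | edge_target (of_fun c) e == v) @weight key_graph e = inflow c u.
  move=> hv; rewrite /inflow -big_keys; apply: eq_big => e; last by rewrite ffunE.
  rewrite /edge_target !ffunE /=; case: (c _) => /=; rewrite -val_eqE /=.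
    by rewrite -[u]hv -[X in _ == X](index_uniq u (ltn_ord v) (uniqV ok));
       apply/eqP/eqP => [|-> //]; apply: index_inj_in; rewrite ?(dv_in ok) ?edge_key_in ?mem_nth.
  by rewrite -[u]hv -[X in _ == X](index_uniq u (ltn_ord v) (uniqV ok));
       apply/eqP/eqP => [|-> //]; apply: index_inj_in; rewrite ?(sv_in ok) ?edge_key_in ?mem_nth.
apply: (iffP forallP) => [h v hv|h v].
  have hi : index v VL < size VL by rewrite index_mem.
  by have := h (Ordinal hi); rewrite ffunE (E _ v) //= nth_index.
have [u0 _] : exists u : V, True by case: (VL) (v : 'I_(size VL)) => [[m hm]|u l v']; [by []|exists u].
rewrite ffunE (E _ (nth u0 VL v)); first by apply: h; apply: mem_nth.
exact: set_nth_default.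
Qed.

(** The two functions may also agree at [k], and they are unconstrained outside [EL]. Steps that
    reverse no edge are thus included, which makes the relation insensitive to the choice among
    functions that agree on the edges; [reach_reconfigurable] drops such steps. *)
Definition key_step (c c' : K -> bool) : Prop :=
  [/\ key_legal c, key_legal c' & exists k, {in EL, forall k', k' != k -> c k' = c' k'}].

Lemma reach_reconfigurable c c' :
  reach key_step c c' -> key_legal c -> reconfigurable (of_fun c) (of_fun c').
Proof.
move=> h lc; elim: h => [|u v _ [p [pp pl pe]] [lu lv [k hk]]].
  by exists [::]; split=> //=; rewrite andbT; apply/legal_of_fun.
have [e|ne] := eqVneq (of_fun u) (of_fun v); first by exists p; rewrite -e.
exists (rcons p (of_fun v)); split.
- rewrite rcons_path pp pe /=; move: ne {pp pl pe}.
  rewrite /one_reversal => ne.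
  have [e he] : exists e, of_fun u e != of_fun v e.
    apply/existsP; apply: contraNT ne => /existsPn h; apply/eqP/ffunP => e.
    by have := h e; rewrite negbK => /eqP.
  have ek e' : of_fun u e' != of_fun v e' -> edge_key e' = k.
    by rewrite !ffunE; apply: contraNeq => /hk -> //; apply: edge_key_in.
  apply/cards1P; exists e; apply/setP => e'; rewrite !inE; apply/idP/eqP => [h|-> //].
  by apply: edge_key_inj; rewrite (ek _ h) (ek _ he).
- by rewrite -rcons_cons all_rcons pl andbT; apply/legal_of_fun.
- by rewrite last_rcons.
Qed.

Lemma reconfigurable_reach C C' : reconfigurable C C' -> reach key_step (to_fun C) (to_fun C').
Proof.
have lg D : legal D -> key_legal (to_fun D) by rewrite -{1}(to_funK D) => /legal_of_fun.
move=> [p [pp pl <-]]; elim: p C pp pl => [|D p IH] C /=; first by constructor.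
move=> /andP[r pp] /andP[lC pl]; apply: reach_trans (IH D pp pl); apply: reach1.
split; [exact: lg|by apply: lg; case/andP: pl|].
move: r => /cards1P[e /setP he]; exists (edge_key e) => k _ kn; rewrite /to_fun.
case: insubP => // i hi ei; have := he i; rewrite !inE.
have [ie _|_ h] := eqVneq i e; last by apply/eqP; rewrite (negbFE h).
case/eqP: kn.
have ik : k \in EL by rewrite -index_mem.
by apply: (index_inj_in ik (edge_key_in e)); rewrite index_edge_key -ei ie.
Qed.

Lemma incident_count (P : pred nat) (v : 'I_(size VL)) u : nth u VL v = u ->
  #|[set e | @incident key_graph v e & P (@weight key_graph e)]| =
  \sum_(k <- EL | ((sv k == u) || (dv k == u)) && P (w k)) 1.
Proof.
move=> hv; rewrite -sum1_card -big_keys; apply: eq_big => // e.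
rewrite !inE /incident !ffunE /= -!val_eqE /=; congr andb.
have iv : index u VL = v by rewrite -[u]hv index_uniq ?(uniqV ok).
have inV : u \in VL by rewrite -[u]hv mem_nth.
have aux x : x \in VL -> (v == index x VL :> nat) = (x == u).
  by move=> hx; rewrite -iv eq_sym; apply/eqP/eqP => [|-> //]; apply: index_inj_in.
by rewrite !aux ?(sv_in ok) ?(dv_in ok) ?edge_key_in.
Qed.

Lemma key_and_or :
  {in VL, forall u, let deg P := \sum_(k <- EL | ((sv k == u) || (dv k == u)) && P (w k)) 1 in
    deg xpredT = 3 /\ (deg (pred1 2) = 3 \/ deg (pred1 1) = 2 /\ deg (pred1 2) = 1)} ->
  and_or_graph key_graph.
Proof.
move=> h v.
have [u0 _] : exists u : V, True by case: (VL) (v : 'I_(size VL)) => [[m hm]|u l v']; [by []|exists u].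
have hv : nth (nth u0 VL v) VL v = nth u0 VL v by apply: set_nth_default.
have [|d3 dd] := h (nth u0 VL v); first exact: mem_nth.
have i3 : #|[set e | @incident key_graph v e]| = 3.
  rewrite -d3 -(incident_count xpredT hv); apply: eq_card => e; by rewrite !inE andbT.
case: dd => [d2|[d1 d2]].
  apply/orP; right; rewrite /or_vertex ffunE eqxx i3 eqxx /=; apply/forallP => e; apply/implyP => ie.
  have : [set e | @incident key_graph v e & @weight key_graph e == 2] =
      [set e | @incident key_graph v e].
    apply/eqP; rewrite eqEcard i3 (incident_count (pred1 2) hv) d2 leqnn andbT.
    by apply/subsetP => e'; rewrite !inE => /andP[].
  by move/setP/(_ e); rewrite !inE ie /=.
apply/orP; left; rewrite /and_vertex ffunE eqxx i3 eqxx /=.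
by rewrite (incident_count (pred1 1) hv) d1 (incident_count (pred1 2) hv) d2.
Qed.

(** The list [VL] itself is the layout. *)
Lemma key_bandwidth c :
  {in EL, forall k, index (dv k) VL - index (sv k) VL <= c} -> bandwidth key_graph <= c.
Proof.
move=> h; rewrite /bandwidth; case: arg_minnP => // s _ /(_ 1%g isT) /leq_trans; apply.
apply/bigmax_leqP => e _; rewrite !perm1 !ffunE /=.
have := h _ (edge_key_in e); have := sv_lt ok (edge_key_in e).
by rewrite -/(edge_key e) -/(edge_key _); lia.
Qed.

Variables (s t : K -> bool).
Hypotheses (ls : key_legal s) (lt : key_legal t).

Definition key_instance : instance :=
  Instance (introT (legal_of_fun s) ls) (introT (legal_of_fun t) lt).

Definition key_data : seq nat :=
  size VL :: size EL :: nseq (size VL) 2 ++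
  flatten [seq [:: index (sv k) VL; index (dv k) VL; w k; nat_of_bool (s k); nat_of_bool (t k)]
          | k <- EL].

Lemma encode_key_instance : encode key_instance = flatten [seq encode_nat n | n <- key_data].
Proof.
rewrite /encode; congr (flatten (map _ _)).
rewrite /instance_data /key_data cat_cons /=; do 2 congr cons; congr cat.
  rewrite (@eq_map _ _ _ (fun=> 2)); last by move=> v; rewrite ffunE.
  by rewrite -[in RHS](size_enum_ord (size VL)); elim: (enum _) => //= x l ->.
have E : EL = [seq edge_key e | e <- enum 'I_(size EL)] by rewrite (map_tnth_enum (in_tuple EL)).
congr flatten; rewrite [X in _ = map _ X]E -map_comp.
by apply: eq_map => e; rewrite /edge_data /= !ffunE.
Qed.

End MakeGraph.

(** * Assembling gadgets *)

(* Every port is the end of an edge of weight 2 that leaves the gadget; a clause is a set of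
   ports of which at least one has to point into the gadget. *)
Record gadget := Gadget {
  gverts : nat;
  gedges : seq (nat * nat * nat);
  gports : seq nat;
  gclauses : seq (seq nat) }.

Definition gedge (K : gadget) (e : nat) : nat * nat * nat := nth (0, 0, 0) (gedges K) e.

(** In [b], true means that the port edge points into the gadget; in [x], that the inner edge points
    to its second end. The function [f] on weights makes the same sum serve for inflows, with [id],
    and for degrees, with a predicate. *)
Definition ginflow (f : nat -> nat) (K : gadget) (b x : seq bool) (v : nat) : nat :=
  sumn [seq if nth false b j && (nth 0 (gports K) j == v) then f 2 else 0
       | j <- iota 0 (size (gports K))] +
  sumn [seq if (if nth false x e then (gedge K e).1.2 else (gedge K e).1.1) == v
            then f (gedge K e).2 else 0 | e <- iota 0 (size (gedges K))].

Definition glegal (K : gadget) (b x : seq bool) : bool :=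
  all (fun v => 2 <= ginflow id K b x v) (iota 0 (gverts K)).

Definition gsat (K : gadget) (b : seq bool) : bool := all (has (nth false b)) (gclauses K).

Fixpoint bitseqs (n : nat) : seq (seq bool) :=
  if n is m.+1 then [seq true :: s | s <- bitseqs m] ++ [seq false :: s | s <- bitseqs m]
  else [:: [::]].

Lemma mem_bitseqs n s : (s \in bitseqs n) = (size s == n).
Proof.
elim: n s => [|n IH] [|b s] //=; rewrite mem_cat; first by apply/orP => -[] /mapP[].
rewrite eqSS -IH; apply/orP/idP => [[] /mapP[u hu [_ ->]] //|h].
by case: b; [left|right]; apply/mapP; exists s.
Qed.

Fixpoint hamming (x y : seq bool) : nat :=
  if x is a :: x' then if y is b :: y' then
    let n := hamming x' y' in if a then if b then n else n.+1 else if b then n.+1 else n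
  else 0 else 0.

Lemma hamming_count x y : hamming x y = count (fun p => p.1 != p.2) (zip x y).
Proof. by elim: x y => [|a x IH] [|b y] //=; rewrite IH; case: a; case: b. Qed.

Definition adjacent (x y : seq bool) : bool := if hamming x y is 1 then true else false.

Lemma adjacentE x y : adjacent x y = (hamming x y == 1).
Proof. by rewrite /adjacent; case: (hamming x y) => [|[]]. Qed.

Lemma hamming1 x y : size x = size y -> hamming x y <= 1 ->
  exists i, forall j, j != i -> nth false x j = nth false y j.
Proof.
rewrite hamming_count; elim: x y => [|a x IH] [|b y] //= => [_ _|[sz]]; first by exists 0.
have [-> /(IH _ sz)[i hi]|_ h] := eqVneq a b.
  by exists i.+1 => -[|j] //=; rewrite eqSS; apply: hi.
exists 0 => -[|j] //= _; move: h; rewrite addnC addn1 ltnS leqn0 => /eqP h.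
elim: x y sz h j {IH} => [|c x IH] [|d y] //= [sz].
by have [-> h [|j] //=|//] := eqVneq c d; apply: IH.
Qed.

(** A flood fill in the graph of words that differ in one bit: [rest] has not been seen yet,
    [frontier] has been seen but not expanded. Fuel equal to the number of words suffices, as each
    is expanded once. *)
Fixpoint spread (fuel : nat) (frontier rest : seq (seq bool)) : bool :=
  if frontier is x :: fr then
    if fuel is n.+1 then
      spread n ([seq y <- rest | adjacent x y] ++ fr) [seq y <- rest | ~~ adjacent x y]
    else false
  else nilp rest.

Lemma spreadP (Q : seq bool -> Prop) (ls : seq (seq bool)) fuel fr rest :
  (forall x y, Q x -> y \in ls -> hamming x y = 1 -> Q y) ->
  spread fuel fr rest -> {subset rest <= ls} -> (forall y, y \in fr -> Q y) ->
  forall y, y \in rest -> Q y.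
Proof.
move=> hQ; elim: fuel fr rest => [|n IH] [|x fr] rest //=; try by move=> /nilP ->.
move=> /IH h sub hf y hy; have [e|ne] := boolP (adjacent x y).
  move: e; rewrite adjacentE => /eqP e; by apply: (hQ x) e; [apply: hf; apply: mem_head|apply: sub].
apply: h; rewrite ?mem_filter ?ne //.
  by move=> z; rewrite mem_filter => /andP[_ /sub].
move=> z; rewrite mem_cat mem_filter => /orP[/andP[]|hz]; last by apply: hf; rewrite inE hz orbT.
rewrite adjacentE => /eqP e hz; by apply: (hQ x) e; [apply: hf; apply: mem_head|apply: sub].
Qed.

(* The incidences of every vertex are tabulated once and for all, to speed up the checks. *)
Definition incidences (K : gadget) (v : nat) : seq nat * (seq (nat * nat) * seq (nat * nat)) :=
  ([seq j <- iota 0 (size (gports K)) | nth 0 (gports K) j == v],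
   ([seq (e, (gedge K e).2) | e <- iota 0 (size (gedges K)) & (gedge K e).1.2 == v],
    [seq (e, (gedge K e).2) | e <- iota 0 (size (gedges K)) & (gedge K e).1.1 == v])).

Definition fast_legal (b : seq bool) (tab : seq (seq nat * (seq (nat * nat) * seq (nat * nat))))
    (x : seq bool) : bool :=
  foldr (fun t r =>
    if sumn [seq if nth false b j then 2 else 0 | j <- t.1] +
       (sumn [seq if nth false x e.1 then e.2 else 0 | e <- t.2.1] +
        sumn [seq if nth false x e.1 then 0 else e.2 | e <- t.2.2]) is _.+2 then r else false)
    true tab.

Definition glegals (K : gadget) (b : seq bool) : seq (seq bool) :=
  let tab := [seq incidences K v | v <- iota 0 (gverts K)] in
  filter (fast_legal b tab) (bitseqs (size (gedges K))).

Lemma glegalsE K b : glegals K b = filter (glegal K b) (bitseqs (size (gedges K))).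
Proof.
apply: eq_filter => x; rewrite /glegal; elim: (iota 0 (gverts K)) => //= v l <-.
set n := (X in if X is _.+2 then _ else _); suff -> : ginflow id K b x v = n by case: n => [|[]].
rewrite /n /ginflow /incidences /= !sumnE !big_map !big_filter; congr addn.
  by rewrite [RHS]big_mkcond; apply: eq_bigr => j _; case: (nth _ b j); case: eqP.
rewrite [X in _ = X + _]big_mkcond [X in _ = _ + X]big_mkcond -big_split.
apply: eq_big_seq => e; rewrite mem_iota /= => he.
by case: (nth _ x e); case: ((gedge K e).1.1 == v); case: ((gedge K e).1.2 == v); rewrite ?addn0.
Qed.

(** First half of what makes a gadget replaceable by its clauses: for given ports, legal inner
    orientations exist exactly if the clauses hold, and then single reversals connect them. *)
Definition connected_fibers (K : gadget) : bool :=
  all (fun b => let ls := glegals K b in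
    (gsat K b == ~~ nilp ls) && (if ls is x :: l then spread (size ls) [:: x] l else true))
    (bitseqs (size (gports K))).

(** Second half: a port can be reversed only while the inner orientation is legal before and after.
    [liftable] demands such a common orientation for any two admissible port assignments that differ
    in at most one place. *)
Definition common_legals (K : gadget) (b b' : seq bool) : seq (seq bool) :=
  filter (glegal K b') (glegals K b).

(* Nested conditionals, since [&&] and [==>] are strict under [vm_compute]. *)
Definition liftable (K : gadget) : bool :=
  let bs := bitseqs (size (gports K)) in
  all (fun b => if gsat K b then
    let ls := glegals K b in
    all (fun b' => if hamming b b' <= 1 then
      if gsat K b' then ~~ nilp (filter (glegal K b') ls) else true else true) bs else true) bs.

Definition gdegree (P : pred nat) (K : gadget) (v : nat) : nat :=
  sumn [seq if nth 0 (gports K) j == v then P 2 : nat else 0 | j <- iota 0 (size (gports K))] +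
  (sumn [seq if (gedge K e).1.2 == v then P (gedge K e).2 : nat else 0 | e <- iota 0 (size (gedges K))] +
   sumn [seq if (gedge K e).1.1 == v then P (gedge K e).2 : nat else 0 | e <- iota 0 (size (gedges K))]).

Definition gadget_ok (K : gadget) : bool :=
  [&& all (fun v => v < gverts K) (gports K),
      all (fun e => (e.1.1 < e.1.2) && (e.1.2 < gverts K) && (0 < e.2)) (gedges K),
      uniq [seq e.1 | e <- gedges K] &
      all (fun v => (gdegree xpredT K v == 3) &&
        ((gdegree (pred1 2) K v == 3) ||
         (gdegree (pred1 1) K v == 2) && (gdegree (pred1 2) K v == 1))) (iota 0 (gverts K))].

Lemma big_iota_sumn n (P : pred nat) (F : nat -> nat) :
  sumn [seq if P j then F j else 0 | j <- iota 0 n] = \sum_(j <- iota 0 n | P j) F j.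
Proof. by rewrite sumnE big_map -big_mkcond. Qed.

Section Assembly.
Variables (P T : eqType) (PL : seq P) (TL : seq T) (kd : P -> gadget).
Variables (att : P -> nat -> T * bool) (tsrc tdst : T -> P * nat).

Let np p := size (gports (kd p)).
Let mp p := size (gedges (kd p)).

(** The function [att] is inverse to [tsrc] and [tdst]: its Boolean tells whether the port is the
    target end of its link. The fields [link_lt] and [link_inj] make the resulting graph simple,
    with ends in increasing order. *)
Record assembly_ok : Prop := AssemblyOk {
  parts_uniq : uniq PL;
  links_uniq : uniq TL;
  att_link : forall p j, p \in PL -> j < np p ->
    (att p j).1 \in TL /\ (if (att p j).2 then tdst else tsrc) (att p j).1 = (p, j);
  tsrc_att : forall k, k \in TL ->
    [/\ (tsrc k).1 \in PL, (tsrc k).2 < np (tsrc k).1 & att (tsrc k).1 (tsrc k).2 = (k, false)];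
  tdst_att : forall k, k \in TL ->
    [/\ (tdst k).1 \in PL, (tdst k).2 < np (tdst k).1 & att (tdst k).1 (tdst k).2 = (k, true)];
  link_lt : forall k, k \in TL -> index (tsrc k).1 PL < index (tdst k).1 PL;
  link_inj : {in TL &, injective (fun k => ((tsrc k).1, (tdst k).1))};
  parts_ok : forall p, p \in PL -> gadget_ok (kd p);
  parts_fibers : forall p, p \in PL -> connected_fibers (kd p);
  parts_lift : forall p, p \in PL -> liftable (kd p) }.

Hypothesis ok : assembly_ok.

Definition part_verts (p : P) : seq (P * nat) := [seq (p, i) | i <- iota 0 (gverts (kd p))].
Definition verts : seq (P * nat) := flatten [seq part_verts p | p <- PL].
Definition inner_edges : seq (P * nat) := flatten [seq [seq (p, e) | e <- iota 0 (mp p)] | p <- PL].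
Definition edges : seq (T + P * nat) := map inl TL ++ map inr inner_edges.

Definition port_vert (x : P * nat) : P * nat := (x.1, nth 0 (gports (kd x.1)) x.2).

Definition esrc (k : T + P * nat) : P * nat :=
  match k with inl k => port_vert (tsrc k) | inr (p, e) => (p, (gedge (kd p) e).1.1) end.
Definition edst (k : T + P * nat) : P * nat :=
  match k with inl k => port_vert (tdst k) | inr (p, e) => (p, (gedge (kd p) e).1.2) end.
Definition eweight (k : T + P * nat) : nat :=
  match k with inl _ => 2 | inr (p, e) => (gedge (kd p) e).2 end.

Lemma mem_verts p i : ((p, i) \in verts) = (p \in PL) && (i < gverts (kd p)).
Proof.
apply/flatten_mapP/andP => [[q hq /mapP[j]]|[hp hi]].
  by rewrite mem_iota => hj [-> ->].
by exists p => //; apply/mapP; exists i; rewrite ?mem_iota.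
Qed.

Lemma mem_inner p e : ((p, e) \in inner_edges) = (p \in PL) && (e < mp p).
Proof.
apply/flatten_mapP/andP => [[q hq /mapP[j]]|[hp hi]].
  by rewrite mem_iota => hj [-> ->].
by exists p => //; apply/mapP; exists e; rewrite ?mem_iota.
Qed.

Lemma mem_edges_inl k : (inl k \in edges) = (k \in TL).
Proof.
rewrite mem_cat mem_map; last by move=> x y [].
suff -> : (inl k \in map inr inner_edges) = false by rewrite orbF.
by apply/mapP => -[].
Qed.

Lemma mem_edges_inr x : (inr x \in edges) = (x \in inner_edges).
Proof.
rewrite mem_cat [X in _ || X]mem_map; last by move=> u v [].
suff -> : (inr x \in map inl TL) = false by [].
by apply/mapP => -[].
Qed.

Lemma port_lt p j : p \in PL -> j < np p -> nth 0 (gports (kd p)) j < gverts (kd p).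
Proof.
move=> hp hj; have /and4P[/allP h _ _ _] := parts_ok ok hp.
by apply: h; rewrite mem_nth.
Qed.

Lemma gedge_lt p e : p \in PL -> e < mp p ->
  [/\ (gedge (kd p) e).1.1 < (gedge (kd p) e).1.2, (gedge (kd p) e).1.2 < gverts (kd p)
    & 0 < (gedge (kd p) e).2].
Proof.
move=> hp hj; have /and4P[_ /allP h _ _] := parts_ok ok hp.
by have /andP[/andP[]] := h _ (mem_nth (0, 0, 0) hj).
Qed.

Lemma uniq_flatten_parts (n : P -> nat) :
  uniq (flatten [seq [seq (p, i) | i <- iota 0 (n p)] | p <- PL]).
Proof.
have := parts_uniq ok; elim: PL => //= p l IH /andP[pl /IH ul].
rewrite cat_uniq map_inj_uniq ?iota_uniq ?ul ?andbT /=; last by move=> i j [].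
apply/hasPn => -[q i] /flatten_mapP[q' hq' /mapP[j _ [-> _]]].
by apply/mapP => -[j' _ [e _]]; rewrite -e hq' in pl.
Qed.

Lemma index_parts p q i j : p \in PL -> q \in PL -> i < gverts (kd p) -> j < gverts (kd q) ->
  index p PL < index q PL \/ p = q /\ i < j ->
  index (p, i) verts < index (q, j) verts.
Proof.
rewrite /verts; elim: PL => // r l IH hp hq hi hj.
have idx s k : k < gverts (kd s) -> index (s, k) (part_verts s) = k.
  move=> h; rewrite index_map; last by move=> x y [].
  have e := nth_iota 0 0 h; rewrite add0n in e.
  by rewrite -{1}e index_uniq ?size_iota ?iota_uniq.
have inm s k : ((s, k) \in part_verts r) = (s == r) && (k < gverts (kd r)).
  apply/mapP/andP => [[m]|[/eqP -> h]]; last by exists k; rewrite ?mem_iota.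
  by rewrite mem_iota => h [-> ->].
rewrite /= !index_cat !inm; have szp : size (part_verts r) = gverts (kd r) by rewrite size_map size_iota.
have [epr|npr] := eqVneq p r; have [eqr|nqr] := eqVneq q r; subst => /=; rewrite ?eqxx ?ltnn.
- by move=> [//|[_ h]]; rewrite hi hj !idx.
- by move=> _; rewrite hi idx // szp; lia.
- by move=> -[//|[e]]; rewrite e eqxx in npr.
- rewrite ltnS ltn_add2l => h.
  apply: IH => //; first by move: hp; rewrite inE (negbTE npr).
  by move: hq; rewrite inE (negbTE nqr).
Qed.

Lemma assembly_graph_ok : graph_ok verts edges esrc edst eweight.
Proof.
have sport k : k \in TL -> esrc (inl k) \in verts /\ edst (inl k) \in verts.
  move=> hk; have [h1 h2 _] := tsrc_att ok hk; have [h3 h4 _] := tdst_att ok hk.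
  by rewrite !mem_verts h1 h3 !port_lt.
have iport x : x \in inner_edges -> esrc (inr x) \in verts /\ edst (inr x) \in verts.
  case: x => p e; rewrite mem_inner => /andP[hp he]; have [h1 h2 h3] := gedge_lt hp he.
  by rewrite !mem_verts hp h2 (ltn_trans h1 h2).
split.
- exact: uniq_flatten_parts.
- rewrite cat_uniq !map_inj_uniq ?(links_uniq ok) ?uniq_flatten_parts ?andbT /=.
  + by apply/hasPn => _ /mapP[x _ ->]; apply/mapP => -[].
  + by move=> x y [].
  + by move=> x y [].
- by case=> [k|x]; rewrite ?mem_edges_inl ?mem_edges_inr; [case/sport|case/iport].
- by case=> [k|x]; rewrite ?mem_edges_inl ?mem_edges_inr; [case/sport|case/iport].
- case=> [k|[p e]]; rewrite ?mem_edges_inl ?mem_edges_inr.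
    move=> hk; have [h1 h2 _] := tsrc_att ok hk; have [h3 h4 _] := tdst_att ok hk.
    by apply: index_parts; rewrite ?port_lt //; left; apply: (link_lt ok).
  rewrite mem_inner => /andP[hp he]; have [h1 h2 h3] := gedge_lt hp he.
  by apply: index_parts => //; [apply: ltn_trans h2|right].
- move=> [k|[p e]] [k'|[p' e']]; rewrite ?mem_edges_inl ?mem_edges_inr => hk hk' [].
  + by move=> h1 _ h2 _; congr inl; apply: (link_inj ok) => //; congr pair.
  + move=> h1 _ h2 _; have := link_lt ok hk; rewrite h1 h2 ltnn //.
  + move=> h1 _ h2 _; have := link_lt ok hk'; rewrite -h1 -h2 ltnn //.
  + move: hk hk'; rewrite !mem_inner => /andP[hp he] /andP[_ he'] ep h1 _ h2; subst p'.
    congr (inr (_, _)); have /and4P[_ _ u _] := parts_ok ok hp.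
    apply/eqP; rewrite -(nth_uniq (0, 0) _ _ u) ?size_map //.
    rewrite !(nth_map (0, 0, 0)) //; apply/eqP.
    by move: h1 h2; rewrite /gedge; case: (nth _ _ e) => [[]] ? ? ?; case: (nth _ _ e') => [[]] ? ? ? /= -> ->.
- case=> [k|[p e]] //; rewrite mem_edges_inr mem_inner => /andP[hp he].
  by have [] := gedge_lt hp he.
Qed.

Definition port_bits (t : T -> bool) (p : P) : seq bool :=
  [seq t (att p j).1 == (att p j).2 | j <- iota 0 (np p)].
Definition inner_bits (c : T + P * nat -> bool) (p : P) : seq bool :=
  [seq c (inr (p, e)) | e <- iota 0 (mp p)].

Lemma sum_links (t : T -> bool) p (g : nat -> nat) : p \in PL ->
  \sum_(k <- TL | (if t k then tdst k else tsrc k).1 == p) g (if t k then tdst k else tsrc k).2 =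
  \sum_(j <- iota 0 (np p) | nth false (port_bits t p) j) g j.
Proof.
move=> hp; set tv := fun k => if t k then tdst k else tsrc k.
have tvP k : k \in TL -> (tv k).2 < np (tv k).1 /\ att (tv k).1 (tv k).2 = (k, t k).
  by move=> hk; rewrite /tv; case: (t k); [have [] := tdst_att ok hk|have [] := tsrc_att ok hk].
rewrite -big_filter -(big_map (fun k => (tv k).2) predT) -[RHS]big_filter.
apply: perm_big; apply: uniq_perm.
- rewrite map_inj_in_uniq ?filter_uniq ?(links_uniq ok) // => k k'; rewrite !mem_filter.
  move=> /andP[/eqP e /tvP[_ h]] /andP[/eqP e' /tvP[_ h']] ee.
  by move: h h'; rewrite -/(tv k) -/(tv k') e e' ee => -> [].
- by rewrite filter_uniq ?iota_uniq.
move=> j; rewrite mem_filter mem_iota /= add0n; apply/mapP/andP => [[k]|[hb hj]].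
  rewrite mem_filter => /andP[/eqP e /tvP[h1 h2]] ->; rewrite -/(tv k) e in h1 h2 *.
  by rewrite /port_bits (nth_map 0) ?size_iota // nth_iota // h2 eqxx.
have [h1 h2] := att_link ok hp hj; exists (att p j).1.
  rewrite mem_filter h1 andbT -/(tv _); move: hb h2.
  by rewrite /port_bits (nth_map 0) ?size_iota // nth_iota // add0n => /eqP; rewrite /tv => ->;
    case: (att p j).2 => ->; rewrite eqxx.
move: hb h2; rewrite /port_bits (nth_map 0) ?size_iota // nth_iota // add0n /tv => /eqP ->.
by case: (att p j).2 => ->.
Qed.

Lemma sum_inner p (Q : P * nat -> bool) (F : P * nat -> nat) : p \in PL ->
  (forall x, Q x -> x.1 = p) ->
  \sum_(x <- inner_edges | Q x) F x = \sum_(e <- iota 0 (mp p) | Q (p, e)) F (p, e).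
Proof.
rewrite /inner_edges; have := parts_uniq ok; elim: PL => //= q l IH /andP[ql ul] hp hQ.
rewrite big_cat /= big_map; have [epq|npq] := eqVneq p q.
  subst q; rewrite [X in _ + X]big_hasC ?addn0 //; apply/hasPn => -[r i].
  case/flatten_mapP => r' hr' /mapP[j _ [-> _]]; apply/negP => /hQ /= e.
  by rewrite -e hr' in ql.
rewrite big1 ?add0n => [|i /hQ /= e]; last by rewrite e eqxx in npq.
by apply: IH => //; move: hp; rewrite inE (negbTE npq).
Qed.

Lemma inflow_parts (f : nat -> nat) (c : T + P * nat -> bool) p i : p \in PL ->
  \sum_(k <- edges | (if c k then edst k else esrc k) == (p, i)) f (eweight k) =
  ginflow f (kd p) (port_bits (fun k => c (inl k)) p) (inner_bits c p) i.
Proof.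
move=> hp; rewrite /edges big_cat /= !big_map /ginflow; congr addn.
  rewrite big_iota_sumn.
  pose t k := c (inl k); pose g j := if nth 0 (gports (kd p)) j == i then f 2 else 0.
  rewrite [RHS](_ : _ = \sum_(j <- iota 0 (np p) | nth false (port_bits t p) j) g j).
    rewrite -sum_links // /g -big_mkcondr; apply: eq_bigl => k.
    by rewrite /= /port_vert /t; case: (c _) => /=; rewrite xpair_eqE; case: eqP => //= ->.
  by rewrite big_mkcondr.
rewrite (sum_inner (p := p)) //; last by move=> [q e] /=; case: ifP => _; rewrite xpair_eqE => /andP[/eqP].
rewrite big_iota_sumn; rewrite big_seq_cond [RHS]big_seq_cond.
apply: eq_bigl => e; rewrite mem_iota /=; case: (ltnP e) => //= he.
rewrite /inner_bits (nth_map 0) ?size_iota // nth_iota // add0n.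
by case: (c _) => /=; rewrite xpair_eqE eqxx.
Qed.

Lemma legal_parts c : key_legal verts edges esrc edst eweight c <->
  forall p, p \in PL -> glegal (kd p) (port_bits (fun k => c (inl k)) p) (inner_bits c p).
Proof.
split=> [h p hp|h [p i]].
  apply/allP => i; rewrite mem_iota /= add0n => hi.
  by rewrite -inflow_parts //; apply: h; rewrite mem_verts hp.
rewrite mem_verts => /andP[hp hi]; rewrite /inflow (inflow_parts id) //.
by have /allP := h p hp; apply; rewrite mem_iota.
Qed.

(** Degrees are computed from inflows: an edge contributes at one end when all edges point forward
    and at the other end when all point backward, so the two inflows add up to the degree. *)
Lemma assembly_and_or : and_or_graph (key_graph assembly_graph_ok).
Proof.
apply: key_and_or => -[p i]; rewrite mem_verts => /andP[hp hi] deg.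
have degE (Q : pred nat) : deg Q = gdegree Q (kd p) i.
  have -> : deg Q = \sum_(k <- edges | edst k == (p, i)) Q (eweight k) +
                    \sum_(k <- edges | esrc k == (p, i)) Q (eweight k).
    rewrite /deg [in RHS]big_mkcond [X in _ + X]big_mkcond -big_split big_mkcond /=.
    apply: eq_big_seq => k hk; have := sv_lt assembly_graph_ok hk.
    have [->|_] := eqVneq (esrc k) (p, i); have [->|_] := eqVneq (edst k) (p, i); rewrite ?ltnn //=;
      by case: (Q _).
  rewrite (inflow_parts Q (fun=> true)) // (inflow_parts Q (fun=> false)) // /ginflow /gdegree.
  rewrite addnACA; congr addn.
    rewrite !sumnE !big_map -big_split /=; apply: eq_big_seq => j; rewrite mem_iota /= => hj.
    rewrite /port_bits !(nth_map 0) ?size_iota // nth_iota // add0n.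
    by case: (att p j).2 => /=; case: ifP; rewrite ?addn0.
  congr addn; rewrite !sumnE !big_map; apply: eq_big_seq => e; rewrite mem_iota /= => he;
  by rewrite /inner_bits (nth_map 0) ?size_iota // nth_iota.
rewrite !degE; have /and4P[_ _ _ /allP h] := parts_ok ok hp.
have := h i; rewrite mem_iota /= add0n => /(_ hi) /andP[/eqP -> h']; split=> //.
by case/orP: h' => [/eqP|/andP[/eqP ? /eqP ?]]; [left|right].
Qed.

Definition sat (t : T -> bool) : Prop := forall p, p \in PL -> gsat (kd p) (port_bits t p).

Lemma size_port_bits t p : size (port_bits t p) = np p.
Proof. by rewrite size_map size_iota. Qed.

Lemma size_inner_bits c p : size (inner_bits c p) = mp p.
Proof. by rewrite size_map size_iota. Qed.

Lemma legal_sat c : key_legal verts edges esrc edst eweight c -> sat (fun k => c (inl k)).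
Proof.
move=> /legal_parts h p hp; have /allP := parts_fibers ok hp.
move/(_ (port_bits (fun k => c (inl k)) p)); rewrite mem_bitseqs size_port_bits => /(_ (eqxx _)).
case/andP=> /eqP -> _; have := h p hp; set b := port_bits _ _ => l.
have : inner_bits c p \in glegals (kd p) b by rewrite glegalsE mem_filter l mem_bitseqs size_inner_bits /=.
by case: (glegals _ _).
Qed.

Definition assemble (t : T -> bool) (y : P -> seq bool) (k : T + P * nat) : bool :=
  match k with inl k => t k | inr (p, e) => nth false (y p) e end.

Definition canonical (t : T -> bool) : T + P * nat -> bool :=
  assemble t (fun p => head [::] (glegals (kd p) (port_bits t p))).

Notation kstep := (key_step verts edges esrc edst eweight).

Lemma inner_assemble t y p : size (y p) = mp p -> inner_bits (assemble t y) p = y p.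
Proof.
move=> sz; apply: (@eq_from_nth _ false); rewrite size_inner_bits ?sz // => e he.
by rewrite /inner_bits (nth_map 0) ?size_iota // nth_iota.
Qed.

Lemma legal_assemble t y :
  (forall p, p \in PL -> y p \in glegals (kd p) (port_bits t p)) ->
  key_legal verts edges esrc edst eweight (assemble t y).
Proof.
move=> h; apply/legal_parts => p hp; have := h p hp; rewrite glegalsE mem_filter mem_bitseqs => /andP[l /eqP sz].
by rewrite inner_assemble.
Qed.

Lemma fiber_connected K b x y : connected_fibers K -> size b = size (gports K) ->
  x \in glegals K b -> y \in glegals K b ->
  reach (fun u v => v \in glegals K b /\ exists i, forall j, j != i -> nth false u j = nth false v j) x y.
Proof.
move=> /allP/(_ b); rewrite mem_bitseqs => h /eqP/h {h} /andP[_]; set ls := glegals K b => h hx hy.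
set R := fun u v => _.
case E: ls h hx hy => [//|z l] sp hx hy; rewrite -E in hx hy.
have zls : z \in ls by rewrite E mem_head.
have szls u : u \in ls -> size u = size (gedges K) by rewrite /ls glegalsE mem_filter mem_bitseqs => /andP[_ /eqP].
have all_reach u : u \in ls -> u \in ls /\ reach (fun u v => u \in ls /\ R u v) z u.
  rewrite {1}E inE => /orP[/eqP ->|]; first by split=> //; constructor.
  apply: (spreadP (Q := fun u => u \in ls /\ reach (fun u v => u \in ls /\ R u v) z u) (ls := ls) _ sp).
  - move=> v w [hv rv] hw hm; split=> //; apply: ReachStep rv _; split=> //; split=> //.
    by apply: hamming1; rewrite ?szls // hm.
  - by move=> v; rewrite E inE => ->; rewrite orbT.
  - by move=> v; rewrite inE => /eqP ->; split=> //; constructor.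
have [_ rx] := all_reach x hx; have [_ ry] := all_reach y hy.
suff : reach (fun u v => u \in ls /\ R u v) x y.
  by apply: (reach_map (f := id)) => u v [_ h]; apply: reach1 h.
apply: reach_trans ry; apply: reach_sym rx => u v [hu [hv [i hi]]].
by split=> //; split=> //; exists i => j /hi.
Qed.

Lemma reach_assemble t y z :
  (forall p, p \in PL -> y p \in glegals (kd p) (port_bits t p)) ->
  (forall p, p \in PL -> z p \in glegals (kd p) (port_bits t p)) ->
  reach kstep (assemble t y) (assemble t (fun p => if p \in PL then z p else y p)).
Proof.
move=> hy hz; pose mix (s : seq P) p := if p \in s then z p else y p.
suff: forall s, {subset s <= PL} -> reach kstep (assemble t y) (assemble t (mix s)).
  by apply.
elim=> [|q s IH] sub; first by constructor.
have sub' : {subset s <= PL} by move=> p hp; apply: sub; rewrite inE hp orbT.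
apply: reach_trans (IH sub') _; have hq : q \in PL by apply: sub; rewrite mem_head.
have hm p : p \in PL -> mix s p \in glegals (kd p) (port_bits t p).
  by move=> hp; rewrite /mix; case: ifP => _; auto.
pose upd u p := if p == q then u else mix s p.
have e0 k : assemble t (upd (mix s q)) k = assemble t (mix s) k.
  by case: k => [//|[p e]] /=; rewrite /upd; case: eqP => [->|].
have e1 k : assemble t (upd (z q)) k = assemble t (mix (q :: s)) k.
  by case: k => [//|[p e]] /=; rewrite /upd /mix inE; case: eqP => [->|].
have lupd u : u \in glegals (kd q) (port_bits t q) ->
    key_legal verts edges esrc edst eweight (assemble t (upd u)).
  by move=> hu; apply: legal_assemble => p hp; rewrite /upd; case: eqP => [->|_] //; apply: hm.
have path : reach kstep (assemble t (upd (mix s q))) (assemble t (upd (z q))).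
  have [r _] : reach (fun u v => v \in glegals (kd q) (port_bits t q) /\
      exists i, forall j, j != i -> nth false u j = nth false v j) (mix s q) (z q) /\ True.
    split=> //; apply: fiber_connected; rewrite ?size_port_bits //; last by apply: hz.
      exact: (parts_fibers ok).
    exact: hm.
  have : mix s q \in glegals (kd q) (port_bits t q) -> reach kstep (assemble t (upd (mix s q))) (assemble t (upd (z q)))
      /\ z q \in glegals (kd q) (port_bits t q).
    elim: r => [h|u v _ IHr [hv [i hi]] h0]; first by split=> //; constructor.
    have [ru hu] := IHr h0; split=> //; apply: ReachStep ru _; split; try exact: lupd.
    exists (inr (q, i)) => -[//|[p e]] _ ne /=; rewrite /upd; case: eqP => [ep|//]; apply: hi.
    by apply: contraNneq ne => ->; rewrite ep.
  by case/(_ (hm _ hq)).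
(* The interpolating configurations agree only pointwise; a [key_step] that reverses nothing
   identifies them. *)
have st c c' : key_legal verts edges esrc edst eweight c -> key_legal verts edges esrc edst eweight c' ->
   (forall k, c k = c' k) -> (exists k : T + P * nat, True) -> reach kstep c c'.
  by move=> lc lc' e [k _]; apply: reach1; split=> //; exists k => k' _ _.
have ex : exists k : T + P * nat, True by exists (inr (q, 0)).
apply: reach_trans (st _ _ _ _ (fun k => esym (e0 k)) ex) _; first exact: legal_assemble.
  by apply: lupd; apply: hm.
apply: reach_trans path (st _ _ _ _ e1 ex); first by apply: lupd; apply: hz.
apply: legal_assemble => p hp; rewrite /mix inE; case: ifP => // _; by [apply: hz|apply: hy].
Qed.

Lemma assemble_ext t t' y y' :
  (forall k, k \in TL -> t k = t' k) -> (forall p, p \in PL -> y p = y' p) ->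
  {in edges, assemble t y =1 assemble t' y'}.
Proof.
move=> ht hy [k|[p e]]; rewrite ?mem_edges_inl ?mem_edges_inr => h /=; first exact: ht.
by move: h; rewrite mem_inner => /andP[hp _]; rewrite hy.
Qed.

(** The two ends of a link lie in different parts, since the order of the parts separates them.
    Hence reversing one link changes at most one port of each gadget, as [liftable] needs. *)
Lemma hamming_port_bits t t' k p : p \in PL ->
  {in TL, forall k', k' != k -> t k' = t' k'} -> hamming (port_bits t p) (port_bits t' p) <= 1.
Proof.
move=> hp hk; rewrite hamming_count /port_bits zip_map count_map -size_filter.
set F := [seq x <- _ | _]; have uF : uniq F by rewrite filter_uniq ?iota_uniq.
have FP j : j \in F -> j < np p /\ (att p j).1 = k.
  rewrite mem_filter mem_iota /= add0n => /andP[ne hj]; split=> //.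
  have [h _] := att_link ok hp hj; apply/eqP; apply: contraNT ne => h'.
  by rewrite (hk _ h h').
case E: F => [//|j l]; rewrite -E.
suff : size F <= size [:: j] by [].
apply: uniq_leq_size => // i hi; rewrite inE.
have hj : j \in F by rewrite E mem_head.
have [lj ej] := FP j hj; have [li ei] := FP i hi.
have [hT h1] := att_link ok hp lj; have [_ h2] := att_link ok hp li.
rewrite ej in hT h1; rewrite ei in h2; have lk := link_lt ok hT.
move: h1 h2; case: (att p j).2; case: (att p i).2 => h1 h2.
- by rewrite h1 in h2; case: h2 => ->.
- by rewrite h1 h2 ltnn in lk.
- by rewrite h1 h2 ltnn in lk.
- by rewrite h1 in h2; case: h2 => ->.
Qed.

Lemma head_glegals t p : sat t -> p \in PL ->
  head [::] (glegals (kd p) (port_bits t p)) \in glegals (kd p) (port_bits t p).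
Proof.
move=> st hp; have /allP := parts_fibers ok hp.
move/(_ (port_bits t p)); rewrite mem_bitseqs size_port_bits => /(_ (eqxx _)) /andP[/eqP e _].
by have := st p hp; rewrite e; case: (glegals _ _) => // x l _; rewrite mem_head.
Qed.

Lemma canonical_legal t : sat t -> key_legal verts edges esrc edst eweight (canonical t).
Proof. by move=> st; apply: legal_assemble => p hp; apply: head_glegals. Qed.

(** The inner edges of all gadgets are moved to orientations that are legal for both [t] and [t'],
    then the link is reversed, and then the inner edges are moved to the new canonical choice. *)
Lemma canonical_step t t' : sat t -> sat t' ->
  (exists k, {in TL, forall k', k' != k -> t k' = t' k'}) ->
  reach kstep (canonical t) (canonical t').
Proof.
move=> st st' [k hk].
pose x p := head [::] (common_legals (kd p) (port_bits t p) (port_bits t' p)).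
have hx p : p \in PL -> x p \in glegals (kd p) (port_bits t p) /\ x p \in glegals (kd p) (port_bits t' p).
  move=> hp; have /allP := parts_lift ok hp.
  move/(_ (port_bits t p)); rewrite mem_bitseqs size_port_bits eqxx => /(_ isT).
  rewrite st //= => /allP/(_ (port_bits t' p)); rewrite mem_bitseqs size_port_bits eqxx => /(_ isT).
  rewrite (hamming_port_bits hp hk) st' // => h.
  have : x p \in common_legals (kd p) (port_bits t p) (port_bits t' p).
    by move: h; rewrite -/(common_legals _ _ _) /x; case: (common_legals _ _ _) => //= u l _; rewrite mem_head.
  by rewrite /common_legals !glegalsE !mem_filter => /and3P[-> -> ->].
set y := fun p => if p \in PL then x p else head [::] (glegals (kd p) (port_bits t p)).
have hy p : p \in PL -> y p \in glegals (kd p) (port_bits t p) /\ y p \in glegals (kd p) (port_bits t' p).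
  by move=> hp; rewrite /y hp; apply: hx.
apply: reach_trans (_ : reach kstep (assemble t y) _).
  by apply: reach_assemble => p hp; [apply: head_glegals|have [] := hx p hp].
have l1 : key_legal verts edges esrc edst eweight (assemble t y).
  by apply: legal_assemble => p hp; have [] := hy p hp.
have l2 : key_legal verts edges esrc edst eweight (assemble t' y).
  by apply: legal_assemble => p hp; have [] := hy p hp.
apply: reach_trans (_ : reach kstep (assemble t' y) _).
  apply: reach1; split=> //; exists (inl k) => -[k'|[p e]] //.
  by rewrite mem_edges_inl => h ne; apply: hk => //; apply: contraNneq ne => ->.
pose h p := head [::] (glegals (kd p) (port_bits t' p)).
have := @reach_assemble t' y h (fun p hp => (hy p hp).2) (fun p hp => head_glegals st' hp).
move=> r; apply: reach_trans r _; apply: reach1.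
set c := assemble _ _; have ec : {in edges, c =1 canonical t'}.
  by apply: assemble_ext => // p ->.
split; last by exists (inl k) => k' hk' _; apply: ec.
  by apply: legal_assemble => p hp; rewrite hp; apply: head_glegals.
exact: canonical_legal.
Qed.

(* The negative literals of a clause come after its positive ones in the order [rank]; then the
   edges on which two comparable configurations differ can be turned one at a time, in order of
   decreasing rank. *)
Lemma canonical_mono (k0 : T) (rank : T -> nat) t t' :
  (forall p cl j1 j2, p \in PL -> cl \in gclauses (kd p) -> j1 \in cl -> j2 \in cl ->
     j1 < np p -> j2 < np p ->
     (att p j1).2 = false -> (att p j2).2 = true -> rank (att p j2).1 < rank (att p j1).1) ->
  sat t -> sat t' -> {in TL, forall k, t k -> t' k} ->
  reach kstep (canonical t') (canonical t).
Proof.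
move=> hr st; pose D u := count (fun k => u k && ~~ t k) TL.
have [m] := ubnP (D t'); elim: m t' => // m IH t' hD st' le.
pose S := [seq k <- TL | t' k && ~~ t k].
case E: S => [|a l].
  apply: canonical_step => //; exists k0 => k hk _; have := le k hk.
  have : k \notin S by rewrite E.
  by rewrite mem_filter hk andbT; case: (t' k); case: (t k) => // _ /(_ isT).
have [k1 [hk1 max1]] : exists k1, k1 \in S /\ forall k, k \in S -> rank k <= rank k1.
  have : S != [::] by rewrite E.
  elim: (S) => // b s IHs _; have [->|/IHs[k1 [hk1 hm]]] := eqVneq s [::].
    by exists b; rewrite mem_head; split=> // k; rewrite inE => /eqP ->.
  have [h|h] := leqP (rank b) (rank k1).
    by exists k1; split=> [|k]; rewrite inE ?hk1 ?orbT // => /orP[/eqP ->|/hm].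
  exists b; split=> [|k]; rewrite inE ?eqxx // => /orP[/eqP -> //|/hm h'].
  exact: leq_trans h' (ltnW h).
move: (hk1); rewrite mem_filter => /andP[/andP[t'k1 tk1] k1T].
(* Only a clause that [k1] satisfied in [t'] could break. In [t] it is satisfied by some other
   literal. If that literal is positive, it holds in [t'] as well. If it is negative, its link has
   larger rank than [k1], hence by maximality it has already been turned. *)
pose u k := if k == k1 then false else t' k.
have su : sat u.
  move=> p hp; apply/allP => cl hcl; apply/hasP.
  have litP v j : nth false (port_bits v p) j <-> j < np p /\ v (att p j).1 = (att p j).2.
    have [h|h] := ltnP j (np p).
      by rewrite /port_bits (nth_map 0) ?size_iota // nth_iota // add0n; split=> [/eqP|[_ ->]].
    by rewrite nth_default ?size_port_bits //; split=> // -[].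
  have /allP/(_ _ hcl)/hasP[j0 j0c /litP[lj0 h0]] := st' p hp.
  have /allP/(_ _ hcl)/hasP[j1 j1c /litP[lj1 h1]] := st p hp.
  have [e0|n0] := eqVneq (att p j0).1 k1; last first.
    by exists j0 => //; apply/litP; rewrite /u (negbTE n0).
  have [e1|n1] := eqVneq (att p j1).1 k1.
    by exists j1 => //; apply/litP; split=> //; rewrite /u e1 eqxx -h1 e1 (negbTE tk1).
  exists j1 => //; apply/litP; split=> //; rewrite /u (negbTE n1) -h1.
  have [hT _] := att_link ok hp lj1.
  case E1: (t (att p j1).1); first by rewrite le.
  apply/negbTE/negP => h'; rewrite e0 t'k1 in h0; rewrite E1 in h1.
  have := hr p cl j1 j0 hp hcl j1c j0c lj1 lj0 (esym h1) (esym h0).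
  by rewrite e0 ltnNge max1 // mem_filter h' E1 hT.
apply: reach_trans (_ : reach kstep (canonical u) _).
  by apply: canonical_step => //; exists k1 => k _ ne; rewrite /u (negbTE ne).
apply: IH => //; last first.
  by move=> k hk tk; rewrite /u; case: eqP => [ek|_]; [rewrite ek (negbTE tk1) in tk|apply: le].
apply: (@leq_trans (D t')); last by rewrite -ltnS.
rewrite /D -!size_filter.
have sub : {subset [seq k <- TL | u k && ~~ t k] <= rem k1 S}.
  move=> k; rewrite mem_filter => /andP[/andP[uk tk] hk].
  rewrite mem_rem_uniq ?filter_uniq ?(links_uniq ok) // inE mem_filter tk hk !andbT.
  by move: uk; rewrite /u; case: eqP.
have := uniq_leq_size _ sub; rewrite filter_uniq ?(links_uniq ok) // size_rem // => /(_ isT) h.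
have : 0 < size S by rewrite E. 
by rewrite -/S; lia.
Qed.

End Assembly.

(** * The gadgets *)

(* The eight AND vertices form a ring L-SW-B-SE-R-NE-T-NW; the blue edge from a corner to the
   OR vertices in the middle is a token that, while it points to the middle, keeps the two sides
   next to that corner from being directed outwards. Some token is always set, so that opposite
   sides are never both directed outwards. *)
Definition ring : seq (nat * nat * nat) :=
  [:: (0, 4, 1); (0, 6, 1); (1, 4, 1); (1, 5, 1); (2, 6, 1); (2, 7, 1); (3, 5, 1); (3, 7, 1)].

(* Ports: left, right, bottom, top. *)
Definition cross_gadget : gadget :=
  Gadget 10 (ring ++ [:: (4, 8, 2); (6, 8, 2); (5, 9, 2); (7, 9, 2); (8, 9, 2)])
    [:: 0; 3; 1; 2] [:: [:: 0; 1]; [:: 2; 3]].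

(* Without the north-east token, left and bottom are never both directed outwards. The fifth
   port feeds the north-east corner. *)
Definition clash_gadget : gadget :=
  Gadget 9 (ring ++ [:: (4, 8, 2); (6, 8, 2); (5, 8, 2)])
    [:: 0; 3; 1; 2; 7] [:: [:: 0; 1]; [:: 2; 3]; [:: 0; 2]; [:: 4; 1]; [:: 4; 3]].

(* Ports: bottom, right, top, and a feed. *)
Definition branch_gadget : gadget :=
  Gadget 4 [:: (0, 2, 1); (1, 2, 1); (0, 3, 1); (1, 3, 1)]
    [:: 2; 0; 1; 3] [:: [:: 0; 1]; [:: 0; 2]; [:: 3; 1]; [:: 3; 2]].

Definition or_gadget : gadget := Gadget 1 [::] [:: 0; 0; 0] [:: [:: 0; 1; 2]].

(** With the port at vertex 0 all degrees are 3. Five vertices are the least possible number for a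
    simple graph with one port: by parity the number is odd, and three vertices would need four
    edges. *)
Definition pentagon (r b : nat) : seq (nat * nat * nat) :=
  [:: (0, 1, r); (1, 2, r); (2, 3, r); (3, 4, r); (0, 4, r); (1, 3, b); (2, 4, b)].

(** It ends an edge without restricting it: all five vertices are OR vertices and can be satisfied
    by the inner edges alone. *)
Definition free_gadget : gadget := Gadget 5 (pentagon 2 2) [:: 0] [::].

(* Five AND vertices whose inner edges have total weight 9. *)
Definition sink_gadget : gadget := Gadget 5 (pentagon 1 2) [:: 0] [:: [:: 0]].

Definition gadget_checks (K : gadget) : bool :=
  [&& gadget_ok K, connected_fibers K & liftable K].

Lemma cross_checks : gadget_checks cross_gadget. Proof. by vm_compute. Qed.
Lemma clash_checks : gadget_checks clash_gadget. Proof. by vm_compute. Qed.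
Lemma branch_checks : gadget_checks branch_gadget. Proof. by vm_compute. Qed.
Lemma or_checks : gadget_checks or_gadget. Proof. by vm_compute. Qed.
Lemma free_checks : gadget_checks free_gadget. Proof. by vm_compute. Qed.
Lemma sink_checks : gadget_checks sink_gadget. Proof. by vm_compute. Qed.

(** * The strip of a word *)

Lemma index_iota0 m i : i < m -> index i (iota 0 m) = i.
Proof.
move=> h; have e := nth_iota 0 0 h; rewrite add0n in e.
by rewrite -{1}e index_uniq ?size_iota ?iota_uniq.
Qed.

Lemma mem_pairs (A B : eqType) (L : seq A) (F : A -> seq B) a x :
  ((a, x) \in flatten [seq [seq (a, x) | x <- F a] | a <- L]) = (a \in L) && (x \in F a).
Proof.
apply/flatten_mapP/andP => [[b hb /mapP[y hy [-> ->]]] //|[ha hx]].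
by exists a => //; apply/mapP; exists x.
Qed.

Lemma uniq_pairs (A B : eqType) (L : seq A) (F : A -> seq B) :
  uniq L -> (forall a, uniq (F a)) -> uniq (flatten [seq [seq (a, x) | x <- F a] | a <- L]).
Proof.
move=> uL uF; elim: L uL => //= a L IH /andP[aL /IH uL].
rewrite cat_uniq map_inj_uniq ?uF ?uL ?andbT /=; last by move=> i j [].
apply/hasPn => -[b x]; rewrite mem_pairs => /andP[hb _]; apply/mapP => -[y _ [e _]].
by rewrite -e hb in aL.
Qed.

Lemma index_pairs (A B : eqType) (L : seq A) (F : A -> seq B) a b x y :
  a \in L -> b \in L -> x \in F a -> y \in F b ->
  index a L < index b L \/ a = b /\ index x (F a) < index y (F a) ->
  index (a, x) (flatten [seq [seq (a, x) | x <- F a] | a <- L]) <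
  index (b, y) (flatten [seq [seq (a, x) | x <- F a] | a <- L]).
Proof.
elim: L => // d L IH ha hb hx hy.
have inj : injective (fun z : B => (d, z)) by move=> ? ? [].
have inm (c : A) z : z \in F c -> ((c, z) \in [seq (d, x) | x <- F d]) = (c == d).
  by move=> hz; apply/mapP/eqP => [[u _ [-> _]] //|ec]; subst c; exists z.
rewrite /= !index_cat !inm // !(eq_sym d).
have [ad|nad] := eqVneq a d; have [bd|nbd] := eqVneq b d; rewrite ?ltnn ?ltn0 /=.
- by subst; move=> [//|[_ h]]; rewrite !index_map.
- by subst; move=> _; rewrite index_map // size_map ltn_addr // index_mem.
- by subst; move=> [//|[e _]]; rewrite e eqxx in nad.
- rewrite ltnS ltn_add2l => h; apply: IH => //.
    by move: ha; rewrite inE (negbTE nad).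
  by move: hb; rewrite inE (negbTE nbd).
Qed.

Lemma index_filter_lt (A : eqType) (p : pred A) (s : seq A) x y :
  p x -> p y -> index x s < index y s -> index x (filter p s) < index y (filter p s).
Proof.
move=> px py; elim: s => //= a s IH.
have [ax|nx] := eqVneq a x; have [ay|ny] := eqVneq a y; subst; rewrite ?ltn0 ?ltnn //.
- by move=> _; rewrite px /= eqxx (negbTE ny).
- by rewrite ltnS => /IH h; case: (p a) => //=; rewrite (negbTE nx) (negbTE ny).
Qed.

(** Caps end the wires at the border of the strip. The OR tiles form the chain in the bottom row of
    a block, which demands that some symbol is chosen; in the outer two, a sink takes up the third
    edge of the OR vertex. [Branch] starts the row wire of a symbol at the column of that symbol and
    lets the wire that arrives from the left end freely. [Cross] lets row and column pass, and
    [Clash] moreover forbids that both carry the value false. *)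
Variant tile := Void | LeftCap | RightCap | TopCap | OrFirst | OrMid | OrLast
  | Cross | Clash | Branch.

(* Sides of a tile: left, right, bottom, top; 4 and 5 are the two ends of a feed inside a tile. *)
Definition tile_parts (t : tile) : seq (gadget * seq nat) :=
  match t with
  | Void => [::]
  | LeftCap => [:: (free_gadget, [:: 1])]
  | RightCap => [:: (free_gadget, [:: 0])]
  | TopCap => [:: (free_gadget, [:: 2])]
  | OrFirst => [:: (or_gadget, [:: 1; 3; 4]); (sink_gadget, [:: 5])]
  | OrMid => [:: (or_gadget, [:: 0; 1; 3])]
  | OrLast => [:: (or_gadget, [:: 0; 3; 4]); (sink_gadget, [:: 5])]
  | Cross => [:: (cross_gadget, [:: 0; 1; 2; 3])]
  | Clash => [:: (clash_gadget, [:: 0; 1; 2; 3; 4]); (free_gadget, [:: 5])]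
  | Branch => [:: (branch_gadget, [:: 2; 1; 3; 4]); (free_gadget, [:: 5]); (free_gadget, [:: 0])]
  end.

Definition tile_part (t : tile) (s : nat) : gadget * seq nat :=
  nth (or_gadget, [::]) (tile_parts t) s.

Definition tile_sides (t : tile) : seq nat := flatten [seq x.2 | x <- tile_parts t].

Definition find_port (t : tile) (d : nat) : nat * nat :=
  let s := find (fun x => d \in x.2) (tile_parts t) in (s, index d (tile_part t s).2).

Lemma tile_part_checks t s : s < size (tile_parts t) ->
  gadget_checks (tile_part t s).1 /\ size (gports (tile_part t s).1) = size (tile_part t s).2.
Proof.
case: t; case: s => [|[|[|s]]] hs; try (exfalso; exact (Bool.diff_false_true hs)).
- exact (conj free_checks erefl).
- exact (conj free_checks erefl).
- exact (conj free_checks erefl).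
- exact (conj or_checks erefl).
- exact (conj sink_checks erefl).
- exact (conj or_checks erefl).
- exact (conj or_checks erefl).
- exact (conj sink_checks erefl).
- exact (conj cross_checks erefl).
- exact (conj clash_checks erefl).
- exact (conj free_checks erefl).
- exact (conj branch_checks erefl).
- exact (conj free_checks erefl).
- exact (conj free_checks erefl).
Qed.

Lemma find_portP t d : d \in tile_sides t ->
  [/\ (find_port t d).1 < size (tile_parts t),
      (find_port t d).2 < size (tile_part t (find_port t d).1).2
    & nth 0 (tile_part t (find_port t d).1).2 (find_port t d).2 = d].
Proof. by case: t; case: d => [|[|[|[|[|[|d]]]]]]. Qed.

Lemma find_port_nth t s j : s < size (tile_parts t) -> j < size (tile_part t s).2 ->
  nth 0 (tile_part t s).2 j \in tile_sides t /\ find_port t (nth 0 (tile_part t s).2 j) = (s, j).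
Proof. by case: t => //; case: s => [|[|[|s]]] //; case: j => [|[|[|[|[|j]]]]]. Qed.

Lemma side_lt t d : d \in tile_sides t -> d < 6.
Proof. by case: t; case: d => [|[|[|[|[|[|d]]]]]]. Qed.

Lemma feed_ends t : (4 \in tile_sides t) = (5 \in tile_sides t).
Proof. by case: t. Qed.

Lemma feed_lt t : 4 \in tile_sides t -> (find_port t 4).1 < (find_port t 5).1.
Proof. by case: t. Qed.

Section Strip.
Variables (q n : nat) (forb : nat -> nat -> bool).
Hypotheses (q2 : 1 < q) (n1 : 0 < n).

(* Blocks [1 .. n] carry the symbols of a word of length [n]; the last column of block [0] and the
   first one of block [n.+1] close the strip. *)
Definition block_kind (i : nat) : nat :=
  if i == 0 then 0 else if i == n.+1 then 1 else if odd i then 2 else 3.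

(** A column belongs to each symbol, and symbol [x] owns the rows [2 * x + 1] and [2 * x + 2]. In
    one of them a block announces its own choice of [x] to the right, starting at column [x]; in the
    other, the [x] announced by the previous block meets every column, with a [Clash] where the pair
    is forbidden. The parity of the block exchanges the two roles, so that a row that is outgoing in
    a block is incoming in the next. *)
Definition tile_at (k c r : nat) : tile :=
  if k == 0 then (if (c == q.-1) && (0 < r <= 2 * q) then LeftCap else Void)
  else if k == 1 then (if (c == 0) && (0 < r <= 2 * q) then RightCap else Void)
  else if r == 0 then (if c == 0 then OrFirst else if c == q.-1 then OrLast else OrMid)
  else if r == (2 * q).+1 then TopCap
  else if odd r.-1 == (k == 2) then (if forb r.-1./2 c then Clash else Cross)
  else if r.-1./2 == c then Branch else Cross.

Definition part := (nat * (nat * nat * nat))%type.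

Definition cells : seq (nat * nat * nat) :=
  flatten [seq [seq (cr, s) | s <- iota 0 3] | cr <-
    flatten [seq [seq (c, r) | r <- iota 0 (2 * q).+2] | c <- iota 0 q]].

Definition block_parts (k : nat) : seq (nat * nat * nat) :=
  [seq y <- cells | y.2 < size (tile_parts (tile_at k y.1.1 y.1.2))].

(** A link is named by the cell that it leaves and by [d]: 0 leads to the right, 1 upwards, 2 is the
    feed inside the tile. The entries are the sides where these links begin. *)
Definition source_side (d : nat) : nat := nth 0 [:: 1; 3; 4] d.

Definition block_links (k : nat) : seq (nat * nat * nat) :=
  [seq y <- cells | source_side y.2 \in tile_sides (tile_at k y.1.1 y.1.2)].

Definition strip_parts : seq part :=
  flatten [seq [seq (i, y) | y <- block_parts (block_kind i)] | i <- iota 0 n.+2].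
Definition strip_links : seq part :=
  flatten [seq [seq (i, y) | y <- block_links (block_kind i)] | i <- iota 0 n.+2].

Definition prev_col (i c : nat) : nat * nat := if c is c'.+1 then (i, c') else (i.-1, q.-1).
Definition next_col (i c : nat) : nat * nat := if c.+1 < q then (i, c.+1) else (i.+1, 0).

Definition link_of (i c r d : nat) : part * bool :=
  match d with
  | 0 => (((prev_col i c).1, ((prev_col i c).2, r, 0)), true)
  | 1 => ((i, (c, r, 0)), false)
  | 2 => ((i, (c, r.-1, 1)), true)
  | 3 => ((i, (c, r, 1)), false)
  | 4 => ((i, (c, r, 2)), false)
  | _ => ((i, (c, r, 2)), true)
  end.

Definition strip_kind (p : part) : gadget :=
  let: (i, (c, r, s)) := p in (tile_part (tile_at (block_kind i) c r) s).1.

Definition strip_att (p : part) (j : nat) : part * bool :=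
  let: (i, (c, r, s)) := p in link_of i c r (nth 0 (tile_part (tile_at (block_kind i) c r) s).2 j).

Definition port_at (i c r d : nat) : part * nat :=
  let: (s, j) := find_port (tile_at (block_kind i) c r) d in ((i, (c, r, s)), j).

Definition strip_src (k : part) : part * nat :=
  let: (i, (c, r, d)) := k in port_at i c r (source_side d).

Definition strip_dst (k : part) : part * nat :=
  let: (i, (c, r, d)) := k in
  match d with
  | 0 => port_at (next_col i c).1 (next_col i c).2 r 0
  | 1 => port_at i c r.+1 2
  | _ => port_at i c r 5
  end.

Lemma mem_cells c r s : ((c, r, s) \in cells) = [&& c < q, r < (2 * q).+2 & s < 3].
Proof. by rewrite !mem_pairs !mem_iota !leq0n /= !add0n andbA. Qed.

Lemma size_tile_parts t : size (tile_parts t) <= 3. Proof. by case: t. Qed.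

Lemma mem_strip_parts i c r s : ((i, (c, r, s)) \in strip_parts) =
  [&& i < n.+2, c < q, r < (2 * q).+2 & s < size (tile_parts (tile_at (block_kind i) c r))].
Proof.
rewrite mem_pairs mem_iota add0n mem_filter mem_cells /=; congr andb.
rewrite andbC -!andbA; do 2 congr andb; apply/andP/idP => [[] //|h]; split=> //.
exact: leq_trans h (size_tile_parts _).
Qed.

Lemma mem_strip_links i c r d : ((i, (c, r, d)) \in strip_links) =
  [&& i < n.+2, c < q, r < (2 * q).+2, d < 3
    & source_side d \in tile_sides (tile_at (block_kind i) c r)].
Proof.
rewrite mem_pairs mem_iota add0n mem_filter mem_cells /=; congr andb.
by rewrite andbC -!andbA.
Qed.

Lemma uniq_cells : uniq cells.
Proof. by apply: uniq_pairs => [|_]; [apply: uniq_pairs => [|_]|]; rewrite iota_uniq. Qed.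

(** The lists are nested products, so their order is lexicographic in block, column, row and slot.
    Links lead to the right, upwards, or to a later slot of the same cell, and therefore forward. *)
Lemma part_lt i c r s i' c' r' s' :
  (i, (c, r, s)) \in strip_parts -> (i', (c', r', s')) \in strip_parts ->
  i < i' \/ i = i' /\ (c < c' \/ c = c' /\ (r < r' \/ r = r' /\ s < s')) ->
  index (i, (c, r, s)) strip_parts < index (i', (c', r', s')) strip_parts.
Proof.
move=> hp hp' h; move: (hp) (hp'); rewrite !mem_pairs !mem_iota !add0n => /andP[hi hy] /andP[hi' hy'].
apply: index_pairs; rewrite ?mem_iota ?add0n // !index_iota0 //.
case: h => [|[ei h]]; [by left|right]; split=> //; rewrite -ei in hy'.
move: (hy) (hy'); rewrite !mem_filter !mem_cells => /and4P[h1 hc hr hs] /and4P[h1' hc' hr' hs'].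
apply: index_filter_lt => //.
apply: index_pairs; rewrite ?mem_pairs ?mem_iota ?add0n ?hc ?hr ?hc' ?hr' //.
case: h => [hlt|[ec h]].
  by left; apply: index_pairs; rewrite ?mem_iota // !index_iota0 //; left.
case: h => [hlt|[er h]].
  by left; apply: index_pairs; rewrite ?mem_iota // !index_iota0 //; right.
by right; rewrite ec er !index_iota0.
Qed.

Lemma kind_mid i : 0 < i <= n -> block_kind i = if odd i then 2 else 3.
Proof. by rewrite /block_kind => h; do 2 (case: eqP; first lia). Qed.

Lemma tile_at_mid i c r : 0 < i <= n -> tile_at (block_kind i) c r =
  if r == 0 then (if c == 0 then OrFirst else if c == q.-1 then OrLast else OrMid)
  else if r == (2 * q).+1 then TopCap
  else if odd r.-1 == odd i then (if forb r.-1./2 c then Clash else Cross)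
  else if r.-1./2 == c then Branch else Cross.
Proof. by move=> /kind_mid ->; rewrite /tile_at; case: (odd i). Qed.

Lemma has_side i c r d : i < n.+2 -> c < q -> r < (2 * q).+2 -> d < 4 ->
  (d \in tile_sides (tile_at (block_kind i) c r)) =
  match d with
  | 0 => if 0 < i <= n then (if r == 0 then 0 < c else r <= 2 * q) else (i == n.+1) && (c == 0) && (0 < r <= 2 * q)
  | 1 => if 0 < i <= n then (if r == 0 then c.+1 < q else r <= 2 * q) else (i == 0) && (c.+1 == q) && (0 < r <= 2 * q)
  | 2 => (0 < i <= n) && (0 < r)
  | _ => (0 < i <= n) && (r <= 2 * q)
  end.
Proof.
move=> hi hc hr hd; case: (boolP (0 < i <= n)) => [him|him].
  rewrite tile_at_mid //; have eqc : (c == q.-1) = ~~ (c.+1 < q) by lia.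
  case: (eqVneq r 0) => [->|r0] /=.
    case: (eqVneq c 0) => [->|c0] /=; first by case: d hd => [|[|[|[|//]]]] _ //=; rewrite ?q2 //; lia.
    by rewrite eqc lt0n c0; case: (c.+1 < q); case: d hd => [|[|[|[|//]]]] _.
  case: (eqVneq r (2 * q).+1) => [->|rq] /=.
    by case: d hd => [|[|[|[|//]]]] _ //=; rewrite ?ltnn //; lia.
  have rle : r <= 2 * q by lia.
  have r0' : 0 < r by lia.
  by case: (_ == odd i); case: ifP => _; case: d hd => [|[|[|[|//]]]] _ /=; rewrite ?rle ?r0'.
rewrite /tile_at /block_kind; have [->|i0] := eqVneq i 0.
  have -> : (c == q.-1) = (c.+1 == q) by lia.
  by case: ifP; case: d hd => [|[|[|[|//]]]] _ //=; rewrite ?andbT // => ->.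
have -> : i == n.+1 by lia.
by rewrite /=; case: ifP; case: d hd => [|[|[|[|//]]]] _ //= ->.
Qed.

Lemma prev_colK i c : c < q -> 0 < i \/ 0 < c -> next_col (prev_col i c).1 (prev_col i c).2 = (i, c).
Proof.
rewrite /prev_col /next_col; case: c => [|c] hc h /=; last by rewrite hc.
by rewrite prednK ?(ltnW q2) // ltnn prednK //; case: h.
Qed.

Lemma next_colK i c : c < q -> prev_col (next_col i c).1 (next_col i c).2 = (i, c).
Proof.
rewrite /next_col => hc; case: ifP => //= h; congr pair; lia.
Qed.

Lemma left_right i c r : i < n.+2 -> c < q -> r < (2 * q).+2 ->
  0 \in tile_sides (tile_at (block_kind i) c r) ->
  [/\ 0 < i, 0 < c \/ 1 < i \/ i = 1, (prev_col i c).1 < n.+2, (prev_col i c).2 < q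
    & 1 \in tile_sides (tile_at (block_kind (prev_col i c).1) (prev_col i c).2 r)].
Proof.
move=> hi hc hr; rewrite has_side // => h.
have i0 : 0 < i by case: (i) h.
have hp1 : (prev_col i c).1 < n.+2 by case: (c) => //=; lia.
have hp2 : (prev_col i c).2 < q by case: (c) hc => //=; lia.
split=> //; first by case: (c); [right; lia|left].
rewrite has_side //; move: h; rewrite /prev_col; case: c hc {hp1 hp2} => [|c] hc /=.
  case: (boolP (0 < i <= n)) => [him|him].
    case: eqP => // r0 rq; case: (boolP (0 < i.-1 <= n)) => him'; rewrite ?rq //.
    by have -> : i.-1 = 0; [lia|rewrite andbT; lia].
  rewrite andbT => /and3P[/eqP -> r0 rq] /=; rewrite n1 leqnn /= rq.
  by case: eqP r0 => // ->.
case: (boolP (0 < i <= n)) => [him|him]; last by rewrite andbF.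
by case: eqP.
Qed.

Lemma right_left i c r : i < n.+2 -> c < q -> r < (2 * q).+2 ->
  1 \in tile_sides (tile_at (block_kind i) c r) ->
  [/\ (next_col i c).1 < n.+2, (next_col i c).2 < q
    & 0 \in tile_sides (tile_at (block_kind (next_col i c).1) (next_col i c).2 r)].
Proof.
move=> hi hc hr; rewrite has_side // => h.
have hin : i <= n by move: h; case: ifP; lia.
have hp1 : (next_col i c).1 < n.+2 by rewrite /next_col; case: ifP => //=; lia.
have hp2 : (next_col i c).2 < q by rewrite /next_col; case: ifP => //=; lia.
split=> //; rewrite has_side //; move: h; rewrite /next_col; case: (ltnP c.+1 q) => hcq /=.
  case: (boolP (0 < i <= n)) => [him|him]; first by case: eqP.
  by move=> /and3P[/andP[_ /eqP e]]; lia.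
case: (boolP (0 < i <= n)) => [him|him].
  case: (eqVneq r 0) => // r0 rq; rewrite rq lt0n r0 eqSS.
  by case: (ltnP i n) => // hni; have -> : i = n; [lia|rewrite eqxx].
move=> /andP[/andP[/eqP -> _] /andP[r0 rq]] /=; rewrite n1 rq.
by rewrite -[r == 0]negbK -lt0n r0.
Qed.

Lemma strip_ok : assembly_ok strip_parts strip_links strip_kind strip_att strip_src strip_dst.
Proof.
have checks i c r s : (i, (c, r, s)) \in strip_parts ->
    gadget_checks (strip_kind (i, (c, r, s))) /\
    size (gports (strip_kind (i, (c, r, s)))) = size (tile_part (tile_at (block_kind i) c r) s).2.
  by rewrite mem_strip_parts => /and4P[_ _ _ /tile_part_checks].
have chk p : p \in strip_parts -> gadget_checks (strip_kind p).
  by case: p => i [[c r] s] /checks [].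
have portP i c r d : i < n.+2 -> c < q -> r < (2 * q).+2 ->
    d \in tile_sides (tile_at (block_kind i) c r) ->
    exists s j, [/\ port_at i c r d = ((i, (c, r, s)), j), (i, (c, r, s)) \in strip_parts,
      j < size (gports (strip_kind (i, (c, r, s)))) & strip_att (i, (c, r, s)) j = link_of i c r d].
  move=> hi hc hr hd; have [h1 h2 h3] := find_portP hd.
  rewrite /port_at; case: (find_port _ d) h1 h2 h3 => s j /= h1 h2 h3; exists s, j.
  have hp : (i, (c, r, s)) \in strip_parts by rewrite mem_strip_parts hi hc hr.
  by split=> //; [have [_ ->] := checks _ _ _ _ hp|rewrite h3].
have below i c r : i < n.+2 -> c < q -> r < (2 * q).+2 ->
    2 \in tile_sides (tile_at (block_kind i) c r) ->
    0 < r /\ 3 \in tile_sides (tile_at (block_kind i) c r.-1).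
  move=> hi hc hr; rewrite !has_side //; last by lia.
  by case/andP => -> r0; split=> //=; lia.
have above i c r : i < n.+2 -> c < q -> r < (2 * q).+2 ->
    3 \in tile_sides (tile_at (block_kind i) c r) ->
    r.+1 < (2 * q).+2 /\ 2 \in tile_sides (tile_at (block_kind i) c r.+1).
  move=> hi hc hr; rewrite has_side // => /andP[h1 h2]; split; first by lia.
  by rewrite has_side // h1.
have srcP k : k \in strip_links -> [/\ (strip_src k).1 \in strip_parts,
    (strip_src k).2 < size (gports (strip_kind (strip_src k).1)),
    strip_att (strip_src k).1 (strip_src k).2 = (k, false)
   & exists s, (strip_src k).1 = (k.1, (k.2.1, s))].
  case: k => i [[c r] d]; rewrite mem_strip_links => /and5P[hi hc hr hd h].
  have [s [j [e h1 h2 h3]]] := portP _ _ _ _ hi hc hr h.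
  rewrite /strip_src e; split=> //; last by exists s.
  by rewrite h3; case: d hd {h e h3} => [|[|[|]]].
have dstP k : k \in strip_links -> [/\ (strip_dst k).1 \in strip_parts,
    (strip_dst k).2 < size (gports (strip_kind (strip_dst k).1)),
    strip_att (strip_dst k).1 (strip_dst k).2 = (k, true)
   & exists s, (strip_dst k).1 = match k.2.2 with
      | 0 => ((next_col k.1 k.2.1.1).1, ((next_col k.1 k.2.1.1).2, k.2.1.2, s))
      | 1 => (k.1, (k.2.1.1, k.2.1.2.+1, s)) | _ => (k.1, (k.2.1, s)) end].
  case: k => i [[c r] d]; rewrite mem_strip_links => /and5P[hi hc hr hd h].
  case: d hd h => [|[|[|//]]] _ h; rewrite /strip_dst.
  - have [a1 a2 a3] := right_left hi hc hr h.
    have [s [j [e h1 h2 h3]]] := portP _ _ _ _ a1 a2 hr a3.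
    rewrite e; split=> //; last by exists s.
    by rewrite h3 /link_of next_colK.
  - have [a1 a2] := above _ _ _ hi hc hr h.
    have [s [j [e h1 h2 h3]]] := portP _ _ _ _ hi hc a1 a2.
    by rewrite e; split=> //; exists s.
  - rewrite feed_ends in h; have [s [j [e h1 h2 h3]]] := portP _ _ _ _ hi hc hr h.
    by rewrite e; split=> //; exists s.
split.
- by apply: uniq_pairs => [|i]; rewrite ?iota_uniq // filter_uniq ?uniq_cells.
- by apply: uniq_pairs => [|i]; rewrite ?iota_uniq // filter_uniq ?uniq_cells.
- case=> i [[c r] s] j hp; have [_ ->] := checks _ _ _ _ hp => hj.
  move: (hp); rewrite mem_strip_parts => /and4P[hi hc hr hs].
  have [hd hf] := find_port_nth hs hj; rewrite /strip_att.
  set d := nth 0 _ j in hd hf *; have d6 := side_lt hd.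
  have pE : port_at i c r d = ((i, (c, r, s)), j) by rewrite /port_at hf.
  case: d d6 hd hf pE => [|[|[|[|[|[|//]]]]]] _ hd hf pE; rewrite /link_of /=.
  + have [h1 h2 h3 h4 h5] := left_right hi hc hr hd.
    by rewrite mem_strip_links h3 h4 hr h5 prev_colK //; left.
  + by rewrite mem_strip_links hi hc hr hd.
  + have [h1 h2] := below _ _ _ hi hc hr hd.
    by rewrite mem_strip_links hi hc h2 prednK // pE andbT; split=> //; lia.
  + by rewrite mem_strip_links hi hc hr hd.
  + by rewrite mem_strip_links hi hc hr hd.
  + by rewrite mem_strip_links hi hc hr feed_ends hd.
- by move=> k /srcP[].
- by move=> k /dstP[].
- move=> k hk; have [h1 _ _ [s e1]] := srcP k hk; have [h2 _ _ [s' e2]] := dstP k hk.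
  have : (k.2.2 = 2 -> s < s').
    case: k hk e1 e2 {h1 h2} => i [[c r] d]; rewrite mem_strip_links => /and5P[_ _ _ _ h] /= e1 e2 ed.
    move: h e1 e2; rewrite ed /= /port_at => /feed_lt.
    by move=> h [<-] [<-].
  rewrite e1 in h1 *; rewrite e2 in h2 *; clear e1 e2.
  case: k hk h1 h2 => i [[c r] d] hk; rewrite /=; case: d hk => [|[|d]] hk h1 h2 hs.
  + apply: part_lt => //; move: h2; rewrite /next_col; case: ifP => _ _ /=; [right|left; lia].
    by split=> //; left.
  + by apply: part_lt => //; right; split=> //; right; split=> //; left.
  + apply: part_lt => //; right; split=> //; right; split=> //; right; split=> //; apply: hs.
    by move: hk; rewrite mem_strip_links => /and5P[_ _ _ hd _]; lia.
- move=> k k' hk hk' [].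
  have [_ _ _ [s e1]] := srcP k hk; have [_ _ _ [s' e2]] := dstP k hk.
  have [_ _ _ [u e3]] := srcP k' hk'; have [_ _ _ [u' e4]] := dstP k' hk'.
  rewrite e1 e2 e3 e4; move: hk hk'; clear e1 e2 e3 e4.
  case: k k' => i [[c r] d] [i' [[c' r'] d']]; rewrite !mem_strip_links.
  move=> /and5P[_ _ _ hd _] /and5P[_ _ _ hd' _] /= [-> -> -> _].
  have nx : next_col i' c' <> (i', c').
    by rewrite /next_col; case: ifP => _ []; lia.
  case: d hd => [|[|[|//]]] _; case: d' hd' => [|[|[|//]]] _ //= [].
  + by move=> _ _; lia.
  + by move=> h1 h2; case: nx; rewrite [LHS]surjective_pairing h1 h2.
  + by move=> _ _; lia.
  + by lia.
  + by move=> h1 h2; case: nx; rewrite [LHS]surjective_pairing -h1 -h2.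
  + by lia.
- by move=> p /chk /and3P[].
- by move=> p /chk /and3P[].
- by move=> p /chk /and3P[].
Qed.

(** * What a satisfying assignment of the links expresses *)

Notation strip_sat := (sat strip_parts strip_kind strip_att).
Notation strip_canonical := (canonical strip_kind strip_att).
Notation strip_verts := (verts strip_parts strip_kind).
Notation strip_edges := (edges strip_parts strip_links strip_kind).
Notation strip_esrc := (esrc strip_kind strip_src).
Notation strip_edst := (edst strip_kind strip_dst).
Notation strip_weight := (@eweight _ part strip_kind).

Lemma port_bits_sides t i c r s : (i, (c, r, s)) \in strip_parts ->
  port_bits strip_kind strip_att t (i, (c, r, s)) =
  [seq t (link_of i c r d).1 == (link_of i c r d).2
  | d <- (tile_part (tile_at (block_kind i) c r) s).2].
Proof.
rewrite mem_strip_parts => /and4P[_ _ _ /tile_part_checks[_ e]].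
rewrite /port_bits /= e -[in RHS](mkseq_nth 0 (tile_part _ _).2) /mkseq -map_comp.
exact: eq_map.
Qed.

Lemma satP t : strip_sat t <-> forall i c r s, (i, (c, r, s)) \in strip_parts ->
  gsat (tile_part (tile_at (block_kind i) c r) s).1
    [seq t (link_of i c r d).1 == (link_of i c r d).2
    | d <- (tile_part (tile_at (block_kind i) c r) s).2].
Proof.
split=> [h i c r s hp|h [i [[c r] s]] hp].
  by have := h _ hp; rewrite port_bits_sides.
by rewrite port_bits_sides //; apply: h.
Qed.

Section TileConstraints.
Variables (t : part -> bool) (i c r : nat).
Hypotheses (st : strip_sat t) (hi : 0 < i <= n) (hc : c < q) (hr : r <= 2 * q).
Let i2 : i < n.+2. Proof. lia. Qed.
Let r2 : r < (2 * q).+2. Proof. lia. Qed.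

Let L := t ((prev_col i c).1, ((prev_col i c).2, r, 0)).
Let Rt := t (i, (c, r, 0)).
Let B := t (i, (c, r.-1, 1)).
Let Tp := t (i, (c, r, 1)).

(** A link is true when it points to the right or upwards. Read contrapositively, it is the value
    false that propagates: up the columns, along the rows to the right, and at a [Branch] from the
    column into the row. At a [Clash] the values false from the left and from below exclude each
    other. *)
Lemma sat_wires : 0 < r -> let T := tile_at (block_kind i) c r in
  [/\ Tp -> B, T <> Branch -> Rt -> L, T = Branch -> Rt -> B & T = Clash -> L || B].
Proof.
move=> r0 T; move/satP: st => /(_ i c r 0); rewrite mem_strip_parts i2 hc r2 -/T.
have : T = Cross \/ T = Clash \/ T = Branch.
  rewrite /T tile_at_mid //; case: eqP; first lia; case: eqP; first lia.
  by move=> _ _; case: ifP => _; case: ifP => _; auto.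
case=> [->|[->|->]] /(_ isT); rewrite /gsat /= -/L -/Rt -/B -/Tp.
- by case: L Rt B Tp => [] [] [] [].
- by case: L Rt B Tp => [] [] [] []; case: (t (i, (c, r, 2))).
- by case: L Rt B Tp => [] [] [] []; case: (t (i, (c, r, 2))).
Qed.

Lemma sat_or : r = 0 -> if c == 0 then Rt ==> ~~ Tp else if c == q.-1 then L || ~~ Tp
  else Rt ==> L || ~~ Tp.
Proof.
move=> r0; have sT := tile_at_mid c r hi; rewrite r0 /= in sT.
move/satP: st => h; have h0 := h i c r 0; have h1 := h i c r 1.
rewrite !mem_strip_parts i2 hc r2 in h0 h1; move: h0 h1; rewrite r0 sT.
rewrite /L /Rt /Tp r0; case: eqP => [_|_]; last case: eqP => [_|_]; rewrite /gsat /=.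
- move=> /(_ isT) h0 /(_ isT); move: h0; case: (t (i, (c, 0, 0))); case: (t (i, (c, 0, 1)));
  by case: (t (i, (c, 0, 2))).
- move=> /(_ isT) h0 /(_ isT); move: h0; case: (t (_, (_, 0, 0))); case: (t (i, (c, 0, 1)));
  by case: (t (i, (c, 0, 2))).
- move=> /(_ isT) h0 _; move: h0; case: (t ((prev_col i c).1, _)); case: (t (i, (c, 0, 0)));
  by case: (t (i, (c, 0, 1))).
Qed.

End TileConstraints.

Definition chosen (t : part -> bool) (i c : nat) : bool := ~~ t (i, (c, 0, 1)).

(** If no symbol were chosen, then along the chain of OR tiles no link of the bottom row could point
    to the right, and the last tile would be left without support. *)
Lemma sat_chosen t i : strip_sat t -> 0 < i <= n -> exists2 c, c < q & chosen t i c.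
Proof.
move=> st hi; have [/hasP[c]|/hasPn none] := boolP (has (chosen t i) (iota 0 q)).
  by rewrite mem_iota => hc ?; exists c.
have {}none c : c < q -> t (i, (c, 0, 1)).
  by move=> hc; have := none c; rewrite mem_iota /chosen negbK; apply.
have noR c : c.+1 < q -> t (i, (c, 0, 0)) = false.
  elim: c => [|c IH] hc.
    have := sat_or st hi (ltnW hc) (leq0n _) erefl; rewrite /= none ?(ltnW hc) //.
    by case: (t _).
  have := sat_or st hi (ltnW hc) (leq0n _) erefl; rewrite /= none ?(ltnW hc) // orbF IH ?(ltnW hc) //.
  by case: eqP => [|_]; [lia|case: (t _)].
have q0 : q.-1 < q by lia.
have := sat_or st hi q0 (leq0n _) erefl; rewrite eqxx.
have -> : (q.-1 == 0) = false by lia.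
rewrite none // orbF /prev_col; case E: q.-1 => [|c] /=; first lia.
by rewrite noR //; lia.
Qed.

Lemma sat_column t i c r : strip_sat t -> 0 < i <= n -> c < q -> r <= 2 * q ->
  t (i, (c, r, 1)) -> ~~ chosen t i c.
Proof.
move=> st hi hc; rewrite /chosen negbK; elim: r => // r IH hr h.
by have [/(_ h) h' _ _ _] := sat_wires st hi hc hr (ltn0Sn r); apply: IH => //; apply: ltnW.
Qed.

Lemma odd_row x b : odd (b + x.*2) = odd b. Proof. by rewrite oddD odd_double addbF. Qed.

Lemma half_row x (b : bool) : (b + x.*2)./2 = x. Proof. by rewrite half_bit_double. Qed.

Lemma sat_clash t i x y : strip_sat t -> 0 < i < n -> x < q -> y < q -> forb x y ->
  ~~ (chosen t i x && chosen t i.+1 y).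
Proof.
move=> st hi hx hy hf; apply/negP => /andP[cx cy].
(* Of the two rows of [x], this is the one that is outgoing in block [i] and incoming in block
   [i.+1]. *)
pose b := ~~ odd i; pose r := (b + x.*2).+1.
have hr : r <= 2 * q by rewrite /r; case: (b); lia.
have hi1 : 0 < i <= n by lia. have hi2 : 0 < i.+1 <= n by lia.
have r0 : (r == 0) = false by []. have rq : (r == (2 * q).+1) = false by lia.
have odr : odd r.-1 = ~~ odd i by rewrite /r /= odd_row oddb.
have har : r.-1./2 = x by rewrite /r /= half_row.
have tnew c : tile_at (block_kind i) c r = if x == c then Branch else Cross.
  by rewrite tile_at_mid // r0 rq odr har; case: (odd i).
have told c : tile_at (block_kind i.+1) c r = if forb x c then Clash else Cross.
  by rewrite tile_at_mid // r0 rq odr har /=; case: (odd i).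
have new c : c < q -> t (i, (c, r, 0)) -> x <= c -> false.
  elim: c => [|c IH] hc h hxc.
    have [_ _ h' _] := sat_wires st hi1 hc hr (ltn0Sn _).
    have ex : x = 0 by lia.
    have := sat_column st hi1 hc (leq_trans (leq_pred _) hr) (h' _ h).
    by rewrite tnew ex eqxx => /(_ erefl); rewrite -ex cx.
  have [_ h1 h2 _] := sat_wires st hi1 hc hr (ltn0Sn _).
  have [ex|nx] := eqVneq x c.+1.
    have := sat_column st hi1 hc (leq_trans (leq_pred _) hr) (h2 _ h).
    by rewrite tnew ex eqxx => /(_ erefl); rewrite -ex cx.
  apply: IH; [exact: ltnW|apply: h1 h|lia].
  by rewrite tnew (negbTE nx).
have old c : c < q -> t ((prev_col i.+1 c).1, ((prev_col i.+1 c).2, r, 0)) -> false.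
  elim: c => [|c IH] hc /= h; first by apply: (new q.-1) => //; lia.
  have [_ h1 _ _] := sat_wires st hi2 (ltnW hc) hr (ltn0Sn _).
  apply: (IH (ltnW hc)); apply: h1 => //.
  by rewrite told; case: ifP.
have [_ _ _ h] := sat_wires st hi2 hy hr (ltn0Sn _).
rewrite told hf in h; case/orP: (h erefl).
  by move/(old y hy).
by move/(sat_column st hi2 hy (leq_trans (leq_pred _) hr)); rewrite cy.
Qed.

(* [u] are the symbols that are chosen, [a] those whose wires are inactive, and [b] those on which
   the chain in the bottom row relies. *)
Definition wiring (u a b : nat -> nat -> bool) (k : part) : bool :=
  let: (i, (c, r, d)) := k in
  match d with
  | 0 => if r == 0 then has (b i) (iota 0 c.+1)
         else if i == 0 then true
         else if odd r.-1 == odd i then (i == 1) || ~~ a i.-1 r.-1./2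
         else (r.-1./2 <= c) && ~~ a i r.-1./2
  | 1 => if r == 0 then ~~ u i c else ~~ a i c
  | _ => r == 0
  end.

(** For a word all three sets consist of its symbols. The slack between them is what allows a symbol
    to be exchanged: [a] may already contain a symbol that is not yet chosen, and [b] may still
    avoid one that is. *)
Record coherent (u a b : nat -> nat -> bool) : Prop := Coherent {
  coh_b : forall i c, b i c -> u i c;
  coh_a : forall i c, u i c -> a i c;
  coh_some : forall i, 0 < i <= n -> exists2 c, c < q & b i c;
  coh_clash : forall i x y, 0 < i < n -> x < q -> y < q -> forb x y -> ~~ (a i x && a i.+1 y) }.

Lemma wiring_sat u a b : coherent u a b -> strip_sat (wiring u a b).
Proof.
move=> co; apply/satP => i c r s; rewrite mem_strip_parts => /and4P[hi hc hr hs].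
case: (boolP (0 < i <= n)) => [him|him]; last first.
  move: hs; rewrite /tile_at /block_kind; have [->|i0] := eqVneq i 0.
    by case: ifP => // _; case: s => [|[]].
  have -> : i == n.+1 by lia.
  by rewrite /=; case: ifP => // _; case: s => [|[]].
have ua c' : a i c' || ~~ u i c' by case E: (u i c'); rewrite ?orbT // (coh_a co E).
have bu c' : u i c' || ~~ b i c' by case E: (b i c'); rewrite ?orbT // (coh_b co E).
have has1 c' : has (b i) (iota 0 c'.+1) = has (b i) (iota 0 c') || b i c'.
  by rewrite -addn1 iotaD has_cat /= orbF add0n.
rewrite tile_at_mid //= in hs *; have [r0|r0] := eqVneq r 0.
  rewrite r0 /= in hs *; move: hs; have [c0|c0] := eqVneq c 0; last have [cq|cq] := eqVneq c q.-1.
  - case: s => [|[|[|s]]] // _; rewrite /gsat /= c0 /= orbF.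
    by have := bu 0; case: (b i 0); case: (u i 0).
  - case: s => [|[|[|s]]] // _; rewrite /gsat /= andbT.
    have [c1 hc1 bc1] := coh_some co him.
    have : has (b i) (iota 0 c.+1) by apply/hasP; exists c1 => //; rewrite mem_iota; lia.
    case: c c0 cq {hr hc} => // c _ cq; rewrite has1 => /orP[/= -> //|h].
    by rewrite (coh_b co h) /= !orbT.
  - case: s => [|[|[|s]]] // _; rewrite /gsat /= andbT.
    case: c c0 cq {hr hc} => // c _ _; have := has1 c.+1; rewrite /= => ->.
    by have := bu c.+1; case: (u i c.+1); case: (b i c.+1) => //; case: (b i 0) => //; case: (has _ _).
move: hs; rewrite (negbTE r0); have [rq|rq] := eqVneq r (2 * q).+1.
  by case: s => [|[]].
have vert : ~~ a i c -> wiring u a b (i, (c, r.-1, 1)).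
  by rewrite /=; case: eqP => // _; have := ua c; case: (a i c); case: (u i c).
have hx : r.-1./2 < q by lia.
have wT : wiring u a b (i, (c, r, 1)) = ~~ a i c by rewrite /= (negbTE r0).
have wZ : wiring u a b (i, (c, r, 2)) = false by rewrite /= (negbTE r0).
case: (boolP (odd r.-1 == odd i)) => [ho|hn].
  have horL : wiring u a b ((prev_col i c).1, ((prev_col i c).2, r, 0)) =
              (i == 1) || ~~ a i.-1 r.-1./2.
    case: (c) hc => [|c'] hc' /=; rewrite (negbTE r0); last first.
      by rewrite ho; case: eqP him => // ->.
    have [->|i1] := eqVneq i 1; first by [].
    have -> : (i.-1 == 0) = false by lia.
    have -> : (odd r.-1 == odd i.-1) = false.
      by move/eqP: ho => ->; case: (i) him => //= i' _; case: (odd i').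
    by have -> : r.-1./2 <= q.-1 by lia.
  have hor : wiring u a b (i, (c, r, 0)) = (i == 1) || ~~ a i.-1 r.-1./2.
    by rewrite /= (negbTE r0) ho; case: eqP him => // ->.
  have hX : forb r.-1./2 c -> a i c -> (i == 1) || ~~ a i.-1 r.-1./2.
    move=> hf E; case: eqP => //= i1; have := @coh_clash _ _ _ co i.-1 r.-1./2 c.
    rewrite prednK; last by case/andP: him.
    move=> /(_ _ hx hc hf); rewrite E andbT; apply; lia.
  case: ifP hX => hf hX; case: s => [|[|[|s]]] // _; rewrite /gsat;
    cbn [map link_of fst snd tile_part nth tile_parts]; rewrite ?horL ?hor ?wT ?wZ.
    move: (hX isT) vert; case: ((i == 1) || _); case: (wiring u a b _); case: (a i c) => //= h1 h2;
      by [have := h1 isT|have := h2 isT].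
  move: vert; case: ((i == 1) || _); case: (wiring u a b _); case: (a i c) => //= h2;
    by have := h2 isT.
have hor : wiring u a b (i, (c, r, 0)) = (r.-1./2 <= c) && ~~ a i r.-1./2.
  by rewrite /= (negbTE r0) (negbTE hn); case: eqP him => // ->.
have horL : r.-1./2 != c -> wiring u a b (i, (c, r, 0)) ->
    wiring u a b ((prev_col i c).1, ((prev_col i c).2, r, 0)).
  rewrite hor; case: (c) hc => [|c'] hc' ne; first by move: ne; rewrite leqn0 => /negbTE ->.
  rewrite /= (negbTE r0) (negbTE hn); case: eqP => // _ /andP[h ->].
  by rewrite andbT; lia.
case: ifP => hf; case: s => [|[|[|s]]] // _; rewrite /gsat; cbn [map link_of fst snd tile_part nth tile_parts].
  rewrite hor wT wZ (eqP hf) leqnn; move: vert; case: (wiring u a b _); case: (a i c) => //= h2.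
  by have := h2 isT.
move: (horL (negbT hf)) vert; rewrite wT.
case: (wiring u a b (i, (c, r, 0))); case: (wiring u a b (_, (_, r, 0)));
  case: (wiring u a b _); case: (a i c) => //= h1 h2;
  by [have := h1 isT|have := h2 isT].
Qed.

Notation strip_step := (key_step strip_verts strip_edges strip_esrc strip_edst strip_weight).

(** Columns are compared first; within a column, vertical links by height, below the horizontal and
    feed links, as [2 * q + 3] exceeds every row. Thus a link that enters a tile from the left or
    from below ranks lower than the links that leave it. *)
Definition link_rank (k : part) : nat :=
  let: (i, (c, r, d)) := k in
  (i * q + c) * (2 * q + 4) + (if d == 1 then r else 2 * q + 3).

Lemma rank_clause p cl j1 j2 : p \in strip_parts -> cl \in gclauses (strip_kind p) ->
  j1 \in cl -> j2 \in cl -> j1 < size (gports (strip_kind p)) -> j2 < size (gports (strip_kind p)) ->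
  (strip_att p j1).2 = false -> (strip_att p j2).2 = true ->
  link_rank (strip_att p j2).1 < link_rank (strip_att p j1).1.
Proof.
case: p => i [[c r] s] hp _ _ _; move: (hp); rewrite mem_strip_parts => /and4P[hi hc hr hs].
have [_ ->] := tile_part_checks hs; rewrite /strip_att => h1 h2.
have [d1 _] := find_port_nth hs h1; have [d2 _] := find_port_nth hs h2.
set e1 := nth 0 _ j1 in d1 *; set e2 := nth 0 _ j2 in d2 *.
have five : e2 = 5 -> e1 = 5.
  rewrite /e1 /e2; move: hs h1 h2; case: (tile_at _ _ _); case: s {hp d1 d2 e1 e2} => [|[|[|s]]] //=;
  by case: j1 => [|[|[|[|[|j1]]]]] //; case: j2 => [|[|[|[|[|j2]]]]].
have l1 := side_lt d1; have l2 := side_lt d2.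
have pos : e2 = 2 -> 0 < r by move=> e; rewrite e has_side // in d2; case/andP: d2.
have left : e2 = 0 -> 0 < i by move=> e; rewrite e in d2; have [] := left_right hi hc hr d2.
case: e1 l1 {d1} five => [|[|[|[|[|[|//]]]]]] _ five //= _;
  case: e2 l2 {d2} five pos left => [|[|[|[|[|[|//]]]]]] _ five pos left //= _;
  try (by have := five erefl); rewrite /link_rank /=.
all: try (have := pos erefl; rewrite ltn_add2l; lia).
all: have i0 := left erefl; rewrite /prev_col; case: (c) hc => [|c'] hc' /=.
all: try (rewrite addnS mulSn; lia).
all: have -> : i * q + 0 = (i.-1 * q + q.-1).+1 by (case: (i) i0 => // i' _; rewrite mulSn; lia).
all: rewrite mulSn; lia.
Qed.

(** The set [u] determines the vertical links at the bottom, and with [u] fixed all other links are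
    monotone in [a] and [b]; so [canonical_mono] applies. *)
Lemma wiring_path u a b a' b' : coherent u a b -> coherent u a' b' ->
  (forall i c, a' i c -> a i c) -> (forall i c, b i c -> b' i c) ->
  reach strip_step (strip_canonical (wiring u a' b')) (strip_canonical (wiring u a b)).
Proof.
move=> co co' ha hb.
apply: (canonical_mono strip_ok (0, (0, 0, 0)) rank_clause (wiring_sat co) (wiring_sat co')).
have na i x : ~~ a i x -> ~~ a' i x by apply: contra; apply: ha.
case=> i [[c r] d] _ /=; case: d => [|[|d]] //; case: ifP => _ //.
- change (has (b i) (iota 0 c.+1) -> has (b' i) (iota 0 c.+1)).
  by case/hasP=> x hx /hb h; apply/hasP; exists x.
- case: ifP => // _; case: ifP => _; first by case/orP => [->//|/na ->]; rewrite orbT.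
  by case/andP => -> /na.
- exact: na.
Qed.

(** * Words as configurations of the strip *)

Definition symbols (w : nat -> nat) (i c : nat) : bool := w i == c.

Definition word_config (w : nat -> nat) : part + part * nat -> bool :=
  strip_canonical (wiring (symbols w) (symbols w) (symbols w)).

Definition word_ok (w : nat -> nat) : Prop :=
  (forall i, 0 < i <= n -> w i < q) /\ (forall i, 0 < i < n -> ~~ forb (w i) (w i.+1)).

Definition word_step (w w' : nat -> nat) : Prop :=
  [/\ word_ok w, word_ok w' & exists i, forall j, 0 < j <= n -> j != i -> w j = w' j].

Lemma word_coherent w : word_ok w -> coherent (symbols w) (symbols w) (symbols w).
Proof.
move=> [h1 h2]; split=> // [i hi|i x y hi hx hy hf]; first by exists (w i); rewrite ?h1 ?/symbols.
apply/negP => /andP[/eqP e1 /eqP e2]; have := h2 i hi; by rewrite e1 e2 hf.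
Qed.

Lemma word_config_legal w : word_ok w ->
  key_legal strip_verts strip_edges strip_esrc strip_edst strip_weight (word_config w).
Proof. by move=> hw; apply: (canonical_legal strip_ok); apply/wiring_sat/word_coherent. Qed.

(** Both configurations are connected to the one in which the old and the new symbol are chosen
    together. The union [m] is free of clashes, because the words differ in one block only and so
    every forbidden pair would already occur in one of them. *)
Lemma word_step_config w w' : word_step w w' -> reach strip_step (word_config w) (word_config w').
Proof.
move=> [hw hw' [i0 h0]].
have hws : word_step w w' by split=> //; exists i0.
pose m i c := symbols w i c || symbols w' i c.
have cow := word_coherent hw; have cow' := word_coherent hw'.
have mclash i x y : 0 < i < n -> x < q -> y < q -> forb x y -> ~~ (m i x && m i.+1 y).
  move=> hi hx hy hf; have [w1 w2] := (hw, hw').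
  have k1 := coh_clash cow hi hx hy hf; have k2 := coh_clash cow' hi hx hy hf.
  rewrite /m /symbols in k1 k2 *.
  have [e|ne] := eqVneq i i0.
    have <- : w i.+1 = w' i.+1 by apply: h0; lia.
    rewrite orbb; move: k1 k2; have -> : w' i.+1 = w i.+1 by symmetry; apply: h0; lia.
    by case: (w i.+1 == y); rewrite ?andbF // !andbT => /negbTE -> /negbTE ->.
  have <- : w i = w' i by apply: h0; lia.
  rewrite orbb; move: k1 k2; have -> : w' i = w i by symmetry; apply: h0; lia.
  by case: (w i == x) => //= /negbTE -> /negbTE ->.
have co v : (forall i c, symbols v i c -> m i c) -> word_ok v -> coherent (symbols v) m (symbols v).
  by move=> hv hok; have c0 := word_coherent hok; split=> //; apply: (coh_some c0).
have com v : (forall i c, symbols v i c -> m i c) -> word_ok v -> coherent m m (symbols v).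
  by move=> hv hok; have c0 := word_coherent hok; split=> //; apply: (coh_some c0).
have mw i c : symbols w i c -> m i c by rewrite /m => ->.
have mw' i c : symbols w' i c -> m i c by rewrite /m => ->; rewrite orbT.
have comm : coherent m m m.
  split=> // i hi; have [c hc h] := coh_some cow hi; by exists c => //; apply: mw.
have half v : (forall i c, symbols v i c -> m i c) -> word_ok v ->
    (forall i c, 0 < i <= n -> m i c -> i != i0 -> symbols v i c) ->
    (exists x, forall c, m i0 c -> c != x -> symbols v i0 c) ->
    reach strip_step (word_config v) (strip_canonical (wiring m m m)).
  move=> mv hv hsame [x hx]; have c0 := word_coherent hv.
  apply: reach_trans (wiring_path (co v mv hv) c0 mv (fun _ _ h => h)) _.
  apply: (@reach_trans _ _ _ (strip_canonical (wiring m m (symbols v)))); last first.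
    apply: reach_sym; last exact: (wiring_path (com v mv hv) comm (fun _ _ h => h) mv).
    by move=> u u' [l1 l2 [k hk]]; split=> //; exists k => k' h1 h2; rewrite hk.
  apply: (canonical_step strip_ok (wiring_sat (co v mv hv)) (wiring_sat (com v mv hv))).
  exists (i0, (x, 0, 1)) => -[i [[c r] d]]; rewrite mem_strip_links => /and5P[hi hc _ _ hd].
  case: d hd => [|[|d]] //= hd ne; case: eqP => // r0; congr negb.
  move: hd; rewrite has_side //; last by lia.
  move=> /andP[him _]; apply/idP/idP => [/mv //|hm].
  have [ei|ni] := eqVneq i i0; last exact: hsame.
  rewrite ei in hm ne *; apply: hx => //; apply: contraNneq ne => ->; by rewrite r0.
apply: reach_trans (half w mw hw _ _) _.
- move=> i c hi; rewrite /m /symbols => /orP[//|/eqP <-] ne; by rewrite (h0 i).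
- by exists (w' i0) => c; rewrite /m /symbols => /orP[//|/eqP ->]; rewrite eqxx.
apply: reach_sym; first by move=> u u' [l1 l2 [k hk]]; split=> //; exists k => k' h1 h2; rewrite hk.
apply: (half w' mw' hw').
- move=> i c hi; rewrite /m /symbols => /orP[/eqP <-|//] ne; by rewrite (h0 i).
- by exists (w i0) => c; rewrite /m /symbols => /orP[/eqP ->|//]; rewrite eqxx.
Qed.

Theorem strip_reconfigurable w w' : word_ok w -> word_ok w' ->
  reconfigurable (of_fun (assembly_graph_ok strip_ok) (word_config w))
                 (of_fun (assembly_graph_ok strip_ok) (word_config w')) <-> reach word_step w w'.
Proof.
move=> hw hw'; split; last first.
  move=> h; apply: reach_reconfigurable; last exact: word_config_legal.
  exact: reach_map word_step_config h.
move/(reconfigurable_reach (ok := assembly_graph_ok strip_ok)) => h.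
set C0 := to_fun _ in h; set C1 := to_fun _ in h.
pose t (c : part + part * nat -> bool) k := c (inl k).
(* A configuration may choose several symbols in a block, so the invariant speaks of all words that
   can be read off it. *)
pose inv (c : part + part * nat -> bool) :=
  key_legal strip_verts strip_edges strip_esrc strip_edst strip_weight c /\
  forall v, (forall i, 0 < i <= n -> v i < q /\ chosen (t c) i (v i)) -> reach word_step w v.
have lsat c : key_legal strip_verts strip_edges strip_esrc strip_edst strip_weight c ->
    strip_sat (t c) by apply: (legal_sat strip_ok).
have okv c v : strip_sat (t c) -> (forall i, 0 < i <= n -> v i < q /\ chosen (t c) i (v i)) -> word_ok v.
  move=> st hv; split=> i hi; first by have [] := hv i hi.
  have hi1 : 0 < i <= n by lia. have hi2 : 0 < i.+1 <= n by lia.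
  have [a1 b1] := hv i hi1; have [a2 b2] := hv _ hi2.
  apply/negP => hf; have := sat_clash st hi a1 a2 hf; by rewrite b1 b2.
have link_in i c : 0 < i <= n -> c < q -> inl (i, (c, 0, 1)) \in strip_edges.
  move=> hi hc; rewrite mem_edges_inl mem_strip_links hc /=.
  have i2 : i < n.+2 by lia.
  by rewrite has_side // hi i2.
have vals v i c : 0 < i <= n -> c < q ->
    chosen (t (to_fun (of_fun (assembly_graph_ok strip_ok) (word_config v)))) i c = (v i == c).
  move=> hi hc; rewrite /chosen /t; have hk := link_in i c hi hc.
  rewrite /to_fun; case: insubP => [e he ee|]; last by rewrite index_mem hk.
  rewrite ffunE; have -> : edge_key e = inl (i, (c, 0, 1)).
    apply: (index_inj_in (s := strip_edges)) => //; first exact: edge_key_in.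
    by rewrite (index_edge_key (assembly_graph_ok strip_ok)) ee.
  by rewrite /word_config /canonical /assemble /wiring /= negbK.
have legal0 v : word_ok v -> key_legal strip_verts strip_edges strip_esrc strip_edst strip_weight
    (to_fun (of_fun (assembly_graph_ok strip_ok) (word_config v))).
  move=> hv; apply/(legal_of_fun (assembly_graph_ok strip_ok)); rewrite to_funK.
  by apply/legal_of_fun; apply: word_config_legal.
have i0 : inv C0.
  split; first exact: legal0.
  move=> v hv; apply: reach1; split=> //; first by apply: okv hv; apply: lsat; apply: legal0.
  exists 0 => j hj _; have [a b] := hv j hj.
  by move: b; rewrite vals // => /eqP.
have [_] : inv C1.
  apply: reach_inv h i0 => c c' [lc lc' [k hk]] [_ hc]; split=> // v hv.
  have sc := lsat _ lc; have sc' := lsat _ lc'.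
  pose good i := chosen (t c) i (v i).
  (* A word [v] of the new configuration is replaced by one of the old configuration, with another
     chosen symbol wherever that of [v] was not chosen yet. This happens at most in the block of the
     reversed link. *)
  have pick i : exists x, 0 < i <= n -> [/\ x < q, chosen (t c) i x & good i -> x = v i].
    have [hi|hi] := boolP (0 < i <= n); last by exists 0.
    case G: (good i); first by exists (v i) => _; split=> //; have [] := hv i hi.
    by have [x hx cx] := sat_chosen sc hi; exists x => _; split.
  have [v1 hv1] : exists v1 : nat -> nat, forall i, 0 < i <= n ->
      [/\ v1 i < q, chosen (t c) i (v1 i) & good i -> v1 i = v i].
    have : forall m, exists v1 : nat -> nat, forall i, i <= m -> 0 < i <= n ->
      [/\ v1 i < q, chosen (t c) i (v1 i) & good i -> v1 i = v i].
      elim=> [|m [v1 IH]]; first by exists (fun=> 0) => -[].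
      have [x hx] := pick m.+1; exists (fun i => if i == m.+1 then x else v1 i) => i him hi.
      by case: eqP => [e|ne]; [move: hi; rewrite e; exact: hx|apply: IH => //; lia].
    by move/(_ n) => [v1 h1]; exists v1 => i hi; apply: h1 => //; case/andP: hi.
  apply: ReachStep (hc v1 _) _; first by move=> i hi; have [] := hv1 i hi.
  have ok1 : word_ok v1 by apply: (okv c) => // i hi; have [] := hv1 i hi.
  split=> //; first exact: (okv c').
  exists (if k is inl (i, _) then i else 0) => j hj ne; have [_ _] := hv1 j hj; apply.
  have [vq cj] := hv j hj; move: cj; rewrite /good /chosen /t => cj.
  rewrite (hk (inl (j, (v j, 0, 1)))) //; first exact: link_in.
  by apply: contraNneq ne => <-.
apply=> i hi; split; first by case: hw' => h1 _; apply: h1.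
by rewrite vals //; case: hw' => h1 _; apply: h1.
Qed.

End Strip.

(** * Rewriting by dominoes *)

Section Dominoes.
Variables (G : finType) (g0 : G) (rule : pred (G * G * G * G)).

(* [inl b]: the two ends of the word; [inr (inl (u, v))]: two consecutive letters, where [v] may be
   replaced by a rule that is being applied to [v] and the letter after it; [inr (inr (r, h))]: the
   rule [r = (a, b, c, d)] in place of the domino [(a, b)] or [(c, d)], in phase [h]. *)
Definition domino : finType :=
  (bool + (option G * option (G + G * G * G * G) + G * G * G * G * 'I_3))%type.

Definition compatible (s t : domino) : bool :=
  match s, t with
  | inl false, inr (inl (None, _)) => true
  | inr (inl (_, None)), inl true => true
  | inr (inl (_, Some (inl z))), inr (inl (Some z', _)) => z == z'
  | inr (inl (_, Some v)), inr (inr (r, h)) => let: (a, b, c, d) := r in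
      rule r && ((v == inr r) ||
        match nat_of_ord h with 0 => v == inl a | 1 => false | _ => v == inl c end)
  | inr (inr (r, h)), inr (inl (Some u, _)) => let: (a, b, c, d) := r in
      rule r && match nat_of_ord h with 0 => u == b | 1 => (u == b) || (u == d) | _ => u == d end
  | _, _ => false
  end.

Definition dom_forb (s t : nat) : bool :=
  ~~ compatible (nth (inl false) (enum domino) s) (nth (inl false) (enum domino) t).

Definition dom_rank (s : domino) : nat := enum_rank s.

Lemma dom_rankK s : nth (inl false) (enum domino) (dom_rank s) = s.
Proof. exact: nth_enum_rank. Qed.

Lemma dom_rank_lt s : dom_rank s < #|domino|. Proof. exact: ltn_ord. Qed.

Lemma card_domino : 1 < #|domino|.
Proof. by rewrite card_sum card_bool; lia. Qed.

Variable m : nat.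

Definition rewrites (x x' : nat -> G) : Prop :=
  (forall j, 0 < j <= m -> x j = x' j) \/
  exists2 k, 0 < k < m &
    [/\ forall j, 0 < j <= m -> j != k -> j != k.+1 -> x j = x' j
      & rule (x k, x k.+1, x' k, x' k.+1) \/ rule (x' k, x' k.+1, x k, x k.+1)].

Lemma rewrites_sym x x' : rewrites x x' -> rewrites x' x.
Proof.
case=> [h|[k hk [h1 h2]]]; first by left=> j /h.
by right; exists k => //; split; [move=> j a b c; rewrite h1|case: h2; auto].
Qed.

Definition letter (x : nat -> G) (p : nat) : option G := if 0 < p <= m then Some (x p) else None.

Definition letter_dom (u v : option G) : domino := inr (inl (u, omap inl v)).

(** Position [i] shows the letters [i.-2] and [i.-1], absent outside the range. The [m] letters thus
    give [m.+1] dominoes, and the end markers bring the length to [m.+3]. *)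
Definition dom_word (x : nat -> G) (i : nat) : domino :=
  if i == 1 then inl false else if i == m.+3 then inl true
  else letter_dom (letter x i.-2) (letter x i.-1).

Definition dom_good (W : nat -> domino) : Prop :=
  [/\ W 1 = inl false, W m.+3 = inl true & forall i, 0 < i < m.+3 -> compatible (W i) (W i.+1)].

Definition dom_step (W W' : nat -> domino) : Prop :=
  [/\ dom_good W, dom_good W' & exists i, forall j, 0 < j <= m.+3 -> j != i -> W j = W' j].

(** In the middle phase the right neighbour decides: the rule counts as applied once that neighbour
    no longer shows the old letter [b]. If [b = d], it counts as applied only in the last phase. *)
Definition applied (r : G * G * G * G) (h : 'I_3) (t : domino) : bool :=
  let: (a, b, c, d) := r in
  match nat_of_ord h with
  | 0 => false
  | 1 => if t is inr (inl (Some u, _)) then u != b else false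
  | _ => true
  end.

Definition letter_of (s t : domino) : G :=
  match s with
  | inr (inl (Some u, _)) => u
  | inr (inr (a, b, c, d, h)) => if applied (a, b, c, d) h t then c else a
  | _ => g0
  end.

Definition decode (W : nat -> domino) (k : nat) : G := letter_of (W k.+2) (W k.+3).

Definition is_rule (s : domino) : bool := if s is inr (inr _) then true else false.

Lemma letter_of_left u z s C : compatible (inr (inl (u, Some (inl z)))) s -> compatible s C ->
  letter_of s C = z.
Proof.
case: s => [[]|[[[u1|] v1]|[[[[a b] c] d] h]]] //=; first by move=> /eqP <-.
case/andP=> _ e1; case: C => [[]|[[[w|] x]|r]] //= /andP[_]; move: e1.
by case: h => [[|[|[|//]]] ?] //= /eqP[->].
Qed.

Lemma rule_left u r s : compatible (inr (inl (u, Some (inr r)))) s ->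
  rule r /\ exists h, s = inr (inr (r, h)).
Proof.
case: s => [[]|[[[u1|] v1]|[[[[a b] c] d] h]]] //= /andP[hr].
case: h => [[|[|[|//]]] hh] /=; rewrite ?orbF => /eqP[->]; split=> //; by eexists.
Qed.

(** A change of the domino [s] can affect the letters read at [A] and at [s]. Either nothing
    changes, or [A] is a rule whose right neighbour switches between its two letters, or [s] is a
    rule that changes phase. In the last case the neighbour shows a letter equal to both [b] and
    [d], so that an application of the rule is seen again. *)
Lemma letter_of_change A s s' C :
  compatible A s -> compatible A s' -> compatible s C -> compatible s' C ->
  [\/ letter_of A s = letter_of A s' /\ letter_of s C = letter_of s' C,
      is_rule A /\ (rule (letter_of A s, letter_of s C, letter_of A s', letter_of s' C) \/
                    rule (letter_of A s', letter_of s' C, letter_of A s, letter_of s C))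
    | letter_of A s = letter_of A s' /\ exists2 u, (if C is inr (inl (Some v, _)) then v == u else false) &
        (rule (letter_of s C, u, letter_of s' C, u) \/ rule (letter_of s' C, u, letter_of s C, u))].
Proof.
case: A => [[]|[[u [[z|r]|]]|[[[[a b] c] d] h]]].
- by [].
- by case: s => [[]|[[[u1|] v1]|r1]] //; case: s' => [[]|[[[u2|] v2]|r2]] // _ _ _ _; constructor 1.
- by move=> h1 h2 k1 k2; constructor 1; rewrite !(letter_of_left h1, letter_of_left h2).
- move=> /rule_left[hr [h ->]] /rule_left[_ [h' ->]].
  move: r hr => [[[a b] c] d] hr; case: C => [[]|[[[w|] x]|r']] //= /andP[_ C1] /andP[_ C2].
  have [e|ne] := eqVneq (if applied (a, b, c, d) h (inr (inl (Some w, x))) then c else a)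
    (if applied (a, b, c, d) h' (inr (inl (Some w, x))) then c else a); first by constructor 1.
  constructor 3; split=> //; exists w; first exact: eqxx.
  move: C1 C2 ne; case: h => [[|[|[|//]]] ?]; case: h' => [[|[|[|//]]] ?] /=; rewrite ?eqxx //=;
    case: (eqVneq w b) => [wb|wb]; case: (eqVneq w d) => [wd|wd] //=; rewrite ?eqxx // => _ _ _;
    by move: hr; rewrite -wb -wd; auto.
- by case: s => [[]|[[[u1|] v1]|r1]] //; case: C.
- case: s => [[]|[[[u1|] v1]|r1]] //=; case: s' => [[]|[[[u2|] v2]|r2]] //=; try by move=> _ [].
  move=> /andP[hr c1] /andP[_ c2] _ _.
  have [e|ne] := eqVneq u1 u2; first by constructor 1; rewrite e.
  case: h c1 c2 => [[|[|[|//]]] ?] /=.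
  + by move=> /eqP e1 /eqP e2; rewrite e1 e2 eqxx in ne.
  + move=> /orP[] /eqP e1 /orP[] /eqP e2; subst; rewrite ?eqxx // in ne *.
    * constructor 2; split=> //; left; by rewrite eq_sym ne.
    * constructor 2; split=> //; right; by rewrite ne.
  + by move=> /eqP e1 /eqP e2; rewrite e1 e2 eqxx in ne.
Qed.

Lemma letter_compatible u v w : isSome v -> compatible (letter_dom u v) (letter_dom v w).
Proof. by case: v => //= z _; rewrite eqxx. Qed.

Hypothesis m1 : 0 < m.

Lemma dom_word_good x : dom_good (dom_word x).
Proof.
split; rewrite /dom_word ?eqxx // => i hi.
have -> : i.+1 == 1 = false by lia.
case: eqP => [->|ne1].
  have -> : 2 == m.+3 = false by lia.
  by rewrite /letter.
have -> : i == m.+3 = false by lia.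
case: eqP => [e|ne].
  by rewrite /letter_dom /letter; have -> : 0 < i.-1 <= m = false by lia.
apply: letter_compatible; rewrite /letter.
by have -> : 0 < i.-1 <= m by lia.
Qed.

Lemma decode_word x k : 0 < k <= m -> decode (dom_word x) k = x k.
Proof.
move=> hk; rewrite /decode /dom_word; have -> : k.+2 == 1 = false by lia.
have -> : k.+2 == m.+3 = false by lia.
by rewrite /letter /= hk.
Qed.

Lemma good_first W : dom_good W -> exists v, W 2 = inr (inl (None, v)).
Proof.
case=> h1 _ /(_ 1 isT); rewrite h1.
by case: (W 2) => [[]|[[[u|] v]|r]] // _; exists v.
Qed.

Lemma good_last W : dom_good W -> exists u, W m.+2 = inr (inl (u, None)).
Proof.
have hm : 0 < m.+2 < m.+3 by lia.
case=> _ h2 /(_ m.+2 hm); rewrite h2.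
by case: (W m.+2) => [[]|[[u [[v|v]|]]|[[[[a b] c] d] h]]] // _; exists u.
Qed.

Lemma dom_step_decode W W' : dom_step W W' -> rewrites (decode W) (decode W').
Proof.
move=> [hW hW' [i hi]].
have same : (forall j, 2 < j <= m.+3 -> W j = W' j) -> rewrites (decode W) (decode W').
  by move=> h; left=> k hk; rewrite /decode !h //; lia.
have [h3|h3] := boolP (2 < i < m.+3); last first.
  apply: same => j hj; have [ej|nj] := eqVneq j i; last by apply: hi => //; lia.
  have -> : j = m.+3 by lia.
  by case: hW hW' => _ -> _ [_ ->].
have [k ek] : exists k, i = k.+2 by exists i.-2; lia.
subst i; have hk : 0 < k <= m by lia.
have eA : W k.+1 = W' k.+1 by apply: hi; lia.
have eC : W k.+3 = W' k.+3 by apply: hi; lia.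
have [_ _ c1] := hW; have [_ _ c2] := hW'.
have a1 : compatible (W k.+1) (W k.+2) by apply: c1; lia.
have a2 : compatible (W k.+1) (W' k.+2) by rewrite eA; apply: c2; lia.
have a3 : compatible (W k.+2) (W k.+3) by apply: c1; lia.
have a4 : compatible (W' k.+2) (W k.+3) by rewrite eC; apply: c2; lia.
have other j : 0 < j <= m -> j != k -> j.+1 != k -> decode W j = decode W' j.
  by move=> hj n1 n2; rewrite /decode !hi //; lia.
have ek : decode W k = letter_of (W k.+2) (W k.+3) by [].
have ek' : decode W' k = letter_of (W' k.+2) (W k.+3) by rewrite eC.
have ep : 0 < k.-1 -> decode W k.-1 = letter_of (W k.+1) (W k.+2) by rewrite /decode => h; rewrite prednK //; lia.
have ep' : 0 < k.-1 -> decode W' k.-1 = letter_of (W k.+1) (W' k.+2).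
  by rewrite /decode eA => h; rewrite prednK //; lia.
case: (letter_of_change a1 a2 a3 a4) => [[e1 e2]|[rA hr]|[e1 [u hu hr]]].
- left=> j hj; have [ej|nj] := eqVneq j k; first by rewrite ej ek ek'.
  have [ej|nj'] := eqVneq j.+1 k; last exact: other.
  have -> : j = k.-1 by lia.
  by rewrite ep ?ep' //; lia.
- have k1 : 0 < k.-1.
    case: (ltnP 1 k) => h; first by lia.
    have [v e] := good_first hW; move: rA; have -> : k.+1 = 2 by lia.
    by rewrite e.
  have ekk : k.-1.+1 = k by lia.
  right; exists k.-1; first by lia.
  split; first by move=> j hj n1 n2; apply: other => //; lia.
  by rewrite ekk ek ek' ep ?ep'.
have km : k < m.
  rewrite ltn_neqAle andbC; case/andP: hk => _ -> /=; apply/eqP => e.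
  by move: hu; rewrite e; case: hW => _ -> _.
have hk1 : 0 < k.+1 <= m by lia.
have eu : decode W k.+1 = u by rewrite /decode; case: (W k.+3) hu => [//|[[[v|//] x]|//]] /eqP.
have eu' : decode W' k.+1 = u.
  by rewrite /decode -eC; case: (W k.+3) hu => [//|[[[v|//] x]|//]] /eqP.
right; exists k; first by lia.
split; last by rewrite eu eu' ek ek'.
move=> j hj n1 n2; have [ej|nj'] := eqVneq j.+1 k; last exact: other.
have -> : j = k.-1 by lia.
by rewrite ep ?ep' //; lia.
Qed.

Definition upd (W : nat -> domino) (i : nat) (s : domino) (j : nat) : domino :=
  if j == i then s else W j.

Lemma upd_step W i s : dom_good W -> 1 < i < m.+3 ->
  compatible (W i.-1) s -> compatible s (W i.+1) -> dom_good (upd W i s) /\ dom_step W (upd W i s).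
Proof.
move=> hW hi c1 c2; have [g1 g2 g3] := hW.
have hU : dom_good (upd W i s).
  split; rewrite /upd; try by rewrite ifN //; lia.
  move=> j hj; have [ej|nj] := eqVneq j i; first by rewrite ej ifN // gtn_eqF.
  have [ej|nj'] := eqVneq j.+1 i; last exact: g3.
  by have -> : j = i.-1 by lia.
by split=> //; split=> //; exists i => j _ nj; rewrite /upd (negbTE nj).
Qed.

Lemma compatible_fst u u' v t :
  compatible (inr (inl (u, v))) t -> compatible (inr (inl (u', v))) t.
Proof. by case: v t => [[v|v]|] [[]|[[u1 v1]|[[[[a b] c] d] h]]]. Qed.

Lemma compatible_snd u v v' s :
  compatible s (inr (inl (u, v))) -> compatible s (inr (inl (u, v'))).
Proof. by case: s => [[]|[[u1 [[v1|v1]|]]|[[[[a b] c] d] h]]]; case: u. Qed.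

Lemma dom_step_sym W W' : dom_step W W' -> dom_step W' W.
Proof. by move=> [h1 h2 [i hi]]; split=> //; exists i => j a b; rewrite hi. Qed.

(** Seven changes at the positions [k.+1], [k.+2], [k.+3]. The left neighbour replaces its right
    letter by the rule itself, which fits every phase; only then may the middle phase be entered, in
    which the right neighbour can pass from the old letter to the new one. The last phase lets both
    neighbours return to ordinary dominoes. *)
Lemma dom_rule x x' k : 0 < k < m ->
  (forall j, 0 < j <= m -> j != k -> j != k.+1 -> x j = x' j) ->
  rule (x k, x k.+1, x' k, x' k.+1) -> reach dom_step (dom_word x) (dom_word x').
Proof.
move=> hk same hr; pose r := (x k, x k.+1, x' k, x' k.+1).
have s0 := dom_word_good x; have [_ _ c0] := s0; set W0 := dom_word x in s0 c0 *.
have i1 : 1 < k.+1 < m.+3 by lia.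
have i2 : 1 < k.+2 < m.+3 by lia.
have i3 : 1 < k.+3 < m.+3 by lia.
have e12 : (k.+1 == k.+2) = false by lia.
have e13 : (k.+1 == k.+3) = false by lia.
have e23 : (k.+2 == k.+3) = false by lia.
have e21 : (k.+2 == k.+1) = false by lia.
have e31 : (k.+3 == k.+1) = false by lia.
have e32 : (k.+3 == k.+2) = false by lia.
have k1 : (k == k.+1) = false by lia.
have k2 : (k == k.+2) = false by lia.
have k3 : (k == k.+3) = false by lia.
have f1 : (k.+4 == k.+1) = false by lia.
have f2 : (k.+4 == k.+2) = false by lia.
have f3 : (k.+4 == k.+3) = false by lia.
have ne := (e12, e13, e23, e21, e31, e32, (k1, k2, k3, f1, f2, f3)).
have lk y : letter y k = Some (y k) by rewrite /letter; have -> : 0 < k <= m by lia.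
have lk1 y : letter y k.+1 = Some (y k.+1) by rewrite /letter; have -> : 0 < k.+1 <= m by lia.
have mid y j : 1 < j < m.+3 -> dom_word y j = letter_dom (letter y j.-2) (letter y j.-1).
  by move=> hj; rewrite /dom_word; do 2 (case: eqP => [?|_]; first lia).
have w1 : W0 k.+1 = inr (inl (letter x k.-1, Some (inl (x k)))) by rewrite /W0 mid //= lk.
have w2 : W0 k.+2 = inr (inl (Some (x k), Some (inl (x k.+1)))) by rewrite /W0 mid //= lk lk1.
have w3 : W0 k.+3 = inr (inl (Some (x k.+1), omap inl (letter x k.+2))) by rewrite /W0 mid //= lk1.
have before v : compatible (W0 k) (inr (inl (letter x k.-1, v))).
  by apply: (@compatible_snd _ (Some (inl (x k)))); rewrite -w1; apply: c0; lia.
have after u : compatible (inr (inl (u, omap inl (letter x k.+2)))) (W0 k.+4).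
  by apply: (@compatible_fst (Some (x k.+1))); rewrite -w3; apply: c0; lia.
pose h0 : 'I_3 := @Ordinal 3 0 isT; pose h1 : 'I_3 := @Ordinal 3 1 isT.
pose h2 : 'I_3 := @Ordinal 3 2 isT.
have [||g1 t1] := @upd_step W0 k.+2 (inr (inr (r, h0))) s0 i2.
- by rewrite /= w1 /r /= hr ?eqxx /= ?eqxx ?orbT.
- by rewrite /= w3 /r /= hr ?eqxx.
set W1 := upd _ _ _ in g1 t1.
have [||g2 t2] := @upd_step W1 k.+1 (inr (inl (letter x k.-1, Some (inr r)))) g1 i1.
- by rewrite /= /W1 /upd k2.
- by rewrite /W1 /upd /r /= ?eqxx hr ?eqxx.
set W2 := upd _ _ _ in g2 t2.
have [||g3 t3] := @upd_step W2 k.+2 (inr (inr (r, h1))) g2 i2.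
- by rewrite /W2 /W1 /upd !ne ?eqxx /r /= hr ?eqxx.
- by rewrite /W2 /W1 /upd !ne w3 /r /= hr ?eqxx.
set W3 := upd _ _ _ in g3 t3.
have [||g4 t4] := @upd_step W3 k.+3 (inr (inl (Some (x' k.+1), omap inl (letter x k.+2)))) g3 i3.
- by rewrite /W3 /W2 /W1 /upd !ne ?eqxx /r /= hr ?eqxx /= ?eqxx ?orbT.
- by rewrite /W3 /W2 /W1 /upd !ne; apply: after.
set W4 := upd _ _ _ in g4 t4.
have [||g5 t5] := @upd_step W4 k.+2 (inr (inr (r, h2))) g4 i2.
- by rewrite /W4 /W3 /W2 /W1 /upd !ne ?eqxx /r /= hr ?eqxx.
- by rewrite /W4 /W3 /W2 /W1 /upd !ne ?eqxx /r /= hr ?eqxx.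
set W5 := upd _ _ _ in g5 t5.
have [||g6 t6] := @upd_step W5 k.+1 (inr (inl (letter x k.-1, Some (inl (x' k))))) g5 i1.
- by rewrite /W5 /W4 /W3 /W2 /W1 /upd !ne.
- by rewrite /W5 /W4 /W3 /W2 /W1 /upd ?eqxx /r /= hr ?eqxx /= ?eqxx ?orbT.
set W6 := upd _ _ _ in g6 t6.
have [||g7 t7] := @upd_step W6 k.+2 (inr (inl (Some (x' k), Some (inl (x' k.+1))))) g6 i2.
- by rewrite /W6 /W5 /W4 /W3 /W2 /W1 /upd !ne ?eqxx /= ?eqxx.
- by rewrite /W6 /W5 /W4 /W3 /W2 /W1 /upd !ne ?eqxx /= ?eqxx.
set W7 := upd _ _ _ in g7 t7.
apply: ReachStep (ReachStep (ReachStep (ReachStep (ReachStep (ReachStep (ReachStep (reach1 t1)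
  t2) t3) t4) t5) t6) t7) _.
have same' j : j != k -> j != k.+1 -> letter x j = letter x' j.
  by move=> n1 n2; rewrite /letter; case: ifP => // hj; rewrite same.
split; [by []|exact: dom_word_good|exists 0 => j hj _].
rewrite /W7 /W6 /W5 /W4 /W3 /W2 /W1 /upd.
have [->|n2] := eqVneq j k.+2; first by rewrite mid //= lk lk1.
have [->|n1] := eqVneq j k.+1; first by rewrite mid //= lk same' //; lia.
have [->|n3] := eqVneq j k.+3.
  by rewrite mid //= lk1 same' //; lia.
rewrite /W0 /dom_word; case: eqP => // j1; case: eqP => // jm.
by congr letter_dom; apply: same'; lia.
Qed.

Lemma dom_rewrites x x' : rewrites x x' -> reach dom_step (dom_word x) (dom_word x').
Proof.
case=> [h|[k hk [h [hr|hr]]]]; last first.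
- by apply: reach_sym (@dom_step_sym) _; apply: dom_rule hr => // j a b c; rewrite h.
- exact: dom_rule hr.
apply: reach1; split; [exact: dom_word_good|exact: dom_word_good|exists 0 => j hj _].
rewrite /dom_word; case: eqP => // j1; case: eqP => // jm.
by congr letter_dom; rewrite /letter; case: ifP => // hj'; rewrite h.
Qed.

Definition dom_code (W : nat -> domino) (i : nat) : nat := dom_rank (W i).

Lemma dom_code_ok W : dom_good W -> word_ok #|domino| m.+3 dom_forb (dom_code W).
Proof.
by case=> _ _ h; split=> i hi; [exact: dom_rank_lt|rewrite /dom_forb !dom_rankK negbK h].
Qed.

Lemma dom_code_step W W' : dom_step W W' ->
  word_step #|domino| m.+3 dom_forb (dom_code W) (dom_code W').
Proof.
move=> [h h' [i hi]]; split; try exact: dom_code_ok.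
by exists i => j hj nj; rewrite /dom_code hi.
Qed.

Theorem domino_reach x x' :
  reach (word_step #|domino| m.+3 dom_forb) (dom_code (dom_word x)) (dom_code (dom_word x')) <->
  reach rewrites x x'.
Proof.
split; last first.
  move=> h; apply: (reach_map (f := dom_code) (fun u v s => reach1 (dom_code_step s))).
  exact: reach_map dom_rewrites h.
pose dec (w : nat -> nat) (i : nat) : domino := nth (inl false) (enum domino) (w i).
have decK W i : dec (dom_code W) i = W i by apply: dom_rankK.
move=> h; have : dom_good (dec (dom_code (dom_word x'))) /\
    reach rewrites (decode (dec (dom_code (dom_word x)))) (decode (dec (dom_code (dom_word x')))).
  have g0' : dom_good (dec (dom_code (dom_word x))).
    by have [a1 a2 a3] := dom_word_good x; split=> [||i hi]; rewrite !decK //; apply: a3.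
  elim: h => [|w w' _ [g IH] [ok1 ok2 [i hi]]]; first by split=> //; constructor.
  have [a1 a2 a3] := g; have [b1 b2] := ok2; have c0 := ok1.2.
  have comp j : 0 < j < m.+3 -> compatible (dec w' j) (dec w' j.+1).
    by move=> hj; have := b2 j hj; rewrite /dom_forb negbK.
  have keep j : 0 < j <= m.+3 -> j != i -> dec w' j = dec w j.
    by move=> h1 h2; rewrite /dec hi.
  (* The relation of neighbours alone does not prescribe the end markers, but the domino next to a
     marker tolerates nothing else in its place. *)
  have g' : dom_good (dec w').
    split=> //.
      have [e1|n1] := eqVneq 1 i; last by rewrite keep.
      have [v ev] := good_first g; have := comp 1 isT; rewrite (keep 2) ?ev //; last by rewrite -e1.
      by case: (dec w' 1) => [[]|[[u1 [[v1|v1]|]]|[[[[a b] c] d] ph]]].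
    have [e1|n1] := eqVneq m.+3 i; last by rewrite keep ?leqnn.
    have [u eu] := good_last g; have hm : 0 < m.+2 < m.+3 by lia.
    have := comp m.+2 hm; rewrite (keep m.+2) ?eu; [|lia|by rewrite -e1; lia].
    by case: (dec w' m.+3) => [[]|[[u1 [[v1|v1]|]]|[[[[a b] c] d] ph]]].
  split=> //; apply: ReachStep IH _; apply: dom_step_decode.
  by split=> //; exists i => j h1 h2; rewrite keep.
case=> _ {}h.
have e y : rewrites y (decode (dec (dom_code (dom_word y)))).
  left=> j hj; rewrite -(decode_word y hj) /decode !decK //.
apply: reach_trans (reach_trans h (reach1 (rewrites_sym (e x')))).
exact: reach1.
Qed.

End Dominoes.

(** * Turing machines as rewriting systems *)

Section Sweep.
Variable M : machine.

Definition tapes_type : finType := 'I_(ntapes M).+1.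
Notation I := tapes_type.
Definition tape_symbol : finType := symbol (extra M).
Notation S := tape_symbol.
Definition vec : finType := {ffun I -> S}.
Definition cell : finType := {ffun I -> S * S}.

(* A sweep to the right ([true]) or to the left, with the state and the scanned symbols before the
   step that is being simulated, and the symbols that are carried along; then erasing ([None]),
   accepted ([Some true]) and stuck ([Some false]). *)
Definition ctrl : finType := (bool * (state M * vec * vec) + option bool)%type.

(* [inl false] and [inl true] are the two end markers. *)
Definition sweep_letter : finType := (bool + (cell + ctrl))%type.
Notation G := sweep_letter.

Definition Cell (a : cell) : G := inr (inl a).
Definition Car (c : ctrl) : G := inr (inr c).
Definition Sweep (b : bool) (q : state M) (s c : vec) : ctrl := inl (b, (q, s, c)).

Definition component (b : bool) (x : S * S) : S := if b then x.1 else x.2.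

Definition exch_cell (f : I -> option bool) (a : cell) (c : vec) : cell :=
  [ffun i => match f i with
   | Some b => if b then (c i, (a i).2) else ((a i).1, c i) | None => a i end].

Definition exch_carry (f : I -> option bool) (a : cell) (c : vec) : vec :=
  [ffun i => if f i is Some b then component b (a i) else c i].

(* Cell [j] holds the [j]-th symbols to the left and to the right of every head, so that moving a
   head pushes a symbol on one of the lists and pops one from the other. *)
Definition pushed (q : state M) (s : vec) (i : I) : option bool :=
  match ((trans q s).2 i).2 with MoveLeft => Some false | Stay => None | MoveRight => Some true end.
Definition popped (q : state M) (s : vec) (i : I) : option bool := omap negb (pushed q s i).

(** A round trip simulates one step. On the way to the right each cell takes the carried symbol and
    hands on its own, so the list that the head leaves behind shifts away from it, with the written
    symbol in front. On the way back the opposite list shifts towards the head, and what arrives on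
    the left is scanned next. A halting state leads to erasure or to a dead end. *)
Definition launch (q : state M) (s : vec) : ctrl :=
  if halting q then (if accepting q then inr None else inr (Some false))
  else Sweep true q s [ffun i => ((trans q s).2 i).1].

Definition relaunch (q : state M) (s c : vec) : ctrl :=
  launch (trans q s).1 [ffun i => if pushed q s i is None then ((trans q s).2 i).1 else c i].

Definition blank_cell : cell := [ffun=> (None, None)].
Definition blank_vec : vec := [ffun=> None].

Definition delta (x y : G) : option (G * G) :=
  match x, y with
  | inr (inr (inl (true, (q, s, c)))), inr (inl a) =>
      Some (Cell (exch_cell (pushed q s) a c), Car (Sweep true q s (exch_carry (pushed q s) a c)))
  | inr (inr (inl (true, (q, s, c)))), inl true => Some (Car (Sweep false q s blank_vec), y)
  | inr (inl a), inr (inr (inl (false, (q, s, c)))) =>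
      Some (Car (Sweep false q s (exch_carry (popped q s) a c)), Cell (exch_cell (popped q s) a c))
  | inl false, inr (inr (inl (false, (q, s, c)))) => Some (x, Car (relaunch q s c))
  | inr (inr (inr None)), inr (inl a) => Some (Cell blank_cell, x)
  | inr (inr (inr None)), inl true => Some (Car (inr (Some true)), y)
  | _, _ => None
  end.

Definition sweep_rule (r : G * G * G * G) : bool :=
  let: (x, y, x', y') := r in delta x y == Some (x', y').

Variable N : nat.
Hypothesis N1 : 0 < N.
Notation m := N.+3.

Definition same (x x' : nat -> G) : Prop := forall j, 0 < j <= m -> x j = x' j.

Definition fstep (x x' : nat -> G) : Prop :=
  exists2 k, 0 < k < m &
    [/\ forall j, 0 < j <= m -> j != k -> j != k.+1 -> x j = x' j
      & delta (x k) (x k.+1) = Some (x' k, x' k.+1)].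

Lemma rewrites_fstep x x' : rewrites sweep_rule m x x' <-> [\/ same x x', fstep x x' | fstep x' x].
Proof.
split=> [[h|[k hk [h [/eqP r|/eqP r]]]]|[h|[k hk [h r]]|[k hk [h r]]]].
- by constructor 1.
- by constructor 2; exists k.
- by constructor 3; exists k => //; split=> // j a b c; rewrite h.
- by left.
- by right; exists k => //; split=> //; left; rewrite /sweep_rule r.
- by right; exists k => //; split; [move=> j a b c; rewrite h|right; rewrite /sweep_rule r].
Qed.

Inductive leads (t : nat -> G) (x : nat -> G) : Prop :=
| LeadsRefl : same x t -> leads t x
| LeadsStep y : fstep x y -> leads t y -> leads t x.

Lemma same_sym x y : same x y -> same y x. Proof. by move=> h j hj; rewrite h. Qed.
Lemma same_trans x y z : same x y -> same y z -> same x z.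
Proof. by move=> h h' j hj; rewrite h // h'. Qed.

Lemma fstep_same x x' y : same x x' -> fstep x y -> fstep x' y.
Proof.
move=> e [k hk [h r]]; exists k => //; split; first by move=> j a b c; rewrite -e // h.
by rewrite -!e //; lia.
Qed.

Lemma leads_same t x x' : same x x' -> leads t x -> leads t x'.
Proof.
move=> e [h|y h l]; first by constructor 1; apply: same_trans h; apply: same_sym.
exact: LeadsStep (fstep_same e h) l.
Qed.

Lemma leads_reach t x : leads t x -> reach (rewrites sweep_rule m) x t.
Proof.
elim=> {x} [x h|x y h _ IH]; first by apply: reach1; apply/rewrites_fstep; constructor 1.
by apply: reach_trans IH; apply: reach1; apply/rewrites_fstep; constructor 2.
Qed.

Definition kind (x : G) : nat :=
  match x with inl false => 0 | inl true => 1 | inr (inl _) => 2 | inr (inr _) => 3 end.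

Definition profile (p j : nat) : nat :=
  if j == 1 then 0 else if j == m then 1 else if j == p then 3 else 2.

Definition wf (x : nat -> G) : Prop :=
  exists2 p, 1 < p < m & forall j, 0 < j <= m -> kind (x j) = profile p j.

Definition rightward (x : G) : bool :=
  match x with inr (inr (inl (b, _))) => b | inr (inr (inr None)) => true | _ => false end.

Lemma delta_kind x y x' y' : delta x y = Some (x', y') ->
  kind x' = kind x /\ kind y' = kind y \/
  [\/ [/\ kind x = 3, kind y = 2, kind x' = 2 & kind y' = 3]
    | [/\ kind x = 2, kind y = 3, kind x' = 3 & kind y' = 2]].
Proof.
case: x => [[]|[a|[[[] [[q s] c]]|[[]|]]]]; case: y => [[]|[b|[[[] [[q' s'] c']]|[[]|]]]] //= [<- <-];
  (by left) || (by right; left) || (by right; right).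
Qed.

(** A carrier acts only on the neighbour in its direction of travel. As a row has a single carrier,
    at most one rule applies to it from left to right, and in only one way. *)
Lemma delta_car x y x' y' : delta x y = Some (x', y') ->
  [/\ kind x = 3, rightward x & kind y <> 3] \/ [/\ kind y = 3, ~~ rightward y & kind x <> 3].
Proof.
by case: x => [[]|[a|[[[] [[q s] c]]|[[]|]]]]; case: y => [[]|[b|[[[] [[q' s'] c']]|[[]|]]]] //= _;
  (by left) || (by right).
Qed.

Lemma wf_change x y k : 0 < k < m -> wf x ->
  (forall j, 0 < j <= m -> j != k -> j != k.+1 -> x j = y j) ->
  kind (y k) = kind (x k) /\ kind (y k.+1) = kind (x k.+1) \/
  [\/ [/\ kind (x k) = 3, kind (x k.+1) = 2, kind (y k) = 2 & kind (y k.+1) = 3]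
    | [/\ kind (x k) = 2, kind (x k.+1) = 3, kind (y k) = 3 & kind (y k.+1) = 2]] -> wf y.
Proof.
move=> hk [p hp h] sm [[e1 e2]|]; last first.
  have h1 : kind (x k) = profile p k by apply: h; lia.
  have h2 : kind (x k.+1) = profile p k.+1 by apply: h; lia.
  have p3 j : profile p j = 3 -> j = p by rewrite /profile; do 3 case: eqP => //.
  have p2 j : profile p j = 2 -> j <> 1 /\ j <> m by rewrite /profile; do 3 case: eqP => //.
  have out j r : 0 < j <= m -> j != k -> j != k.+1 -> p = k \/ p = k.+1 -> r = k \/ r = k.+1 ->
      kind (y j) = profile r j.
    move=> hj n1 n2 hkp hkr; rewrite -sm // h // /profile; do 2 case: eqP => // _.
    by do 2 case: eqP => //; lia.
  case=> -[a1 a2 b1 b2]; rewrite ?a1 ?a2 in h1 h2.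
    have ep := p3 _ (esym h1); have [n1 n2] := p2 _ (esym h2).
    exists k.+1; first by lia.
    move=> j hj; have [->|nk1] := eqVneq j k.+1.
      by rewrite b2 /profile eqxx; do 2 (case: eqP => [?|_]; first lia).
    have [->|nk] := eqVneq j k; last by apply: out => //; auto.
    by rewrite b1 /profile; do 3 (case: eqP => [?|_]; first lia).
  have ep := p3 _ (esym h2); have [n1 n2] := p2 _ (esym h1).
  exists k; first by lia.
  move=> j hj; have [->|nk1] := eqVneq j k.+1.
    by rewrite b2 /profile; do 3 (case: eqP => [?|_]; first lia).
  have [->|nk] := eqVneq j k; last by apply: out => //; auto.
  by rewrite b1 /profile eqxx; do 2 (case: eqP => [?|_]; first lia).
exists p => // j hj; have [->|nk] := eqVneq j k; first by rewrite e1 h //; lia.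
have [->|nk1] := eqVneq j k.+1; first by rewrite e2 h //; lia.
by rewrite -sm // h.
Qed.

Lemma wf_fstep x y : fstep x y -> wf x <-> wf y.
Proof.
move=> [k hk [h /delta_kind r]]; split=> w; first exact: wf_change hk w h r.
apply: (wf_change hk w); first by move=> j a b c; rewrite h.
by case: r => [[-> ->]|[[a b c d]|[a b c d]]]; [left|right; right|right; left].
Qed.

Lemma fstep_det x y z : wf x -> fstep x y -> fstep x z -> same y z.
Proof.
move=> [p hp h] [k hk [h1 r1]] [l hl [h2 r2]].
have at_p j : 0 < j <= m -> kind (x j) = 3 -> j = p.
  by move=> hj; rewrite h // /profile; do 3 (case: eqP => //).
have kl : k = l.
  have k0 : 0 < k <= m by lia.
  have k1 : 0 < k.+1 <= m by lia.
  have l0 : 0 < l <= m by lia.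
  have l1 : 0 < l.+1 <= m by lia.
  case: (delta_car r1) => -[a b _]; case: (delta_car r2) => -[c d _].
  - by rewrite (at_p _ k0 a) (at_p _ l0 c).
  - by move: b d; rewrite (at_p _ k0 a) (at_p _ l1 c) => ->.
  - by move: b d; rewrite (at_p _ k1 a) (at_p _ l0 c) => /negbTE ->.
  - by have := at_p _ k1 a; have := at_p _ l1 c; lia.
subst l; move: r2; rewrite r1 => -[e1 e2] j hj.
have [->//|nk] := eqVneq j k; have [->//|nk1] := eqVneq j k.+1.
by rewrite -h1 // h2.
Qed.

Definition terminal (x : nat -> G) : Prop := forall y, ~ fstep x y.

Lemma leads_fstep t x y : terminal t -> wf x -> fstep x y -> leads t x <-> leads t y.
Proof.
move=> tt wx xy; split=> [|l]; last exact: LeadsStep xy l.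
case=> [e|z xz l]; first by case: (tt _ (fstep_same e xy)).
exact: leads_same (fstep_det wx xz xy) l.
Qed.

(** An undirected walk may also go backward, to other predecessors. But by determinism a row leads
    to the terminal [t] if and only if its successor does, so the property is preserved along the
    walk in both directions. *)
Lemma reach_leads t x : terminal t -> wf x -> reach (rewrites sweep_rule m) x t -> leads t x.
Proof.
move=> tt wx h; have : leads t t /\ wf t.
  split; first by constructor 1.
  apply: reach_inv h wx => u v /rewrites_fstep[e|s|s].
  - by case=> p hp hk; exists p => // j hj; rewrite -e // hk.
  - by apply (wf_fstep s).
  - by apply (wf_fstep s).
(* The walk is followed backward from [t], which trivially leads to itself. *)
have {}h := reach_sym (@rewrites_sym _ sweep_rule m) h.
suff: leads t t /\ wf t -> leads t x /\ wf x by move=> h' /h' [].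
apply: (@reach_inv _ _ (fun z => leads t z /\ wf z) _ _ _ h) => u v /rewrites_fstep[e|s|s] [l w].
- split; first exact: leads_same e l.
  by case: w => p hp hk; exists p => // j hj; rewrite -e // hk.
- have w' : wf v by apply (wf_fstep s).
  by split=> //; apply (leads_fstep tt w s).
- have w' : wf v by apply (wf_fstep s).
  by split=> //; apply (leads_fstep tt w' s).
Qed.

Lemma leads_unique t t' x : terminal t -> terminal t' -> wf x -> leads t x -> leads t' x -> same t t'.
Proof.
move=> tt tt' wx l; elim: l wx => {x} [x e|x y xy _ IH] wx l'.
  case: l' => [e'|z xz _]; first exact: same_trans (same_sym e) e'.
  by case: (tt _ (fstep_same e xz)).
apply: IH; first by apply (wf_fstep xy).
by apply (leads_fstep tt' wx xy).
Qed.

(** The carrier at position [p.+2] has [p] cells on its left. Cell [j] is at position [j.+2] before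
    the carrier and [j.+3] behind it, as position 1 is the left marker and cells are numbered from
    0. *)
Definition row (c : ctrl) (p : nat) (F : nat -> cell) (j : nat) : G :=
  if j == 1 then inl false else if j == m then inl true
  else if j == p.+2 then Car c else Cell (F (if j < p.+2 then j.-2 else (j - 3))).

Lemma row_wf c p F : p <= N -> wf (row c p F).
Proof.
move=> hp; exists p.+2; first by lia.
move=> j hj; rewrite /row /profile; case: eqP => // n1; case: eqP => // nm.
by case: eqP.
Qed.

Lemma row_same c p F F' : p <= N -> (forall j, j < N -> F j = F' j) -> same (row c p F) (row c p F').
Proof.
move=> hp h j hj; rewrite /row; case: eqP => // n1; case: eqP => // nm; case: eqP => // np.
by rewrite h //; case: (ltnP j p.+2); lia.
Qed.

Lemma row_car c p F : p <= N -> row c p F p.+2 = Car c.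
Proof. by move=> hp; rewrite /row eqxx; do 2 (case: eqP => [?|_]; first lia). Qed.

Lemma row_next c p F : p < N -> row c p F p.+3 = Cell (F p).
Proof.
move=> hp; rewrite /row; do 3 (case: eqP => [?|_]; first lia).
by rewrite ltnNge leqnSn /= subSS subn2.
Qed.

Lemma row_prev c p F : p < N -> row c p.+1 F p.+2 = Cell (F p).
Proof. by move=> hp; rewrite /row leqnn; do 3 (case: eqP => [?|_]; first lia). Qed.

Lemma row_first c p F : row c p F 1 = inl false. Proof. by []. Qed.

Lemma row_last c p F : row c p F m = inl true. Proof. by rewrite /row eqxx. Qed.

Lemma row_away c c' p F a j : 0 < j -> j != p.+2 -> j != p.+3 ->
  row c p F j = row c' p.+1 (fun j => if j == p then a else F j) j.
Proof.
move=> j0 n1 n2; rewrite /row (negbTE n1) (negbTE n2); do 2 case: eqP => // ?.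
have -> : (j < p.+3) = (j < p.+2) by lia.
by case: (ltnP j p.+2) => h; case: eqP => //; lia.
Qed.

Lemma row_right c c' p F a : p < N -> delta (Car c) (Cell (F p)) = Some (Cell a, Car c') ->
  fstep (row c p F) (row c' p.+1 (fun j => if j == p then a else F j)).
Proof.
move=> hp e; exists p.+2; first by lia.
split; first by move=> j /andP[j0 _]; apply: row_away.
by rewrite row_car ?row_next ?row_prev ?row_car ?eqxx //; lia.
Qed.

Lemma row_left c c' p F a : p < N -> delta (Cell (F p)) (Car c) = Some (Car c', Cell a) ->
  fstep (row c p.+1 F) (row c' p (fun j => if j == p then a else F j)).
Proof.
move=> hp e; exists p.+2; first by lia.
split; last by rewrite row_car ?row_next ?row_prev ?row_car ?eqxx //; lia.
move=> j /andP[j0 _] n1 n2; rewrite [RHS](row_away c' c _ (F p) j0 n1 n2) /row.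
do 3 case: eqP => // _; congr Cell; by case: eqP => // ->.
Qed.

Lemma row_turn c c' F : delta (Car c) (inl true) = Some (Car c', inl true) ->
  fstep (row c N F) (row c' N F).
Proof.
move=> e; exists N.+2; first by lia.
split; last by rewrite !row_car // !row_last.
move=> j hj n1 n2; rewrite /row (negbTE n1); do 2 case: eqP => // _.
Qed.

Lemma row_start c c' F : delta (inl false) (Car c) = Some (inl false, Car c') ->
  fstep (row c 0 F) (row c' 0 F).
Proof.
move=> e; exists 1; first by lia.
split; last by rewrite !row_car // !row_first.
move=> j hj n1 n2; rewrite /row (negbTE n1) (negbTE n2); do 2 case: eqP => // _.
Qed.

Lemma leads_right t (c : nat -> ctrl) (F a : nat -> cell) :
  (forall p, p < N -> delta (Car (c p)) (Cell (F p)) = Some (Cell (a p), Car (c p.+1))) ->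
  leads t (row (c N) N a) -> leads t (row (c 0) 0 F).
Proof.
move=> h l; suff: forall d, d <= N ->
    leads t (row (c (N - d)) (N - d) (fun j => if j < N - d then a j else F j)).
  by move/(_ N (leqnn N)); rewrite subnn; apply: leads_same => j _.
elim=> [_|d IH hd].
  by rewrite subn0; apply: leads_same l; apply: row_same => // j ->.
have hp : N - d.+1 < N by lia.
have e : N - d = (N - d.+1).+1 by lia.
have hF : (if N - d.+1 < N - d.+1 then a (N - d.+1) else F (N - d.+1)) = F (N - d.+1) by rewrite ltnn.
have := h _ hp; rewrite -hF => st.
apply: (LeadsStep (row_right hp st)); rewrite -e.
apply: leads_same (IH (ltnW hd)); apply: row_same => [|j hj]; first by lia.
have [->|nj] := eqVneq j (N - d.+1); first by rewrite ifT //; lia.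
by have -> : (j < N - d) = (j < N - d.+1) by lia.
Qed.

Lemma leads_left t (c : nat -> ctrl) (F a : nat -> cell) :
  (forall p, p < N -> delta (Cell (F p)) (Car (c p.+1)) = Some (Car (c p), Cell (a p))) ->
  leads t (row (c 0) 0 a) -> leads t (row (c N) N F).
Proof.
move=> h l; suff: forall p, p <= N -> leads t (row (c p) p (fun j => if j < p then F j else a j)).
  by move/(_ N (leqnn N)); apply: leads_same; apply: row_same => // j ->.
elim=> [_|p IH hp]; first by apply: leads_same l => j _.
have hF : (if p < p.+1 then F p else a p) = F p by rewrite leqnn.
have := h _ hp; rewrite -hF => st.
apply: (LeadsStep (row_left hp st)).
apply: leads_same (IH (ltnW hp)); apply: row_same => [|j hj]; first exact: ltnW.
have [->|nj] := eqVneq j p; first by rewrite ltnn.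
by have -> : (j < p.+1) = (j < p) by lia.
Qed.

(** What the carrier holds in front of cell [j] on the way to the right: the symbol of the preceding
    cell, or the written one at the start. In [carry_left] it is the symbol of cell [j], and a blank
    beyond the last cell. *)
Definition carry_right (f : I -> option bool) (c : vec) (F : nat -> cell) (j : nat) : vec :=
  [ffun i => if f i is Some b then if j is j'.+1 then component b (F j' i) else c i else c i].

Definition carry_left (f : I -> option bool) (F : nat -> cell) (j : nat) : vec :=
  [ffun i => if f i is Some b then if j < N then component b (F j i) else None else None].

Definition after_right q s (F : nat -> cell) (j : nat) : cell :=
  exch_cell (pushed q s) (F j) (carry_right (pushed q s) [ffun i => ((trans q s).2 i).1] F j).

Definition after_round q s (F : nat -> cell) (j : nat) : cell :=
  exch_cell (popped q s) (after_right q s F j) (carry_left (popped q s) (after_right q s F) j.+1).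

Lemma leads_round t q s F : ~~ halting q ->
  leads t (row (relaunch q s (carry_left (popped q s) (after_right q s F) 0)) 0 (after_round q s F)) ->
  leads t (row (launch q s) 0 F).
Proof.
move=> hq l; rewrite /launch (negbTE hq); set w := [ffun i => _].
have ew : carry_right (pushed q s) w F 0 = w.
  by apply/ffunP => i; rewrite [LHS]ffunE; case: (pushed q s i).
rewrite -[X in row (Sweep _ _ _ X)]ew.
apply: (@leads_right t (fun p => Sweep true q s (carry_right (pushed q s) w F p)) F
  (after_right q s F)) => [p hp|].
  rewrite /=; have -> // : exch_carry (pushed q s) (F p) (carry_right (pushed q s) w F p) =
      carry_right (pushed q s) w F p.+1.
  by apply/ffunP => i; rewrite [LHS]ffunE [RHS]ffunE; case E : (pushed q s i) => //; rewrite ffunE E.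
set c := carry_right _ _ _ _; set F' := after_right q s F in l *.
apply: (LeadsStep (@row_turn (Sweep true q s c) (Sweep false q s blank_vec) F' erefl)).
have -> : blank_vec = carry_left (popped q s) F' N.
  by apply/ffunP => i; rewrite [LHS]ffunE [RHS]ffunE ltnn; case: (popped q s i).
apply: (@leads_left t (fun p => Sweep false q s (carry_left (popped q s) F' p)) F'
  (after_round q s F)) => [p hp|].
  rewrite /=; have -> // : exch_carry (popped q s) (F' p) (carry_left (popped q s) F' p.+1) =
      carry_left (popped q s) F' p.
  by apply/ffunP => i; rewrite [LHS]ffunE [RHS]ffunE hp; case E : (popped q s i) => //; rewrite ffunE E.
by apply: LeadsStep l; apply: row_start.
Qed.

Definition scanned (c : config M) : vec := [ffun i => tcur (ctapes c i)].

Definition represents (F : nat -> cell) (c : config M) : Prop :=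
  forall j, j < N -> forall i,
    F j i = (nth None (tleft (ctapes c i)) j, nth None (tright (ctapes c i)) j).

Definition fits (c : config M) : Prop :=
  forall i, size (tleft (ctapes c i)) <= N /\ size (tright (ctapes c i)) <= N.

Lemma round_step c F : represents F c -> fits c -> ~~ halted c ->
  let q := cstate c in let s := scanned c in
  relaunch q s (carry_left (popped q s) (after_right q s F) 0) =
    launch (cstate (step c)) (scanned (step c)) /\
  represents (after_round q s F) (step c).
Proof.
move=> rF fit nh q s; rewrite /step (negbTE nh).
have E : trans (cstate c) [ffun i => tcur (ctapes c i)] = trans q s by [].
rewrite E; case T : (trans q s) => [q' act] /=.
have pE i : pushed q s i = match (act i).2 with
    MoveLeft => Some false | Stay => None | MoveRight => Some true end by rewrite /pushed T.
have popE i : popped q s i = match (act i).2 with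
    MoveLeft => Some true | Stay => None | MoveRight => Some false end.
  by rewrite /popped pE; case: (act i).2.
have cL j i : carry_left (popped q s) (after_right q s F) j i = match (act i).2 with
    | MoveLeft => if j < N then (after_right q s F j i).1 else None
    | Stay => None
    | MoveRight => if j < N then (after_right q s F j i).2 else None end.
  by rewrite /carry_left ffunE popE; case: (act i).2.
have R1 j i : j < N -> after_right q s F j i = match (act i).2 with
    | Stay => F j i
    | MoveRight => (if j is j'.+1 then (F j' i).1 else (act i).1, (F j i).2)
    | MoveLeft => ((F j i).1, if j is j'.+1 then (F j' i).2 else (act i).1) end.
  move=> hj; rewrite /after_right /exch_cell ffunE pE /carry_right ffunE pE T /=.
  by case: (act i).2 => //; case: j {hj} => [|j]; rewrite ?ffunE.
split.
  rewrite /relaunch T /=; congr launch; apply/ffunP => i.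
  rewrite [LHS]ffunE [RHS]ffunE [in RHS]ffunE pE; case: (fit i) => szl szr.
  have r0 := rF 0 N1 i; have a0 := R1 0 i N1; have cl := cL 0 i.
  case dE : (act i).2 a0 cl => a0 cl /=.
  - by rewrite cl N1 a0 r0 /=; case: (ctapes c i) => -[|? l].
  - by case: (ctapes c i) => l x r.
  - by rewrite cl N1 a0 r0 /=; case: (ctapes c i) => l x [|? r].
move=> j hj i; rewrite /after_round /exch_cell ffunE popE cL (R1 _ _ hj) [in RHS]ffunE.
case: (fit i) => szl szr; have rj := rF j hj i.
have nxt : j.+1 < N -> after_right q s F j.+1 i = _ := R1 j.+1 i.
have rnxt (hj1 : j.+1 < N) := rF _ hj1 i.
have prev : 0 < j -> F j.-1 i = (nth None (tleft (ctapes c i)) j.-1, nth None (tright (ctapes c i)) j.-1).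
  by move=> j0; apply: rF; lia.
case: (ctapes c i) szl szr rj rnxt prev => l x r /= szl szr rj rnxt prev.
(* The blank that enters from the right end is the true content, since the lists have at most [N]
   entries. *)
have nl : (j.+1 < N) = false -> nth None l j.+1 = None.
  by move=> h; apply: nth_default; apply: leq_trans szl _; lia.
have nr : (j.+1 < N) = false -> nth None r j.+1 = None.
  by move=> h; apply: nth_default; apply: leq_trans szr _; lia.
case dE : (act i).2 nxt => nxt /=.
- congr pair; last by case: j hj rj prev {nxt rnxt nl nr} => //= j _ _ ->.
  rewrite nth_behead; case Ej : (j.+1 < N); last by rewrite nl.
  by rewrite nxt // rnxt.
- by rewrite rj.
- congr pair; first by case: j hj rj prev {nxt rnxt nl nr} => //= j _ _ ->.
  rewrite nth_behead; case Ej : (j.+1 < N); last by rewrite nr.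
  by rewrite nxt // rnxt.
Qed.

Definition start_row (c : config M) (F : nat -> cell) : nat -> G :=
  row (launch (cstate c) (scanned c)) 0 F.

Definition accept_row : nat -> G := row (inr (Some true)) N (fun=> blank_cell).

Lemma leads_run c F t : represents F c -> (forall t, fits (iter t (@step M) c)) ->
  exists2 F', represents F' (iter t (@step M) c) &
    forall x, leads x (start_row (iter t (@step M) c) F') -> leads x (start_row c F).
Proof.
move=> rF fit; elim: t => [|t [F' rF' IH]]; first by exists F.
have [h|h] := boolP (halted (iter t (@step M) c)).
  by exists F'; rewrite iterS /step h.
have [e r] := round_step rF' (fit t) h.
exists (after_round (cstate (iter t (@step M) c)) (scanned (iter t (@step M) c)) F') => // x l.
by apply/IH/(leads_round h); rewrite e.
Qed.

Lemma terminal_row (b : bool) p F : p <= N -> terminal (row (inr (Some b)) p F).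
Proof.
move=> hp y [k hk [_ e]].
have car j : 0 < j <= m -> kind (row (inr (Some b)) p F j) = 3 -> row (inr (Some b)) p F j = Car (inr (Some b)).
  by move=> hj; rewrite /row; do 3 case: eqP => //.
have inert j : 0 < j <= m -> kind (row (inr (Some b)) p F j) = 3 ->
    forall z, delta (row (inr (Some b)) p F j) z = None /\ delta z (row (inr (Some b)) p F j) = None.
  by move=> hj /(car _ hj) -> z; split; case: z => [[]|[a|[[[] [[q s] c]]|[[]|]]]].
have k0 : 0 < k <= m by lia.
have k1 : 0 < k.+1 <= m by lia.
case: (delta_car e) => -[a _ _].
  by have [] := inert _ k0 a (row (inr (Some b)) p F k.+1); rewrite e.
by have [_] := inert _ k1 a (row (inr (Some b)) p F k); rewrite e.
Qed.

(** Erasing the cells makes all accepting runs end in the same row. A run that does not accept ends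
    in another terminal row, with its carrier on the left, and a row leads to at most one terminal
    row. *)
Theorem sweep_reach c F t : represents F c -> (forall t, fits (iter t (@step M) c)) ->
  halted (iter t (@step M) c) ->
  reach (rewrites sweep_rule m) (start_row c F) accept_row <->
  accepting (cstate (iter t (@step M) c)).
Proof.
move=> rF fit h; have tA : terminal accept_row by apply: terminal_row.
have wS : wf (start_row c F) by apply: row_wf.
have erase F' : leads accept_row (row (inr None) 0 F').
  apply: (@leads_right _ (fun=> inr None) F' (fun=> blank_cell)) => //.
  by apply: LeadsStep (LeadsRefl _); [apply: row_turn|move=> j].
have [F' _ IH] := leads_run t rF fit.
split=> [/(reach_leads tA wS) l|a]; last first.
  apply/leads_reach/IH; rewrite /start_row /launch; move: h; rewrite /halted => ->.
  by rewrite a.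
apply: contraT => na; pose x := row (inr (Some false)) 0 F'.
have l' : leads x (start_row c F).
  apply: IH; constructor 1; rewrite /start_row /launch; move: h; rewrite /halted => ->.
  by rewrite (negbTE na).
have two : 0 < 2 <= m by [].
have := leads_unique tA (@terminal_row false 0 F' (leq0n _)) wS l l' two.
rewrite /accept_row /row /=; case: eqP => [?|_]; first by lia.
by case.
Qed.

End Sweep.

(** * Computing encodings *)

Lemma polyf_bounded X Y {EX : Enc X} {EY : Enc Y} (g : X -> nat) (F : nat -> X -> Y) y0 B :
  polyf g -> (forall k, k < B -> polyf (F k)) -> polyf (fun x => if g x < B then F (g x) x else y0).
Proof.
move=> pg; elim: B => [|B IH] pF; first by apply: (polyf_ext (f := fun=> y0)) => //; exact: polyf_const.
apply: (polyf_ext (f := fun x => if g x == B then F B x else if g x < B then F (g x) x else y0)).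
  by move=> x; case: eqP => [->|ne]; rewrite ?leqnn //; have -> : (g x < B.+1) = (g x < B) by lia.
apply: polyf_if; last by apply: IH => k hk; apply: pF; lia.
- by apply: polyf_eq => //; apply: polyf_const.
- exact: pF.
Qed.

(** Arguments below fixed bounds make [F] a finite table, so nothing has to be known about how [F]
    is computed. All data of tiles and gadgets are obtained in this way. *)
Lemma polyf_local X Y {EX : Enc X} {EY : Enc Y} (a b c d : X -> nat) (F : nat -> nat -> nat -> nat -> Y)
    y0 A B C D : polyf a -> polyf b -> polyf c -> polyf d ->
  polyf (fun x => if [&& a x < A, b x < B, c x < C & d x < D] then F (a x) (b x) (c x) (d x) else y0).
Proof.
move=> pa pb pc pd.
apply: (polyf_ext (f := fun x => if a x < A then if b x < B then if c x < C then if d x < D then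
  F (a x) (b x) (c x) (d x) else y0 else y0 else y0 else y0)).
  by move=> x; case: (a x < A); case: (b x < B); case: (c x < C).
apply: (polyf_bounded (F := fun a' x => if b x < B then if c x < C then if d x < D then
  F a' (b x) (c x) (d x) else y0 else y0 else y0)) pa _ => a' _.
apply: (polyf_bounded (F := fun b' x => if c x < C then if d x < D then
  F a' b' (c x) (d x) else y0 else y0)) pb _ => b' _.
apply: (polyf_bounded (F := fun c' x => if d x < D then F a' b' c' (d x) else y0)) pc _ => c' _.
by apply: (polyf_bounded (F := fun d' x => F a' b' c' d')) pd _ => d' _; apply: polyf_const.
Qed.

Lemma polyf_odd X {EX : Enc X} (n : X -> nat) : polyf n -> polyf (fun x => odd (n x)).
Proof.
move=> pn; apply: (polyf_ext (f := fun x => foldl (fun b _ => ~~ b) false (nseq (n x) tt))).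
  by move=> x; rewrite foldl_unary; elim: (n x) => //= k ->.
apply: (polyf_foldl_grow (f := fun _ b _ => ~~ b)) => //; first exact: polyf_unary.
- exact: polyf_const.
- by apply: polyf_negb; pproj.
by exists (fun=> 3); [auto with mp|move=> x s a; have := esize_bool (~~ s); lia].
Qed.

Definition increment (s : seq bool) : seq bool :=
  let k := index false s in nseq k false ++ true :: drop k.+1 s.

Lemma increment_positive p : increment (positive_digits p) = positive_digits (BinPosDef.Pos.succ p).
Proof.
elim: p => [p IH|p _|] //; first by rewrite /= -IH.
by rewrite /increment /= drop0.
Qed.

Lemma nat_digitsS n : nat_digits n.+1 = increment (nat_digits n).
Proof.
rewrite /nat_digits; set b := bin_of_nat n.
have -> : bin_of_nat n.+1 = BinNums.Npos (if b is BinNums.Npos p then BinPosDef.Pos.succ p else BinNums.xH).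
  rewrite -[RHS]nat_of_binK; congr bin_of_nat; have : nat_of_bin b = n by apply: bin_of_natK.
  by case: b => [<-|p] //= <-; rewrite nat_of_succ_pos.
by case: b => [|p] //; rewrite increment_positive.
Qed.

Lemma size_nat_digits n : size (nat_digits n) <= n.
Proof.
elim: n => // n IH; rewrite nat_digitsS /increment size_cat size_nseq /= size_drop.
by move: (index_size false (nat_digits n)) IH; move: (index false _) (size _) => k s hk IH; lia.
Qed.

Lemma esize_bits (s : seq bool) : esize s <= 4 * size s + 1.
Proof. by elim: s => // b s IH; rewrite esize_cons /=; have := esize_bool b; lia. Qed.

Lemma polyf_increment : polyf increment.
Proof.
have pk : polyf (fun s : seq bool => index false s) by apply: polyf_index; pproj.
apply: polyf_cat; last first.
  by apply: polyf_cons; pproj; apply: polyf_drop; pproj; apply: polyf_succ.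
apply: (polyf_ext (f := fun s : seq bool => map (fun _ : unit => false) (nseq (index false s) tt))).
  by move=> s; elim: (index _ _) => //= k ->.
by apply: (polyf_map (f := fun _ _ => false)); [pproj|apply: polyf_unary].
Qed.

Lemma polyf_nat_digits X {EX : Enc X} (n : X -> nat) : polyf n -> polyf (fun x => nat_digits (n x)).
Proof.
move=> pn; have E k : iter k increment [::] = nat_digits k by elim: k => //= k ->; rewrite nat_digitsS.
apply: (polyf_ext (f := fun x => foldl (fun s _ => increment s) [::] (nseq (n x) tt))).
  by move=> x; rewrite foldl_unary E.
apply: (polyf_foldl (f := fun _ s _ => increment s)); first exact: polyf_unary.
- exact: polyf_const.
- by apply: (polyf_comp polyf_increment); pproj.
have [q mq hq] := polyf_size pn; exists (fun k => 4 * q k + 1); first by auto 20 with mp.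
move=> x i; rewrite size_nseq => il; rewrite take_nseq // foldl_unary E.
apply: leq_trans (esize_bits _) _; have := size_nat_digits i; have := hq x; rewrite esize_nat; lia.
Qed.

Lemma polyf_encode_nat X {EX : Enc X} (n : X -> nat) : polyf n -> polyf (fun x => encode_nat (n x)).
Proof.
move=> pn; apply: polyf_cat; last exact: polyf_const.
apply: (polyf_flatmap (f := fun _ b => [:: true; b])); last exact: polyf_nat_digits.
by do 2 (apply: polyf_cons; pproj).
Qed.

(** * Computing the strip *)

Lemma polyf_half X {EX : Enc X} (n : X -> nat) : polyf n -> polyf (fun x => (n x)./2).
Proof.
move=> pn; pose g (s : nat * nat) := (s.2, s.1.+1).
apply: (polyf_ext (f := fun x => (foldl (fun s _ => g s) (0, 0) (nseq (n x) tt)).1)).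
  move=> x; rewrite foldl_unary.
  suff -> : iter (n x) g (0, 0) = ((n x)./2, uphalf (n x)) by [].
  by elim: (n x) => //= k ->.
apply: polyf_fst; apply: (polyf_foldl_grow (f := fun _ s _ => g s)).
- exact: polyf_unary.
- exact: polyf_const.
- by apply: polyf_pair; pproj; apply: polyf_succ; pproj.
by exists (fun=> 10); [auto with mp|move=> x [a b] c; rewrite /g [fst _]/= [snd _]/= !esize_pair !esize_nat; lia].
Qed.

Lemma polyf_kind X Y {EX : Enc X} {EY : Enc Y} (F : nat -> Y) (k : X -> nat) :
  polyf k -> (forall x, k x < 4) -> polyf (fun x => F (k x)).
Proof.
move=> pk hk; apply: (polyf_ext (f := fun x => if k x < 4 then F (k x) else F 0)).
  by move=> x; rewrite hk.
by apply: (polyf_bounded (F := fun k _ => F k)) => // j _; apply: polyf_const.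
Qed.

Section StripData.
Variables (q : nat) (forb : nat -> nat -> bool).
Hypothesis q2 : 1 < q.
Variables (X : Type) (EX : Enc X) (n : X -> nat).
Hypotheses (pn : polyf n) (n1 : forall x, 0 < n x).

Notation P := (nat * (nat * nat * nat))%type.
Notation T k c r := (tile_at q forb k c r).

Lemma kind_lt m i : block_kind m i < 4.
Proof. by rewrite /block_kind; case: eqP => // _; case: eqP => // _; case: odd. Qed.

Lemma polyf_block_kind : polyf (fun t : X * nat => block_kind (n t.1) t.2).
Proof.
apply: polyf_if; [by apply: polyf_eq; pproj|exact: polyf_const|apply: polyf_if].
- by apply: polyf_eq; pproj; apply: polyf_succ; apply: (polyf_comp pn); pproj.
- exact: polyf_const.
by apply: polyf_if; [apply: polyf_odd; pproj|apply: polyf_const|apply: polyf_const].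
Qed.

(** The bound on [r] exceeds the number of rows by one, so that the row [r.+1] at the upper end of a
    vertical link is always covered. *)
Definition guarded Y (y0 : Y) (F : nat -> nat -> nat -> nat -> Y) (k c r s : nat) : Y :=
  if [&& k < 4, c < q, r < (2 * q).+3 & s < 3] then F k c r s else y0.

Lemma guardedE Y (y0 : Y) F m i c r s : c < q -> r < (2 * q).+3 -> s < 3 ->
  guarded y0 F (block_kind m i) c r s = F (block_kind m i) c r s.
Proof. by move=> h1 h2 h3; rewrite /guarded kind_lt h1 h2 h3. Qed.

Lemma polyf_guarded Z Y {EZ : Enc Z} {EY : Enc Y} (y0 : Y) F (x : Z -> X) (i c r s : Z -> nat) :
  polyf x -> polyf i -> polyf c -> polyf r -> polyf s ->
  polyf (fun z => guarded y0 F (block_kind (n (x z)) (i z)) (c z) (r z) (s z)).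
Proof.
move=> px pi pc pr ps; apply: polyf_local => //.
by apply: (polyf_comp (f := fun z => (x z, i z)) polyf_block_kind); apply: polyf_pair.
Qed.

Lemma polyf_blocks (F : nat -> seq (nat * nat * nat)) :
  polyf (fun x => flatten [seq [seq (i, y) | y <- F (block_kind (n x) i)] | i <- iota 0 (n x).+2]).
Proof.
apply: (polyf_flatmap (f := fun x i => [seq (i, y) | y <- F (block_kind (n x) i)])).
  apply: (polyf_map (f := fun t y => (t.2, y))); first by apply: polyf_pair; pproj.
  by apply: polyf_kind => [|t]; [exact: polyf_block_kind|exact: kind_lt].
by apply: polyf_iota; do 2 apply: polyf_succ.
Qed.

Lemma polyf_parts : polyf (fun x => strip_parts q (n x) forb : seq P).
Proof. exact: (polyf_blocks (block_parts q forb)). Qed.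

Lemma polyf_links : polyf (fun x => strip_links q (n x) forb : seq P).
Proof. exact: (polyf_blocks (block_links q forb)). Qed.

Definition part_table (F : gadget -> nat) (k c r s : nat) : nat := F (tile_part (T k c r) s).1.

Lemma polyf_part_items (F : gadget -> nat) :
  polyf (fun x => flatten [seq [seq (p, j) | j <- iota 0 (F (strip_kind q (n x) forb p))]
                         | p <- strip_parts q (n x) forb] : seq (P * nat)).
Proof.
apply: (polyf_ext (f := fun x => flatten [seq [seq (p, j) | j <- iota 0
    (guarded 0 (part_table F) (block_kind (n x) p.1) p.2.1.1 p.2.1.2 p.2.2)]
  | p : P <- strip_parts q (n x) forb])).
  move=> x; congr flatten; apply/eq_in_map => -[i [[c r] s]].
  rewrite mem_strip_parts => /and4P[_ hc hr hs]; rewrite guardedE //; first exact: leqW.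
  exact: leq_trans hs (size_tile_parts _).
apply: (polyf_flatmap (f := fun x (p : P) => [seq (p, j) | j <- iota 0
    (guarded 0 (part_table F) (block_kind (n x) p.1) p.2.1.1 p.2.1.2 p.2.2)])); last exact: polyf_parts.
apply: (polyf_map (f := fun t j => (t.2, j))); first by apply: polyf_pair; pproj.
by apply: polyf_iota; apply: polyf_guarded; pproj.
Qed.

Definition vertex_list x : seq (P * nat) := verts (strip_parts q (n x) forb) (strip_kind q (n x) forb).
Definition inner_list x : seq (P * nat) :=
  inner_edges (strip_parts q (n x) forb) (strip_kind q (n x) forb).

Lemma polyf_vertices : polyf vertex_list.
Proof. exact: (polyf_part_items gverts). Qed.

Lemma polyf_inner : polyf inner_list.
Proof. exact: (polyf_part_items (fun K => size (gedges K))). Qed.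

Definition port_table (side : nat -> nat) (k c r d : nat) : nat * nat :=
  let: (s, j) := find_port (T k c r) (side d) in (s, nth 0 (gports (tile_part (T k c r) s).1) j).

Definition sink_side (d : nat) : nat := nth 0 [:: 0; 2; 5] d.

Definition link_src x (k : P) : P * nat :=
  let sv := guarded (0, 0) (port_table source_side) (block_kind (n x) k.1) k.2.1.1 k.2.1.2 k.2.2 in
  ((k.1, (k.2.1.1, k.2.1.2, sv.1)), sv.2).

Definition link_cell (k : P) : nat * (nat * nat) :=
  if k.2.2 == 0 then if k.2.1.1.+1 < q then (k.1, (k.2.1.1.+1, k.2.1.2)) else (k.1.+1, (0, k.2.1.2))
  else if k.2.2 == 1 then (k.1, (k.2.1.1, k.2.1.2.+1)) else (k.1, (k.2.1.1, k.2.1.2)).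

Definition link_dst x (k : P) : P * nat :=
  let icr := link_cell k in
  let sv := guarded (0, 0) (port_table sink_side) (block_kind (n x) icr.1) icr.2.1 icr.2.2 k.2.2 in
  ((icr.1, (icr.2.1, icr.2.2, sv.1)), sv.2).

Lemma link_srcE x k : k \in strip_links q (n x) forb ->
  port_vert (strip_kind q (n x) forb) (strip_src q (n x) forb k) = link_src x k.
Proof.
case: k => i [[c r] d]; rewrite mem_strip_links => /and5P[hi hc hr hd h].
by rewrite /link_src guardedE ?(leqW hr) //= /port_table /port_at.
Qed.

Lemma link_dstE x k : k \in strip_links q (n x) forb ->
  port_vert (strip_kind q (n x) forb) (strip_dst q (n x) forb k) = link_dst x k.
Proof.
case: k => i [[c r] d]; rewrite mem_strip_links => /and5P[hi hc hr hd h].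
have pE i' c' r' e s : c' < q -> r' < (2 * q).+3 -> sink_side e = s -> e < 3 ->
    port_vert (strip_kind q (n x) forb) (port_at q (n x) forb i' c' r' s) =
    let sv := guarded (0, 0) (port_table sink_side) (block_kind (n x) i') c' r' e in
    ((i', (c', r', sv.1)), sv.2).
  move=> h1 h2 h3 h4; rewrite guardedE // /port_table /port_at h3; by case: (find_port _ _).
rewrite /link_dst /link_cell; case: d hd {h} => [|[|[|//]]] hd /=.
- by rewrite /next_col; case: ifP => hq /=; apply: pE => //; lia.
- by apply: pE.
- by apply: pE => //; lia.
Qed.

Lemma polyf_link_src : polyf (fun t : X * P => link_src t.1 t.2).
Proof.
have pg : polyf (fun t : X * P => guarded (0, 0) (port_table source_side)
    (block_kind (n t.1) t.2.1) t.2.2.1.1 t.2.2.1.2 t.2.2.2) by apply: polyf_guarded; pproj.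
apply: polyf_pair; last by apply: polyf_snd.
apply: polyf_pair; first by pproj.
by apply: polyf_pair; [apply: polyf_pair; pproj|apply: polyf_fst].
Qed.

Lemma polyf_link_cell : polyf link_cell.
Proof.
apply: polyf_if; first by apply: polyf_eq; pproj.
  apply: polyf_if; first by apply: polyf_leq; pproj; do 2 apply: polyf_succ; pproj.
    apply: polyf_pair; pproj; apply: polyf_pair; pproj; apply: polyf_succ; pproj.
  by apply: polyf_pair; [apply: polyf_succ; pproj|apply: polyf_pair; pproj].
apply: polyf_if; first by apply: polyf_eq; pproj.
  by apply: polyf_pair; pproj; apply: polyf_pair; pproj; apply: polyf_succ; pproj.
by apply: polyf_pair; pproj; apply: polyf_pair; pproj.
Qed.

Lemma polyf_link_dst : polyf (fun t : X * P => link_dst t.1 t.2).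
Proof.
have pc : polyf (fun t : X * P => link_cell t.2) by apply: (polyf_comp polyf_link_cell); pproj.
have pg : polyf (fun t : X * P => guarded (0, 0) (port_table sink_side)
    (block_kind (n t.1) (link_cell t.2).1) (link_cell t.2).2.1 (link_cell t.2).2.2 t.2.2.2).
  by apply: polyf_guarded; pproj.
apply: polyf_pair; last by apply: polyf_snd.
apply: polyf_pair; first by pproj.
apply: polyf_pair; last by apply: polyf_fst.
by apply: polyf_pair; pproj.
Qed.

Definition link_pos (z : nat * (nat * nat) * nat) : P * bool := link_of q z.1.1 z.1.2.1 z.1.2.2 z.2.

Lemma polyf_link_pos : polyf link_pos.
Proof.
have at_d (d : nat) (F : nat * (nat * nat) * nat -> P * bool) : polyf F -> forall G, polyf G ->
    polyf (fun z => if z.2 == d then F z else G z).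
  by move=> pF G pG; apply: polyf_if => //; apply: polyf_eq; pproj.
apply: (polyf_ext (f := fun z : nat * (nat * nat) * nat =>
  if z.2 == 0 then (if z.1.2.1 is c.+1 then (z.1.1, (c, z.1.2.2, 0)) else (z.1.1.-1, (q.-1, z.1.2.2, 0)), true)
  else if z.2 == 1 then ((z.1.1, (z.1.2.1, z.1.2.2, 0)), false)
  else if z.2 == 2 then ((z.1.1, (z.1.2.1, z.1.2.2.-1, 1)), true)
  else if z.2 == 3 then ((z.1.1, (z.1.2.1, z.1.2.2, 1)), false)
  else if z.2 == 4 then ((z.1.1, (z.1.2.1, z.1.2.2, 2)), false)
  else ((z.1.1, (z.1.2.1, z.1.2.2, 2)), true))).
  by case=> [[i [c r]] d]; rewrite /link_pos /=; case: d => [|[|[|[|[|d]]]]] //; case: c.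
have tri (a b c : nat * (nat * nat) * nat -> nat) (d : nat) (e : bool) : polyf a -> polyf b -> polyf c ->
    polyf (fun z => ((a z, (b z, c z, d)), e)).
  move=> pa pb pc; apply: polyf_pair; pproj; apply: polyf_pair => //.
  by apply: polyf_pair; pproj; apply: polyf_pair.
apply: (at_d).
  apply: polyf_pair; pproj.
  apply: (polyf_nat_case (h := fun z : nat * (nat * nat) * nat => z.1.2.1)
    (g0 := fun z : nat * (nat * nat) * nat => (z.1.1.-1, (q.-1, z.1.2.2, 0)))
    (g1 := fun t : nat * (nat * nat) * nat * nat => (t.1.1.1, (t.2, t.1.1.2.2, 0)))); pproj.
  - by apply: polyf_pair; [apply: polyf_pred; pproj|apply: polyf_pair; pproj; apply: polyf_pair; pproj].
  - by apply: polyf_pair; pproj; apply: polyf_pair; pproj; apply: polyf_pair; pproj.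
apply: (at_d); first by apply: (tri); pproj.
apply: (at_d); first by apply: (tri); pproj; apply: polyf_pred; pproj.
by apply: (at_d); first (by apply: (tri); pproj); apply: (at_d); apply: (tri); pproj.
Qed.

Variables (u : X -> nat -> nat).
Hypothesis pu : polyf (fun t : X * nat => u t.1 t.2).

Definition wire (x : X) : P -> bool := wiring (symbols (u x)) (symbols (u x)) (symbols (u x)).

Lemma polyf_wire : polyf (fun t : X * P => wire t.1 t.2).
Proof.
have pui Z (EZ : Enc Z) (x : Z -> X) (i : Z -> nat) : polyf x -> polyf i -> polyf (fun z => u (x z) (i z)).
  by move=> px pi; apply: (polyf_comp (f := fun z => (x z, i z)) pu); apply: polyf_pair.
apply: (polyf_ext (f := fun t : X * P =>
  if t.2.2.2 == 0 then if t.2.2.1.2 == 0 then u t.1 t.2.1 <= t.2.2.1.1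
    else if t.2.1 == 0 then true
    else if odd t.2.2.1.2.-1 == odd t.2.1 then (t.2.1 == 1) || ~~ (u t.1 t.2.1.-1 == t.2.2.1.2.-1./2)
    else (t.2.2.1.2.-1./2 <= t.2.2.1.1) && ~~ (u t.1 t.2.1 == t.2.2.1.2.-1./2)
  else if t.2.2.2 == 1 then ~~ (u t.1 t.2.1 == t.2.2.1.1) else t.2.2.1.2 == 0)).
  case=> x [i [[c r] d]]; rewrite /wire /wiring /=; case: d => [|[|d]] //=; last by case: ifP.
  case: ifP => // _; rewrite -[RHS]/(has (symbols (u x) i) (iota 0 c.+1)); apply/idP/hasP => [h|[c']].
    by exists (u x i); rewrite ?mem_iota /symbols //= add0n ltnS.
  by rewrite mem_iota add0n ltnS /symbols /= => h /eqP ->.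
have eq0 Z (EZ : Enc Z) (a b : Z -> nat) : polyf a -> polyf b -> polyf (fun z => a z == b z).
  exact: polyf_eq.
have ph : polyf (fun t : X * P => t.2.2.1.2.-1./2) by apply: polyf_half; apply: polyf_pred; pproj.
apply: polyf_if; first by apply: (eq0); pproj.
  apply: polyf_if; first by apply: (eq0); pproj.
    by apply: polyf_leq; pproj; apply: (pui); pproj.
  apply: polyf_if; first by apply: (eq0); pproj.
    exact: polyf_const.
  apply: polyf_if.
  - by apply: polyf_eq; apply: polyf_odd; pproj; apply: polyf_pred; pproj.
  - apply: polyf_orb; first by apply: (eq0); pproj.
    by apply: polyf_negb; apply: (eq0) => //; apply: (pui); pproj; apply: polyf_pred; pproj.
  - apply: polyf_andb; first by apply: polyf_leq; pproj.
    by apply: polyf_negb; apply: (eq0) => //; apply: (pui); pproj.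
apply: polyf_if; first by apply: (eq0); pproj.
  by apply: polyf_negb; apply: (eq0); pproj; apply: (pui); pproj.
by apply: (eq0); pproj.
Qed.

Definition side_table (k c r s : nat) : seq nat := (tile_part (T k c r) s).2.
Definition key_table (k c r s : nat) : seq (seq bool) :=
  bitseqs (size (gports (tile_part (T k c r) s).1)).
(** The canonical inner orientation of a gadget is tabulated for all port assignments; computing it
    for a given part is a lookup by the index of the assignment in [key_table]. *)
Definition fill_table (k c r s : nat) : seq (seq bool) :=
  [seq head [::] (glegals (tile_part (T k c r) s).1 b) | b <- key_table k c r s].

Definition part_bits (x : X) (p : P) : seq bool :=
  [seq wire x (link_pos ((p.1, p.2.1), d)).1 == (link_pos ((p.1, p.2.1), d)).2
  | d <- guarded [::] side_table (block_kind (n x) p.1) p.2.1.1 p.2.1.2 p.2.2].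

Definition part_fill (x : X) (p : P) : seq bool :=
  nth [::] (guarded [::] fill_table (block_kind (n x) p.1) p.2.1.1 p.2.1.2 p.2.2)
    (index (part_bits x p) (guarded [::] key_table (block_kind (n x) p.1) p.2.1.1 p.2.1.2 p.2.2)).

Lemma part_fillE x p : p \in strip_parts q (n x) forb ->
  part_fill x p = head [::] (glegals (strip_kind q (n x) forb p)
    (port_bits (strip_kind q (n x) forb) (strip_att q (n x) forb) (wire x) p)).
Proof.
case: p => i [[c r] s] hp; rewrite port_bits_sides //.
move: hp; rewrite mem_strip_parts => /and4P[hi hc hr hs].
have [_ sz] := tile_part_checks hs.
have hs3 : s < 3 by apply: leq_trans hs (size_tile_parts _).
rewrite /part_fill /part_bits !guardedE ?(leqW hr) //= /fill_table /side_table /link_pos /=.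
set b : seq bool := map _ (tile_part _ s).2; have hb : b \in key_table (block_kind (n x) i) c r s.
  by rewrite /key_table mem_bitseqs size_map sz.
by rewrite (nth_map b) ?index_mem // nth_index.
Qed.

Lemma polyf_part_fill : polyf (fun t : X * P => part_fill t.1 t.2).
Proof.
have pg Y (EY : Enc Y) (y0 : Y) F : polyf (fun t : X * P => guarded y0 F
    (block_kind (n t.1) t.2.1) t.2.2.1.1 t.2.2.1.2 t.2.2.2) by apply: polyf_guarded; pproj.
apply: polyf_nth; first exact: pg.
apply: polyf_index; last exact: pg.
apply: (polyf_map (f := fun (t : X * P) (d : nat) =>
  wire t.1 (link_pos ((t.2.1, t.2.2.1), d)).1 == (link_pos ((t.2.1, t.2.2.1), d)).2)); last exact: pg.
have pl : polyf (fun t : X * P * nat => link_pos ((t.1.2.1, t.1.2.2.1), t.2)).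
  apply: (polyf_comp (f := fun t : X * P * nat => ((t.1.2.1, t.1.2.2.1), t.2)) polyf_link_pos).
  by apply: polyf_pair; pproj; apply: polyf_pair; pproj.
apply: polyf_eq; last by apply: polyf_snd.
apply: (polyf_comp (f := fun t : X * P * nat => (t.1.1, (link_pos ((t.1.2.1, t.1.2.2.1), t.2)).1)) polyf_wire).
by apply: polyf_pair; pproj.
Qed.

End StripData.

Section StripCode.
Variables (q : nat) (forb : nat -> nat -> bool).
Hypothesis q2 : 1 < q.
Variables (X : Type) (EX : Enc X) (n : X -> nat) (u u' : X -> nat -> nat).
Hypotheses (pn : polyf n).
Hypotheses (pu : polyf (fun t : X * nat => u t.1 t.2)) (pu' : polyf (fun t : X * nat => u' t.1 t.2)).

Notation P := (nat * (nat * nat * nat))%type.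
Notation VL := (vertex_list q forb n).

Definition bit (b : bool) : nat := b.

Definition link_data (x : X) (k : P) : seq nat :=
  [:: index (link_src q forb n x k) (VL x); index (link_dst q forb n x k) (VL x); 2;
      bit (wire u x k); bit (wire u' x k)].

Definition edge_table (k c r s : nat) : seq (nat * nat * nat) :=
  gedges (tile_part (tile_at q forb k c r) s).1.

Definition inner_data (x : X) (y : P * nat) : seq nat :=
  let p := y.1 in
  let g := nth (0, 0, 0) (guarded q [::] edge_table (block_kind (n x) p.1) p.2.1.1 p.2.1.2 p.2.2) y.2 in
  [:: index (p, g.1.1) (VL x); index (p, g.1.2) (VL x); g.2;
      bit (nth false (part_fill q forb n u x p) y.2); bit (nth false (part_fill q forb n u' x p) y.2)].

Definition strip_data (x : X) : seq nat :=
  size (VL x) :: (size (strip_links q (n x) forb) + size (inner_list q forb n x)) ::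
  nseq (size (VL x)) 2 ++
  flatten [seq link_data x k | k <- strip_links q (n x) forb] ++
  flatten [seq inner_data x y | y <- inner_list q forb n x].

Lemma strip_dataE x : strip_data x =
  key_data (verts (strip_parts q (n x) forb) (strip_kind q (n x) forb))
    (edges (strip_parts q (n x) forb) (strip_links q (n x) forb) (strip_kind q (n x) forb))
    (esrc (strip_kind q (n x) forb) (strip_src q (n x) forb))
    (edst (strip_kind q (n x) forb) (strip_dst q (n x) forb))
    (@eweight _ part (strip_kind q (n x) forb))
    (word_config q (n x) forb (u x)) (word_config q (n x) forb (u' x)).
Proof.
have E : size (edges (strip_parts q (n x) forb) (strip_links q (n x) forb) (strip_kind q (n x) forb)) =
    size (strip_links q (n x) forb) + size (inner_list q forb n x).
  by rewrite /edges size_cat !size_map.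
rewrite /strip_data /key_data E; congr (_ :: _ :: (_ ++ _)).
rewrite /edges [in RHS]map_cat [in RHS]flatten_cat -[map _ (map inl _)]map_comp -[map _ (map inr _)]map_comp.
apply: (congr2 cat); apply: (congr1 flatten).
  apply/eq_in_map => k hk; rewrite /link_data /= link_srcE // link_dstE //.
apply/eq_in_map => -[p e]; rewrite mem_inner => /andP[hp he].
rewrite /inner_data /= /word_config /canonical /assemble !part_fillE //.
move: hp he; case: p => i [[c r] s]; rewrite mem_strip_parts => /and4P[hi hc hr hs] he.
by rewrite guardedE ?(leqW hr) // (leq_trans hs (size_tile_parts _)).
Qed.

Lemma polyf_bit Z {EZ : Enc Z} (b : Z -> bool) : polyf b -> polyf (fun z => bit (b z)).
Proof.
move=> pb; apply: (polyf_ext (f := fun z => if b z then 1 else 0)); first by move=> z; case: (b z).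
by apply: polyf_if => //; apply: polyf_const.
Qed.

Lemma polyf_strip_code : polyf (fun x => flatten [seq encode_nat z | z <- strip_data x]).
Proof.
apply: (polyf_flatmap (f := fun _ z => encode_nat z)); first by apply: polyf_encode_nat; pproj.
have pV : polyf (fun x : X => VL x) by apply: polyf_vertices.
have pV1 Z (EZ : Enc Z) : polyf (fun t : X * Z => VL t.1) by apply: (polyf_comp pV); pproj.
have pL : polyf (fun x => strip_links q (n x) forb : seq P) by apply: polyf_links.
have pI : polyf (fun x => inner_list q forb n x) by apply: polyf_inner.
apply: polyf_cons; first exact: polyf_size_seq.
apply: polyf_cons; first by apply: polyf_addn; apply: polyf_size_seq.
apply: polyf_cat.
  apply: (polyf_ext (f := fun x => [seq 2 | _ <- nseq (size (VL x)) tt])).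
    by move=> x; elim: (size _) => //= k ->.
  apply: (polyf_map (f := fun _ _ => 2)); first exact: polyf_const.
  by apply: polyf_unary; apply: polyf_size_seq.
apply: polyf_cat.
  apply: (polyf_flatmap (f := link_data)) => //.
  apply: polyf_cons; first by apply: polyf_index => //; apply: polyf_link_src.
  apply: polyf_cons; first by apply: polyf_index => //; apply: polyf_link_dst.
  apply: polyf_cons; first exact: polyf_const.
  apply: polyf_cons; first by apply: polyf_bit; apply: polyf_wire.
  apply: polyf_cons; first by apply: polyf_bit; apply: polyf_wire.
  exact: polyf_const.
apply: (polyf_flatmap (f := inner_data)) => //.
have pg : polyf (fun t : X * (P * nat) => nth (0, 0, 0) (guarded q [::] edge_table
    (block_kind (n t.1) t.2.1.1) t.2.1.2.1.1 t.2.1.2.1.2 t.2.1.2.2) t.2.2).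
  by apply: polyf_nth; pproj; apply: polyf_guarded => //; pproj.
have pf v : polyf (fun t : X * nat => v t.1 t.2) ->
    polyf (fun t : X * (P * nat) => bit (nth false (part_fill q forb n v t.1 t.2.1) t.2.2)).
  move=> pv; apply: polyf_bit; apply: polyf_nth; pproj.
  apply: (polyf_comp (f := fun t : X * (P * nat) => (t.1, t.2.1)) (g := fun t : X * P => part_fill q forb n v t.1 t.2)).
    exact: polyf_part_fill.
  by apply: polyf_pair; pproj.
apply: polyf_cons.
  by apply: polyf_index => //; apply: polyf_pair; pproj.
apply: polyf_cons.
  by apply: polyf_index => //; apply: polyf_pair; pproj.
apply: polyf_cons; first by apply: polyf_snd.
apply: polyf_cons; first exact: pf.
by apply: polyf_cons; [exact: pf|exact: polyf_const].
Qed.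

End StripCode.

(** * Decoding instances *)

Definition digits_value (s : seq bool) : nat := foldr (fun (b : bool) v => b + v.*2) 0 s.

Lemma increment_value s : digits_value (increment s) = (digits_value s).+1.
Proof.
elim: s => [|[] s IH] //; last by rewrite /increment /= drop0.
rewrite -[increment _]/(false :: increment s) /= IH; lia.
Qed.

Lemma nat_digitsK n : digits_value (nat_digits n) = n.
Proof. by elim: n => // n IH; rewrite nat_digitsS increment_value IH. Qed.

(** The leading digit comes last and must be 1; the default admits the empty numeral of 0. Without
    this test a padded word could pass for the code of an instance. *)
Definition canonical_digits (s : seq bool) : bool := last true s.

Lemma nat_digits_canonical n : canonical_digits (nat_digits n).
Proof.
elim: n => // n IH; rewrite nat_digitsS /increment /canonical_digits last_cat /=.
move: IH; rewrite /canonical_digits; elim: (nat_digits n) => // -[] s IHs; rewrite /= ?drop0 //.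
by case: s IHs => //= b s IHs h; apply: IHs.
Qed.

Lemma digits_valueK s : canonical_digits s -> nat_digits (digits_value s) = s.
Proof.
have i0 t : increment (false :: t) = true :: t by rewrite /increment /= drop0.
have i1 t : increment (true :: t) = false :: increment t by [].
have dbl n : 0 < n -> nat_digits n.*2 = false :: nat_digits n.
  elim: n => // -[_ _|n IH _] //; rewrite doubleS 2!nat_digitsS IH //.
  by rewrite i0 i1 -nat_digitsS.
have dbl1 n : nat_digits n.*2.+1 = true :: nat_digits n.
  by case: n => // n; rewrite nat_digitsS dbl // i0.
elim: s => // b s IH; case: b; rewrite /canonical_digits /=.
  by move=> h; rewrite add1n dbl1 IH.
case: s IH => // c s IH h; rewrite add0n dbl ?IH //.
have := IH h; case: (digits_value _) => // e; have : size (nat_digits 0) = size (c :: s) by rewrite e.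
Qed.

(** An automaton for the self-delimiting code: [pending] records that a digit was announced, [cur]
    holds the digits of the current number and [done] the finished numbers, both reversed. *)
Definition parse_step (st : bool * (seq bool * seq (seq bool))) (b : bool) :=
  let: (pending, (cur, done)) := st in
  if pending then (false, (b :: cur, done)) else if b then (true, (cur, done))
  else (false, ([::], rev cur :: done)).

Definition parse_state (w : seq bool) := foldl parse_step (false, ([::], [::])) w.

Definition parsed (w : seq bool) : bool :=
  let: (pending, (cur, done)) := parse_state w in
  [&& ~~ pending, nilp cur & all canonical_digits done].

Definition parse (w : seq bool) : seq (seq bool) := rev (parse_state w).2.2.

Definition encode_digits (s : seq bool) : seq bool := flatten [seq [:: true; b] | b <- s] ++ [:: false].

Lemma parse_digits cur s done :
  foldl parse_step (false, (cur, done)) (encode_digits s) = (false, ([::], (rev cur ++ s) :: done)).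
Proof.
elim: s cur => [|b s IH] cur; first by rewrite /= cats0.
by rewrite /encode_digits /= IH rev_cons cat_rcons.
Qed.

Lemma parse_encode l : parse_state (flatten [seq encode_nat n | n <- l]) =
  (false, ([::], rev (map nat_digits l))).
Proof.
rewrite /parse_state; suff H : forall D, foldl parse_step (false, ([::], D)) (flatten [seq encode_nat n | n <- l]) =
    (false, ([::], rev (map nat_digits l) ++ D)) by rewrite H cats0.
elim: l => // n l IH D.
by rewrite /= foldl_cat -[encode_nat n]/(encode_digits (nat_digits n)) parse_digits IH rev_cons cat_rcons.
Qed.

Lemma parsed_encode l : parsed (flatten [seq encode_nat n | n <- l]).
Proof.
rewrite /parsed parse_encode /= all_rev; apply/allP => s /mapP[n _ ->]; exact: nat_digits_canonical.
Qed.

Lemma parse_encodeK l : map digits_value (parse (flatten [seq encode_nat n | n <- l])) = l.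
Proof.
by rewrite /parse parse_encode /= revK -map_comp -[RHS]map_id; apply: eq_map => n; apply: nat_digitsK.
Qed.

Lemma parsedK w : parsed w -> flatten [seq encode_nat n | n <- map digits_value (parse w)] = w.
Proof.
suff H : forall w, let: (p, (cur, D)) := parse_state w in
    w = flatten [seq encode_digits s | s <- rev D] ++ flatten [seq [:: true; b] | b <- rev cur] ++ nseq p true.
  rewrite /parsed /parse; move: (H w); case: (parse_state w) => p [cur D] /= ->.
  case/and3P => /negbTE -> /nilP -> hD; rewrite cats0 -map_comp; congr flatten.
  apply/eq_in_map => s hs; rewrite /= -[in RHS](digits_valueK (s := s)) //.
  by apply: (allP hD); rewrite -mem_rev.
move=> {}w; elim/last_ind: w => [|w b IH] //; rewrite /parse_state foldl_rcons -/(parse_state w).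
case: (parse_state w) IH => [[] [cur D]] IH; rewrite IH /=.
  by rewrite cats0 rev_cons map_rcons flatten_rcons -cats1 -!catA.
case: b; first by rewrite -cats1 -!catA.
by rewrite rev_cons map_rcons flatten_rcons /encode_digits -cats1 -!catA /= ?cats0.
Qed.

Lemma encode_data I I' : encode I = encode I' -> instance_data I = instance_data I'.
Proof. by move=> e; rewrite -(parse_encodeK (instance_data I)) -/(encode I) e parse_encodeK. Qed.

Lemma flatten_blocks (T : eqType) (A : Type) k (f g : A -> seq T) s :
  (forall a, size (f a) = k) -> (forall a, size (g a) = k) ->
  flatten (map f s) = flatten (map g s) -> map f s = map g s.
Proof.
move=> hf hg; elim: s => //= a s IH /eqP; rewrite eqseq_cat ?hf ?hg // => /andP[/eqP -> /eqP h].
by rewrite IH.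
Qed.

(** Instances with the same code have the same data and differ at most in their proofs, on which
    reconfiguration does not depend. *)
Lemma encode_reconfigurable I I' : encode I = encode I' ->
  reconfigurable (source I) (target I) -> reconfigurable (source I') (target I').
Proof.
move/encode_data; rewrite /instance_data /edge_data.
case: I I' => [[nv ne ends wt mi lt inj w0] s t ls lt'] [[nv' ne' ends' wt' mi' lt'' inj' w0'] s' t' ls' lt3] /=.
case=> env ene; subst nv' ne' => h.
have [h1 h2] : [seq mi v | v <- enum 'I_nv] = [seq mi' v | v <- enum 'I_nv] /\
   flatten [seq [:: nat_of_ord (ends e).1; nat_of_ord (ends e).2; wt e; nat_of_bool (s e); nat_of_bool (t e)] | e <- enum 'I_ne] =
   flatten [seq [:: nat_of_ord (ends' e).1; nat_of_ord (ends' e).2; wt' e; nat_of_bool (s' e); nat_of_bool (t' e)] | e <- enum 'I_ne].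
  by move/eqP: h; rewrite eqseq_cat ?size_map // => /andP[/eqP ? /eqP ?].
have emi : mi = mi'.
  by apply/ffunP => v; move/eq_in_map: h1; apply; rewrite mem_enum.
have {}h2 e : [:: nat_of_ord (ends e).1; nat_of_ord (ends e).2; wt e; nat_of_bool (s e); nat_of_bool (t e)] =
    [:: nat_of_ord (ends' e).1; nat_of_ord (ends' e).2; wt' e; nat_of_bool (s' e); nat_of_bool (t' e)].
  have h3 := flatten_blocks (k := 5) _ _ h2.
  by move: (h3 (fun=> erefl) (fun=> erefl)) => /eq_in_map; apply; rewrite mem_enum.
have bi (b b' : bool) : nat_of_bool b = b' -> b = b' by case: b; case: b'.
have ee : ends = ends'.
  by apply/ffunP => e; case: (h2 e) => /val_inj e1 /val_inj e2 _ _ _; rewrite [LHS]surjective_pairing e1 e2 -surjective_pairing.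
have ew : wt = wt' by apply/ffunP => e; case: (h2 e).
have es : s = s' by apply/ffunP => e; case: (h2 e) => _ _ _ /bi.
have et : t = t' by apply/ffunP => e; case: (h2 e) => _ _ _ _ /bi.
by subst.
Qed.

(** * Savitch's search *)

Lemma digits_value_lt s : digits_value s < 2 ^ size s.
Proof. by elim: s => // b s IH; rewrite /= expnS; case: b; lia. Qed.

Lemma digits_value_inj s t : size s = size t -> digits_value s = digits_value t -> s = t.
Proof.
elim: s t => [|b s IH] [|c t] //= [sz] e.
have eb : b = c by move: e; case: b; case: c => //; lia.
by rewrite eb (IH t) //; move: e; rewrite eb; lia.
Qed.

Lemma size_increment s : false \in s -> size (increment s) = size s.
Proof.
rewrite -index_mem /increment size_cat size_nseq /= size_drop.
by move: (index _ _) (size s) => i z; lia.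
Qed.

Lemma digits_value_max s t : false \notin s -> size s = size t -> digits_value s <= digits_value t -> s = t.
Proof.
move=> hs sz h; apply: digits_value_inj => //; apply/eqP; rewrite eqn_leq h /=.
have -> : digits_value s = (2 ^ size s).-1.
  elim: s hs {sz h} => // -[] s IH; rewrite inE //= => /IH ->; rewrite expnS.
  have : 0 < 2 ^ size s by rewrite expn_gt0.
  by move: (2 ^ size s) => z; lia.
by rewrite sz; have := digits_value_lt t; lia.
Qed.

Section Savitch.
Variables (X : Type) (EX : Enc X) (width : X -> nat) (base : X -> seq bool -> seq bool -> bool).

Notation B := (seq bool).
(** The ends [u] and [v] of the path sought, the current midpoint [w], the depth [k] of the calls
    for the halves, and whether the second half is being searched. *)
Definition frame := ((B * (B * B)) * (nat * bool))%type.
Definition search := (X * ((bool * bool) * ((B * (B * nat)) * seq frame)))%type.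

Definition Call (x : X) (u v : B) (k : nat) (stk : seq frame) : search :=
  (x, ((false, false), ((u, (v, k)), stk))).
Definition Return (x : X) (b : bool) (stk : seq frame) : search :=
  (x, ((true, b), (([::], ([::], 0)), stk))).
Definition Frame (u v w : B) (k : nat) (half : bool) : frame := ((u, (v, w)), (k, half)).

(** Midpoints run through all bit words in numerical order, starting with zeros and ending with the
    word that has no [false]. The recursion is unfolded into an explicit stack because programs only
    have loops. *)
Definition search_step (s : search) : search :=
  let x := s.1 in let u := s.2.2.1.1 in let v := s.2.2.1.2.1 in
  if s.2.1.1 then
    if s.2.2.2 is f :: stk then
      let w := f.1.2.2 in
      if s.2.1.2 then
        if f.2.2 then Return x true stk
        else Call x w f.1.2.1 f.2.1 (Frame f.1.1 f.1.2.1 w f.2.1 true :: stk)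
      else if false \in w then
        Call x f.1.1 (increment w) f.2.1 (Frame f.1.1 f.1.2.1 (increment w) f.2.1 false :: stk)
      else Return x false stk
    else s
  else if s.2.2.1.2.2 is k.+1 then
    let w := nseq (width x) false in Call x u w k (Frame u v w k false :: s.2.2.2)
  else Return x (base x u v) s.2.2.2.

Definition searching (s : search) : bool := ~~ (s.2.1.1 && nilp s.2.2.2).

Fixpoint reaches_in (x : X) (k : nat) (u v : B) : Prop :=
  if k is j.+1 then exists w, [/\ size w = width x, reaches_in x j u w & reaches_in x j w v]
  else base x u v.

Definition frames_ok (x : X) (D : nat) (stk : seq frame) : bool :=
  all (fun f : frame => [&& size f.1.1 <= width x, size f.1.2.1 <= width x,
                             size f.1.2.2 <= width x & f.2.1 <= D]) stk.

Lemma frames_cons x D u v w k h stk : size u = width x -> size v = width x -> size w = width x ->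
  k <= D -> frames_ok x D stk -> frames_ok x D (Frame u v w k h :: stk).
Proof.
move=> su sv sw hk hf.
change ([&& size u <= width x, size v <= width x, size w <= width x & k <= D] && frames_ok x D stk).
by rewrite su sv sw leqnn hk hf.
Qed.

(** The stack height plus the depth of the pending call is at most [D]. With all words bounded by
    [width x], this bounds the size of a search state polynomially. *)
Definition good (x : X) (D : nat) (s : search) : bool :=
  [&& size s.2.2.1.1 <= width x, size s.2.2.1.2.1 <= width x,
      size s.2.2.2 + (if s.2.1.1 then 0 else s.2.2.1.2.2) <= D, s.2.2.1.2.2 <= D &
      frames_ok x D s.2.2.2].

Lemma good_call x D u v k stk : size u = width x -> size v = width x -> size stk + k <= D ->
  frames_ok x D stk -> good x D (Call x u v k stk).
Proof. by move=> su sv h hf; rewrite /good [_.2]/= hf /= su sv leqnn; lia. Qed.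

Lemma good_return x D b stk : size stk <= D -> frames_ok x D stk -> good x D (Return x b stk).
Proof. by move=> h hf; rewrite /good [_.2]/= hf /= addn0 h. Qed.

Definition search_run (x : X) (D : nat) (s s' : search) : Prop :=
  exists2 n, iter n search_step s = s' &
    forall i, i < n -> [/\ searching (iter i search_step s), (iter i search_step s).1 = x &
                         good x D (iter i search_step s)].

Lemma search_trans x D s s' s'' : search_run x D s s' -> search_run x D s' s'' -> search_run x D s s''.
Proof.
move=> [n e h] [n' e' h']; exists (n' + n); first by rewrite iterD e.
move=> i hi; case: (ltnP i n) => hin; first exact: h.
have -> : i = (i - n) + n by lia.
by rewrite iterD e; apply: h'; lia.
Qed.

Lemma search_next x D s : searching s -> s.1 = x -> good x D s -> search_run x D s (search_step s).
Proof. by move=> h1 h2 h3; exists 1 => // -[|i]. Qed.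

Lemma search_call x D k u v stk : size u = width x -> size v = width x -> size stk + k <= D ->
  frames_ok x D stk -> exists b : bool, search_run x D (Call x u v k stk) (Return x b stk) /\ (b <-> reaches_in x k u v).
Proof.
elim: k u v stk => [|k IH] u v stk su sv hD hf.
  exists (base x u v); split=> //; by apply: search_next => //; apply: good_call.
have loop w : size w = width x -> exists b : bool,
    search_run x D (Call x u w k (Frame u v w k false :: stk)) (Return x b stk) /\
    (b <-> exists w', [/\ size w' = width x, digits_value w <= digits_value w', reaches_in x k u w' & reaches_in x k w' v]).
  (* Induction on the number of midpoints that are still to be tried. *)
  have [r hr] := ubnP (2 ^ width x - digits_value w); elim: r w hr => // r IHr w hr sw.
  have hf' h : frames_ok x D (Frame u v w k h :: stk) by apply: frames_cons => //; lia.
  have hD' h : size (Frame u v w k h :: stk) + k <= D by rewrite /=; lia.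
  have next : (~ (reaches_in x k u w /\ reaches_in x k w v)) -> search_run x D (Call x u w k (Frame u v w k false :: stk))
      (Return x false (Frame u v w k false :: stk)) \/ search_run x D (Call x u w k (Frame u v w k false :: stk))
      (Return x false (Frame u v w k true :: stk)) -> exists b : bool,
    search_run x D (Call x u w k (Frame u v w k false :: stk)) (Return x b stk) /\
    (b <-> exists w', [/\ size w' = width x, digits_value w <= digits_value w', reaches_in x k u w' & reaches_in x k w' v]).
    move=> no hrun.
    have {}hrun s : search_step (Return x false (Frame u v w k false :: stk)) = s ->
        search_run x D (Call x u w k (Frame u v w k false :: stk)) s.
      move=> <-; case: hrun => h; apply: search_trans h _.
        by apply: search_next => //; apply: good_return => //; rewrite /=; lia.
      have -> : search_step (Return x false (Frame u v w k false :: stk)) =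
        search_step (Return x false (Frame u v w k true :: stk)) by [].
      by apply: search_next => //; apply: good_return => //; rewrite /=; lia.
    have [hw|hw] := boolP (false \in w); last first.
      exists false; split; first by apply: hrun; rewrite /search_step /= (negbTE hw).
      split=> // -[w' [sw' hv h1 h2]]; case: no.
      by rewrite (digits_value_max hw _ hv) // sw sw'.
    have si : size (increment w) = width x by rewrite size_increment.
    have vlt := digits_value_lt (increment w); rewrite si increment_value in vlt.
    have [|b [hb hbP]] := IHr (increment w) _ si; first by rewrite increment_value; lia.
    exists b; split; first by apply: search_trans hb; apply: hrun; rewrite /search_step /= hw.
    rewrite hbP increment_value; split=> -[w' [sw' hv h1 h2]]; exists w'; split=> //; first exact: ltnW.
    rewrite ltn_neqAle hv andbT; apply/eqP => e; case: no.
    by rewrite (@digits_value_inj w w') // sw sw'.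
  have [b1 [r1 p1]] := IH u w _ su sw (hD' false) (hf' false).
  case: b1 r1 p1 => r1 p1; last by apply: next; [move=> [/p1]|left].
  have [b2 [r2 p2]] := IH w v _ sw sv (hD' true) (hf' true).
  have r12 : search_run x D (Call x u w k (Frame u v w k false :: stk)) (Return x b2 (Frame u v w k true :: stk)).
    apply: search_trans r1 _; apply: search_trans r2.
    by apply: search_next => //; apply: good_return => //; rewrite /=; lia.
  case: b2 r2 p2 r12 => r2 p2 r12; last by apply: next; [move=> [_ /p2]|right].
  exists true; split; last by split=> // _; exists w; split=> //; [apply/p1|apply/p2].
  apply: search_trans r12 _.
  by apply: search_next => //; apply: good_return => //; rewrite /=; lia.
have sw : size (nseq (width x) false) = width x by rewrite size_nseq.
have [b [hb hbP]] := loop _ sw; exists b; split.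
  apply: search_trans hb; by apply: search_next => //; apply: good_call.
rewrite hbP; have -> : digits_value (nseq (width x) false) = 0 by elim: (width x) => //= j ->.
by split=> -[w' ]; [move=> [h1 _ h2 h3]|move=> [h1 h2 h3]]; exists w'.
Qed.
Hypothesis pw : polyf width.
Hypothesis pb : polyf (fun t : X * (B * B) => base t.1 t.2.1 t.2.2).

Lemma polyf_Call Z {EZ : Enc Z} (x : Z -> X) (u v : Z -> B) (k : Z -> nat) (stk : Z -> seq frame) :
  polyf x -> polyf u -> polyf v -> polyf k -> polyf stk ->
  polyf (fun z => Call (x z) (u z) (v z) (k z) (stk z)).
Proof.
move=> px pu pv pk ps; apply: polyf_pair => //; apply: polyf_pair; first exact: polyf_const.
by apply: polyf_pair => //; apply: polyf_pair => //; apply: polyf_pair.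
Qed.

Lemma polyf_Return Z {EZ : Enc Z} (x : Z -> X) (b : Z -> bool) (stk : Z -> seq frame) :
  polyf x -> polyf b -> polyf stk -> polyf (fun z => Return (x z) (b z) (stk z)).
Proof.
move=> px pb' ps; apply: polyf_pair => //; apply: polyf_pair.
  by apply: polyf_pair => //; apply: polyf_const.
by apply: polyf_pair => //; apply: polyf_const.
Qed.

Lemma polyf_Frame Z {EZ : Enc Z} (u v w : Z -> B) (k : Z -> nat) (h : Z -> bool) :
  polyf u -> polyf v -> polyf w -> polyf k -> polyf h ->
  polyf (fun z => Frame (u z) (v z) (w z) (k z) (h z)).
Proof.
by move=> pu pv pw' pk ph; apply: polyf_pair; [apply: polyf_pair => //|]; apply: polyf_pair.
Qed.

Lemma polyf_search_step : polyf search_step.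
Proof.
apply: polyf_if; first by pproj.
  apply: (polyf_seq_case (h := fun s : search => s.2.2.2) (g0 := fun s => s)
    (g1 := fun t : search * (frame * seq frame) => let s := t.1 in let f := t.2.1 in let stk := t.2.2 in
      let x := s.1 in let w := f.1.2.2 in
      if s.2.1.2 then
        if f.2.2 then Return x true stk
        else Call x w f.1.2.1 f.2.1 (Frame f.1.1 f.1.2.1 w f.2.1 true :: stk)
      else if false \in w then
        Call x f.1.1 (increment w) f.2.1 (Frame f.1.1 f.1.2.1 (increment w) f.2.1 false :: stk)
      else Return x false stk)); first by pproj.
    exact: polyf_id.
  have pi : polyf (fun t : search * (frame * seq frame) => increment t.2.1.1.2.2).
    by apply: (polyf_comp polyf_increment); pproj.
  apply: polyf_if; first by pproj.
    apply: polyf_if; first by pproj.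
      by apply: polyf_Return; pproj.
    by apply: polyf_Call; pproj; apply: polyf_cons; pproj; apply: polyf_Frame; pproj.
  apply: polyf_if; first by apply: polyf_mem; pproj.
    by apply: polyf_Call => //; pproj; apply: polyf_cons; pproj; apply: polyf_Frame => //; pproj.
  by apply: polyf_Return; pproj.
apply: (polyf_nat_case (h := fun s : search => s.2.2.1.2.2)
  (g0 := fun s : search => Return s.1 (base s.1 s.2.2.1.1 s.2.2.1.2.1) s.2.2.2)
  (g1 := fun t : search * nat => let s := t.1 in let u := s.2.2.1.1 in let v := s.2.2.1.2.1 in
    let w := nseq (width s.1) false in
    Call s.1 u w t.2 (Frame u v w t.2 false :: s.2.2.2))); first by pproj.
  apply: polyf_Return; pproj.
  apply: (polyf_comp (f := fun s : search => (s.1, (s.2.2.1.1, s.2.2.1.2.1))) pb).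
  by apply: polyf_pair; pproj; apply: polyf_pair; pproj.
have pz : polyf (fun t : search * nat => nseq (width t.1.1) false).
  apply: (polyf_ext (f := fun t : search * nat => map (fun _ : unit => false) (nseq (width t.1.1) tt))).
    by move=> t; elim: (width _) => //= k ->.
  apply: (polyf_map (f := fun _ _ => false)); first exact: polyf_const.
  by apply: polyf_unary; apply: (polyf_comp pw); pproj.
by apply: polyf_Call => //; pproj; apply: polyf_cons; pproj; apply: polyf_Frame => //; pproj.
Qed.

Lemma good_esize x D s : s.1 = x -> good x D s ->
  esize s <= esize x + (D.+1 * (12 * width x + 2 * D + 20) + 8 * width x + 2 * D + 20).
Proof.
case: s => x' [[b1 b2] [[u [v k]] stk]] /= -> /and5P[su sv h hk hf].
set K := 12 * width x + 2 * D + 20; have hs : esize stk <= D.+1 * K.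
  have h1 : size stk <= D by move: h => /=; lia.
  apply: (@leq_trans ((size stk).+1 * K)); last by rewrite leq_mul2r; lia.
  move: hf; rewrite /frames_ok [_.2.2]/=; elim: (stk) => [|[[fu [fv fw]] [fk fh]] l IH].
    by rewrite esize_nil /K; lia.
  move=> /andP[/and4P[/= k1 k2 k3 k4] hf]; have := IH hf; rewrite esize_cons !esize_pair esize_nat.
  have := esize_bits fu; have := esize_bits fv; have := esize_bits fw; have := esize_bool fh.
  rewrite (mulSn (size l).+1 K); move: ((size l).+1 * K) => z; rewrite /K; lia.
rewrite !esize_pair esize_nat; move: su sv hk => /= su sv hk.
have := esize_bits u; have := esize_bits v; have := esize_bool b1; have := esize_bool b2; lia.
Qed.

(** Recursion depth [width] suffices for a graph whose nodes are words of that length, as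
    [2 ^ width] bounds the length of a path without repetitions; the second equivalence takes this
    as given. *)
Theorem search_PSPACE (L : language) (ini : seq bool -> X) (ok : X -> bool) (s t : X -> B) :
  polyf ini -> polyf ok -> polyf s -> polyf t ->
  (forall w, ok (ini w) -> size (s (ini w)) = width (ini w) /\ size (t (ini w)) = width (ini w)) ->
  (forall w, L w <-> ok (ini w) /\ reaches_in (ini w) (width (ini w)) (s (ini w)) (t (ini w))) ->
  in_PSPACE L.
Proof.
move=> pini pok ps pt hsz hL.
pose start w := let x := ini w in
  if ok x then Call x (s x) (t x) (width x) [::] else Return x false [::].
have [qi mqi hqi] := polyf_size pini; have [qw mqw hqw] := polyf_size pw.
pose W n := qw (qi (4 * n + 1)).
pose bound n := qi (4 * n + 1) + ((W n).+1 * (12 * W n + 2 * W n + 20) + 8 * W n + 2 * W n + 20).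
apply: (@pspace_loop L search _ start searching (fun z => z.2.1.2) search_step bound).
- by rewrite /bound /W; auto 30 with mp.
- apply: polyf_if; first exact: (polyf_comp pok).
    apply: polyf_Call => //; try exact: (polyf_comp _ pini); exact: polyf_const.
  by apply: polyf_Return => //; apply: polyf_const.
- apply: polyf_negb; apply: polyf_andb; first by pproj.
  apply: (polyf_ext (f := fun z : search => size z.2.2.2 == 0)) => //.
  by apply: polyf_eq; [apply: polyf_size_seq; pproj|apply: polyf_const].
- exact: polyf_search_step.
- by pproj.
move=> w; set x := ini w.
have ex : esize x <= qi (4 * size w + 1).
  by apply: leq_trans (hqi w) _; apply: (mpoly_mono mqi); apply: esize_bits.
have wx : width x <= W (size w).
  have := hqw x; rewrite esize_nat => h; have : qw (esize x) <= W (size w) by apply: (mpoly_mono mqw).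
  by lia.
have small z : z.1 = x -> good x (width x) z -> esize z <= bound (size w).
  move=> h1 h2; apply: leq_trans (good_esize h1 h2) _; rewrite /bound; apply: leq_add => //.
  by rewrite !leq_add // ?leq_mul // ?leq_add // ?leq_mul.
case O : (ok x); last first.
  exists 0; rewrite /start -/x O; split=> //.
    by move=> [|//] _; apply: small => //; apply: good_return.
  by split=> // /hL[]; rewrite -/x O.
have [szs szt] := hsz w O.
have hD : size ([::] : seq frame) + width x <= width x by [].
have [b [[n e h] hb]] := search_call szs szt hD isT.
exists n; rewrite /start -/x O e; split=> //.
- by move=> i /h[].
- move=> i; rewrite leq_eqVlt => /orP[/eqP ->|/h[_ h1 h2]]; last exact: small.
  by rewrite e; apply: small => //; apply: good_return.
by rewrite /= hb; split=> [hw|/hL[]//]; apply/hL.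
Qed.

End Savitch.

(** * Instances as lists of numbers *)

Section ListInstance.
Variable l : seq nat.

(* Numbers that are too large to be an index are cut off, so that they have a short unary form. *)
Definition cap (x : nat) : nat := minn x (size l).+1.
Definition list_nv : nat := cap (nth 0 l 0).
Definition list_ne : nat := cap (nth 0 l 1).
Definition field (j k : nat) : nat := nth 0 l (2 + list_nv + 5 * k + j).
Definition list_bits (j : nat) : seq bool := [seq field j k == 1 | k <- iota 0 list_ne].

Definition list_inflow (c : seq bool) (v : nat) : nat :=
  sumn [seq if cap (if nth false c k then field 1 k else field 0 k) == v then field 2 k else 0
       | k <- iota 0 list_ne].

Definition list_legal (c : seq bool) : bool :=
  all (fun v => nth 0 l (2 + v) <= list_inflow c v) (iota 0 list_nv).

Definition list_valid : bool :=
  [&& size l == 2 + list_nv + 5 * list_ne,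
      all (fun k => [&& cap (field 0 k) < cap (field 1 k), cap (field 1 k) < list_nv, 0 < field 2 k,
                     field 3 k <= 1 & field 4 k <= 1]) (iota 0 list_ne),
      uniq [seq (cap (field 0 k), cap (field 1 k)) | k <- iota 0 list_ne],
      list_legal (list_bits 3) & list_legal (list_bits 4)].

Definition list_diff (u v : seq bool) : nat :=
  count (fun k => nth false u k != nth false v k) (iota 0 list_ne).

Definition list_base (u v : seq bool) : bool := [&& list_legal u, list_legal v & list_diff u v <= 1].

End ListInstance.

Lemma size_flatten_blocks (A : Type) (T : eqType) k (f : A -> seq T) s :
  (forall a, size (f a) = k) -> size (flatten (map f s)) = k * size s.
Proof. by move=> hf; elim: s => [|a s IH] /=; rewrite ?muln0 // size_cat hf IH mulnS. Qed.

Lemma nth_flatten_blocks (A : Type) (T : eqType) (x : T) (a0 : A) k (f : A -> seq T) s i j :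
  (forall a, size (f a) = k) -> i < size s -> j < k ->
  nth x (flatten (map f s)) (k * i + j) = nth x (f (nth a0 s i)) j.
Proof.
move=> hf; elim: s i => //= a s IH [|i] hi hj; rewrite nth_cat hf; first by rewrite muln0 hj.
rewrite mulnS ifF; last by apply/negbTE; lia.
by rewrite -IH //; congr nth; lia.
Qed.

Definition bits (n : nat) (C : {ffun 'I_n -> bool}) : seq bool := [seq C e | e <- enum 'I_n].

Lemma nth_bits n (C : {ffun 'I_n -> bool}) (e : 'I_n) : nth false (bits C) e = C e.
Proof. by rewrite /bits (nth_map e) ?size_enum_ord // nth_ord_enum. Qed.

Lemma size_bits n (C : {ffun 'I_n -> bool}) : size (bits C) = n.
Proof. by rewrite size_map size_enum_ord. Qed.

Lemma bits_of n (s : seq bool) : size s = n -> exists C : {ffun 'I_n -> bool}, bits C = s.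
Proof.
move=> sz; exists [ffun e : 'I_n => nth false s e].
apply: (@eq_from_nth _ false) => [|i]; rewrite size_bits ?sz // => hi.
by rewrite (nth_bits _ (Ordinal hi)) ffunE.
Qed.

Lemma iota_ord (T : Type) n (f : nat -> T) : [seq f k | k <- iota 0 n] = [seq f (val e) | e <- enum 'I_n].
Proof. by rewrite -val_enum_ord -map_comp. Qed.

Section InstanceData.
Variable I : instance.
Notation l := (instance_data I).
Notation nv := (nv (graph I)).
Notation ne := (ne (graph I)).

Lemma size_instance_data : size l = 2 + nv + 5 * ne.
Proof.
rewrite /instance_data !size_cat size_map size_enum_ord (size_flatten_blocks (k := 5)) //.
by rewrite size_enum_ord.
Qed.

Lemma data_nv : list_nv l = nv.
Proof. by rewrite /list_nv /cap size_instance_data /=; lia. Qed.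

Lemma data_ne : list_ne l = ne.
Proof. by rewrite /list_ne /cap size_instance_data /=; lia. Qed.

Lemma data_inflow (v : 'I_nv) : nth 0 l (2 + v) = min_inflow v.
Proof.
rewrite /instance_data /= nth_cat size_map size_enum_ord add0n ltn_ord.
by rewrite (nth_map v) ?size_enum_ord // nth_ord_enum.
Qed.

Lemma data_field j (e : 'I_ne) : j < 5 -> field l j e = nth 0 (edge_data e) j.
Proof.
move=> hj; rewrite /field data_nv /instance_data /= nth_cat size_map size_enum_ord.
rewrite ifF; last by apply/negbTE; lia.
have -> : nv + 5 * e + j - nv = 5 * e + j by lia.
by rewrite (nth_flatten_blocks _ e (k := 5)) ?size_enum_ord // nth_ord_enum.
Qed.

Lemma cap_small x : x <= size l -> cap l x = x.
Proof. by rewrite /cap; lia. Qed.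

Lemma cap_end (v : 'I_nv) : cap l v = v.
Proof. by apply: cap_small; rewrite size_instance_data; have := ltn_ord v; lia. Qed.

Lemma data_bits : list_bits l 3 = bits (source I) /\ list_bits l 4 = bits (target I).
Proof.
rewrite /list_bits data_ne !iota_ord; split; apply: eq_map => e; rewrite data_field //=.
  by case: (source I e).
by case: (target I e).
Qed.

Lemma data_legal (C : orientation (graph I)) : list_legal l (bits C) = legal C.
Proof.
have E (v : 'I_nv) : list_inflow l (bits C) v = \sum_(e | edge_target C e == v) weight e.
  rewrite /list_inflow data_ne iota_ord sumnE big_map big_enum /= [RHS]big_mkcond.
  apply: eq_bigr => e _; rewrite !data_field //= nth_bits /edge_target.
  by case: (C e); rewrite cap_end val_eqE.
rewrite /list_legal data_nv; apply/allP/forallP => h v.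
  have hv : val v \in iota 0 nv by rewrite mem_iota /= ltn_ord.
  by have := h _ hv; rewrite E data_inflow.
rewrite mem_iota /= => hv; have := h (Ordinal hv).
by rewrite -E -data_inflow.
Qed.

Lemma data_valid : list_valid l.
Proof.
have [b3 b4] := data_bits.
apply/and5P; split.
- by rewrite data_nv data_ne size_instance_data.
- apply/allP => k; rewrite data_ne mem_iota /= => hk.
  have hf j := @data_field j (Ordinal hk); rewrite /= in hf.
  rewrite !hf //= !cap_end data_nv ends_lt ltn_ord weight_gt0.
  by case: (source I _); case: (target I _).
- rewrite data_ne iota_ord map_inj_uniq ?enum_uniq // => e e' [].
  rewrite !data_field //= !cap_end => /val_inj e1 /val_inj e2; apply: (@ends_inj (graph I)).
  by rewrite [LHS]surjective_pairing e1 e2 -surjective_pairing.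
- by rewrite b3 data_legal source_legal.
- by rewrite b4 data_legal target_legal.
Qed.

Lemma data_diff (C D : orientation (graph I)) : list_diff l (bits C) (bits D) = #|[set e | C e != D e]|.
Proof.
rewrite /list_diff data_ne -val_enum_ord -sum1_count big_map big_enum_cond -sum1_card.
by apply: eq_bigl => e; rewrite !inE /= !nth_bits.
Qed.

Lemma reaches_in_reconfigurable k (C D : orientation (graph I)) :
  reaches_in (fun l => list_ne l) list_base l k (bits C) (bits D) -> reconfigurable C D.
Proof.
elim: k C D => [|k IH] C D.
  move=> /and3P[lC lD]; rewrite data_legal in lC; rewrite data_legal in lD; rewrite data_diff => h.
  have [e|ne] := eqVneq C D; first by exists [::]; split; rewrite //= ?lC.
  exists [:: D]; split; rewrite //= ?lC ?lD // andbT /one_reversal eqn_leq h card_gt0.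
  apply: contraNneq ne => /setP h0; apply/eqP/ffunP => e; have := h0 e; rewrite !inE.
  by move/negbFE/eqP.
move=> /= [w [sw /= h1 h2]]; rewrite data_ne in sw; have [E eE] := bits_of sw; subst w.
have [p [p1 p2 p3]] := IH _ _ h1; have [p' [q1 q2 q3]] := IH _ _ h2; exists (p ++ p'); split.
- by rewrite cat_path p1 p3.
- by rewrite -cat_cons all_cat p2; move: q2 => /= /andP[].
- by rewrite last_cat p3.
Qed.

(** After loops are removed the path is shorter than the number [2 ^ list_ne] of orientations, and
    it is halved repeatedly at position [2 ^ k]. Shorter paths are no exception, since the base
    relation is reflexive on legal orientations. *)
Lemma reconfigurable_reaches_in (C D : orientation (graph I)) :
  reconfigurable C D -> reaches_in (fun l => list_ne l) list_base l (list_ne l) (bits C) (bits D).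
Proof.
pose r (A B : orientation (graph I)) := list_base l (bits A) (bits B).
have base0 A B : legal A -> legal B -> list_diff l (bits A) (bits B) <= 1 -> r A B.
  by move=> hA hB h; rewrite /r /list_base !data_legal hA hB.
move=> [p [p1 p2 p3]].
have {p1 p2} : path r C p /\ legal C.
  split; last by case/andP: p2.
  elim: p C p1 p2 {p3} => //= A p IH B /andP[h1 h2] /andP[hB hp].
  have hA : legal A by case/andP: hp.
  by rewrite IH // base0 // data_diff (eqP h1).
rewrite -p3 => -[hp lC]; case/shortenP: hp => q hq uq _.
have sq : size q < 2 ^ list_ne l.
  have := max_card (mem (C :: q)); rewrite (card_uniqP uq) card_ffun card_bool card_ord /=.
  by rewrite data_ne.
move: (ltnW sq) hq lC; clear uq sq p p3 D; elim: (list_ne l) q C => [|k IH] q C sq hq lC.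
  case: q sq hq => [|A [|]] //= _; last by rewrite andbT.
  move=> _; apply: base0 => //; rewrite data_diff.
  by rewrite eq_card0 // => e; rewrite !inE eqxx.
have lr A B : r A B -> legal B by case/and3P => _; rewrite data_legal.
have legal_last s A : path r A s -> legal A -> legal (last A s).
  by elim: s A => //= B s IHs A /andP[/lr hB hs] _; apply: IHs.
rewrite -(cat_take_drop (2 ^ k) q) in hq *; rewrite last_cat /=.
move: hq; rewrite cat_path => /andP[h1 h2].
exists (bits (last C (take (2 ^ k) q))); split; first by rewrite size_bits data_ne.
  by apply: IH => //; rewrite size_take; case: ifP; lia.
apply: IH => //; last exact: legal_last.
by rewrite size_drop; move: sq; rewrite expnS; lia.
Qed.

End InstanceData.

(** The equation for the length of [l] bounds both counts, so neither they nor the ends of edges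
    were altered by [cap]. Every admissible list is therefore the data of an instance. *)
Lemma valid_instance l : list_valid l -> exists I, instance_data I = l.
Proof.
case/and5P => /eqP sz /allP ok un ls lt.
have okk (e : 'I_(list_ne l)) : [&& cap l (field l 0 e) < cap l (field l 1 e),
  cap l (field l 1 e) < list_nv l, 0 < field l 2 e, field l 3 e <= 1 & field l 4 e <= 1].
  by apply: ok; rewrite mem_iota /= ltn_ord.
have capE x : cap l x <= size l -> cap l x = x by rewrite /cap; lia.
have hV (e : 'I_(list_ne l)) : cap l (field l 1 e) < list_nv l by have /and5P[] := okk e.
have hU (e : 'I_(list_ne l)) : cap l (field l 0 e) < list_nv l.
  by have /and5P[h _ _ _ _] := okk e; apply: ltn_trans h (hV e).
pose en : {ffun 'I_(list_ne l) -> 'I_(list_nv l) * 'I_(list_nv l)} :=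
  [ffun e => (Ordinal (hU e), Ordinal (hV e))].
have en_lt e : (en e).1 < (en e).2 by rewrite ffunE /=; have /and5P[] := okk e.
have en_inj : injective en.
  move=> e e'; rewrite !ffunE => -[e1 e2]; apply: val_inj.
  apply/eqP; rewrite -(nth_uniq (0, 0) _ _ un) ?size_map ?size_iota ?(ltn_ord e) ?(ltn_ord e') //.
  have nE (a : 'I_(list_ne l)) : nth (0, 0) [seq (cap l (field l 0 k), cap l (field l 1 k))
      | k <- iota 0 (list_ne l)] a = (cap l (field l 0 a), cap l (field l 1 a)).
    by rewrite (nth_map 0) ?size_iota ?ltn_ord // nth_iota ?ltn_ord // add0n.
  by rewrite !nE e1 e2.
pose wt : {ffun 'I_(list_ne l) -> nat} := [ffun e => field l 2 (val e)].
have wt0 e : 0 < wt e by rewrite ffunE; have /and5P[] := okk e.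
pose G := ConstraintGraph [ffun v => nth 0 l (2 + val v)] en_lt en_inj wt0.
have legalE (C : orientation G) : list_legal l (bits C) -> legal C.
  move=> /allP h; apply/forallP => v; rewrite ffunE.
  have hv : val v \in iota 0 (list_nv l) by rewrite mem_iota /= ltn_ord.
  apply: leq_trans (h _ hv) _; rewrite /list_inflow iota_ord sumnE big_map big_enum /=.
  rewrite [X in _ <= X]big_mkcond leq_sum // => e _; rewrite nth_bits /edge_target !ffunE /=.
  by case: (C e); rewrite -val_eqE /=.
pose src (j : nat) : orientation G := [ffun e => field l j (val e) == 1].
have bitsE j : bits (src j) = list_bits l j.
  by rewrite /bits /list_bits iota_ord; apply: eq_map => e; rewrite ffunE.
have ls' : legal (src 3) by apply: legalE; rewrite bitsE.
have lt' : legal (src 4) by apply: legalE; rewrite bitsE.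
pose I := Instance ls' lt'; exists I.
have e0 : list_nv l = nth 0 l 0 by apply: capE; rewrite -/(list_nv l); lia.
have e1 : list_ne l = nth 0 l 1 by apply: capE; rewrite -/(list_ne l); lia.
have szI : size (instance_data I) = size l by rewrite size_instance_data sz.
apply: (@eq_from_nth _ 0) => // i hi.
case: i hi => [|[|i]] hi; [by rewrite -e0|by rewrite -e1|].
case: (ltnP i (list_nv l)) => hiv.
  by rewrite -[i.+2]/(2 + Ordinal hiv) data_inflow ffunE.
have [k [j [hj hk ei]]] : exists k j, [/\ j < 5, k < list_ne l & i.+2 = 2 + list_nv l + 5 * k + j].
  exists ((i - list_nv l) %/ 5), ((i - list_nv l) %% 5); rewrite ltn_mod; split=> //.
    by rewrite ltn_divLR //; move: hi; rewrite szI sz; lia.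
  by have := divn_eq (i - list_nv l) 5; lia.
have fI : field (instance_data I) j k = nth 0 (instance_data I) i.+2 by rewrite /field data_nv ei.
rewrite -fI (@data_field I j (Ordinal hk)) // ei -/(field l j k).
have /and5P[_ _ _ s3 s4] := okk (Ordinal hk).
have b01 x : x <= 1 -> nat_of_bool (x == 1) = x by case: x => [|[]].
have cU := ltnW (hU (Ordinal hk)); have cV := ltnW (hV (Ordinal hk)).
rewrite /edge_data /=; case: j hj {ei fI} => [|[|[|[|[|//]]]]] _ /=; rewrite !ffunE //=.
- by apply: capE; rewrite /= in cU; lia.
- by apply: capE; rewrite /= in cV; lia.
- exact: b01.
- exact: b01.
Qed.

(** * Binary arithmetic *)

Lemma digits_value_rcons s (b : bool) : digits_value (rcons s b) = digits_value s + b * 2 ^ size s.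
Proof. by elim: s => [|c s IH] /=; [lia|rewrite IH expnS; lia]. Qed.

Definition low_value (s : seq bool) (i : nat) : nat := digits_value (take i s).

Lemma low_valueS s i : low_value s i.+1 = low_value s i + nth false s i * 2 ^ i.
Proof.
rewrite /low_value; case: (ltnP i (size s)) => h.
  by rewrite (take_nth false h) digits_value_rcons size_takel // ltnW.
by rewrite !take_oversize ?(leqW h) // nth_default // mul0n addn0.
Qed.

Lemma low_value_lt s i : low_value s i < 2 ^ i.
Proof.
apply: leq_trans (digits_value_lt _) _; rewrite leq_exp2l // size_take.
by case: ltnP.
Qed.

Lemma low_value_all s i : size s <= i -> low_value s i = digits_value s.
Proof. by move=> h; rewrite /low_value take_oversize. Qed.

Definition add_step (s t : seq bool) (st : bool * seq bool) (i : nat) : bool * seq bool :=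
  let a := nth false s i in let b := nth false t i in
  (if a then b || st.1 else b && st.1, (a (+) b (+) st.1) :: st.2).

(** Weights are given in binary, so inflows are summed and compared digit by digit instead of in
    unary. The sum may have leading zeros, which do no harm in comparisons. *)
Definition add_digits (s t : seq bool) : seq bool :=
  let st := foldl (add_step s t) (false, [::]) (iota 0 (size s + size t)) in rev (st.1 :: st.2).

Lemma add_digits_inv s t n : let st := foldl (add_step s t) (false, [::]) (iota 0 n) in
  size st.2 = n /\ digits_value (rev st.2) + st.1 * 2 ^ n = low_value s n + low_value t n.
Proof.
elim: n => [|n IH]; first by rewrite /low_value !take0.
rewrite -addn1 iotaD foldl_cat addn1 /=; move: IH; case: (foldl _ _ _) => c out /= [sz IH].
rewrite sz; split=> //; rewrite rev_cons digits_value_rcons size_rev sz expnS !low_valueS.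
by move: IH; case: c; case: (nth false s n); case: (nth false t n) => /=; lia.
Qed.

Lemma add_digits_value s t : digits_value (add_digits s t) = digits_value s + digits_value t.
Proof.
rewrite /add_digits; have [] := add_digits_inv s t (size s + size t).
case: (foldl _ _ _) => c out /= sz; rewrite rev_cons digits_value_rcons size_rev sz => ->.
by rewrite !low_value_all //; lia.
Qed.

Lemma size_add_digits s t : size (add_digits s t) = (size s + size t).+1.
Proof. by rewrite /add_digits size_rev /=; have [-> _] := add_digits_inv s t (size s + size t). Qed.

Definition sum_digits (L : seq (seq bool)) : seq bool := foldl add_digits [::] L.

Lemma sum_digits_value L : digits_value (sum_digits L) = sumn (map digits_value L).
Proof.
rewrite /sum_digits; suff H s : digits_value (foldl add_digits s L) = digits_value s + sumn (map digits_value L).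
  by rewrite H.
by elim: L s => [|t L IH] s /=; rewrite ?addn0 // IH add_digits_value addnA.
Qed.

(** The digits are read from the least significant one upwards, so that a later difference overrides
    all earlier ones. *)
Definition leq_digits (s t : seq bool) : bool :=
  foldl (fun r i => if nth false s i == nth false t i then r else nth false t i) true
    (iota 0 (size s + size t)).

Lemma leq_digitsE s t : leq_digits s t = (digits_value s <= digits_value t).
Proof.
rewrite /leq_digits; have [hs ht] : size s <= size s + size t /\ size t <= size s + size t by lia.
rewrite -(low_value_all hs) -(low_value_all ht); elim: (size s + size t) => [|n IH]; first by rewrite /low_value !take0.
rewrite -addn1 iotaD foldl_cat IH addn1 /= !low_valueS add0n.
have := low_value_lt s n; have := low_value_lt t n.
by case: (nth false s n); case: (nth false t n) => /=; lia.
Qed.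

Lemma polyf_add_digits X {EX : Enc X} (s t : X -> seq bool) : polyf s -> polyf t ->
  polyf (fun x => add_digits (s x) (t x)).
Proof.
move=> ps pt; pose f x st i := add_step (s x) (t x) st i.
have pf : polyf (fun x => foldl (f x) (false, [::]) (iota 0 (size (s x) + size (t x)))).
  apply: (polyf_foldl_grow (f := f)).
  - by apply: polyf_iota; apply: polyf_addn; apply: polyf_size_seq.
  - exact: polyf_const.
  - have pa : polyf (fun z : X * (bool * seq bool * nat) => nth false (s z.1) z.2.2).
      by apply: polyf_nth; pproj; apply: (polyf_comp ps); pproj.
    have pb : polyf (fun z : X * (bool * seq bool * nat) => nth false (t z.1) z.2.2).
      by apply: polyf_nth; pproj; apply: (polyf_comp pt); pproj.
    have pxor Z (EZ : Enc Z) (b c : Z -> bool) : polyf b -> polyf c -> polyf (fun z => b z (+) c z).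
      move=> hb hc; apply: (polyf_ext (f := fun z => if b z then ~~ c z else c z)).
        by move=> z; case: (b z).
      by apply: polyf_if => //; apply: polyf_negb.
    apply: polyf_pair.
      apply: polyf_if => //; first by apply: polyf_orb => //; pproj.
      by apply: polyf_andb => //; pproj.
    by apply: polyf_cons; pproj; apply: (pxor); pproj; apply: (pxor).
  exists (fun=> 10); first by auto with mp.
  move=> x [c out] i; rewrite /f /add_step [fst _]/= [snd _]/= !esize_pair esize_cons.
  have : 0 < esize c by apply: esize_gt0.
  move: (if _ then _ else _) (_ (+) _) => b1 b2.
  have := esize_bool b1; have := esize_bool b2; lia.
by apply: polyf_rev; apply: polyf_cons; [apply: polyf_fst|apply: polyf_snd].
Qed.

Lemma size_esize_sum (L : seq (seq bool)) : sumn [seq (size s).+1 | s <- L] < esize L.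
Proof.
elim: L => // s L IH; rewrite esize_cons /=; have h : size s < esize s by apply: size_esize.
lia.
Qed.

Lemma polyf_sum_digits X {EX : Enc X} (L : X -> seq (seq bool)) : polyf L ->
  polyf (fun x => sum_digits (L x)).
Proof.
move=> pL; apply: (polyf_foldl (f := fun _ s t => add_digits s t)) => //; first exact: polyf_const.
  by apply: polyf_add_digits; pproj.
have [q mq hq] := polyf_size pL; exists (fun n => 4 * q n + 1); first by auto 10 with mp.
move=> x i _; apply: leq_trans (esize_bits _) _.
have H s l : size (foldl add_digits s l) = size s + sumn [seq (size t).+1 | t <- l].
  by elim: l s => [|t l IH] s /=; rewrite ?addn0 // IH size_add_digits; lia.
rewrite H add0n; have h1 := size_esize_sum (take i (L x)); have h2 := hq x.
have h3 : esize (take i (L x)) <= esize (L x) by apply: esize_take.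
by move: h1 h2 h3; lia.
Qed.

Lemma polyf_leq_digits X {EX : Enc X} (s t : X -> seq bool) : polyf s -> polyf t ->
  polyf (fun x => leq_digits (s x) (t x)).
Proof.
move=> ps pt; apply: (polyf_foldl_grow (f := fun x r i =>
  if nth false (s x) i == nth false (t x) i then r else nth false (t x) i)).
- by apply: polyf_iota; apply: polyf_addn; apply: polyf_size_seq.
- exact: polyf_const.
- have pa : polyf (fun z : X * (bool * nat) => nth false (s z.1) z.2.2).
    by apply: polyf_nth; pproj; apply: (polyf_comp ps); pproj.
  have pb : polyf (fun z : X * (bool * nat) => nth false (t z.1) z.2.2).
    by apply: polyf_nth; pproj; apply: (polyf_comp pt); pproj.
  by apply: polyf_if => //; [apply: polyf_eq|pproj].
exists (fun=> 10); first by auto with mp.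
move=> x r i; move: (if _ then _ else _) => b; have := esize_bool b; lia.
Qed.

Lemma esize_rev A {EA : Enc A} (l : seq A) : esize (rev l) = esize l.
Proof.
have E (s : seq A) : esize s = (sumn [seq (esize a).+1 | a <- s]).+1.
  by elim: s => // a s IH; rewrite esize_cons IH /=; lia.
by rewrite !E map_rev sumn_rev.
Qed.

Lemma polyf_parse : polyf (fun w => (parsed w, parse w)).
Proof.
have ps : polyf parse_state.
  apply: (polyf_foldl_grow (f := fun _ st b => parse_step st b)); [by pproj|exact: polyf_const| |].
    apply: (polyf_ext (f := fun z : seq bool * ((bool * (seq bool * seq (seq bool))) * bool) =>
      if z.2.1.1 then (false, (z.2.2 :: z.2.1.2.1, z.2.1.2.2)) else if z.2.2 then (true, (z.2.1.2.1, z.2.1.2.2))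
      else (false, ([::], rev z.2.1.2.1 :: z.2.1.2.2)))).
      by case=> x [[p [c d]] b].
    apply: polyf_if; first by pproj.
      by apply: polyf_pair; pproj; apply: polyf_pair; pproj; apply: polyf_cons; pproj.
    apply: polyf_if; first by pproj.
      by apply: polyf_pair; pproj; apply: polyf_pair; pproj.
    by apply: polyf_pair; pproj; apply: polyf_pair; pproj; apply: polyf_cons; pproj; apply: polyf_rev; pproj.
  exists (fun n => n + 10); first by auto with mp.
  move=> w [[] [cur done]] b; rewrite /parse_step; last case: b; rewrite !esize_pair ?esize_cons ?esize_rev;
  have := esize_bool false; have := esize_bool true; have := esize_gt0 true; have := esize_gt0 false;
  rewrite ?esize_nil; lia.
apply: polyf_pair; last by apply: polyf_rev; do 2 apply: polyf_snd.
apply: (polyf_ext (f := fun w => ~~ (parse_state w).1 && ((size (parse_state w).2.1 == 0) &&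
  all (fun s => nth true (true :: s) (size s)) (parse_state w).2.2))).
  move=> w; rewrite /parsed; case: (parse_state w) => p [cur D] /=; congr (_ && (_ && _)).
  by apply: eq_all => s; rewrite /canonical_digits (last_nth true).
apply: polyf_andb; first by apply: polyf_negb; apply: polyf_fst.
apply: polyf_andb.
  by apply: polyf_eq; [apply: polyf_size_seq; apply: polyf_fst; apply: polyf_snd|apply: polyf_const].
apply: (polyf_all (p := fun _ s => nth true (true :: s) (size s))); last by do 2 apply: polyf_snd.
by apply: polyf_nth; [apply: polyf_cons; pproj|apply: polyf_size_seq; pproj].
Qed.

(** * Straight-line drawings *)

From mathcomp Require Import all_order interval classical_sets set_interval reals topology normedtype.
From mathcomp Require Import ring lra.

Import Order.TTheory GRing.Theory Num.Theory numFieldNormedType.Exports.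

Section Segments.
Local Open Scope ring_scope.

Definition point := (int * int)%type.

Definition affine (f : int * int * int) (P : point) : int := f.1.1 * P.1 + f.1.2 * P.2 + f.2.

Definition through (a b : int) (P : point) : int * int * int := (a, b, - (a * P.1 + b * P.2)).

(** Weak inequalities with one strict among the four suffice, because the segments are open: a
    strict inequality at one end is strict on the whole interior. *)
Definition separates (f : int * int * int) (A B C D : point) : bool :=
  let a := affine f A in let b := affine f B in let c := affine f C in let d := affine f D in
  if a <= 0 then if b <= 0 then if 0 <= c then if 0 <= d then
  [|| a < 0, b < 0, 0 < c | 0 < d] else false else false else false else false.

Fixpoint any (T : Type) (p : pred T) (s : seq T) : bool :=
  if s is x :: s' then if p x then true else any p s' else false.

(** Candidate lines pass through one of the four ends, orthogonal or parallel to one of the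
    segments. The directions [u] and [v] as normals separate collinear segments; a vertex is treated
    as a segment with equal ends. *)
Definition separated (A B C D : point) : bool :=
  let u := (B.1 - A.1, B.2 - A.2) in let v := (D.1 - C.1, D.2 - C.2) in
  any (fun P => any (fun n => separates (through n.1 n.2 P) A B C D)
    [:: (u.2, - u.1); (- u.2, u.1); (v.2, - v.1); (- v.2, v.1); u; v; (- u.1, - u.2); (- v.1, - v.2)])
    [:: A; C; B; D].

Variable R : realType.

Definition segment_point (A B : point) (t : R) : R * R :=
  ((1 - t) * A.1%:~R + t * B.1%:~R, (1 - t) * A.2%:~R + t * B.2%:~R).

Definition on_segment (A B : point) (z : R * R) : Prop :=
  exists2 t : R, 0 < t < 1 & z = segment_point A B t.

Lemma anyP (T : Type) (p : pred T) s : any p s -> exists x, p x.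
Proof. by elim: s => //= x s IH; case E: (p x) => // _; exists x. Qed.

Lemma affine_segment f A B t : f.1.1%:~R * (segment_point A B t).1 +
  f.1.2%:~R * (segment_point A B t).2 + f.2%:~R =
  (1 - t) * (affine f A)%:~R + t * (affine f B)%:~R :> R.
Proof. rewrite /affine /= !intrD !intrM; ring. Qed.

Lemma separated_disjoint A B C D z :
  separated A B C D -> on_segment A B z -> on_segment C D z -> False.
Proof.
move=> /anyP[P /anyP[n]]; move: (through _ _ _) => f h [t ht ez] [s hs ez'].
have := affine_segment f A B t; rewrite -ez ez' affine_segment; move: h.
rewrite /separates; move: (affine f A) (affine f B) (affine f C) (affine f D) => a b c d.
case: (lerP a 0) => // ha; case: (lerP b 0) => // hb.
case: (lerP 0 c) => // hc; case: (lerP 0 d) => // hd.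
have ha' : a%:~R <= 0 :> R by rewrite (ler_int _ a 0).
have hb' : b%:~R <= 0 :> R by rewrite (ler_int _ b 0).
have hc' : 0 <= c%:~R :> R by rewrite (ler_int _ 0 c).
have hd' : 0 <= d%:~R :> R by rewrite (ler_int _ 0 d).
case/andP: ht => t0 t1; case/andP: hs => s0 s1.
have t1' : 0 < 1 - t by rewrite subr_gt0.
have s1' : 0 < 1 - s by rewrite subr_gt0.
have pa : (1 - t) * a%:~R <= 0 by rewrite pmulr_rle0.
have pb : t * b%:~R <= 0 by rewrite pmulr_rle0.
have pc : 0 <= (1 - s) * c%:~R by rewrite pmulr_rge0.
have pd : 0 <= s * d%:~R by rewrite pmulr_rge0.
case/or4P => h e; clear ez ez'.
- have : (1 - t) * a%:~R < 0 by rewrite pmulr_rlt0 // (ltr_int _ a 0).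
  lra.
- have : t * b%:~R < 0 by rewrite pmulr_rlt0 // (ltr_int _ b 0).
  lra.
- have : 0 < (1 - s) * c%:~R by rewrite pmulr_rgt0 // (ltr_int _ 0 c).
  lra.
- have : 0 < s * d%:~R by rewrite pmulr_rgt0 // (ltr_int _ 0 d).
  lra.
Qed.

Lemma segment_point_inj A B : A != B -> injective (segment_point A B).
Proof.
move=> ne s t [e1 e2]; apply/eqP; rewrite -subr_eq0.
have h1 : (s - t) * (B.1 - A.1)%:~R = 0 :> R by rewrite intrB; lra.
have h2 : (s - t) * (B.2 - A.2)%:~R = 0 :> R by rewrite intrB; lra.
move/eqP: h1; move/eqP: h2; rewrite !mulf_eq0; case: (s - t == 0) => //=.
rewrite !intr_eq0 !subr_eq0 => /eqP h2 /eqP h1; case/eqP: ne.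
by rewrite [LHS]surjective_pairing -h1 -h2 -surjective_pairing.
Qed.

Lemma segment_point_continuous A B : continuous (segment_point A B).
Proof.
have lin (a b : R) : continuous (fun t : R => (1 - t) * a + t * b).
  move=> t; apply: cvgD.
    by apply: cvgMl; apply: cvgB; [exact: cvg_cst|exact: cvg_id].
  by apply: cvgMl; exact: cvg_id.
move=> t; have h1 := lin A.1%:~R B.1%:~R t; have h2 := lin A.2%:~R B.2%:~R t.
exact: (cvg_pair h1 h2).
Qed.

Variables (V K : eqType) (VL : seq V) (EL : seq K) (sv dv : K -> V) (w : K -> nat).
Hypothesis ok : graph_ok VL EL sv dv w.
Variable pos : V -> point.
Hypothesis pos_inj : {in VL &, injective pos}.
Hypothesis pos_off : forall k v z, k \in EL -> v \in VL ->
  on_segment (pos (sv k)) (pos (dv k)) z -> z <> ((pos v).1%:~R, (pos v).2%:~R).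
Hypothesis segments_disjoint : forall k k' z, k \in EL -> k' \in EL -> k != k' ->
  on_segment (pos (sv k)) (pos (dv k)) z -> on_segment (pos (sv k')) (pos (dv k')) z -> False.

Lemma straight_planar : planar R (key_graph ok).
Proof.
pose p (v : 'I_(size VL)) : R * R :=
  let P := pos (tnth (in_tuple VL) v) in (P.1%:~R, P.2%:~R).
pose g (e : 'I_(size EL)) : R -> R * R :=
  segment_point (pos (sv (edge_key e))) (pos (dv (edge_key e))).
have nthV (u : V) (h : (index u VL < size VL)%N) : u \in VL -> tnth (in_tuple VL) (Ordinal h) = u.
  by move=> hu; rewrite (tnth_nth u) /= nth_index.
exists p, g; split.
- move=> u v [/eqP]; rewrite eqr_int => /eqP e1 /eqP; rewrite eqr_int => /eqP e2.
  have /eqP : tnth (in_tuple VL) u = tnth (in_tuple VL) v.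
    apply: pos_inj; rewrite ?mem_tnth //.
    by rewrite [LHS]surjective_pairing e1 e2 -surjective_pairing.
  move: (tnth_nth (tnth (in_tuple VL) u) (in_tuple VL)); move: {1}(tnth _ u) => x0 hx.
  by rewrite !hx nth_uniq ?(uniqV ok) // => /eqP/val_inj.
- move=> e; have hs := sv_in ok (edge_key_in e); have hd := dv_in ok (edge_key_in e).
  split.
  + by apply: continuous_subspaceT; apply: segment_point_continuous.
  + move=> s t _ _; apply: segment_point_inj; apply/eqP => /(pos_inj hs hd) E.
    by have := sv_lt ok (edge_key_in e); rewrite E ltnn.
  + rewrite /g /segment_point /p /= ffunE /= nthV //; congr pair; ring.
  + rewrite /g /segment_point /p /= ffunE /= nthV //; congr pair; ring.
- move=> e v t ht; apply: pos_off; [exact: edge_key_in|exact: mem_tnth|by exists t].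
- move=> e e' s t ne hs ht ge.
  apply: (@segments_disjoint (edge_key e) (edge_key e') (g e s)); rewrite ?edge_key_in //.
  + by apply: contraNneq ne => /(edge_key_inj ok) ->.
  + by exists s.
  + by exists t => //; rewrite ge.
Qed.

End Segments.

Definition int_point (x : nat * nat) : point := (Posz x.1, Posz x.2).

Section Placement.
Variable R : realType.
Local Open Scope ring_scope.

Definition place (X r : nat) (P : point) : point := (P.1 + Posz (20 * X)%N, P.2 + Posz (20 * r)%N).

Definition in_cell (X r : nat) (z : R * R) : Prop :=
  [/\ (20 * X)%N%:R <= z.1, z.1 < (20 * X.+1)%N%:R, (20 * r)%N%:R <= z.2 & z.2 < (20 * r.+1)%N%:R].

Lemma in_cell_inj X r X' r' z : in_cell X r z -> in_cell X' r' z -> X = X' /\ r = r'.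
Proof.
have aux a b (y : R) : (20 * a)%N%:R <= y -> y < (20 * b.+1)%N%:R -> (a <= b)%N.
  by move=> h1 h2; have := le_lt_trans h1 h2; rewrite ltr_nat; lia.
move=> [h1 h2 h3 h4] [k1 k2 k3 k4]; split; apply/eqP; rewrite eqn_leq.
  by rewrite (aux _ _ _ h1 k2) (aux _ _ _ k1 h2).
by rewrite (aux _ _ _ h3 k4) (aux _ _ _ k3 h4).
Qed.

Lemma place1 X r P : (place X r P).1%:~R = P.1%:~R + (20 * X)%N%:R :> R.
Proof. by rewrite intrD. Qed.

Lemma place2 X r P : (place X r P).2%:~R = P.2%:~R + (20 * r)%N%:R :> R.
Proof. by rewrite intrD. Qed.

Lemma on_segment_place X r A B z : on_segment (place X r A) (place X r B) z <->
  on_segment A B (z.1 - (20 * X)%N%:R, z.2 - (20 * r)%N%:R : R).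
Proof.
split=> -[t ht].
  rewrite /segment_point !place1 !place2 => ->; exists t => //.
  by rewrite /segment_point; congr pair => /=; lra.
move=> [e1 e2]; exists t => //; rewrite /segment_point !place1 !place2 [LHS]surjective_pairing.
by congr pair; lra.
Qed.

Lemma place_disjoint X r A B C D (z : R * R) : separated A B C D ->
  on_segment (place X r A) (place X r B) z -> on_segment (place X r C) (place X r D) z ->
  False.
Proof.
by move=> sp /on_segment_place h1 /on_segment_place h2; apply: (separated_disjoint sp h1 h2).
Qed.

Lemma on_segment_point P : on_segment P P (P.1%:~R, P.2%:~R : R).
Proof.
have h1 : (0 : R) < 2^-1 by lra.
have h2 : 2^-1 < (1 : R) by lra.
by exists (2^-1); rewrite ?h1 ?h2 // /segment_point; congr pair; lra.
Qed.

Lemma between (a b t : R) : 0 < t < 1 -> a < b -> a < (1 - t) * a + t * b < b.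
Proof.
move=> /andP[t0 t1] ab.
have h1 : 0 < t * (b - a) by rewrite mulr_gt0 // subr_gt0.
have h2 : 0 < (1 - t) * (b - a) by rewrite mulr_gt0 // subr_gt0.
by apply/andP; split; lra.
Qed.

Lemma on_segment_cell X r (P Q : nat * nat) (z : R * R) :
  (P.1 < 20)%N -> (P.2 < 20)%N -> (Q.1 < 20)%N -> (Q.2 < 20)%N ->
  on_segment (place X r (int_point P)) (place X r (int_point Q)) z -> in_cell X r z.
Proof.
move=> p1 p2 q1 q2 /on_segment_place[t /andP[t0 t1]] [e1 e2].
have conv (a b : nat) : (a < 20)%N -> (b < 20)%N ->
    0 <= (1 - t) * a%:R + t * b%:R < 20%:R.
  move=> ha hb; have ha' : a%:R <= 19%:R :> R by rewrite ler_nat.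
  have hb' : b%:R <= 19%:R :> R by rewrite ler_nat.
  have t1' : 0 <= 1 - t by lra.
  have h1 : 0 <= (1 - t) * a%:R by rewrite mulr_ge0.
  have h2 : 0 <= t * b%:R by rewrite mulr_ge0 // ltW.
  have h3 : 0 <= (1 - t) * (19%:R - a%:R) by rewrite mulr_ge0 // subr_ge0.
  have h4 : 0 <= t * (19%:R - b%:R) by rewrite mulr_ge0 ?subr_ge0 // ltW.
  by apply/andP; split; lra.
have /andP[h1 h2] := conv _ _ p1 q1; have /andP[h3 h4] := conv _ _ p2 q2.
move: e1 e2; rewrite /int_point /= -!pmulrn => e1 e2.
by split; rewrite ?mulnS ?natrD; lra.
Qed.

Lemma on_horizontal (a b h : int) (z : R * R) : a < b ->
  on_segment (a, h) (b, h) z <-> z.2 = h%:~R /\ a%:~R < z.1 < b%:~R.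
Proof.
rewrite -(ltr_int R) => ab; split=> [[t ht ->]|[e /andP[h1 h2]]] /=.
  by split; [lra|apply: between].
have d0 : 0 < b%:~R - a%:~R :> R by rewrite subr_gt0.
exists ((z.1 - a%:~R) / (b%:~R - a%:~R)).
  by apply/andP; split; rewrite ?ltr_pdivlMr // ?ltr_pdivrMr //; lra.
rewrite /segment_point /= [LHS]surjective_pairing e; congr pair; last lra.
have : (z.1 - a%:~R) / (b%:~R - a%:~R) * (b%:~R - a%:~R) = z.1 - a%:~R.
  by rewrite divfK // gt_eqF.
by lra.
Qed.

Lemma on_segment_swap A B (z : R * R) :
  on_segment A B z -> on_segment (A.2, A.1) (B.2, B.1) (z.2, z.1).
Proof. by move=> [t ht ->]; exists t. Qed.

Lemma on_vertical (a b h : int) (z : R * R) : a < b ->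
  on_segment (h, a) (h, b) z <-> z.1 = h%:~R /\ a%:~R < z.2 < b%:~R.
Proof.
move=> ab; split=> [/on_segment_swap /(on_horizontal h _ ab)[] //|hz].
have : on_segment (a, h) (b, h) (z.2, z.1) by apply/on_horizontal.
by move=> /on_segment_swap /=; rewrite -surjective_pairing.
Qed.

Lemma on_segment_sym A B (z : R * R) : on_segment A B z -> on_segment B A z.
Proof.
move=> [t /andP[t0 t1] ->]; exists (1 - t); first by apply/andP; split; lra.
by rewrite /segment_point; congr pair; lra.
Qed.

(* The two halves of a horizontal link; vertical ones are obtained by swapping the coordinates. *)
Lemma split_link X (a b h : nat) (z : R * R) : (a < 20)%N -> (b < 20)%N ->
  on_segment (Posz (20 * X + a)%N, Posz h) (Posz (20 * X.+1 + b)%N, Posz h) z ->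
  z.2 = h%:R /\
  ((20 * X)%N%:R <= z.1 < (20 * X.+1)%N%:R /\
     (20 * X + a)%N%:R < z.1 < (20 * X + 21)%N%:R \/
   (20 * X.+1)%N%:R <= z.1 < (20 * X.+2)%N%:R /\
     (20 * X.+1)%N%:R - 1 < z.1 < (20 * X.+1 + b)%N%:R).
Proof.
have -> : (20 * X.+2 = 20 * X + 40)%N by lia.
have -> : (20 * X.+1 = 20 * X + 20)%N by lia.
move: (20 * X)%N => m ha hb /on_horizontal [|->]; first by lia.
rewrite -!pmulrn => /andP[h1 h2]; split=> //.
have hb' : b%:R <= 19%:R :> R by rewrite ler_nat.
have ha' : 0 <= a%:R :> R by [].
move: h1 h2; rewrite !natrD => h1 h2.
case: (ltrP z.1 (m%:R + 20%:R)) => hz; [left|right].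
  by split; apply/andP; split; lra.
by split; apply/andP; split; lra.
Qed.

End Placement.

(** * Drawings of the tiles *)

(* Every tile is drawn in a square of side 20; its sides are met at their midpoints. *)
Definition tile_drawing (t : tile) : seq (seq (nat * nat)) :=
  match t with
  | Void => [::]
  | LeftCap => [:: [:: (14, 10); (12, 8); (10, 10); (12, 10); (12, 12)]]
  | RightCap => [:: [:: (6, 10); (8, 8); (10, 10); (8, 10); (8, 12)]]
  | TopCap => [:: [:: (10, 6); (8, 8); (10, 10); (10, 8); (12, 8)]]
  | OrFirst | OrLast => [:: [:: (10, 10)]; [:: (10, 8); (8, 6); (10, 4); (10, 6); (12, 6)]]
  | OrMid => [:: [:: (10, 10)]]
  | Cross => [:: [:: (2, 10); (10, 2); (10, 18); (18, 10); (4, 4); (16, 4); (4, 16); (16, 16);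
                     (8, 10); (12, 10)]]
  | Clash => [:: [:: (2, 10); (10, 2); (10, 18); (18, 10); (4, 4); (16, 4); (4, 16); (16, 16);
                     (8, 8)];
                 [:: (14, 14); (12, 14); (10, 10); (12, 12); (14, 12)]]
  | Branch => [:: [:: (18, 10); (10, 18); (10, 6); (16, 16)];
                  [:: (15, 15); (13, 15); (12, 12); (13, 13); (15, 13)];
                  [:: (2, 10); (4, 8); (6, 10); (4, 10); (4, 12)]]
  end.

Definition vertex_at (t : tile) (s v : nat) : nat * nat :=
  nth (0, 0) (nth [::] (tile_drawing t) s) v.

Definition side_vertex (t : tile) (d : nat) : nat * nat :=
  let: (s, j) := find_port t d in vertex_at t s (nth 0 (gports (tile_part t s).1) j).

(* Stubs reach over the boundary, so that, as open segments, they contain the midpoint of the side. *)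
Definition stub_end (d : nat) : point :=
  nth (Posz 0, Posz 0) [:: (Negz 0, Posz 10); (Posz 21, Posz 10); (Posz 10, Negz 0); (Posz 10, Posz 21)] d.

(** Inside a tile an edge is seen either as an inner edge of a gadget, as the stub of a link at a
    side, or, for side 4, as the whole feed. *)
Definition piece (t : tile) (x : nat * nat + nat) : point * point :=
  match x with
  | inl (s, e) => let K := (tile_part t s).1 in
      (int_point (vertex_at t s (gedge K e).1.1), int_point (vertex_at t s (gedge K e).1.2))
  | inr d => (int_point (side_vertex t d),
      if d == 4 then int_point (side_vertex t 5) else stub_end d)
  end.

Definition tile_vertices (t : tile) : seq (nat * nat) :=
  flatten [seq [seq (s, v) | v <- iota 0 (gverts (tile_part t s).1)] | s <- iota 0 (size (tile_parts t))].

Definition tile_pieces (t : tile) : seq (nat * nat + nat) :=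
  [seq inl (s, e) | s <- iota 0 (size (tile_parts t)), e <- iota 0 (size (gedges (tile_part t s).1))] ++
  [seq inr d | d <- iota 0 5 & d \in tile_sides t].

Definition drawing_checks (t : tile) : bool :=
  [&& all (fun x => let: (s, v) := x in let P := vertex_at t s v in
        [&& P.1 < 20, P.2 < 20 &
          all (fun y => (x == y) || (vertex_at t y.1 y.2 != P)) (tile_vertices t)])
        (tile_vertices t),
      all (fun x => let: (A, B) := piece t x in
        all (fun y => if x == y then true else
          let: (C, D) := piece t y in separated A B C D) (tile_pieces t) &&
        all (fun y => let P := int_point (vertex_at t y.1 y.2) in separated A B P P)
          (tile_vertices t)) (tile_pieces t) &
      all (fun d => (d \notin tile_sides t) ||
        (if d < 2 then (side_vertex t d).2 == 10 else (side_vertex t d).1 == 10)) (iota 0 4)].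

Lemma drawing_ok t : drawing_checks t.
Proof. by case: t; vm_compute. Qed.

(** * Planarity and bandwidth of the strip *)

Import GRing.Theory.

Lemma vertex_at_lt t s v : (vertex_at t s v).1 < 20 /\ (vertex_at t s v).2 < 20.
Proof.
case: t; case: s => [|[|[|s]]]; do 11 ?[case: v => [|v]]; rewrite /vertex_at /= ?nth_nil //;
  by rewrite nth_nil.
Qed.

Lemma side_vertex_mid t d : d < 4 -> d \in tile_sides t ->
  if d < 2 then (side_vertex t d).2 = 10 else (side_vertex t d).1 = 10.
Proof. by case: t; case: d => [|[|[|[|d]]]]. Qed.

Lemma side_vertex_lt t d : (side_vertex t d).1 < 20 /\ (side_vertex t d).2 < 20.
Proof. by rewrite /side_vertex; case: (find_port t d) => s j; apply: vertex_at_lt. Qed.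

Lemma mem_tile_vertices t s v : ((s, v) \in tile_vertices t) =
  (s < size (tile_parts t)) && (v < gverts (tile_part t s).1).
Proof. by rewrite mem_pairs !mem_iota. Qed.

Lemma mem_tile_pieces t x : (x \in tile_pieces t) =
  match x with
  | inl (s, e) => (s < size (tile_parts t)) && (e < size (gedges (tile_part t s).1))
  | inr d => (d < 5) && (d \in tile_sides t)
  end.
Proof.
rewrite /tile_pieces mem_cat; case: x => [[s e]|d].
  rewrite [X in _ || X](_ : _ = false) ?orbF; last by apply/mapP => -[].
  apply/allpairsPdep/andP => [[s' [e' [hs he [-> ->]]]]|[hs he]].
    by move: hs he; rewrite !mem_iota.
  by exists s, e; rewrite !mem_iota.
rewrite [X in X || _](_ : _ = false); last by apply/allpairsPdep => -[? [? []]].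
by rewrite orFb mem_map ?mem_filter ?mem_iota 1?andbC //; move=> ? ? [].
Qed.

Lemma mid_range (R : realType) r (y : R) : (y = (20 * r + 10)%N%:R)%R ->
  ((20 * r)%N%:R <= y)%R /\ (y < (20 * r.+1)%N%:R)%R.
Proof.
move=> ->; rewrite Num.Theory.ler_nat Num.Theory.ltr_nat mulnS leq_addr addnC ltn_add2r.
by split.
Qed.

Section Drawing.
Variables (q n : nat) (forb : nat -> nat -> bool) (R : realType).
Hypotheses (q2 : 1 < q) (n1 : 0 < n).

Notation T i c r := (tile_at q forb (block_kind n i) c r).

Definition strip_point (x : part * nat) : point :=
  let: ((i, (c, r, s)), v) := x in
  place (i * q + c) r (int_point (vertex_at (T i c r) s v)).

Definition owner (i c r : nat) (x : nat * nat + nat) : part + part * nat :=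
  match x with
  | inl (s, e) => inr ((i, (c, r, s)), e)
  | inr d => inl (link_of q i c r d).1
  end.

Lemma placeE X r (P : nat * nat) :
  place X r (int_point P) = (Posz (20 * X + P.1), Posz (20 * r + P.2)).
Proof. by rewrite /place /= -!PoszD ![(_ + 20 * _)%N]addnC. Qed.

Lemma place_stub X r : [/\
  place X r (stub_end 0) = (Posz (20 * X) - 1, Posz (20 * r + 10))%R,
  place X r (stub_end 1) = (Posz (20 * X + 21), Posz (20 * r + 10)),
  place X r (stub_end 2) = (Posz (20 * X + 10), Posz (20 * r) - 1)%R
& place X r (stub_end 3) = (Posz (20 * X + 10), Posz (20 * r + 21))].
Proof. by split; rewrite /place /stub_end /=; congr pair; lia. Qed.

Lemma piece_side t d : d < 4 ->
  piece t (inr d) = (int_point (side_vertex t d), stub_end d).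
Proof. by case: d => [|[|[|[|d]]]]. Qed.

Lemma point_port i c r d : strip_point (port_vert (strip_kind q n forb) (port_at q n forb i c r d)) =
  place (i * q + c) r (int_point (side_vertex (T i c r) d)).
Proof. by rewrite /port_at /side_vertex; case: (find_port _ d). Qed.

Lemma next_col_pos i c : c < q ->
  (next_col q i c).1 * q + (next_col q i c).2 = (i * q + c).+1.
Proof. by rewrite /next_col => hc; case: ifP => h /=; rewrite ?mulSn; lia. Qed.

Lemma col_inj i c i' c' : c < q -> c' < q -> i * q + c = i' * q + c' -> i = i' /\ c = c'.
Proof.
move=> hc hc' e; have e1 := congr1 (divn^~ q) e; have e2 := congr1 (modn^~ q) e.
by move: e1 e2; rewrite /= !divnMDl ?modnMDl ?divn_small ?modn_small ?addn0 //; lia.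
Qed.

(** Each point of an edge is covered by a piece of that edge in the cell containing the point. Two
    edges that meet thus meet inside one tile, where the finitely many pairs of pieces have been
    checked. *)
Lemma edge_in_cell k z :
  k \in edges (strip_parts q n forb) (strip_links q n forb) (strip_kind q n forb) ->
  on_segment (strip_point (esrc (strip_kind q n forb) (strip_src q n forb) k))
    (strip_point (edst (strip_kind q n forb) (strip_dst q n forb) k)) z ->
  exists i c r x, [/\ c < q, x \in tile_pieces (T i c r), k = owner i c r x,
    @in_cell R (i * q + c) r z
  & on_segment (place (i * q + c) r (piece (T i c r) x).1)
      (place (i * q + c) r (piece (T i c r) x).2) z].
Proof.
rewrite mem_cat => /orP[/mapP[[i [[c r] d]]]|/mapP[[[i [[c r] s]] e]]]; last first.
  rewrite mem_inner mem_strip_parts => /andP[/and4P[hi hc hr hs] he] -> /= hz.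
  exists i, c, r, (inl (s, e)); split=> //; first by rewrite mem_tile_pieces hs.
  have [[h1 h2] [h3 h4]] := (vertex_at_lt (T i c r) s (gedge (tile_part (T i c r) s).1 e).1.1,
    vertex_at_lt (T i c r) s (gedge (tile_part (T i c r) s).1 e).1.2).
  exact: on_segment_cell hz.
rewrite mem_strip_links => /and5P[hi hc hr hd h] ->; move: hd h.
have -> : strip_point (esrc (strip_kind q n forb) (strip_src q n forb) (inl (i, (c, r, d)))) =
  place (i * q + c) r (int_point (side_vertex (T i c r) (source_side d))) by exact: point_port.
have -> : strip_point (edst (strip_kind q n forb) (strip_dst q n forb) (inl (i, (c, r, d)))) =
    match d with
    | 0 => place ((next_col q i c).1 * q + (next_col q i c).2) r
             (int_point (side_vertex (T (next_col q i c).1 (next_col q i c).2 r) 0))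
    | 1 => place (i * q + c) r.+1 (int_point (side_vertex (T i c r.+1) 2))
    | _ => place (i * q + c) r (int_point (side_vertex (T i c r) 5))
    end.
  by case: d => [|[|d]]; exact: point_port.
move=> hd h.
have [x1 y1] := side_vertex_lt (T i c r) (source_side d).
case: d hd h x1 y1 => [|[|[|//]]] _.
- rewrite (erefl 1 : source_side 0 = 1) => h x1 y1.
  have [h1 h2 h3] := right_left q2 n1 hi hc hr h.
  have [x2 y2] := side_vertex_lt (T (next_col q i c).1 (next_col q i c).2 r) 0.
  have m1 := side_vertex_mid (isT : 1 < 4) h; have m2 := side_vertex_mid (isT : 0 < 4) h3.
  rewrite next_col_pos // !placeE m1 m2 => /(split_link x1 x2)[e []] [b1 b2].
    exists i, c, r, (inr 1); split=> //; first by rewrite mem_tile_pieces.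
      by have [] := mid_range e; case/andP: b1.
    have [_ s1 _ _] := place_stub (i * q + c) r.
    rewrite piece_side // placeE m1 s1.
    by apply/on_horizontal; [lia|split].
  exists (next_col q i c).1, (next_col q i c).2, r, (inr 0).
  split=> //; rewrite ?mem_tile_pieces ?next_col_pos //; rewrite ?piece_side //.
  + by rewrite /= (next_colK q2 n1).
  + by have [] := mid_range e; case/andP: b1.
  have [s0 _ _ _] := place_stub (i * q + c).+1 r.
  rewrite placeE m2 s0; apply: on_segment_sym; apply/on_horizontal; [lia|split=> //].
  by rewrite intrB.
- rewrite (erefl 3 : source_side 1 = 3) => h x1 y1.
  have h' := h; rewrite has_side // in h'.
  have hr' : r.+1 < (2 * q).+2 by move: h'; lia.
  have h3 : 2 \in tile_sides (T i c r.+1) by rewrite has_side //; case/andP: h' => ->.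
  have [x2 y2] := side_vertex_lt (T i c r.+1) 2.
  have m1 := side_vertex_mid (isT : 3 < 4) h; have m2 := side_vertex_mid (isT : 2 < 4) h3.
  rewrite !placeE m1 m2 => /on_segment_swap /(split_link y1 y2)[/= e []] [b1 b2].
    exists i, c, r, (inr 3); split=> //; first by rewrite mem_tile_pieces.
      by have [] := mid_range e; case/andP: b1.
    have [_ _ _ s3] := place_stub (i * q + c) r.
    rewrite piece_side // placeE m1 s3.
    by apply/on_vertical; [lia|split].
  exists i, c, r.+1, (inr 2); split=> //; first by rewrite mem_tile_pieces.
    by have [] := mid_range e; case/andP: b1.
  have [_ _ s2 _] := place_stub (i * q + c) r.+1.
  rewrite piece_side // placeE m2 s2; apply: on_segment_sym; apply/on_vertical; [lia|split=> //].
  by rewrite intrB.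
- rewrite (erefl 4 : source_side 2 = 4) => h x1 y1 hz.
  exists i, c, r, (inr 4); split=> //; first by rewrite mem_tile_pieces.
  have [x2 y2] := side_vertex_lt (T i c r) 5.
  exact: on_segment_cell hz.
Qed.
Lemma vertex_in_cell i c r s v : ((i, (c, r, s)), v) \in verts (strip_parts q n forb) (strip_kind q n forb) ->
  let P := strip_point ((i, (c, r, s)), v) in
  [/\ c < q, (s, v) \in tile_vertices (T i c r),
      @in_cell R (i * q + c) r (P.1%:~R, P.2%:~R)%R
    & on_segment P P (P.1%:~R, P.2%:~R : R)%R].
Proof.
rewrite mem_verts mem_strip_parts => /andP[/and4P[hi hc hr hs] hv] P.
have onP : on_segment P P (P.1%:~R, P.2%:~R : R)%R by apply: on_segment_point.
split=> //; first by rewrite mem_tile_vertices hs.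
by have [h1 h2] := vertex_at_lt (T i c r) s v; apply: on_segment_cell onP.
Qed.

Lemma strip_planar : planar R (key_graph (assembly_graph_ok (strip_ok forb q2 n1))).
Proof.
apply: (@straight_planar R _ _ _ _ _ _ _ _ strip_point).
- move=> [[i [[c r] s]] v] [[i' [[c' r'] s']] v'] hx hx' e.
  have [hc hv hx1 _] := vertex_in_cell hx; have [hc' hv' hx1' _] := vertex_in_cell hx'.
  rewrite -e in hx1'; have [eX er] := in_cell_inj hx1 hx1'.
  have [ei ec] := col_inj hc hc' eX; subst i' c' r'.
  move: e; rewrite /strip_point !placeE => -[/addnI e1 /addnI e2].
  have /and3P[/allP/(_ _ hv)/and3P[_ _ /allP/(_ _ hv') h] _ _] := drawing_ok (T i c r).
  move: h; case/orP => [/eqP[-> ->] //|/negP[]].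
  by rewrite /= [X in _ == X]surjective_pairing e1 e2 -surjective_pairing.
- move=> k [[i' [[c' r'] s]] v] z hk hx /(edge_in_cell hk)[i [c [r [x [hc hp _ hz hs]]]]] ez.
  have [hc' hv hz' hs'] := vertex_in_cell hx; rewrite -ez in hz' hs'.
  have [eX er] := in_cell_inj hz hz'; have [ei ec] := col_inj hc hc' eX; subst i' c' r'.
  have /and3P[_ /allP/(_ _ hp) + _] := drawing_ok (T i c r).
  case E : (piece _ x) hs => [A B] hs /andP[_ /allP/(_ _ hv) sep].
  exact: (place_disjoint sep hs hs').
- move=> k k' z hk hk' ne /(edge_in_cell hk)[i [c [r [x [hc hp ek hz hs]]]]].
  move=> /(edge_in_cell hk')[i' [c' [r' [x' [hc' hp' ek' hz' hs']]]]].
  have [eX er] := in_cell_inj hz hz'; have [ei ec] := col_inj hc hc' eX; subst i' c' r'.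
  have /and3P[_ /allP/(_ _ hp) + _] := drawing_ok (T i c r).
  case E : (piece _ x) hs => [A B] hs /andP[/allP/(_ _ hp') + _].
  case: eqP => [exx|_]; first by rewrite ek ek' exx eqxx in ne.
  case E' : (piece _ x') hs' => [C D] hs' sep.
  exact: (place_disjoint sep hs hs').
Qed.

End Drawing.

(** If [x] is in block [i] and [y] is there or in the next block, then the distance is at most the
    size of the two blocks; that [x] occurs in no earlier block makes its index start there. *)
Lemma index_blocks (A : eqType) (F : nat -> seq A) (m i j : nat) (x y : A) :
  i <= j <= i.+1 -> j < m -> x \in F i -> y \in F j ->
  (forall k, k < i -> x \notin F k) ->
  index y (flatten (map F (iota 0 m))) - index x (flatten (map F (iota 0 m))) <=
  size (F i) + size (F i.+1).
Proof.
move=> hij hj hx hy hn.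
have -> : iota 0 m = iota 0 i ++ iota i (j - i).+1 ++ iota j.+1 (m - j.+1).
  by rewrite -{2}(add0n i) catA -iotaD; rewrite -[in iota j.+1 _](_ : 0 + (i + (j - i).+1) = j.+1)
    -?iotaD; [congr iota; lia|lia].
rewrite !map_cat !flatten_cat; set pre := flatten (map F (iota 0 i)).
have xpre : x \notin pre.
  by apply/negP => /flatten_mapP[k]; rewrite mem_iota => /hn/negP.
rewrite [X in _ - X]index_cat (negbTE xpre) leq_subLR.
set mid := flatten _; set suf := flatten _.
have sm : size mid <= size (F i) + size (F i.+1).
  rewrite /mid; have [->|->] : j = i \/ j = i.+1 by lia.
    by rewrite subnn /= cats0 leq_addr.
  by rewrite subSnn /= cats0 size_cat.
have ym : y \in mid by apply/flatten_mapP; exists j => //; rewrite mem_iota; lia.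
suff h : index y (pre ++ mid ++ suf) <= size pre + size mid by lia.
rewrite index_cat; case: ifP => [h|_]; first by rewrite -index_mem in h; lia.
by rewrite index_cat ym leq_add2l index_size.
Qed.

Section Bandwidth.
Variables (q n : nat) (forb : nat -> nat -> bool).
Hypotheses (q2 : 1 < q) (n1 : 0 < n).

(** Two blocks, each with [q * (2 * q).+2] cells, at most 3 gadgets in a cell and at most 10
    vertices in a gadget. *)
Definition strip_width : nat := 60 * (q * (2 * q).+2).

Definition block_verts (i : nat) : seq (part * nat) :=
  flatten [seq part_verts (strip_kind q n forb) (i, y) | y <- block_parts q forb (block_kind n i)].

Lemma strip_verts_blocks : verts (strip_parts q n forb) (strip_kind q n forb) =
  flatten (map block_verts (iota 0 n.+2)).
Proof.
rewrite /verts /strip_parts; elim: (iota 0 n.+2) => //= i l <-.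
by rewrite map_cat flatten_cat -map_comp.
Qed.

Lemma gverts_le t s : gverts (tile_part t s).1 <= 10.
Proof. by case: t; case: s => [|[|[|s]]]; rewrite /tile_part //= nth_nil. Qed.

Lemma size_block_verts i : size (block_verts i) <= 30 * (q * (2 * q).+2).
Proof.
have sc : size (cells q) = q * (2 * q).+2 * 3 by rewrite /cells !size_allpairs !size_iota.
have : size (block_parts q forb (block_kind n i)) <= q * (2 * q).+2 * 3.
  by rewrite -sc size_filter count_size.
suff : size (block_verts i) <= 10 * size (block_parts q forb (block_kind n i)) by lia.
rewrite /block_verts; elim: (block_parts _ _ _) => //= -[[c r] s] l IH.
rewrite size_cat size_map size_iota mulnS leq_add //.
exact: gverts_le.
Qed.

Lemma edge_blocks k :
  k \in edges (strip_parts q n forb) (strip_links q n forb) (strip_kind q n forb) ->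
  (esrc (strip_kind q n forb) (strip_src q n forb) k).1.1 <=
  (edst (strip_kind q n forb) (strip_dst q n forb) k).1.1 <=
  (esrc (strip_kind q n forb) (strip_src q n forb) k).1.1.+1.
Proof.
have pE i c r d : (port_at q n forb i c r d).1.1 = i.
  by rewrite /port_at; case: (find_port _ d).
rewrite mem_cat => /orP[/mapP[[i [[c r] d]] _ ->]|/mapP[[[i [[c r] s]] e] _ ->] /=]; last first.
  by rewrite leqnn leqnSn.
have -> : (esrc (strip_kind q n forb) (strip_src q n forb) (inl (i, (c, r, d)))).1.1 = i by exact: pE.
have -> : (edst (strip_kind q n forb) (strip_dst q n forb) (inl (i, (c, r, d)))).1.1 =
    if d is 0 then (next_col q i c).1 else i by case: d => [|[|d]]; exact: pE.
by rewrite /next_col; case: d => [|d]; rewrite ?leqnn ?leqnSn //; case: ifP; rewrite /= ?leqnn ?leqnSn.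
Qed.

Lemma strip_bandwidth :
  bandwidth (key_graph (assembly_graph_ok (strip_ok forb q2 n1))) <= strip_width.
Proof.
apply: key_bandwidth => k hk; have ok := assembly_graph_ok (strip_ok forb q2 n1).
have hb := edge_blocks hk; have hs := sv_in ok hk; have hd := dv_in ok hk.
move: hb hs hd; move: (esrc _ _ k) (edst _ _ k) => [[i y] v] [[j y'] v'] /= hij.
have inB (a b : nat) z u : ((a, z), u) \in block_verts b -> a = b.
  by move=> /flatten_mapP[z' _ /mapP[u' _ []]].
have memB a z u : ((a, z), u) \in verts (strip_parts q n forb) (strip_kind q n forb) ->
    a < n.+2 /\ ((a, z), u) \in block_verts a.
  rewrite strip_verts_blocks => /flatten_mapP[b]; rewrite mem_iota /= => hb h.
  have e := inB _ _ _ _ h; subst b.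
  by split.
move=> /memB[hi hx] /memB[hj hy]; rewrite strip_verts_blocks.
apply: leq_trans (index_blocks hij hj hx hy _) _.
  by move=> b hb; apply/negP => /inB e; rewrite e ltnn in hb.
have h1 := size_block_verts i; have h2 := size_block_verts i.+1.
by apply: leq_trans (leq_add h1 h2) _; rewrite -mulnDl.
Qed.

End Bandwidth.

(** * The reduction from a machine *)

Lemma polyf_dom_code (G : finType) X {EX : Enc X} (m : X -> nat) (x : X -> nat -> G) :
  polyf m -> @polyf _ _ _ (@enc_fin G) (fun t : X * nat => x t.1 t.2) ->
  polyf (fun t : X * nat => dom_code (dom_word (m t.1) (x t.1)) t.2).
Proof.
move=> pm px; pose EG := @enc_fin G; pose IG := @inj_fin G.
have pl (p : X * nat -> nat) : polyf p ->
    @polyf _ _ _ (@enc_option _ EG) (fun t : X * nat => letter (m t.1) (x t.1) (p t)).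
  move=> pp; apply: polyf_if; last exact: polyf_const.
    apply: polyf_andb; apply: polyf_leq => //; first exact: polyf_const.
    by apply: (polyf_comp pm); pproj.
  by apply: polyf_some; apply: (polyf_comp (f := fun t => (t.1, p t)) px); apply: polyf_pair; pproj.
apply: (polyf_ext (f := fun t : X * nat => if t.2 == 1 then dom_rank (inl false : domino G)
  else if t.2 == (m t.1).+3 then dom_rank (inl true : domino G)
  else dom_rank (letter_dom (letter (m t.1) (x t.1) t.2.-2) (letter (m t.1) (x t.1) t.2.-1)))).
  by move=> t; rewrite /dom_code /dom_word; case: ifP => // _; case: ifP.
apply: polyf_if; first by apply: polyf_eq; pproj.
  exact: polyf_const.
apply: polyf_if.
- by apply: polyf_eq; pproj; do 3 apply: polyf_succ; apply: (polyf_comp pm); pproj.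
- exact: polyf_const.
pose EO := @enc_option _ EG.
have pf : @polyf _ _ (@enc_prod _ _ EO EO) _
    (fun y : option G * option G => dom_rank (letter_dom y.1 y.2)).
  exact: (@polyf_fin (option G * option G)%type _ (@enc_prod _ _ EO EO)
    (@inj_prod _ _ EO EO (@inj_option _ EG IG) (@inj_option _ EG IG))).
apply: (polyf_comp (f := fun t : X * nat =>
  (letter (m t.1) (x t.1) t.2.-2, letter (m t.1) (x t.1) t.2.-1)) pf).
by apply: polyf_pair; apply: pl; repeat apply: polyf_pred; pproj.
Qed.

Lemma polyf_poly_bound X {EX : Enc X} a d (n : X -> nat) : polyf n -> polyf (fun x => poly_bound a d (n x)).
Proof.
move=> pn; apply: polyf_addn; last exact: polyf_const.
apply: polyf_muln; first exact: polyf_const.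
by elim: d => [|d IH]; [exact: polyf_const|
  apply: (polyf_ext (f := fun x => n x * n x ^ d)); [move=> x; rewrite expnS|apply: polyf_muln]].
Qed.

Section MachineReduction.
Variables (M : machine) (L : language) (a d : nat).
Hypothesis ML : decides_in_space M L (poly_bound a d).

Notation G := (sweep_letter M).
Notation rule := (@sweep_rule M).
Notation dom := (domino G).

(** As many cells as the space bound, plus one to have at least one cell. The row then has
    [(row_size w).+3] letters, and its domino word has three positions more; this is [strip_len]. *)
Definition row_size (w : seq bool) : nat := (poly_bound a d (size w)).+1.
Definition strip_len (w : seq bool) : nat := (row_size w).+3.+3.

Definition input_row (w : seq bool) (j : nat) : cell M :=
  [ffun i => (None, nth None (tright (ctapes (init M w) i)) j)].

Lemma input_represents w : represents (row_size w) (input_row w) (init M w).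
Proof.
move=> j _ i; rewrite ffunE; congr pair; rewrite ffunE /=.
by case: ifP => _; case: w => [|b w] /=; rewrite nth_nil.
Qed.

Lemma run_fits w t : fits (row_size w) (iter t (@step M) (init M w)).
Proof.
move=> i; have [h _] := ML w; have := h t; rewrite /space (bigD1 i) //= /tape_space /row_size.
by rewrite -[run M w t]/(iter t (@step M) (init M w)); lia.
Qed.

Definition start_word (w : seq bool) : nat -> nat :=
  dom_code (dom_word (row_size w).+3 (start_row (row_size w) (init M w) (input_row w))).
Definition accept_word (w : seq bool) : nat -> nat :=
  dom_code (dom_word (row_size w).+3 (@accept_row M (row_size w))).

Lemma word_reach w :
  reach (word_step #|dom| (strip_len w) (dom_forb rule)) (start_word w) (accept_word w) <-> L w.
Proof.
rewrite (domino_reach (inl false) rule) //; have [_ [t ht <-]] := ML w.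
exact: (sweep_reach _ (@input_represents w) (run_fits w) ht).
Qed.
Definition scan_bit (o : option bool) : vec M :=
  [ffun i => if i == ord0 then omap inl o else None].

Definition head_letter (o : option bool) : G := Car (launch (start M) (scan_bit o)).

Definition cell_letter (o : option bool) : G := Cell [ffun i => (None, scan_bit o i)].

Definition input_bit (w : seq bool) (j : nat) : option bool := nth None [seq Some b | b <- w] j.

Lemma scan_init w : scanned (init M w) = scan_bit (input_bit w 0).
Proof. by apply/ffunP => i; rewrite !ffunE /=; case: eqP => // _; case: w. Qed.

Lemma input_rowE w j : Cell (input_row w j) = cell_letter (input_bit w j.+1).
Proof.
congr Cell; apply/ffunP => i; rewrite !ffunE /= /input_bit; congr pair.
case: eqP => [_|_]; last by rewrite nth_nil.
case: w => [|b w] /=; first by rewrite !nth_nil.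
by elim: w j => [|b' w IH] [|j] //=; rewrite ?nth_nil.
Qed.

Lemma polyf_row_size : polyf row_size.
Proof. by apply: polyf_succ; apply: polyf_poly_bound; apply: polyf_size_seq; pproj. Qed.

Lemma polyf_input_bit Z {EZ : Enc Z} (w : Z -> seq bool) (j : Z -> nat) :
  polyf w -> polyf j -> polyf (fun z => input_bit (w z) (j z)).
Proof.
move=> pw pj; apply: polyf_nth => //.
by apply: (polyf_map (f := fun _ b => Some b)) => //; apply: polyf_some; pproj.
Qed.

Lemma polyf_bit_letter Z {EZ : Enc Z} (F : option bool -> G) (o : Z -> option bool) :
  polyf o -> @polyf _ _ _ (@enc_fin G) (fun z => F (o z)).
Proof.
move=> po; apply: (@polyf_comp _ _ _ _ _ (@enc_fin G) o F) po.
exact: (@polyf_fin (option bool) _ (@enc_option _ enc_bool) (@inj_option _ enc_bool inj_bool) (@enc_fin G)).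
Qed.

(** Besides its position, a letter of the initial row depends on a single bit of the input, so it is
    found by a finite table. *)
Lemma polyf_start_row : @polyf _ _ _ (@enc_fin G)
  (fun t : seq bool * nat => start_row (row_size t.1) (init M t.1) (input_row t.1) t.2).
Proof.
pose EG := @enc_fin G.
apply: (@polyf_ext _ _ _ EG (fun t : seq bool * nat => if t.2 == 1 then inl false
  else if t.2 == (row_size t.1).+3 then inl true
  else if t.2 == 2 then head_letter (input_bit t.1 0)
  else cell_letter (input_bit t.1 (if t.2 < 2 then t.2.-2 else t.2 - 3).+1))).
  move=> t; rewrite /start_row /row scan_init -/(head_letter _).
  by do 3 (case: ifP => // _); rewrite -input_rowE.
have ps : polyf (fun t : seq bool * nat => (row_size t.1).+3).
  by do 3 apply: polyf_succ; apply: (polyf_comp polyf_row_size); pproj.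
apply: polyf_if; [by apply: polyf_eq; pproj|exact: polyf_const|apply: polyf_if].
- by apply: polyf_eq; pproj.
- exact: polyf_const.
apply: polyf_if; first by apply: polyf_eq; pproj.
  by apply: polyf_bit_letter; apply: polyf_input_bit; pproj.
apply: polyf_bit_letter; apply: polyf_input_bit; pproj.
apply: polyf_succ; apply: polyf_if; first by apply: polyf_leq; pproj; apply: polyf_succ; pproj.
  by do 2 apply: polyf_pred; pproj.
by apply: polyf_subn; pproj.
Qed.

Lemma polyf_accept_row : @polyf _ _ _ (@enc_fin G)
  (fun t : seq bool * nat => @accept_row M (row_size t.1) t.2).
Proof.
pose EG := @enc_fin G.
have ps : polyf (fun t : seq bool * nat => row_size t.1).
  by apply: (polyf_comp polyf_row_size); pproj.
apply: (@polyf_ext _ _ _ EG (fun t : seq bool * nat => if t.2 == 1 then inl false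
  else if t.2 == (row_size t.1).+3 then inl true
  else if t.2 == (row_size t.1).+2 then Car (inr (Some true)) else Cell (blank_cell M))) => //.
apply: polyf_if; [by apply: polyf_eq; pproj|exact: polyf_const|apply: polyf_if].
- by apply: polyf_eq; pproj; do 3 apply: polyf_succ.
- exact: polyf_const.
by apply: polyf_if; [apply: polyf_eq; pproj; do 2 apply: polyf_succ|apply: polyf_const|apply: polyf_const].
Qed.

Definition reduction (w : seq bool) : seq bool :=
  flatten [seq encode_nat z | z <- strip_data #|dom| (dom_forb rule) strip_len start_word accept_word w].

Lemma polyf_reduction : polyf reduction.
Proof.
have pm : polyf (fun w => (row_size w).+3) by do 3 apply: polyf_succ; exact: polyf_row_size.
apply: polyf_strip_code; first by do 3 apply: polyf_succ.
  exact: (polyf_dom_code (x := fun w => start_row (row_size w) (init M w) (input_row w)) pm polyf_start_row).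
exact: (polyf_dom_code (x := fun w => @accept_row M (row_size w)) pm polyf_accept_row).
Qed.

Lemma reduction_correct w :
  (forall R : realType, instances_on (fun G : constraint_graph =>
     [/\ planar R G, bandwidth G <= strip_width #|dom| & and_or_graph G]) (reduction w)) /\
  (L w <-> C2C_NCL (reduction w)).
Proof.
have n1 : 0 < strip_len w by [].
have okS : word_ok #|dom| (strip_len w) (dom_forb rule) (start_word w).
  by apply: dom_code_ok; apply: dom_word_good.
have okA : word_ok #|dom| (strip_len w) (dom_forb rule) (accept_word w).
  by apply: dom_code_ok; apply: dom_word_good.
set ok' := assembly_graph_ok (strip_ok (dom_forb rule) (card_domino G) n1).
pose I := @key_instance _ _ _ _ _ _ _ ok' _ _ (word_config_legal (card_domino G) n1 okS)
  (word_config_legal (card_domino G) n1 okA).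
have eI : encode I = reduction w.
  by rewrite encode_key_instance /reduction strip_dataE // card_domino.
split.
  move=> R; exists I => //; split; first exact: strip_planar.
    exact: strip_bandwidth.
  exact: assembly_and_or.
have key : reconfigurable (source I) (target I) <-> L w.
  by rewrite -word_reach -(strip_reconfigurable (card_domino G) n1 okS okA).
(* Membership provides some instance [J] with this code, not necessarily [I]. *)
rewrite -key; split=> [h|[J eJ]]; first by exists I.
by apply: encode_reconfigurable; rewrite eI eJ.
Qed.

End MachineReduction.

(** * Completeness *)

Local Notation B := (seq bool).

Section DigitLists.
Variable ds : seq B.

(** The position among the numerals of [0] to [size ds] is the capped value in unary. The search
    also avoids converting a numeral whose value may be exponential. *)
Definition dig_cap (d : B) : nat := index d [seq nat_digits i | i <- iota 0 (size ds).+1].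
Definition dig_nv : nat := dig_cap (nth [::] ds 0).
Definition dig_ne : nat := dig_cap (nth [::] ds 1).
Definition dig_field (j k : nat) : B := nth [::] ds (2 + dig_nv + 5 * k + j).
Definition dig_bits (j : nat) : B :=
  [seq leq_digits (dig_field j k) [:: true] && leq_digits [:: true] (dig_field j k) | k <- iota 0 dig_ne].

Definition dig_inflow (c : B) (v : nat) : B :=
  sum_digits [seq if dig_cap (if nth false c k then dig_field 1 k else dig_field 0 k) == v
                  then dig_field 2 k else [::] | k <- iota 0 dig_ne].

Definition dig_legal (c : B) : bool :=
  all (fun v => leq_digits (nth [::] ds (2 + v)) (dig_inflow c v)) (iota 0 dig_nv).

Definition dig_pairs : seq (nat * nat) :=
  [seq (dig_cap (dig_field 0 k), dig_cap (dig_field 1 k)) | k <- iota 0 dig_ne].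

Definition dig_edge (k : nat) : bool :=
  [&& (dig_cap (dig_field 0 k)).+1 <= dig_cap (dig_field 1 k), (dig_cap (dig_field 1 k)).+1 <= dig_nv,
      leq_digits [:: true] (dig_field 2 k), leq_digits (dig_field 3 k) [:: true]
    & leq_digits (dig_field 4 k) [:: true]].

Definition dig_valid : bool :=
  [&& size ds == 2 + dig_nv + 5 * dig_ne, all dig_edge (iota 0 dig_ne),
      all (fun i => index (nth (0, 0) dig_pairs i) dig_pairs == i) (iota 0 (size dig_pairs)),
      dig_legal (dig_bits 3) & dig_legal (dig_bits 4)].

Definition dig_base (u v : B) : bool :=
  [&& dig_legal u, dig_legal v &
      size [seq k <- iota 0 dig_ne | ~~ (nth false u k == nth false v k)] <= 1].

Hypothesis canon : all canonical_digits ds.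
Notation l := (map digits_value ds).

Lemma canon_nth i : canonical_digits (nth [::] ds i).
Proof.
case: (ltnP i (size ds)) => h; last by rewrite nth_default.
by apply: (allP canon); apply: mem_nth.
Qed.

Lemma nth_value i : nth 0 l i = digits_value (nth [::] ds i).
Proof.
case: (ltnP i (size ds)) => h; first by rewrite (nth_map [::]).
by rewrite !nth_default ?size_map.
Qed.

Lemma nat_digits_inj : injective nat_digits.
Proof. by move=> m n e; rewrite -(nat_digitsK m) e nat_digitsK. Qed.

Lemma dig_capE d : canonical_digits d -> dig_cap d = cap l (digits_value d).
Proof.
move=> hd; rewrite /dig_cap /cap size_map -{1}(digits_valueK hd); move: (digits_value d) => x.
case: (leqP x (size ds)) => h.
  rewrite index_map; last exact: nat_digits_inj.
  by rewrite index_iota0 //; lia.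
rewrite memNindex ?size_map ?size_iota; first lia.
by rewrite mem_map ?mem_iota; [lia|exact: nat_digits_inj].
Qed.

Lemma dig_nvE : dig_nv = list_nv l.
Proof. by rewrite /list_nv nth_value -dig_capE ?canon_nth. Qed.

Lemma dig_neE : dig_ne = list_ne l.
Proof. by rewrite /list_ne nth_value -dig_capE ?canon_nth. Qed.

Lemma dig_fieldE j k : digits_value (dig_field j k) = field l j k.
Proof. by rewrite /field nth_value -dig_nvE. Qed.

Lemma dig_capF j k : dig_cap (dig_field j k) = cap l (field l j k).
Proof. by rewrite dig_capE ?canon_nth // dig_fieldE. Qed.

Lemma dig_bitsE j : dig_bits j = list_bits l j.
Proof.
rewrite /dig_bits /list_bits dig_neE; apply: eq_map => k.
by rewrite !leq_digitsE dig_fieldE /= eqn_leq.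
Qed.

Lemma dig_legalE c : dig_legal c = list_legal l c.
Proof.
rewrite /dig_legal /list_legal dig_nvE; apply: eq_all => v.
rewrite leq_digitsE nth_value /dig_inflow sum_digits_value /list_inflow -map_comp dig_neE.
congr (_ <= sumn _); apply: eq_map => k /=; case: (nth false c k); rewrite dig_capF;
  by case: eqP => // _; rewrite dig_fieldE.
Qed.

Lemma dig_pairsE : dig_pairs = [seq (cap l (field l 0 k), cap l (field l 1 k)) | k <- iota 0 (list_ne l)].
Proof. by rewrite /dig_pairs dig_neE; apply: eq_map => k; rewrite !dig_capF. Qed.

(** This restates absence of repetitions by indices, in a form for which polynomial-time programs
    are available. *)
Lemma uniq_index (T : eqType) (x0 : T) (s : seq T) :
  uniq s = all (fun i => index (nth x0 s i) s == i) (iota 0 (size s)).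
Proof.
apply/idP/allP => [u i|h]; first by rewrite mem_iota => /= hi; rewrite index_uniq.
apply/(uniqP x0) => i j; rewrite !inE => hi hj e.
have hi' : i \in iota 0 (size s) by rewrite mem_iota.
have hj' : j \in iota 0 (size s) by rewrite mem_iota.
by rewrite -(eqP (h _ hi')) e (eqP (h _ hj')).
Qed.

Lemma dig_validE : dig_valid = list_valid l.
Proof.
rewrite /dig_valid /list_valid size_map !dig_legalE !dig_bitsE -(uniq_index (0, 0)) dig_pairsE dig_nvE dig_neE.
congr (_ && (_ && _)); apply: eq_all => k.
by rewrite /dig_edge !dig_capF dig_nvE !leq_digitsE !dig_fieldE.
Qed.

Lemma dig_baseE u v : dig_base u v = list_base l u v.
Proof. by rewrite /dig_base /list_base !dig_legalE /list_diff dig_neE size_filter. Qed.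

End DigitLists.

Section DigitListsPolyf.
Variables (Z : Type) (EZ : Enc Z) (ds : Z -> seq B).
Hypothesis pds : polyf ds.

Lemma polyf_dig_cap (d : Z -> B) : polyf d -> polyf (fun z => dig_cap (ds z) (d z)).
Proof.
move=> pd; apply: polyf_index => //.
apply: (polyf_map (f := fun _ i => nat_digits i)); first by apply: polyf_nat_digits; pproj.
by apply: polyf_iota; apply: polyf_succ; apply: polyf_size_seq.
Qed.

Lemma polyf_dig_nv : polyf (fun z => dig_nv (ds z)).
Proof. by apply: polyf_dig_cap; apply: polyf_nth => //; apply: polyf_const. Qed.

Lemma polyf_dig_ne : polyf (fun z => dig_ne (ds z)).
Proof. by apply: polyf_dig_cap; apply: polyf_nth => //; apply: polyf_const. Qed.

Lemma polyf_dig_field j (k : Z -> nat) : polyf k -> polyf (fun z => dig_field (ds z) j (k z)).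
Proof.
move=> pk; apply: polyf_nth => //; apply: polyf_addn; last exact: polyf_const.
apply: polyf_addn; first by apply: polyf_addn; [exact: polyf_const|exact: polyf_dig_nv].
by apply: polyf_muln => //; apply: polyf_const.
Qed.

End DigitListsPolyf.

Section DigitListsPolyf2.
Variables (Z : Type) (EZ : Enc Z) (ds : Z -> seq B).
Hypothesis pds : polyf ds.

Let pds1 Y (EY : Enc Y) : polyf (fun t : Z * Y => ds t.1).
Proof. by apply: (polyf_comp pds); pproj. Qed.

Lemma polyf_dig_bits j : polyf (fun z => dig_bits (ds z) j).
Proof.
apply: (polyf_map (f := fun z k => leq_digits (dig_field (ds z) j k) [:: true] &&
   leq_digits [:: true] (dig_field (ds z) j k))); last by apply: polyf_iota; apply: polyf_dig_ne.
have pf : polyf (fun t : Z * nat => dig_field (ds t.1) j t.2) by apply: polyf_dig_field; pproj.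
by apply: polyf_andb; apply: polyf_leq_digits => //; apply: polyf_const.
Qed.

Lemma polyf_dig_legal (c : Z -> B) : polyf c -> polyf (fun z => dig_legal (ds z) (c z)).
Proof.
move=> pc; apply: (polyf_all (p := fun z v => leq_digits (nth [::] (ds z) (2 + v)) (dig_inflow (ds z) (c z) v)));
  last by apply: polyf_iota; apply: polyf_dig_nv.
apply: polyf_leq_digits.
  by apply: polyf_nth => //; apply: polyf_addn; pproj.
apply: polyf_sum_digits; apply: (polyf_map (f := fun (t : Z * nat) k =>
  if dig_cap (ds t.1) (if nth false (c t.1) k then dig_field (ds t.1) 1 k else dig_field (ds t.1) 0 k) == t.2
  then dig_field (ds t.1) 2 k else [::])); last by apply: polyf_iota; apply: polyf_dig_ne.
have pd : polyf (fun t : Z * nat * nat => ds t.1.1) by apply: (polyf_comp pds); pproj.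
have pf j : polyf (fun t : Z * nat * nat => dig_field (ds t.1.1) j t.2).
  by apply: (polyf_dig_field (ds := fun t : Z * nat * nat => ds t.1.1)) => //; pproj.
apply: polyf_if => //; last exact: polyf_const.
apply: polyf_eq; last by pproj.
apply: (polyf_dig_cap (ds := fun t : Z * nat * nat => ds t.1.1)) => //.
by apply: polyf_if => //; apply: polyf_nth; pproj; apply: (polyf_comp pc); pproj.
Qed.

Lemma polyf_dig_valid : polyf (fun z => dig_valid (ds z)).
Proof.
have pf j : polyf (fun t : Z * nat => dig_field (ds t.1) j t.2) by apply: polyf_dig_field; pproj.
have pc j : polyf (fun t : Z * nat => dig_cap (ds t.1) (dig_field (ds t.1) j t.2)).
  by apply: polyf_dig_cap.
have pp : polyf (fun z => dig_pairs (ds z)).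
  apply: (polyf_map (f := fun z k => (dig_cap (ds z) (dig_field (ds z) 0 k), dig_cap (ds z) (dig_field (ds z) 1 k)))).
    by apply: polyf_pair.
  by apply: polyf_iota; apply: polyf_dig_ne.
apply: polyf_andb.
  apply: polyf_eq; first exact: polyf_size_seq.
  apply: polyf_addn; first by apply: polyf_addn; [exact: polyf_const|exact: polyf_dig_nv].
  by apply: polyf_muln; [exact: polyf_const|exact: polyf_dig_ne].
apply: polyf_andb.
  apply: (polyf_all (p := fun z k => dig_edge (ds z) k)); last by apply: polyf_iota; apply: polyf_dig_ne.
  apply: polyf_andb; first by apply: polyf_leq => //; apply: polyf_succ.
  apply: polyf_andb; first by apply: polyf_leq; [apply: polyf_succ|apply: polyf_dig_nv].
  by do 2?apply: polyf_andb; apply: polyf_leq_digits => //; apply: polyf_const.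
apply: polyf_andb.
  apply: (polyf_all (p := fun z i => index (nth (0, 0) (dig_pairs (ds z)) i) (dig_pairs (ds z)) == i)).
    have pp1 : polyf (fun t : Z * nat => dig_pairs (ds t.1)) by apply: (polyf_comp pp); pproj.
    by apply: polyf_eq; pproj; apply: polyf_index => //; apply: polyf_nth; pproj.
  by apply: polyf_iota; apply: polyf_size_seq.
by apply: polyf_andb; apply: polyf_dig_legal; apply: polyf_dig_bits.
Qed.

Lemma polyf_dig_base (u v : Z -> B) : polyf u -> polyf v -> polyf (fun z => dig_base (ds z) (u z) (v z)).
Proof.
move=> pu pv; apply: polyf_andb; first exact: polyf_dig_legal.
apply: polyf_andb; first exact: polyf_dig_legal.
apply: polyf_leq; last exact: polyf_const.
apply: polyf_size_seq.
apply: (polyf_filter (p := fun z k => ~~ (nth false (u z) k == nth false (v z) k))); last first.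
  by apply: polyf_iota; apply: polyf_dig_ne.
by apply: polyf_negb; apply: polyf_eq; apply: polyf_nth; pproj;
  [apply: (polyf_comp pu)|apply: (polyf_comp pv)]; pproj.
Qed.

End DigitListsPolyf2.

Lemma reaches_in_dig (p : bool) ds k u v : all canonical_digits ds ->
  reaches_in (fun x : bool * seq B => dig_ne x.2) (fun x => dig_base x.2) (p, ds) k u v <->
  reaches_in (fun l => list_ne l) list_base (map digits_value ds) k u v.
Proof.
move=> canon; elim: k u v => [|k IH] u v; first by rewrite /= dig_baseE.
by rewrite /= dig_neE //; split=> -[w [sw h1 h2]]; exists w; split=> //; apply/IH.
Qed.

(** The nodes of the search are the words with one bit for each edge, and the number of edges also
    serves as recursion depth. Words that encode no instance are rejected beforehand, by [parsed]
    and [dig_valid]. *)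
Theorem C2C_NCL_PSPACE : in_PSPACE C2C_NCL.
Proof.
pose width (x : bool * seq B) := dig_ne x.2; pose base (x : bool * seq B) := dig_base x.2.
have p2 : polyf (fun x : bool * seq B => x.2) by pproj.
have canonP w : parsed w -> all canonical_digits (parse w).
  rewrite /parsed /parse all_rev; case: (parse_state w) => p [c D] /= /and3P[_ _ ->].
  by [].
apply: (@search_PSPACE _ _ width base _ _ C2C_NCL (fun w => (parsed w, parse w))
  (fun x => x.1 && dig_valid x.2) (fun x => dig_bits x.2 3) (fun x => dig_bits x.2 4)).
- exact: polyf_dig_ne.
- by apply: (polyf_dig_base (ds := fun t : (bool * seq B) * (B * B) => t.1.2)); pproj.
- exact: polyf_parse.
- by apply: polyf_andb; [pproj|exact: polyf_dig_valid].
- exact: polyf_dig_bits.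
- exact: polyf_dig_bits.
- by move=> w _; rewrite /width /dig_bits !size_map !size_iota.
move=> w; rewrite /width /base; split.
  case=> I eI h; have pw : parsed w by rewrite -eI parsed_encode.
  have el : map digits_value (parse w) = instance_data I by rewrite -eI parse_encodeK.
  have cw := canonP w pw; rewrite /= pw dig_validE // el data_valid; split=> //.
  apply/reaches_in_dig => //; rewrite !dig_bitsE // dig_neE // el.
  by have [-> ->] := data_bits I; apply: reconfigurable_reaches_in.
case=> /= /andP[pw]; have cw := canonP w pw.
rewrite dig_validE // => /valid_instance[I eI] /reaches_in_dig -/(_ cw).
rewrite !dig_bitsE // dig_neE // -eI; have [-> ->] := data_bits I => h.
exists I; last exact: reaches_in_reconfigurable h.
by rewrite /encode eI parsedK.
Qed.

Theorem theorem9 :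
  exists c : nat, forall R : realType,
    PSPACE_complete_on C2C_NCL
      (instances_on (fun G : constraint_graph =>
         [/\ planar R G, bandwidth G <= c & and_or_graph G])).
Proof.
have [M [a [d MD]]] := C2C_NCL_PSPACE.
exists (strip_width #|domino (sweep_letter M)|) => R; split; first exact: C2C_NCL_PSPACE.
move=> K [M' [a' [d' MD']]].
exists (fun w => reduction M a d (reduction M' a' d' w)); split.
  apply: polyf_polytime.
  have p1 := polyf_reduction M' a' d'; have p2 := polyf_reduction M a d.
  move: (reduction M' a' d') (reduction M a d) p1 p2 => f g p1 p2; exact: polyf_comp p2 p1.
move=> w; have [_ h1] := reduction_correct MD' w.
have [h2 h3] := reduction_correct MD (reduction M' a' d' w).
exact (conj (h2 R) (iff_trans h1 h3)).
Qed.
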